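(* Suppose the collision kernel satisfies the Assumption stated in the context with $\eta\ge\frac32$. Let $\{F_t\}_{t\ge0}$ be a conservative measure-valued isotropic solution on $[0,\infty)$ whose initial datum $F_0$ is regular (absolutely continuous with respect to Lebesgue measure, $dF_0(x)=f_0(x)\sqrt x\,dx$) and satisfies $M_{-1/2}(F_0)<\infty$. Then $F_t$ is regular for all $t\in[0,\infty)$, and its density $f(\cdot,t)$ (defined by $dF_t(x)=f(x,t)\sqrt x\,dx$) is a mild solution on $[0,\infty)$ satisfying $f\in C([0,\infty);L^1(\mathbb R_+))$ and $f(\cdot,0)=f_0$. In particular, $f(\cdot,t)$ is conservative on $[0,\infty)$.
   Context: Notation. $\mathcal B_k^+(\mathbb R_{\ge0})$ ($k\ge0$) is the set of nonnegative Borel measures $F$ on $[0,\infty)$ with $\int(1+x)^k\,dF<\infty$. $M_p(F)=\int x^p\,dF(x)$ ($p\in\mathbb R$, with $0^p=\infty$ for $p<0$, $\infty\cdot0=0$); $N(F)=M_0(F)$, $E(F)=M_1(F)$. $C^{1,1}_b(\mathbb R_{\ge0})$: $C^1_b$ functions with Lipschitz derivative. $L^1(\mathbb R_+)$ is with respect to $dx$. Kernel. $\hat\phi:[0,\infty)\to\mathbb R$ continuous bounded, $\Phi(r,\rho)=(\hat\phi(r)+\hat\phi(\rho))^2$, $x_*=(y+z-x)_+$. If $x_*xyz>0$, $W(x,y,z)=\frac{1}{4\pi\sqrt{xyz}}\int_{|\sqrt x-\sqrt y|\vee|\sqrt{x_*}-\sqrt z|}^{(\sqrt x+\sqrt y)\wedge(\sqrt{x_*}+\sqrt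 z)}ds\int_0^{2\pi}\Phi(\sqrt2 s,\sqrt2 Y_* )d\theta$ with $Y_*=\big|\sqrt{(z-\frac{(x-y+s^2)^2}{4s^2})_+}+e^{i\theta}\sqrt{(x-\frac{(x-y+s^2)^2}{4s^2})_+}\big|$ ($s>0$), $Y_*=0$ ($s=0$). Otherwise $W(0,y,z)=\Phi(\sqrt{2y},\sqrt{2z})/\sqrt{yz}$ ($y,z>0$), $W(x,0,z)=\Phi(\sqrt{2x},\sqrt{2(z-x)})/\sqrt{xz}$ ($z>x>0$), $W(x,y,0)=\Phi(\sqrt{2(y-x)},\sqrt{2x})/\sqrt{xy}$ ($y>x>0$), $W=0$ otherwise. $\mathcal K[\varphi]=W\,(\varphi(x)+\varphi(x_* )-\varphi(y)-\varphi(z))$, $\mathcal J[\varphi](y,z)=\frac12\int_0^{y+z}\mathcal K[\varphi](x,y,z)\sqrt x\,dx$. Measure solutions. $\{F_t\}_{t\ge0}\subset\mathcal B_1^+$ is a conservative measure-valued isotropic solution with initial datum $F_0$ if $N(F_t),E(F_t)$ are constant in $t$, $t\mapsto\int\varphi\,dF_t\in C^1([0,\infty))$ for every $\varphi\in C^{1,1}_b$, and $\frac{d}{dt}\int\varphi\,dF_t=\int\mathcal J[\varphi]\,d(F_t\otimes F_t)+\int\mathcal K[\varphi]\,d(F_t\otimes F_t\otimes F_t)$ for all $t\ge0$. Mild solutions. Write $f=f(x)$, $f_*=f(x_* )$, $f'=f(y)$, $f_*'=f(z)$ and $Q(f)(x)=\int_{\mathbb R_{\ge0}^2}W(x,y,z)[f'f_*'(1+f+f_*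 )-ff_*(1+f'+f_*')]\sqrt y\sqrt z\,dy\,dz$. A nonnegative measurable $f$ on $\mathbb R_{\ge0}\times[0,\infty)$ is a mild solution on $[0,\infty)$ if (i) $\sup_{t\in[0,T]}\int(1+x)f(x,t)\sqrt x\,dx<\infty$ for all $T>0$; (ii) there is a null set $Z$ independent of $t$ such that for all $x\notin Z$ and $t\ge0$, $\int_0^tdτ\int W[f'f_*'(1+f+f_* )+ff_*(1+f'+f_*')]\sqrt y\sqrt z\,dy\,dz<\infty$ and $f(x,t)=f(x,0)+\int_0^tQ(f)(x,\tau)d\tau$. It is conservative if $\int f(x,t)\sqrt x\,dx$ and $\int xf(x,t)\sqrt x\,dx$ are constant in $t$. Assumption. $\hat\phi$ continuous on $[0,\infty)$; constants $b_0>0,\eta\ge1$ with $0\le\hat\phi(r)\le b_0\frac{r^\eta}{1+r^\eta}$ for all $r\ge0$; there is $k\in C^1([1,\sqrt2])$, $k(1)=1$, with $\hat\phi(ar)\le k(a)\hat\phi(r)$ for all $r>0$, $1<a\le\sqrt2$. *)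

(* Defs.v *)
From mathcomp Require Import all_boot all_order all_algebra.
From mathcomp Require Import all_classical all_reals all_analysis.
Set Implicit Arguments.
Unset Strict Implicit.
Unset Printing Implicit Defensive.
Import Order.TTheory GRing.Theory Num.Theory numFieldNormedType.Exports.
Local Open Scope classical_set_scope.
Local Open Scope ring_scope.

Section Defs.
Variable R : realType.

Notation RB := (measurableTypeR R).
Notation leb := (@lebesgue_measure R).

Definition nonneg : set RB := [set x | 0 <= x].
Definition quadrant : set (RB * RB) := [set p | 0 <= p.1 /\ 0 <= p.2].

(** ---------- Measures on [0,oo): finite Borel measures on R carried by [0,oo) ---------- *)

(** x |-> x^p with 0^p = +oo for p < 0 (and 0^0 = 1, 0^p = 0 for p > 0). *)
Definition mom_fun (p x : R) : \bar R :=
  if (x == 0) && (p < 0) then +oo%E else (x `^ p)%:E.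

Definition moment (p : R) (F : set RB -> \bar R) : \bar R :=
  (\int[F]_(x in nonneg) mom_fun p x)%E.

Definition B1plus (F : set RB -> \bar R) : Prop :=
  F [set x | x < 0] = 0%E /\
  (\int[F]_(x in nonneg) (1 + x)%:E < +oo)%E.

Definition intF (F : set RB -> \bar R) (phi : R -> R) : R :=
  fine (\int[F]_(x in nonneg) (phi x)%:E)%E.

Definition has_deriv_within (A : set R) (u : R -> R) (t d : R) : Prop :=
  (fun h : R => (u (t + h) - u t) / h) @
     within [set h : R | h != 0 /\ A (t + h)] (nbhs (0 : R)) --> d.

Definition C1_on (A : set R) (u : R -> R) : Prop :=
  exists du : R -> R,
    {within A, continuous du} /\
    forall t, A t -> has_deriv_within A u t (du t).

Definition C11b (phi : R -> R) : Prop :=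
  exists dphi : R -> R,
    (forall x, 0 <= x -> has_deriv_within nonneg phi x (dphi x)) /\
    (exists M : R, forall x, 0 <= x -> `|phi x| <= M /\ `|dphi x| <= M) /\
    (exists L : R, forall x y, 0 <= x -> 0 <= y ->
        `|dphi x - dphi y| <= L * `|x - y|).

Definition Phi (ph : R -> R) (r rho : R) : R := (ph r + ph rho) ^+ 2.

Definition xstar (x y z : R) : R := Num.max (y + z - x) 0.

(** Y_* = | sqrt((z - q)_+) + e^{i theta} sqrt((x - q)_+) |,
    q = (x-y+s^2)^2/(4 s^2), for s > 0; Y_* = 0 for s = 0.
    The modulus of u + e^{i theta} v (u, v real) is written via real and
    imaginary parts: sqrt((u + v cos theta)^2 + (v sin theta)^2). *)
Definition Ystar (x y z s th : R) : R :=
  if s == 0 then 0 else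
  let q := (x - y + s ^+ 2) ^+ 2 / (4 * s ^+ 2) in
  let u := Num.sqrt (Num.max (z - q) 0) in
  let v := Num.sqrt (Num.max (x - q) 0) in
  Num.sqrt ((u + v * cos th) ^+ 2 + (v * sin th) ^+ 2).

Definition W (ph : R -> R) (x y z : R) : R :=
  let xs := xstar x y z in
  if 0 < xs * x * y * z then
    let lo := Num.max `|Num.sqrt x - Num.sqrt y| `|Num.sqrt xs - Num.sqrt z| in
    let hi := Num.min (Num.sqrt x + Num.sqrt y) (Num.sqrt xs + Num.sqrt z) in
    (4 * pi * Num.sqrt (x * y * z))^-1 *
      Rintegral leb `[lo, hi]
        (fun s => Rintegral leb `[0, 2 * pi]
           (fun th => Phi ph (Num.sqrt 2 * s) (Num.sqrt 2 * Ystar x y z s th)))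
  else if [&& x == 0, 0 < y & 0 < z] then
    Phi ph (Num.sqrt (2 * y)) (Num.sqrt (2 * z)) / Num.sqrt (y * z)
  else if [&& y == 0, 0 < x & x < z] then
    Phi ph (Num.sqrt (2 * x)) (Num.sqrt (2 * (z - x))) / Num.sqrt (x * z)
  else if [&& z == 0, 0 < x & x < y] then
    Phi ph (Num.sqrt (2 * (y - x))) (Num.sqrt (2 * x)) / Num.sqrt (x * y)
  else 0.

Definition Kop (ph phi : R -> R) (x y z : R) : R :=
  W ph x y z * (phi x + phi (xstar x y z) - phi y - phi z).

Definition Jop (ph phi : R -> R) (y z : R) : R :=
  2^-1 * Rintegral leb `[0, y + z] (fun x => Kop ph phi x y z * Num.sqrt x).

Definition cons_measure_solution (ph : R -> R)
    (F : R -> {finite_measure set RB -> \bar R}) : Prop :=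
  (forall t, 0 <= t -> B1plus (F t)) /\
  (forall t, 0 <= t ->
     moment 0 (F t) = moment 0 (F 0) /\ moment 1 (F t) = moment 1 (F 0)) /\
  (forall phi, C11b phi ->
     C1_on nonneg (fun t => intF (F t) phi) /\
     forall t, 0 <= t ->
       has_deriv_within nonneg (fun t => intF (F t) phi) t
         (fine (\int[(F t \x F t)%E]_(p in setT)
                   (Jop ph phi p.1 p.2)%:E)%E
          + fine (\int[((F t \x F t) \x F t)%E]_(q in setT)
                   (Kop ph phi q.1.1 q.1.2 q.2)%:E)%E)).

Definition gain (f : R -> R -> R) (x y z t : R) : R :=
  f y t * f z t * (1 + f x t + f (xstar x y z) t).
Definition loss (f : R -> R -> R) (x y z t : R) : R :=
  f x t * f (xstar x y z) t * (1 + f y t + f z t).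

Definition Qop (ph : R -> R) (f : R -> R -> R) (x t : R) : R :=
  Rintegral (leb \x leb)%E quadrant
    (fun p => W ph x p.1 p.2 * (gain f x p.1 p.2 t - loss f x p.1 p.2 t)
              * Num.sqrt p.1 * Num.sqrt p.2).

Definition mild_solution (ph : R -> R) (f : R -> R -> R) : Prop :=
  (forall x t, 0 <= x -> 0 <= t -> 0 <= f x t) /\
  measurable_fun (quadrant : set (RB * RB)) (fun p => f p.1 p.2) /\
  (forall T, 0 <= T -> exists C : R, forall t, 0 <= t <= T ->
     (\int[leb]_(x in nonneg) ((1 + x) * f x t * Num.sqrt x)%:E <= C%:E)%E) /\
  (exists Z : set RB, leb.-negligible Z /\
     forall x, 0 <= x -> ~ Z x -> forall t, 0 <= t ->
       (\int[leb]_(tau in `[0%R, t])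
          \int[(leb \x leb)%E]_(p in quadrant)
             (W ph x p.1 p.2 * (gain f x p.1 p.2 tau + loss f x p.1 p.2 tau)
               * Num.sqrt p.1 * Num.sqrt p.2)%:E < +oo)%E /\
       f x t = f x 0 + Rintegral leb `[0, t] (fun tau => Qop ph f x tau)).

Definition conservative (f : R -> R -> R) : Prop :=
  forall t, 0 <= t ->
    (\int[leb]_(x in nonneg) (f x t * Num.sqrt x)%:E
       = \int[leb]_(x in nonneg) (f x 0 * Num.sqrt x)%:E)%E /\
    (\int[leb]_(x in nonneg) (x * f x t * Num.sqrt x)%:E
       = \int[leb]_(x in nonneg) (x * f x 0 * Num.sqrt x)%:E)%E.

Definition C_L1 (f : R -> R -> R) : Prop :=
  (forall t, 0 <= t -> leb.-integrable nonneg (fun x => (f x t)%:E)) /\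
  forall t0, 0 <= t0 ->
    (fun t => \int[leb]_(x in nonneg) `|(f x t - f x t0)%:E|)%E
      @ within [set t : R | 0 <= t] (nbhs t0) --> 0%E.

Definition kernel_assumption (ph : R -> R) (b0 eta : R) (k : R -> R) : Prop :=
  {within [set r : R | 0 <= r], continuous ph} /\
  0 < b0 /\ 1 <= eta /\
  (forall r, 0 <= r -> 0 <= ph r <= b0 * (r `^ eta / (1 + r `^ eta))) /\
  C1_on `[1, Num.sqrt 2] k /\ k 1 = 1 /\
  (forall r a, 0 < r -> 1 < a <= Num.sqrt 2 -> ph (a * r) <= k a * ph r).

End Defs.

(* Main.v *)
(** The linear bound on [phi] near 0 bounds [W x y z] by a constant times the inverse square
    root of the product of any two of its arguments, so the collision integrals are controlled
    by [N], [E] and [M_(-1/2)]. The dilation bound near [a = 1] makes [W] almost symmetric for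
    nearby arguments, which closes a Gronwall estimate for regularizations of [M_(-1/2)].
    For a test function of small Lebesgue integral, a second Gronwall estimate on the supremum
    over its translates shows that its integral against [F_t] stays small, hence [F_t] stays
    absolutely continuous. Averages against bumps give a density [w(x, t)] that is jointly
    measurable, each average being measurable in [x] and continuous in [t]. Rewritten through
    the symmetries of the kernel, the weak equation says that at each time [w] satisfies the
    time-integrated equation for almost every [x]. The mild solution is the right-hand side of
    that identity: it equals the density almost everywhere at each time, and solves the
    equation for all times off a single null set. *)
From HB Require Import structures.
Require Import Defs.
From mathcomp Require Import all_boot all_order all_algebra.
From mathcomp Require Import all_classical all_reals all_analysis.
From mathcomp Require Import measurable_realfun ring lra.
Set Implicit Arguments.
Unset Strict Implicit.
Unset Printing Implicit Defensive.
Import Order.TTheory GRing.Theory Num.Theory numFieldNormedType.Exports.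
Local Open Scope classical_set_scope.
Local Open Scope ring_scope.

(** The obstacle is the size [sqrt (c / b)] that [W] may reach on arguments [a <= b <= c] with [b]
    much smaller than [c]. A bound of the moment for all times needs the cubic term, tested on
    [f x = (e + x)^(-1/2)], to be linear in the moment, and this factor would make it quadratic.
    Summing over the six permutations of the arguments pairs each dangerous gain with a loss. If the
    two kernels agree up to a relative error [O(b / c)], convexity leaves a second difference of [f]
    at [c], again of order [b / c], and the products are bounded. For absolute continuity, the cubic
    term turns a test [phi] into [phi (z + (y - x))], so no single test obeys a closed inequality,
    while all translates share one Lebesgue integral and hence one initial smallness. Collision
    integrals are estimated with the weight [1 + x^(-1/2)]: the equation for the Lebesgue density
    [w] carries a factor [sqrt x], and dividing it out must stay within [L^1(dx)]. *)

Lemma eq_ler (R : realType) (x y : R) : x = y -> x <= y.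
Proof. by move=> ->. Qed.

(** * Measurability of elementary real functions *)

Lemma measurable_sqrt (R : realType) d (T : measurableType d) (D : set T) (f : T -> R) :
  measurable_fun D f -> measurable_fun D (fun x => Num.sqrt (f x)).
Proof.
move=> mf; apply: (measurableT_comp _ mf).
apply: continuous_measurable_fun; exact: sqrt_continuous.
Qed.

Lemma measurable_inv (R : realType) d (T : measurableType d) (D : set T) (f : T -> R) :
  measurable_fun D f -> measurable_fun D (fun x => (f x)^-1).
Proof.
move=> mf; apply: (measurableT_comp (f := @GRing.inv R) _ mf).
have -> : [set: R] = [set 0] `|` ~` [set 0] by rewrite setUv.
apply/measurable_funU => //; first exact: measurableC.
split; first exact: measurable_fun_set1.
apply: open_continuous_measurable_fun.
  by apply: closed_openC; exact: closed_eq.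
by move=> x /[!inE]/= x0; apply: inv_continuous; exact/eqP.
Qed.

Lemma measurable_cos (R : realType) : measurable_fun setT (@cos R).
Proof. apply: continuous_measurable_fun; exact: continuous_cos. Qed.

Lemma measurable_sin (R : realType) : measurable_fun setT (@sin R).
Proof. apply: continuous_measurable_fun; exact: continuous_sin. Qed.

Lemma measurable_normr_comp (R : realType) d (T : measurableType d) (D : set T)
    (f : T -> R) :
  measurable_fun D f -> measurable_fun D (fun x => `|f x|).
Proof. by move=> mf; apply: (measurableT_comp _ mf). Qed.

(** The patterns [@?a x] read the component functions off the body, so that each closure lemma is
    applied with explicit functions and never left to higher-order unification. *)
Ltac meas1 :=
  lazymatch goal with
  | |- measurable_fun _ (fun _ => ?c) => exact: measurable_cst
  | |- measurable_fun _ (fun x => @?a x + @?b x) =>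
      apply: (@measurable_funD _ _ _ _ a b)
  | |- measurable_fun _ (fun x => - @?a x) =>
      apply: (@measurable_funN _ _ _ _ a)
  | |- measurable_fun _ (fun x => @?a x * @?b x) =>
      apply: (@measurable_funM _ _ _ _ a b)
  | |- measurable_fun _ (fun x => (@?a x) ^+ ?n) =>
      apply: (@measurable_funX _ _ _ _ a n)
  | |- measurable_fun _ (fun x => (@?a x)^-1) => apply: (@measurable_inv _ _ _ _ a)
  | |- measurable_fun _ (fun x => Num.sqrt (@?a x)) =>
      apply: (@measurable_sqrt _ _ _ _ a)
  | |- measurable_fun _ (fun x => Num.max (@?a x) (@?b x)) =>
      apply: (@measurable_maxr _ _ _ _ a b)
  | |- measurable_fun _ (fun x => Num.min (@?a x) (@?b x)) =>
      apply: (@measurable_minr _ _ _ _ a b)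
  | |- measurable_fun _ (fun x => `|@?a x|%R) =>
      apply: (@measurable_normr_comp _ _ _ _ a)
  | |- measurable_fun _ (fun x => (@?a x)%:E) =>
      apply/measurable_EFinP
  | |- measurable_fun _ (fun x => cos (@?a x)) =>
      apply: (@measurableT_comp _ _ _ _ _ _ cos _ a);
        [exact: measurable_cos|]
  | |- measurable_fun _ (fun x => sin (@?a x)) =>
      apply: (@measurableT_comp _ _ _ _ _ _ sin _ a);
        [exact: measurable_sin|]
  | |- measurable_fun _ (fun x => (@?a x).1) =>
      apply: (@measurableT_comp _ _ _ _ _ _ fst _ a); [exact: measurable_fst|]
  | |- measurable_fun _ (fun x => (@?a x).2) =>
      apply: (@measurableT_comp _ _ _ _ _ _ snd _ a); [exact: measurable_snd|]
  | |- measurable_fun _ (fun x => (@?a x, @?b x)) =>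
      apply: (@measurable_fun_pair _ _ _ _ _ _ a b)
  | |- measurable_fun _ (fun x => (@?a x < @?b x)%R) =>
      apply: (@measurable_fun_ltr _ _ _ _ a b)
  | |- measurable_fun _ (fun x => (@?a x <= @?b x)%R) =>
      apply: (@measurable_fun_ler _ _ _ _ a b)
  | |- measurable_fun _ (fun x => (@?a x == @?b x)) =>
      apply: (@measurable_fun_eqr _ _ _ _ a b)
  | |- measurable_fun _ (fun x => (@?a x && @?b x)) =>
      apply: (@measurable_and _ _ _ a b)
  | |- measurable_fun _ (fun x => x) => exact: measurable_id
  | |- measurable_fun _ (fun x => if _ then _ else _) =>
      apply: measurable_fun_ifT
  | |- measurable_fun _ _ => solve [assumption | exact: measurable_id | done]
  end.
Ltac meas := repeat meas1.

(** * Integrals depending on a parameter, and translation and reflection of Lebesgue measure *)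

Section Tools.
Variable R : realType.
Notation leb := (@lebesgue_measure R).
Notation RB := (measurableTypeR R).

Lemma measurable_Ystar d (T : measurableType d) (x y z s th : T -> R) :
  measurable_fun setT x -> measurable_fun setT y -> measurable_fun setT z ->
  measurable_fun setT s -> measurable_fun setT th ->
  measurable_fun setT (fun t => Ystar (x t) (y t) (z t) (s t) (th t)).
Proof.
move=> mx my mz ms mth; rewrite /Ystar/=.
meas.

Qed.


Lemma measurable_integral_param d (T : measurableType d) (h : T * RB -> R) :
  measurable_fun setT h ->
  measurable_fun setT (fun t => \int[leb]_s (h (t, s))%:E)%E.
Proof.
move=> mh.
under eq_fun do rewrite integralE.
apply: emeasurable_funB.
- rewrite [X in measurable_fun _ X](_ : _ = fubini_F leb (EFin \o h)^\+%E); last first.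
    by apply/funext => t; apply: eq_integral => s _; rewrite !funeposE.
  apply: measurable_fun_fubini_tonelli_F => //.
  by apply: measurable_funepos; apply/measurable_EFinP.
- rewrite [X in measurable_fun _ X](_ : _ = fubini_F leb (EFin \o h)^\-%E); last first.
    by apply/funext => t; apply: eq_integral => s _; rewrite !funenegE.
  apply: measurable_fun_fubini_tonelli_F => //.
  by apply: measurable_funeneg; apply/measurable_EFinP.
Qed.

Lemma measurable_Rintegral_param d (T : measurableType d) (lo hi : T -> R)
    (h : T * RB -> R) :
  measurable_fun setT lo -> measurable_fun setT hi -> measurable_fun setT h ->
  measurable_fun setT (fun t => Rintegral leb `[lo t, hi t] (fun s => h (t, s))).
Proof.
move=> mlo mhi mh.
apply: (measurableT_comp (f := fine)) => //.
(* The moving endpoints become a condition in the integrand, so that the domain of integration no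
   longer depends on the parameter. *)
have -> : (fun t => \int[leb]_(s in `[lo t, hi t]) (h (t, s))%:E)%E =
  (fun t => \int[leb]_s ((fun p : T * RB => if (lo p.1 <= p.2) && (p.2 <= hi p.1)
     then h p else 0) (t, s))%:E)%E.
  apply/funext => t; rewrite integral_mkcond; apply: eq_integral => s _.
  rewrite /= patchE mem_setE in_itv/=.
  by case: ifPn.
apply: (@measurable_integral_param _ _ (fun p : T * RB =>
  if (lo p.1 <= p.2) && (p.2 <= hi p.1) then h p else 0)).
apply: measurable_fun_ifT => //.
apply: measurable_and; apply: measurable_fun_ler.
- by apply: measurableT_comp.
- exact: measurable_snd.
- exact: measurable_snd.
- by apply: measurableT_comp.
Qed.

Lemma leb_itv_lty (a b : R) : (leb `[a, b] < +oo)%E.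
Proof. by rewrite lebesgue_measure_itv/=; case: ifP => _; rewrite ?ltry// -EFinB ltry. Qed.

Lemma integrable_itv_bounded (a b M : R) (f : R -> R) :
  measurable_fun setT f -> (forall x, a <= x <= b -> `|f x| <= M) ->
  leb.-integrable `[a, b] (EFin \o f).
Proof.
move=> mf fM; apply: measurable_bounded_integrable => //.
- exact: leb_itv_lty.
- exact: measurable_funTS.
exists M; split; first exact: num_real.
by move=> N MN x /=; rewrite in_itv/= => /fM xM; apply: le_trans xM (ltW MN).
Qed.

Lemma Rintegral_itv_le (a b M : R) (f : R -> R) : a <= b ->
  measurable_fun setT f -> (forall x, a <= x <= b -> 0 <= f x <= M) ->
  0 <= Rintegral leb `[a, b] f <= (b - a) * M.
Proof.
move=> ab mf fM; apply/andP; split.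
  by apply: Rintegral_ge0 => x /=; rewrite in_itv/= => /fM/andP[].
have -> : (b - a) * M = Rintegral leb `[a, b] (cst M).
  rewrite Rintegral_cst//= lebesgue_measure_itv/= mulrC.
  by case: ifPn => // ; rewrite lte_fin -leNgt => ba; rewrite (le_anti (_ : a <= b <= a)) ?subrr ?ab.
apply: le_Rintegral => //=.
- apply: (@integrable_itv_bounded _ _ M) => // x /fM/andP[x0 xM].
  by rewrite ger0_norm.
- apply: (@integrable_itv_bounded _ _ `|M|) => // x; exact: measurable_cst.
- by move=> x; rewrite in_itv/= => /fM/andP[].
Qed.

Definition shiftm (a : R) (x : R) : R := x + a.

(** By uniqueness of Lebesgue measure: the pushforward under a translation has the right value on
    half-open intervals. *)
Lemma lebesgue_measure_shift (a : R) (A : set R) : measurable A ->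
  leb (shiftm a @^-1` A) = leb A.
Proof.
move=> mA.
have ms : measurable_fun setT (shiftm a : RB -> RB) by rewrite /shiftm; meas.
pose mfa : {mfun RB >-> RB} := HB.pack (shiftm a : RB -> RB) (isMeasurableFun.Build _ _ _ _ _ ms).
have /= := @lebesgue_measure_unique R (pushforward leb mfa).
move=> /(_ ms _ A mA) H.
apply/esym/H => _ [[c e]/= _ <-]; rewrite /pushforward /=.
have -> : shiftm a @^-1` [set` `]c, e]] = [set` `]c - a, e - a]].
  by apply/seteqP; split => x /=; rewrite /shiftm !in_itv/= ltrBlDr lerBrDr.
rewrite !lebesgue_measure_itv/= !lte_fin ltrD2r; case: ifPn => // _.
by rewrite -!EFinB; congr EFin; lra.
Qed.

Lemma ge0_integral_shift (a : R) (f : R -> \bar R) :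
  measurable_fun setT f -> (forall x, 0 <= f x)%E ->
  (\int[leb]_x f (x + a)%R = \int[leb]_x f x)%E.
Proof.
move=> mf f0.
have ms : measurable_fun setT (shiftm a : RB -> RB) by rewrite /shiftm; meas.
have := @ge0_integral_pushforward _ _ RB RB R _ ms leb setT f measurableT mf.
rewrite preimage_setT => <-; last by move=> x _.
by apply: eq_measure_integral => A mA _; exact: lebesgue_measure_shift.
Qed.

Lemma ge0_integral_reflect (a : R) (f : R -> \bar R) :
  measurable_fun setT f -> (forall x, 0 <= f x)%E ->
  (\int[leb]_x f (a - x)%R = \int[leb]_x f x)%E.
Proof.
move=> mf f0.
have mo : measurable_fun setT (@GRing.opp R : RB -> RB) by apply: oppr_measurable.
rewrite -[RHS](@ge0_integral_shift a)//.
have mg : measurable_fun setT (fun x : R => f (x + a)).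
  by apply: (measurableT_comp mf); meas.
have := @ge0_integral_pushforward _ _ RB RB R _ mo leb setT (fun x => f (x + a)) measurableT mg.
rewrite preimage_setT/=.
move=> /(_ (fun x _ => f0 _)) H.
transitivity (\int[leb]_x f (- x + a)%R)%E.
  by apply: eq_integral => x _ /=; rewrite addrC.
rewrite -H; apply: eq_measure_integral => A mA _; exact: lebesgue_measureN.
Qed.

End Tools.

(** * Pointwise bounds on the collision kernel *)

Section Kernel.
Variable R : realType.
Notation leb := (@lebesgue_measure R).
Notation RB := (measurableTypeR R).

Lemma Rintegral_itv_eq0 (a b : R) (f : R -> R) : b <= a ->
  Rintegral leb `[a, b] f = 0.
Proof.
rewrite le_eqVlt => /predU1P[->|ba]; first by rewrite set_itv1 Rintegral_set1.
rewrite (_ : [set` _] = set0) ?Rintegral_set0//.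
by apply/seteqP; split => x //=; rewrite in_itv/= => /andP[ax xb]; lra.
Qed.

Lemma Rintegral_shift (l r h : R) (f : R -> R) :
  measurable_fun setT f -> (forall s, 0 <= f s) ->
  Rintegral leb `[l + h, r + h] f = Rintegral leb `[l, r] (fun s => f (s + h)).
Proof.
move=> mf f0; rewrite /Rintegral; congr fine.
pose F s := (if (l + h <= s) && (s <= r + h) then f s else 0)%:E.
rewrite [LHS]integral_mkcond [RHS]integral_mkcond.
transitivity (\int[leb]_s F s)%E.
  apply: eq_integral => s _; rewrite patchE mem_setE in_itv/= /F.
  by case: ifP.
rewrite -(@ge0_integral_shift _ h F).
- apply: eq_integral => s _; rewrite patchE mem_setE in_itv/= /F !lerD2r.
  by case: ifP.
- by rewrite /F; meas.
- by move=> s; rewrite /F lee_fin; case: ifP.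
Qed.

(** The shift [h] is there because kernels will be compared whose integration intervals differ by a
    translation; [e] is the part of the integrand that admits no multiplicative comparison. *)
Lemma Rintegral_compare (l r h K e M : R) (f g : R -> R) : l <= r ->
  measurable_fun setT f -> measurable_fun setT g ->
  (forall s, 0 <= f s <= M) -> (forall s, 0 <= g s <= M) ->
  (forall s, l <= s <= r -> f (s + h) <= K * g s + e) ->
  Rintegral leb `[l + h, r + h] f <= K * Rintegral leb `[l, r] g + (r - l) * e.
Proof.
move=> lr mf mg fM gM fg.
rewrite Rintegral_shift//; last by move=> s; case/andP: (fM s).
have ig : leb.-integrable `[l, r] (EFin \o g).
  apply: (@integrable_itv_bounded _ _ _ M) => // x _.
  by rewrite ger0_norm; case/andP: (gM x).
have mfh : measurable_fun setT (fun s : R => f (s + h)).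
  by apply: (measurableT_comp mf); meas.
have ie : leb.-integrable `[l, r] (EFin \o cst e).
  by apply: (@integrable_itv_bounded _ _ _ `|e|) => //; exact: measurable_cst.
have ig' : leb.-integrable `[l, r] (EFin \o (fun s => K * g s)).
  apply: (@integrable_itv_bounded _ _ _ (`|K| * M)) => //; first by meas.
  by move=> x _; rewrite normrM ler_wpM2l// ger0_norm; case/andP: (gM x).
have -> : K * Rintegral leb `[l, r] g + (r - l) * e =
    Rintegral leb `[l, r] (fun s => K * g s + e).
  rewrite RintegralD//= RintegralZl//; congr (_ + _).
  rewrite Rintegral_cst//= lebesgue_measure_itv/= mulrC.
  by case: ifPn => // ; rewrite lte_fin -leNgt => ba; rewrite (le_anti (_ : l <= r <= l)) ?subrr ?lr.
apply: le_Rintegral => //=.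
- apply: (@integrable_itv_bounded _ _ _ M) => // x _.
  by rewrite ger0_norm; case/andP: (fM (x + h)).
- apply: (@integrable_itv_bounded _ _ _ (`|K| * M + `|e|)) => //; first by meas.
  move=> x _; rewrite (le_trans (ler_normD _ _))// lerD2r normrM ler_wpM2l//.
  by rewrite ger0_norm; case/andP: (gM x).
Qed.

Variables (p : R -> R) (b0 : R).
Hypothesis mp : measurable_fun setT p.
Hypothesis b0_gt0 : 0 < b0.
Hypothesis p_ge0 : forall r, 0 <= p r.
Hypothesis p_leb : forall r, p r <= b0.
Hypothesis p_lin : forall r : R, 0 <= r -> p r <= b0 * r.

Definition inner (x y z s : R) : R :=
  Rintegral leb `[0, 2 * pi]
    (fun th => Phi p (Num.sqrt 2 * s) (Num.sqrt 2 * Ystar x y z s th)).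
Definition lo (x y z : R) :=
  Num.max `|Num.sqrt x - Num.sqrt y| `|Num.sqrt (xstar x y z) - Num.sqrt z|.
Definition hi (x y z : R) :=
  Num.min (Num.sqrt x + Num.sqrt y) (Num.sqrt (xstar x y z) + Num.sqrt z).

Lemma Phi_ge0 (r rho : R) : 0 <= Phi p r rho.
Proof. exact: sqr_ge0. Qed.

Lemma Phi_leb (r rho : R) : Phi p r rho <= 4 * b0 ^+ 2.
Proof.
rewrite /Phi; have := p_ge0 r; have := p_ge0 rho; have := p_leb r.
have := p_leb rho; nra.
Qed.

(** Origin of 32: both values of [p] are at most [b0 * M], so [Phi] is at most [(2 * b0 * M)^2],
    which is at most [4 * b0^2 * 8 * m]. The hypothesis has the shape [8 * m] because [M] will be
    [sqrt 2 * (2 * sqrt (y + z))]. *)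
Lemma Phi_le (r rho M m : R) : 0 <= r <= M -> 0 <= rho <= M -> M ^+ 2 <= 8 * m ->
  Phi p r rho <= 32 * b0 ^+ 2 * Num.min 1 m.
Proof.
move=> /andP[r0 rM] /andP[h0 hM] Mm.
rewrite /Num.min; case: ifP => _.
  by rewrite mulr1 (le_trans (Phi_leb _ _))// ler_wpM2r ?sqr_ge0// ler_nat.
have := p_lin r0; have := p_lin h0; have := p_ge0 r; have := p_ge0 rho => a1 a2 a3 a4.
have hr : p r <= b0 * M by apply: (le_trans a4); rewrite ler_wpM2l// ltW.
have hh : p rho <= b0 * M by apply: (le_trans a3); rewrite ler_wpM2l// ltW.
have -> : 32 * b0 ^+ 2 * m = 4 * b0 ^+ 2 * (8 * m) by ring.
apply: (@le_trans _ _ (4 * b0 ^+ 2 * M ^+ 2)); last first.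
  by rewrite ler_wpM2l// mulr_ge0// sqr_ge0.
rewrite /Phi (_ : 4 * b0 ^+ 2 * M ^+ 2 = (b0 * M + b0 * M) ^+ 2); last by ring.
by rewrite lerXn2r ?nnegrE ?lerD// addr_ge0// (le_trans a2 hr).
Qed.

Lemma Ystar_ge0 (x y z s th : R) : 0 <= Ystar x y z s th.
Proof. by rewrite /Ystar; case: ifP => // _; rewrite sqrtr_ge0. Qed.

Lemma modulus_sqr (u v th : R) :
  (u + v * cos th) ^+ 2 + (v * sin th) ^+ 2 = u ^+ 2 + v ^+ 2 + 2 * u * v * cos th.
Proof. rewrite [(v * sin th) ^+ 2]exprMn sin2cos2; ring. Qed.

Lemma Ystar_le (x y z s th : R) : 0 <= x -> 0 <= z ->
  Ystar x y z s th <= Num.sqrt z + Num.sqrt x.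
Proof.
move=> x0 z0; rewrite /Ystar; case: ifP => [_|s0]; first by rewrite addr_ge0// sqrtr_ge0.
set q := _ / _.
have q0 : 0 <= q.
  by apply: divr_ge0; [exact: sqr_ge0|apply: mulr_ge0 => //; exact: sqr_ge0].
have hx (a : R) : 0 <= a -> Num.sqrt (Num.max (a - q) 0) <= Num.sqrt a.
  by move=> a0; rewrite ler_wsqrtr// ge_max a0 andbT; lra.
set u := Num.sqrt (Num.max (z - q) 0); set v := Num.sqrt (Num.max (x - q) 0).
have u0 : 0 <= u by exact: sqrtr_ge0.
have v0 : 0 <= v by exact: sqrtr_ge0.
apply: (@le_trans _ _ (u + v)); last by rewrite lerD ?hx.
rewrite -(ger0_norm (addr_ge0 u0 v0)) -sqrtr_sqr ler_wsqrtr// modulus_sqr.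
by have := cos_le1 th; have := mulr_ge0 u0 v0; nra.
Qed.

Lemma measurable_Phi d (T : measurableType d) (f g : T -> R) :
  measurable_fun setT f -> measurable_fun setT g ->
  measurable_fun setT (fun t => Phi p (f t) (g t)).
Proof.
move=> mf mg; rewrite /Phi; meas; by apply: (measurableT_comp mp).
Qed.

Lemma measurable_inner d (T : measurableType d) (x y z s : T -> R) :
  measurable_fun setT x -> measurable_fun setT y -> measurable_fun setT z ->
  measurable_fun setT s ->
  measurable_fun setT (fun t => inner (x t) (y t) (z t) (s t)).
Proof.
move=> mx my mz ms; rewrite /inner.
apply: (@measurable_Rintegral_param _ _ _ (fun _ => 0) (fun _ => 2 * pi)
  (fun q : T * RB => Phi p (Num.sqrt 2 * s q.1)
     (Num.sqrt 2 * Ystar (x q.1) (y q.1) (z q.1) (s q.1) q.2))); [meas..|].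
have m1 (f : T -> R) : measurable_fun setT f ->
    measurable_fun setT (fun q : T * RB => f q.1).
  by move=> mf; apply: (measurableT_comp mf); exact: measurable_fst.
apply: measurable_Phi; meas; first exact: m1.
by apply: measurable_Ystar; [exact: m1..|exact: measurable_snd].
Qed.

Lemma measurable_xstar d (T : measurableType d) (x y z : T -> R) :
  measurable_fun setT x -> measurable_fun setT y -> measurable_fun setT z ->
  measurable_fun setT (fun t => xstar (x t) (y t) (z t)).
Proof. by move=> mx my mz; rewrite /xstar; meas. Qed.

Lemma measurable_W d (T : measurableType d) (x y z : T -> R) :
  measurable_fun setT x -> measurable_fun setT y -> measurable_fun setT z ->
  measurable_fun setT (fun t => W p (x t) (y t) (z t)).
Proof.
move=> mx my mz; rewrite /W.
have mxs := measurable_xstar mx my mz.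
have m1 (f : T -> R) : measurable_fun setT f ->
    measurable_fun setT (fun q : T * RB => f q.1).
  by move=> mf; apply: (measurableT_comp mf); exact: measurable_fst.
have mi : measurable_fun setT (fun t => Rintegral leb
    `[lo (x t) (y t) (z t), hi (x t) (y t) (z t)] (inner (x t) (y t) (z t))).
  apply: (@measurable_Rintegral_param _ _ _ _ _
    (fun q : T * RB => inner (x q.1) (y q.1) (z q.1) q.2)).
  - by rewrite /lo; meas.
  - by rewrite /hi; meas.
  - by apply: measurable_inner; [exact: m1..|exact: measurable_snd].
apply: measurable_fun_ifT; first by meas.
  apply: measurable_funM => //; first by meas.
apply: measurable_fun_ifT; first by meas.
  by apply: measurable_funM; [apply: measurable_Phi; meas|meas].
apply: measurable_fun_ifT; first by meas.
  by apply: measurable_funM; [apply: measurable_Phi; meas|meas].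
apply: measurable_fun_ifT; first by meas.
  by apply: measurable_funM; [apply: measurable_Phi; meas|meas].
exact: measurable_cst.
Qed.

Lemma inner_bound (x y z s M : R) :
  (forall th, Phi p (Num.sqrt 2 * s) (Num.sqrt 2 * Ystar x y z s th) <= M) ->
  0 <= inner x y z s <= 2 * pi * M.
Proof.
move=> hM; have := @Rintegral_itv_le R 0 (2 * pi) M
  (fun th => Phi p (Num.sqrt 2 * s) (Num.sqrt 2 * Ystar x y z s th)).
rewrite subr0; apply.
- by rewrite mulr_ge0// pi_ge0.
- apply: measurable_Phi; meas; apply: measurable_Ystar; meas.
- by move=> th _; rewrite Phi_ge0 hM.
Qed.

Lemma inner_ge0 (x y z s : R) : 0 <= inner x y z s.
Proof. by apply: Rintegral_ge0 => th _; exact: Phi_ge0. Qed.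

Lemma W_posE (x y z : R) : 0 < x -> 0 < y -> 0 < z -> x < y + z ->
  W p x y z = (4 * pi * (Num.sqrt x * Num.sqrt y * Num.sqrt z))^-1 *
     Rintegral leb `[lo x y z, hi x y z] (inner x y z).
Proof.
move=> x0 y0 z0 xyz.
have xs : 0 < xstar x y z by rewrite /xstar lt_max; apply/orP; left; lra.
by rewrite /W !mulr_gt0// !sqrtrM// ?mulr_ge0// ltW.
Qed.

Lemma lo_ge0 (x y z : R) : 0 <= lo x y z.
Proof. by rewrite /lo le_max normr_ge0. Qed.

Lemma W_ge0 (x y z : R) : 0 <= W p x y z.
Proof.
rewrite /W; case: ifP => _.
  rewrite mulr_ge0// ?invr_ge0 ?mulr_ge0 ?pi_ge0 ?sqrtr_ge0//.
  by apply: Rintegral_ge0 => s _; exact: inner_ge0.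
by do 3 (case: ifP => _; first by rewrite divr_ge0 ?Phi_ge0 ?sqrtr_ge0).
Qed.

(** Negative arguments can enter the first branch of [W], but [Num.sqrt] vanishes on them: with
    [x < 0] the lower endpoint is at least [sqrt y] and the upper one at most [sqrt y]. *)
Lemma W_cases (x y z : R) :
  [\/ [/\ 0 < x, 0 < y, 0 < z & x < y + z], [/\ x = 0, 0 < y & 0 < z],
   [/\ y = 0, 0 < x & x < z] | [/\ z = 0, 0 < x & x < y] \/ W p x y z = 0].
Proof.
rewrite /W; case: ifPn => [h|h0]; last first.
  case: ifPn => [/and3P[/eqP]|_]; first by move=> *; constructor 2.
  case: ifPn => [/and3P[/eqP]|_]; first by move=> *; constructor 3.
  case: ifPn => [/and3P[/eqP]|_]; first by move=> *; constructor 4; left.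
  by constructor 4; right.
have xs0 : 0 < xstar x y z.
  rewrite lt_neqAle {2}/xstar le_max lexx orbT andbT eq_sym.
  by apply: contraTneq h => ->; rewrite !mul0r ltxx.
have xyz : x < y + z by move: xs0; rewrite /xstar lt_max ltxx orbF subr_gt0.
have h' : 0 < x * y * z.
  by move: h; rewrite -!mulrA pmulr_rgt0// mulrA.
have [x0|x0|x0] := ltgtP x 0; last first.
- by move: h'; rewrite x0 !mul0r ltxx.
- have yz0 : 0 < y * z by move: h'; rewrite -mulrA pmulr_rgt0.
  have y0 : 0 < y.
    rewrite ltNge; apply/negP; rewrite le_eqVlt => /predU1P[y0|y0].
      by move: yz0; rewrite y0 mul0r ltxx.
    by move: yz0; rewrite nmulr_rgt0// => z0; lra.
  by constructor 1; split => //; move: yz0; rewrite pmulr_rgt0.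
constructor 4; right.
suff -> : Rintegral leb `[Num.max `|Num.sqrt x - Num.sqrt y| `|Num.sqrt (xstar x y z) - Num.sqrt z|,
   Num.min (Num.sqrt x + Num.sqrt y) (Num.sqrt (xstar x y z) + Num.sqrt z)]
   (inner x y z) = 0 by rewrite mulr0.
apply: Rintegral_itv_eq0; rewrite (ler0_sqrtr (ltW x0)) add0r sub0r normrN.
by rewrite ge_min le_max ger0_norm ?sqrtr_ge0// lexx.
Qed.


(** Each of the pairs [(x, y)] and [(xstar, z)] bounds [hi] by the sum and [lo] by the difference of
    its roots, so the length is at most twice the smaller root of either pair. *)
Lemma hi_lo_le (x y z m : R) :
  m \in [:: Num.sqrt x; Num.sqrt y; Num.sqrt z; Num.sqrt (xstar x y z)] ->
  hi x y z - lo x y z <= 2 * m.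
Proof.
have h1 : hi x y z <= Num.sqrt x + Num.sqrt y by rewrite /hi ge_min lexx.
have h2 : hi x y z <= Num.sqrt (xstar x y z) + Num.sqrt z.
  by rewrite /hi ge_min lexx orbT.
have l1 : `|Num.sqrt x - Num.sqrt y| <= lo x y z by rewrite /lo le_max lexx.
have l2 : `|Num.sqrt (xstar x y z) - Num.sqrt z| <= lo x y z.
  by rewrite /lo le_max lexx orbT.
move: l1 l2; rewrite !ler_norml => /andP[a1 a2] /andP[a3 a4].
by rewrite !inE => /or4P[] /eqP ->; lra.
Qed.

(** The prefactor [1 / (4 pi)], the angular length [2 pi] and [hi - lo <= 2 m] multiply to [m].
    Choosing [m] among the roots then cancels one of the three on the left. *)
Lemma W_interior_le (x y z m : R) : 0 < x -> 0 < y -> 0 < z -> x < y + z ->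
  m \in [:: Num.sqrt x; Num.sqrt y; Num.sqrt z; Num.sqrt (xstar x y z)] ->
  W p x y z * (Num.sqrt x * Num.sqrt y * Num.sqrt z) <=
    32 * b0 ^+ 2 * Num.min 1 (y + z) * m.
Proof.
move=> x0 y0 z0 xyz hm.
have sx := sqrtr_gt0 x; rewrite x0 in sx.
have sy := sqrtr_gt0 y; rewrite y0 in sy.
have sz := sqrtr_gt0 z; rewrite z0 in sz.
have m0 : 0 <= m by move: hm; rewrite !inE => /or4P[] /eqP ->; rewrite sqrtr_ge0.
rewrite W_posE//.
set P := Num.sqrt x * Num.sqrt y * Num.sqrt z; set I := Rintegral _ _ _.
have P0 : 0 < P by rewrite !mulr_gt0.
have pi0 := pi_gt0 R.
have aux (a q i : R) : 0 < a -> 0 < q -> (4 * q * a)^-1 * i * a = i / (4 * q).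
  by move=> a0 q0; field; rewrite (gt_eqF a0) (gt_eqF q0).
rewrite aux//.
rewrite ler_pdivrMr ?mulr_gt0//.
set B := 32 * b0 ^+ 2 * Num.min 1 (y + z).
have B0 : 0 <= B.
  by rewrite !mulr_ge0 ?sqr_ge0 ?(ltW b0_gt0)// le_min ler01 addr_ge0// ltW.
have [lohi|hilo] := leP (lo x y z) (hi x y z); last first.
  by rewrite /I (Rintegral_itv_eq0 _ (ltW hilo)) mulr_ge0 ?(mulr_ge0 B0)// mulr_ge0// ltW.
have /andP[_ hI] : 0 <= I <= (hi x y z - lo x y z) * (2 * pi * B).
  apply: Rintegral_itv_le => //; first by apply: measurable_inner; meas.
  move=> s /andP[los shi]; apply: inner_bound => th.
  have s0 : 0 <= s by apply: le_trans los; exact: lo_ge0.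
  have st : Num.sqrt 2 * s <= Num.sqrt 2 * (2 * Num.sqrt (y + z)).
    rewrite ler_wpM2l ?sqrtr_ge0// (le_trans shi)// /hi ge_min; apply/orP; right.
    have h1 : Num.sqrt (xstar x y z) <= Num.sqrt (y + z).
      by rewrite ler_wsqrtr// /xstar ge_max; apply/andP; split; lra.
    have h2 : Num.sqrt z <= Num.sqrt (y + z) by rewrite ler_wsqrtr//; lra.
    lra.
  have Yt : Num.sqrt 2 * Ystar x y z s th <= Num.sqrt 2 * (2 * Num.sqrt (y + z)).
    rewrite ler_wpM2l ?sqrtr_ge0// (le_trans (Ystar_le _ _ _ (ltW x0) (ltW z0)))//.
    have h1 : Num.sqrt x <= Num.sqrt (y + z) by rewrite ler_wsqrtr//; lra.
    have h2 : Num.sqrt z <= Num.sqrt (y + z) by rewrite ler_wsqrtr//; lra.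
    lra.
  apply: (Phi_le (M := Num.sqrt 2 * (2 * Num.sqrt (y + z)))).
  - by rewrite st mulr_ge0 ?sqrtr_ge0.
  - by rewrite Yt mulr_ge0 ?sqrtr_ge0// Ystar_ge0.
  - have yz0 : 0 <= y + z by lra.
    by rewrite !exprMn !sqr_sqrtr//; lra.
apply: (le_trans hI).
have := hi_lo_le hm.
have : 0 <= 2 * pi * B by rewrite mulr_ge0// mulr_ge0// ltW.
move=> h1 h2; apply: (le_trans (ler_wpM2r h1 h2)).
by apply: eq_ler; ring.
Qed.

(** The support conditions travel with the bounds, since a nonzero value of [W] forces them. The
    last estimate keeps the root of the fourth argument [y + z - x], which will compensate functions
    that are singular there. *)
Definition W_estimates (C x y z : R) : Prop :=
  [/\ [/\ 0 <= x, 0 <= y, 0 <= z & x < y + z],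
      W p x y z * (Num.sqrt x * Num.sqrt y) <= C * Num.min 1 (y + z),
      W p x y z * (Num.sqrt x * Num.sqrt z) <= C * Num.min 1 (y + z),
      W p x y z * (Num.sqrt y * Num.sqrt z) <= C * Num.min 1 (y + z) &
      W p x y z * (Num.sqrt x * Num.sqrt y * Num.sqrt z) <=
         C * Num.min 1 (y + z) * Num.sqrt (y + z - x)].

Lemma W_bound (x y z : R) :
  W p x y z = 0 \/ W_estimates (32 * b0 ^+ 2) x y z.
Proof.
case: (W_cases x y z) => [[x0 y0 z0 xyz]|[xE y0 z0]|[yE x0 z0]|[[zE x0 y0]|]]; last by left.
- right; split; first by split => //; exact: ltW.
  + have := W_interior_le (m := Num.sqrt z) x0 y0 z0 xyz.
    by rewrite !inE eqxx !orbT => /(_ isT); rewrite !mulrA ler_pM2r// sqrtr_gt0.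
  + have := W_interior_le (m := Num.sqrt y) x0 y0 z0 xyz.
    rewrite !inE eqxx !orbT => /(_ isT).
    have -> : W p x y z * (Num.sqrt x * Num.sqrt y * Num.sqrt z) =
      W p x y z * (Num.sqrt x * Num.sqrt z) * Num.sqrt y by ring.
    by rewrite ler_pM2r// sqrtr_gt0.
  + have := W_interior_le (m := Num.sqrt x) x0 y0 z0 xyz.
    rewrite !inE eqxx => /(_ isT).
    have -> : W p x y z * (Num.sqrt x * Num.sqrt y * Num.sqrt z) =
      W p x y z * (Num.sqrt y * Num.sqrt z) * Num.sqrt x by ring.
    by rewrite ler_pM2r// sqrtr_gt0.
  + have := W_interior_le (m := Num.sqrt (xstar x y z)) x0 y0 z0 xyz.
    rewrite !inE eqxx !orbT => /(_ isT).
    by rewrite {1}/xstar (max_idPl _)// subr_ge0 ltW.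
- have m0 : 0 <= 32 * b0 ^+ 2 * Num.min 1 (y + z).
    by rewrite !mulr_ge0 ?(ltW b0_gt0)// le_min ler01 addr_ge0// ltW.
  right; split; rewrite ?xE ?sqrtr0 ?mul0r ?mulr0 ?(mulr_ge0 m0) ?sqrtr_ge0//; last first.
    rewrite /W mulr0 !mul0r ltxx eqxx y0 z0/= (sqrtrM z (ltW y0)) mulfVK; last first.
      by rewrite mulf_neq0// gt_eqF ?sqrtr_gt0.
    apply: (Phi_le (M := Num.sqrt (2 * (y + z)))).
    + by rewrite sqrtr_ge0 ler_wsqrtr//; lra.
    + by rewrite sqrtr_ge0 ler_wsqrtr//; lra.
    + by rewrite sqr_sqrtr; lra.
  by split => //; lra.
- have m0 : 0 <= 32 * b0 ^+ 2 * Num.min 1 (y + z).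
    by rewrite !mulr_ge0 ?(ltW b0_gt0)// le_min ler01 addr_ge0//; lra.
  move: m0; rewrite yE add0r => m0.
  have z1 : 0 < z by lra.
  right; split; rewrite ?yE ?add0r ?sqrtr0 ?mul0r ?mulr0 ?mulr0 ?mul0r ?mulr0 ?(mulr_ge0 m0) ?sqrtr_ge0//.
    by split => //; lra.
  rewrite /W mulr0 mul0r ltxx (gt_eqF x0)/= eqxx x0 z0/= (sqrtrM z (ltW x0)) mulfVK; last first.
    by rewrite mulf_neq0// gt_eqF ?sqrtr_gt0.
  apply: (Phi_le (M := Num.sqrt (2 * z))).
  + by rewrite sqrtr_ge0 ler_wsqrtr//; lra.
  + by rewrite sqrtr_ge0 ler_wsqrtr//; lra.
  + by rewrite sqr_sqrtr; lra.
- have m0 : 0 <= 32 * b0 ^+ 2 * Num.min 1 (y + z).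
    by rewrite !mulr_ge0 ?(ltW b0_gt0)// le_min ler01 addr_ge0//; lra.
  move: m0; rewrite zE addr0 => m0.
  have y1 : 0 < y by lra.
  right; split; rewrite ?zE ?addr0 ?sqrtr0 ?mul0r ?mulr0 ?mulr0 ?mul0r ?mulr0 ?(mulr_ge0 m0) ?sqrtr_ge0//.
    by split => //; lra.
  rewrite /W !mulr0 ltxx (gt_eqF x0)/= (gt_eqF y1)/= eqxx x0 y0/= (sqrtrM y (ltW x0)) mulfVK; last first.
    by rewrite mulf_neq0// gt_eqF ?sqrtr_gt0.
  apply: (Phi_le (M := Num.sqrt (2 * y))).
  + by rewrite sqrtr_ge0 ler_wsqrtr//; lra.
  + by rewrite sqrtr_ge0 ler_wsqrtr//; lra.
  + by rewrite sqr_sqrtr; lra.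
Qed.

End Kernel.

(** * Almost-symmetry of the kernel when one argument dominates *)

Section Compare.
Variable R : realType.
Notation leb := (@lebesgue_measure R).
Variables (p : R -> R) (b0 : R).
Hypothesis mp : measurable_fun setT p.
Hypothesis b0_gt0 : 0 < b0.
Hypothesis p_ge0 : forall r, 0 <= p r.
Hypothesis p_leb : forall r, p r <= b0.
Hypothesis p_lin : forall r : R, 0 <= r -> p r <= b0 * r.
Variables (L dl : R).
Hypothesis L_ge0 : 0 <= L.
Hypothesis dl_gt0 : 0 < dl.
Hypothesis p_dil : forall r al : R, 0 < r -> 1 <= al <= 1 + dl ->
  p (al * r) <= (1 + L * (al - 1)) * p r.

(** Factor both sides: for equal differences of squares, the larger sum goes with the smaller
    difference. Conservation of energy is such an equality between the four roots, so this decides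
    which entry of the maximum in [lo] wins. *)
Lemma diff_sqr_le (P Q S T : R) : 0 <= Q <= P -> 0 <= T <= S ->
  P ^+ 2 - Q ^+ 2 = S ^+ 2 - T ^+ 2 -> S + T <= P + Q -> P - Q <= S - T.
Proof.
move=> /andP[Q0 QP] /andP[T0 TS] e h; rewrite leNgt; apply/negP => lt.
have : (S - T) * (S + T) < (P - Q) * (P + Q).
  apply: (@le_lt_trans _ _ ((S - T) * (P + Q))).
    by rewrite ler_wpM2l// subr_ge0.
  by rewrite ltr_pM2r//; lra.
by rewrite -!subr_sqr e ltxx.
Qed.

Lemma p_dilate (r1 r2 ka : R) : 0 < r2 -> r2 <= r1 -> r1 <= (1 + ka) * r2 ->
  ka <= dl -> p r1 <= (1 + L * ka) * p r2.
Proof.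
move=> r20 r21 r1k kdl.
have -> : r1 = r1 / r2 * r2 by rewrite divfK// gt_eqF.
have a1 : 1 <= r1 / r2 by rewrite ler_pdivlMr// mul1r.
have a2 : r1 / r2 <= 1 + ka by rewrite ler_pdivrMr.
apply: (le_trans (p_dil r20 _)); first by rewrite a1/= (le_trans a2)// lerD2l.
by rewrite ler_wpM2r// lerD2l ler_wpM2l// lerBlDl.
Qed.

Lemma inner_measurable1 (x y z : R) : measurable_fun setT (inner p x y z).
Proof.
apply: (@measurable_inner _ p mp _ _ (fun _ => x) (fun _ => y) (fun _ => z) id); meas.
Qed.

Lemma inner_bounded (x y z s : R) : 0 <= inner p x y z s <= 2 * pi * (4 * b0 ^+ 2).
Proof. by apply: inner_bound => // th; exact: Phi_leb. Qed.

Lemma inner_compare (x y z s x' y' z' s' K e : R) :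
  (forall th, Phi p (Num.sqrt 2 * s) (Num.sqrt 2 * Ystar x y z s th) <=
     K * Phi p (Num.sqrt 2 * s') (Num.sqrt 2 * Ystar x' y' z' s' th) + e) ->
  inner p x y z s <= K * inner p x' y' z' s' + 2 * pi * e.
Proof.
move=> h; rewrite /inner.
have := @Rintegral_compare R 0 (2 * pi) 0 K e (4 * b0 ^+ 2)
  (fun th => Phi p (Num.sqrt 2 * s) (Num.sqrt 2 * Ystar x y z s th))
  (fun th => Phi p (Num.sqrt 2 * s') (Num.sqrt 2 * Ystar x' y' z' s' th)).
rewrite !addr0 subr0; apply.
- by rewrite mulr_ge0// pi_ge0.
- by apply: measurable_Phi => //; meas; apply: measurable_Ystar; meas.
- by apply: measurable_Phi => //; meas; apply: measurable_Ystar; meas.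
- by move=> th; rewrite Phi_ge0 Phi_leb.
- by move=> th; rewrite Phi_ge0 Phi_leb.
- by move=> th _; rewrite addr0.
Qed.

(** Equal products of roots and intervals of equal length reduce the comparison to the integrands;
    the additive error [e] picks up [2 pi * (r - l)] and the prefactor. *)
Lemma W_interior_compare (x y z x' y' z' l r h K e : R) :
  0 < x -> 0 < y -> 0 < z -> x < y + z ->
  0 < x' -> 0 < y' -> 0 < z' -> x' < y' + z' ->
  Num.sqrt x * Num.sqrt y * Num.sqrt z = Num.sqrt x' * Num.sqrt y' * Num.sqrt z' ->
  l <= r -> lo x' y' z' = l -> hi x' y' z' = r -> lo x y z = l + h -> hi x y z = r + h ->
  (forall s, l <= s <= r -> forall th,
     Phi p (Num.sqrt 2 * (s + h)) (Num.sqrt 2 * Ystar x y z (s + h) th) <=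
     K * Phi p (Num.sqrt 2 * s) (Num.sqrt 2 * Ystar x' y' z' s th) + e) ->
  W p x y z <= K * W p x' y' z' +
     (r - l) * e / (2 * (Num.sqrt x * Num.sqrt y * Num.sqrt z)).
Proof.
move=> x0 y0 z0 xyz x0' y0' z0' xyz' eP lr el er eh1 eh2 H.
rewrite !W_posE// el er eh1 eh2 -eP.
set P := _ * _ * Num.sqrt z.
have P0 : 0 < P by rewrite !mulr_gt0// sqrtr_gt0.
have pi0 := pi_gt0 R.
have := @Rintegral_compare R l r h K (2 * pi * e) (2 * pi * (4 * b0 ^+ 2))
  (inner p x y z) (inner p x' y' z') lr (inner_measurable1 _ _ _) (inner_measurable1 _ _ _).
move=> /(_ (inner_bounded _ _ _) (inner_bounded _ _ _)) hI.
have {}hI := hI (fun s hs => inner_compare (H s hs)).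
have aux (q a i j : R) : 0 < a -> 0 < q -> j <= K * i + (r - l) * (2 * q * e) ->
    (4 * q * a)^-1 * j <= K * ((4 * q * a)^-1 * i) + (r - l) * e / (2 * a).
  move=> a0 q0 ij; rewrite [leLHS]mulrC ler_pdivrMr ?mulr_gt0//; apply: (le_trans ij).
  by apply: eq_ler; field; rewrite (gt_eqF a0) (gt_eqF q0).
exact: aux.
Qed.

Lemma Phi_dilate (r rho r' rho' ka : R) : 0 <= ka -> p r <= (1 + ka) * p r' ->
  p rho <= (1 + ka) * p rho' -> Phi p r rho <= (1 + ka) ^+ 2 * Phi p r' rho'.
Proof.
move=> k0 h1 h2; rewrite /Phi -exprMn lerXn2r ?nnegrE ?addr_ge0// ?mulr_ge0 ?addr_ge0//.
by rewrite mulrDr lerD.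
Qed.

Lemma YstarE (x y z s th q : R) : s != 0 ->
  q = (x - y + s ^+ 2) ^+ 2 / (4 * s ^+ 2) -> q <= z -> q <= x ->
  Ystar x y z s th ^+ 2 = Num.sqrt (z - q) ^+ 2 + Num.sqrt (x - q) ^+ 2 +
     2 * Num.sqrt (z - q) * Num.sqrt (x - q) * cos th.
Proof.
move=> s0 qE qz qx; rewrite /Ystar (negbTE s0) -qE.
rewrite !(max_idPl _) ?subr_ge0//.
by rewrite [LHS]sqr_sqrtr ?modulus_sqr// -modulus_sqr addr_ge0// sqr_ge0.
Qed.

Section fixed.
Variables (a b c : R).
Hypothesis a_gt0 : 0 < a.
Hypothesis ab : a < b.
Hypothesis bc : 16 * b <= c.
Hypothesis bdl : 2 * b <= dl * c.
(** [1 + ka] bounds the quotient of those arguments of [p] that are compared by dilation; [bdl]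
    keeps it in the range where the dilation bound is linear. *)
Let ka := 2 * b / c.
Let A := Num.sqrt a.
Let B := Num.sqrt b.
Let C := Num.sqrt c.
Let D := Num.sqrt (b + c - a).
Let E := Num.sqrt (a + c - b).
Let b_gt0 : 0 < b. Proof. exact: lt_trans ab. Qed.
Let c_gt0 : 0 < c. Proof. by move: b_gt0 bc; lra. Qed.
Let A0 : 0 < A. Proof. by rewrite sqrtr_gt0. Qed.
Let B0 : 0 < B. Proof. by rewrite sqrtr_gt0. Qed.
Let C0 : 0 < C. Proof. by rewrite sqrtr_gt0. Qed.
Let A2 : A ^+ 2 = a. Proof. by rewrite sqr_sqrtr// ltW. Qed.
Let B2 : B ^+ 2 = b. Proof. by rewrite sqr_sqrtr// ltW. Qed.
Let C2 : C ^+ 2 = c. Proof. by rewrite sqr_sqrtr// ltW. Qed.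
Let D2 : D ^+ 2 = b + c - a. Proof. by rewrite sqr_sqrtr//; move: c_gt0 ab; lra. Qed.
Let E2 : E ^+ 2 = a + c - b. Proof. by rewrite sqr_sqrtr//; move: c_gt0 a_gt0 bc b_gt0; lra. Qed.
Let E0 : 0 <= E. Proof. exact: sqrtr_ge0. Qed.
Let AB : A < B. Proof. by rewrite ltr_sqrt. Qed.
Let BE : B <= E. Proof. by rewrite ler_wsqrtr//; move: b_gt0 bc a_gt0; lra. Qed.
Let EC : E <= C. Proof. by rewrite ler_wsqrtr//; move: ab; lra. Qed.
Let CD : C <= D. Proof. by rewrite ler_wsqrtr//; move: ab; lra. Qed.
Let ka0 : 0 <= ka. Proof. by rewrite divr_ge0 ?mulr_ge0// ltW. Qed.
Let kadl : ka <= dl. Proof. by rewrite ler_pdivrMr. Qed.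

Let xsa : xstar a b c = b + c - a.
Proof. by rewrite /xstar (max_idPl _)//; move: c_gt0 ab; lra. Qed.
Let xsb : xstar b a c = a + c - b.
Proof. by rewrite /xstar (max_idPl _)//; move: c_gt0 a_gt0 bc b_gt0; lra. Qed.
Let xsa' : xstar a c b = b + c - a.
Proof. by rewrite /xstar [c + b]addrC (max_idPl _)//; move: c_gt0 ab; lra. Qed.
Let xsb' : xstar b c a = a + c - b.
Proof. by rewrite /xstar [c + a]addrC (max_idPl _)//; move: c_gt0 a_gt0 bc b_gt0; lra. Qed.

(** In all four orderings the smallest root [A] determines the length [2 * A]. The first two
    intervals coincide, and the last two differ by the translation [C - E]. *)
Let range1 : lo a b c = B - A /\ hi a b c = B + A.
Proof.
rewrite /lo /hi xsa -/A -/B -/C -/D; split.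
  rewrite distrC (ger0_norm (_ : 0 <= B - A)) ?subr_ge0 ?ltW//.
  rewrite (ger0_norm (_ : 0 <= D - C)) ?subr_ge0//; apply/max_idPl.
  apply: diff_sqr_le; rewrite ?CD ?(ltW AB) ?(ltW C0) ?(ltW A0)//.
    by rewrite D2 C2 B2 A2; lra.
  by move: AB BE EC CD; lra.
by rewrite addrC; apply/min_idPl; move: AB BE EC CD; lra.
Qed.

Let range2 : lo b a c = B - A /\ hi b a c = B + A.
Proof.
rewrite /lo /hi xsb -/A -/B -/C -/E; split.
  rewrite (ger0_norm (_ : 0 <= B - A)) ?subr_ge0 ?ltW//.
  rewrite distrC (ger0_norm (_ : 0 <= C - E)) ?subr_ge0//; apply/max_idPl.
  apply: diff_sqr_le; rewrite ?EC ?(ltW AB) ?E0 ?(ltW A0)//.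
    by rewrite E2 C2 B2 A2; lra.
  by move: AB BE EC CD; lra.
by apply/min_idPl; move: AB BE EC CD; lra.
Qed.

Let range3 : lo a c b = C - A /\ hi a c b = C + A.
Proof.
rewrite /lo /hi xsa' -/A -/B -/C -/D; split.
  rewrite distrC (ger0_norm (_ : 0 <= C - A)); last by move: AB BE EC; lra.
  rewrite (ger0_norm (_ : 0 <= D - B)); last by move: AB BE EC CD; lra.
  apply/max_idPl; apply: diff_sqr_le; rewrite ?(ltW B0) ?(ltW A0)/=.
  - by move: AB BE EC CD; lra.
  - by move: AB BE EC CD; lra.
  - by rewrite D2 C2 B2 A2; lra.
  - by move: AB BE EC CD; lra.
by rewrite addrC; apply/min_idPl; move: AB BE EC CD; lra.
Qed.

Let range4 : lo b c a = E - A /\ hi b c a = E + A.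
Proof.
rewrite /lo /hi xsb' -/A -/B -/C -/E; split.
  rewrite distrC (ger0_norm (_ : 0 <= C - B)); last by move: AB BE EC; lra.
  rewrite (ger0_norm (_ : 0 <= E - A)); last by move: AB BE EC CD; lra.
  apply/max_idPr; apply: diff_sqr_le; rewrite ?(ltW B0) ?(ltW A0)/=.
  - by move: AB BE EC CD; lra.
  - by move: AB BE EC CD; lra.
  - by rewrite E2 C2 B2 A2; lra.
  - by move: AB BE EC CD; lra.
by apply/min_idPr; move: AB BE EC CD; lra.
Qed.

(** Both kernels use the same [s]. Exchanging [a] and [b] shifts [q] by [b - a], so the short leg
    [v] in [Ystar] is unchanged and only the long leg, of order [sqrt c], moves: [Ystar] changes by
    a relative amount [O(b / c)]. *)
Lemma W_compare_near_interior :
  W p a b c <= (1 + L * ka) ^+ 2 * W p b a c.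
Proof.
have [l1 h1] := range1; have [l2 h2] := range2.
have := @W_interior_compare a b c b a c (B - A) (B + A) 0 ((1 + L * ka) ^+ 2) 0.
rewrite !addr0 mulr0 mul0r addr0; apply => //.
- by move: c_gt0 ab; lra.
- by move: c_gt0 a_gt0 bc b_gt0; lra.
- by rewrite [Num.sqrt a * _]mulrC.
- by move: A0 ; lra.
move=> s /andP[s1 s2] th; rewrite !addr0.
have s0 : 0 < s by move: AB; lra.
have sn0 : s != 0 by rewrite gt_eqF.
apply: Phi_dilate; first by rewrite mulr_ge0.
  by rewrite ler_peMl// lerDl mulr_ge0.
pose q := (a - b + s ^+ 2) ^+ 2 / (4 * s ^+ 2).
pose q' := (b - a + s ^+ 2) ^+ 2 / (4 * s ^+ 2).
have q'E : q' = q + (b - a) by rewrite /q /q'; field.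
have q0 : 0 <= q.
  by apply: divr_ge0; [exact: sqr_ge0|apply: mulr_ge0 => //; exact: sqr_ge0].
(* Heron's formula: the difference factors into four terms, nonnegative as long as [A], [B], [s] are
   the sides of a triangle, which is the range of [s]. *)
have qa : q <= a.
  rewrite /q ler_pdivrMr ?mulr_gt0 ?exprn_gt0// -A2 -B2 -subr_ge0.
  have -> : A ^+ 2 * (4 * s ^+ 2) - (A ^+ 2 - B ^+ 2 + s ^+ 2) ^+ 2 =
    ((B - (s - A)) * (B + (s - A))) * ((s + A - B) * (s + A + B)) by ring.
  by rewrite !mulr_ge0//; move: A0 B0 AB; lra.
have bc' : b <= c by move: bc b_gt0; lra.
have q'b : q' <= b by rewrite q'E; lra.
have Y1 := @YstarE a b c s th q sn0 erefl (le_trans qa (le_trans (ltW ab) bc')) qa.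
have Y2 := @YstarE b a c s th q' sn0 erefl (le_trans q'b bc') q'b.
have v'E : b - q' = a - q by rewrite q'E; ring.
rewrite {}v'E in Y2.
set u1 := Num.sqrt (c - q) in Y1; set v := Num.sqrt (a - q) in Y1 Y2.
set u2 := Num.sqrt (c - q') in Y2.
have u10 : 0 <= u1 by exact: sqrtr_ge0.
have u20 : 0 <= u2 by exact: sqrtr_ge0.
have v0 : 0 <= v by exact: sqrtr_ge0.
have u1E : u1 ^+ 2 = c - q by rewrite sqr_sqrtr//; move: ab; lra.
have u2E : u2 ^+ 2 = c - q' by rewrite sqr_sqrtr//; lra.
have vE : v ^+ 2 = a - q by rewrite sqr_sqrtr//; lra.
have u12 : u2 <= u1 by rewrite ler_wsqrtr//; rewrite q'E; move: ab; lra.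
(* From [16 * b <= c] one has [v^2 <= u2^2 / 15], and [1 / 15 <= (4 / 15)^2]. This ratio is what
   makes [Y2v^2] at least [c / 2] below. *)
have vu2 : v <= 4 / 15 * u2.
  rewrite -ler_sqr ?nnegrE ?mulr_ge0//.
  by rewrite exprMn vE u2E; move: bc ab q'b q0 a_gt0; lra.
have cl := cos_le1 th; have cg := cos_geN1 th.
have vc1 : v * cos th <= v by rewrite ler_piMr.
have vc2 : - v <= v * cos th by rewrite -mulrN1 ler_wpM2l.
set Y1v := Ystar a b c s th in Y1 *; set Y2v := Ystar b a c s th in Y2 *.
have Y10 : 0 <= Y1v by exact: Ystar_ge0.
have Y20 : 0 <= Y2v by exact: Ystar_ge0.
have dY : Y1v ^+ 2 - Y2v ^+ 2 = (u1 - u2) * (u1 + u2 + 2 * (v * cos th)).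
  by rewrite Y1 Y2; ring.
have d1 : (u1 - u2) * (u1 + u2) = b - a.
  by rewrite -subr_sqr u1E u2E q'E; ring.
have Y2c : c / 2 <= Y2v ^+ 2.
  have : (11 / 15 * u2) ^+ 2 <= Y2v ^+ 2.
    have -> : Y2v ^+ 2 = (u2 - v) ^+ 2 + 2 * u2 * (v + v * cos th) by rewrite Y2; ring.
    apply: (@le_trans _ _ ((u2 - v) ^+ 2)); last by rewrite lerDl !mulr_ge0//; lra.
    by rewrite lerXn2r ?nnegrE ?mulr_ge0//; lra.
  by rewrite exprMn u2E; move: bc ab q'b a_gt0; lra.
have Y21 : Y2v ^+ 2 <= Y1v ^+ 2.
  by rewrite -subr_ge0 dY mulr_ge0//; lra.
have Y12 : Y1v ^+ 2 <= Y2v ^+ 2 + 2 * (b - a).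
  rewrite -lerBlDl dY -d1.
  have -> : 2 * ((u1 - u2) * (u1 + u2)) = (u1 - u2) * (2 * (u1 + u2)) by ring.
  by rewrite ler_wpM2l//; lra.
have s20 : 0 < Num.sqrt 2 :> R by rewrite sqrtr_gt0.
apply: p_dilate => //.
- rewrite mulr_gt0// lt_neqAle Y20 andbT eq_sym -sqrf_eq0 gt_eqF//.
  by move: Y2c c_gt0; lra.
- by rewrite ler_pM2l// -ler_sqr ?nnegrE.
- rewrite mulrCA ler_pM2l// -ler_sqr ?nnegrE ?mulr_ge0 ?addr_ge0//.
  rewrite exprMn (le_trans Y12)//.
  have : c * ka = 2 * b by rewrite /ka; field; rewrite gt_eqF.
  move=> ckb.
  apply: (@le_trans _ _ (Y2v ^+ 2 + (2 * ka) * Y2v ^+ 2)).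
    rewrite lerD2l (le_trans (_ : _ <= 2 * ka * (c / 2)))//; last first.
      by rewrite ler_wpM2l// mulr_ge0.
    by move: ckb a_gt0; lra.
  have -> : Y2v ^+ 2 + 2 * ka * Y2v ^+ 2 = (1 + 2 * ka) * Y2v ^+ 2 by ring.
  by rewrite ler_wpM2r ?sqr_ge0//; have := sqr_ge0 ka; lra.
Qed.

(** Here [s] is of order [sqrt c] and is dilated by the translation [C - E]. [Ystar] is at most
    [A + B], small but not comparable between the two kernels, so all terms containing it go into
    the additive error. *)
Lemma W_compare_far_interior : L * ka <= 1 ->
  W p a c b <= (1 + L * ka) ^+ 2 * W p b c a + 40 * b0 ^+ 2.
Proof.
move=> Lka; have [l1 h1] := range3; have [l2 h2] := range4.
have Lka0 : 0 <= L * ka by rewrite mulr_ge0.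
have h0 : 0 <= C - E by move: EC; lra.
(* [40 = 4 * 8 + 8]: the cross term has coefficient at most 4, and both products of values of [p]
   are at most [8 * b0^2 * B * C]. The factor [B * C] and the length [2 * A] cancel the product of
   roots in the denominator. *)
have H := @W_interior_compare a c b b c a (E - A) (E + A) (C - E) ((1 + L * ka) ^+ 2)
   (40 * b0 ^+ 2 * (B * C)).
have e1 : E - A + (C - E) = C - A by ring.
have e2 : E + A + (C - E) = C + A by ring.
rewrite e1 e2 in H.
apply: le_trans (_ : _ <= _) _; first apply: H => //.
- by move: c_gt0 ab; lra.
- by move: c_gt0 a_gt0 bc b_gt0; lra.
- by ring.
- by move: A0 ; lra.
- move=> s /andP[s1 s2] th.
  have E15 : 15 / 16 * C <= E.
    rewrite -ler_sqr ?nnegrE ?mulr_ge0 ?(ltW C0)//.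
    by rewrite exprMn C2 E2; move: bc a_gt0 c_gt0; lra.
  have A4 : A <= C / 4.
    rewrite -ler_sqr ?nnegrE ?(ltW A0) ?divr_ge0 ?(ltW C0)//.
    by rewrite exprMn C2 A2; move: bc ab; lra.
  have sC : C / 2 <= s by lra.
  have s0 : 0 < s by move: C0; lra.
  have hC : (C - E) * C <= b.
    apply: (@le_trans _ _ ((C - E) * (C + E))); first by rewrite ler_wpM2l//; lra.
    by rewrite -subr_sqr C2 E2; move: a_gt0; lra.
  have hs : C - E <= ka * s.
    apply: (@le_trans _ _ (ka * (C / 2))); last by rewrite ler_wpM2l.
    have -> : ka * (C / 2) = b / C.
      by rewrite /ka -C2; field; rewrite gt_eqF.
    by rewrite ler_pdivlMr.
  have s20 : 0 < Num.sqrt 2 :> R by rewrite sqrtr_gt0.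
  have ps : p (Num.sqrt 2 * (s + (C - E))) <= (1 + L * ka) * p (Num.sqrt 2 * s).
    apply: p_dilate => //; first by rewrite mulr_gt0.
      by rewrite ler_pM2l//; lra.
    by rewrite mulrCA ler_pM2l// mulrDl mul1r lerD2l.
  rewrite /Phi.
  set ps1 := p (Num.sqrt 2 * (s + (C - E))) in ps *.
  set ps2 := p (Num.sqrt 2 * s) in ps *.
  have ps2l : ps2 <= b0 * (Num.sqrt 2 * (2 * C)).
    apply: (le_trans (p_lin _)); first by rewrite mulr_ge0 ?ltW.
    by rewrite ler_pM2l// ler_pM2l//; move: EC; lra.
  set p1 := p (Num.sqrt 2 * Ystar a c b (s + (C - E)) th).
  have p1l : p1 <= b0 * (Num.sqrt 2 * (2 * B)).
    apply: (le_trans (p_lin _)); first by rewrite mulr_ge0 ?Ystar_ge0// ltW.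
    rewrite ler_pM2l// ler_pM2l// (le_trans (Ystar_le _ _ _ (ltW a_gt0) (ltW b_gt0)))//.
    by rewrite -/A -/B; move: AB; lra.
  set p2 := p (_ * Ystar b c a s th).
  have p10 : 0 <= p1 by exact: p_ge0.
  have p20 : 0 <= p2 by exact: p_ge0.
  have ps20 : 0 <= ps2 by exact: p_ge0.
  have ps10 : 0 <= ps1 by exact: p_ge0.
  apply: (@le_trans _ _ (((1 + L * ka) * ps2 + p1) ^+ 2)).
    by rewrite lerXn2r ?nnegrE ?addr_ge0 ?mulr_ge0 ?addr_ge0// lerD2r.
  apply: (@le_trans _ _ ((1 + L * ka) ^+ 2 * ps2 ^+ 2 + (4 * (ps2 * p1) + p1 * p1))).
    have -> : ((1 + L * ka) * ps2 + p1) ^+ 2 = (1 + L * ka) ^+ 2 * ps2 ^+ 2 +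
      (2 * (1 + L * ka) * (ps2 * p1) + p1 * p1) by ring.
    by rewrite lerD2l lerD2r ler_wpM2r ?mulr_ge0//; lra.
  apply: lerD.
    by rewrite ler_wpM2l ?sqr_ge0// lerXn2r ?nnegrE ?addr_ge0// lerDl.
  have e3 : Num.sqrt 2 * Num.sqrt 2 = 2 :> R by rewrite -expr2 sqr_sqrtr.
  have f1 : ps2 * p1 <= 8 * b0 ^+ 2 * (B * C).
    apply: (le_trans (ler_pM ps20 p10 ps2l p1l)).
    have -> : b0 * (Num.sqrt 2 * (2 * C)) * (b0 * (Num.sqrt 2 * (2 * B))) =
      4 * b0 ^+ 2 * (B * C) * (Num.sqrt 2 * Num.sqrt 2) by ring.
    by rewrite e3; apply: eq_ler; ring.
  have f2 : p1 * p1 <= 8 * b0 ^+ 2 * (B * C).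
    apply: (le_trans (ler_pM p10 p10 p1l p1l)).
    have -> : b0 * (Num.sqrt 2 * (2 * B)) * (b0 * (Num.sqrt 2 * (2 * B))) =
      4 * b0 ^+ 2 * (B * B) * (Num.sqrt 2 * Num.sqrt 2) by ring.
    rewrite e3; apply: (@le_trans _ _ (4 * b0 ^+ 2 * (B * C) * 2)); last by apply: eq_ler; ring.
    rewrite ler_pM2r// ler_wpM2l ?mulr_ge0 ?sqr_ge0 ?(ltW b0_gt0)// ler_pM2l//.
    by move: BE EC; lra.
  by move: f1 f2; lra.
rewrite lerD2l -/A -/B -/C.
have aux (x y z u : R) : 0 < x -> 0 < y -> 0 < z ->
    (E + x - (E - x)) * (u * (y * z)) / (2 * (x * z * y)) = u.
  by move=> x0 y0 z0; field; rewrite (gt_eqF x0) (gt_eqF y0) (gt_eqF z0).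
by rewrite aux.
Qed.

End fixed.
End Compare.

(** * Sum of the collision operator over permutations of its arguments *)

Section Symmetrized.
Variable R : realType.
Notation leb := (@lebesgue_measure R).
Variables (p : R -> R) (b0 : R).
Hypothesis mp : measurable_fun setT p.
Hypothesis b0_gt0 : 0 < b0.
Hypothesis p_ge0 : forall r, 0 <= p r.
Hypothesis p_leb : forall r, p r <= b0.
Hypothesis p_lin : forall r : R, 0 <= r -> p r <= b0 * r.
Variables (L dl : R).
Hypothesis L_ge0 : 0 <= L.
Hypothesis dl_gt0 : 0 < dl.
Hypothesis p_dil : forall r al : R, 0 < r -> 1 <= al <= 1 + dl ->
  p (al * r) <= (1 + L * (al - 1)) * p r.

Variable C0 : R.
Hypothesis C0E : C0 = 32 * b0 ^+ 2.
Let C0_gt0 : 0 < C0. Proof. by rewrite C0E mulr_gt0// exprn_gt0. Qed.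

Lemma W_bound_C0 (x y z : R) : W p x y z = 0 \/ W_estimates p C0 x y z.
Proof. by rewrite C0E; exact: W_bound. Qed.

Lemma min1_le_sqrt (c : R) : 0 <= c -> Num.min 1 (2 * c) <= 2 * Num.sqrt c.
Proof.
move=> c0; have s0 := sqrtr_ge0 c; have s2 := sqr_sqrtr c0.
have [c1|c1] := leP 1 (Num.sqrt c); rewrite ge_min; apply/orP; [left|right]; first lra.
by rewrite -{1}s2 ler_pM2l// expr2 ler_piMr// (ltW c1).
Qed.

Lemma W_zero2 (x y z : R) : [\/ x = 0 /\ y = 0, x = 0 /\ z = 0 | y = 0 /\ z = 0] ->
  W p x y z = 0.
Proof.
move=> h; case: (W_cases p x y z) => [[]|[]|[]|[[]|//]].
- by case: h => [[-> ->]|[-> ->]|[-> ->]]; lra.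
- by case: h => [[-> ->]|[-> ->]|[-> ->]]; lra.
- by case: h => [[-> ->]|[-> ->]|[-> ->]]; lra.
- by case: h => [[-> ->]|[-> ->]|[-> ->]]; lra.
Qed.

Lemma W_sum_le (x y z : R) : y + z <= x -> W p x y z = 0.
Proof.
by case: (W_bound_C0 x y z) => // -[[]]; lra.
Qed.

Lemma W_neg (x y z : R) : [\/ x < 0, y < 0 | z < 0] -> W p x y z = 0.
Proof.
by case: (W_bound_C0 x y z) => // -[[]] ? ? ? _ _ _ _ _ [] /=; lra.
Qed.

(** Serves the face [a = 0], where [W] is an explicit quotient and the two kernels involve [c] and
    [c - b]. *)
Lemma p_sqrt_dilate (b c : R) : 0 < b -> 2 * b <= c -> 2 * b <= dl * c ->
  p (Num.sqrt (2 * c)) <= (1 + L * (2 * b / c)) * p (Num.sqrt (2 * (c - b))).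
Proof.
move=> b_gt0 bc bdl; have c0 : 0 < c by lra.
have k0 : 0 <= 2 * b / c by rewrite divr_ge0//; lra.
apply: (@p_dilate _ p p_ge0 L dl L_ge0 p_dil).
- by rewrite sqrtr_gt0; lra.
- by rewrite ler_wsqrtr//; lra.
- rewrite -ler_sqr ?nnegrE ?mulr_ge0 ?sqrtr_ge0 ?addr_ge0// exprMn !sqr_sqrtr; [|lra..].
  have e : c * (2 * b / c) = 2 * b by field; rewrite gt_eqF.
  have h : 1 + 2 * (2 * b / c) <= (1 + 2 * b / c) ^+ 2.
    rewrite [leRHS](_ : _ = 1 + 2 * (2 * b / c) + (2 * b / c) ^+ 2); last by ring.
    by rewrite lerDl sqr_ge0.
  apply: (@le_trans _ _ ((1 + 2 * (2 * b / c)) * (2 * (c - b)))); last first.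
    by rewrite ler_wpM2r//; lra.
  have e2 : b * (2 * b / c) <= b.
    by rewrite ler_piMr ?ler_pdivrMr//; lra.
  have -> : (1 + 2 * (2 * b / c)) * (2 * (c - b)) =
     2 * (c - b) + 4 * (c * (2 * b / c)) - 4 * (b * (2 * b / c)) by ring.
  by rewrite e; lra.
- by rewrite ler_pdivrMr.
Qed.

(** The thresholds of the geometric comparison and of the dilation range, and the condition
    [L * (2 * b / c) <= 1], under which the square of [1 + L * (2 * b / c)] can be linearized. *)
Definition near_ok (b c : R) := [/\ 0 < b, 16 * b <= c, 2 * b <= dl * c & 2 * L * b <= c].

Lemma W_compare (a b c : R) : 0 <= a <= b -> near_ok b c ->
  W p a b c <= (1 + L * (2 * b / c)) ^+ 2 * W p b a c + 40 * b0 ^+ 2 /\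
  W p a c b <= (1 + L * (2 * b / c)) ^+ 2 * W p b c a + 40 * b0 ^+ 2.
Proof.
move=> /andP[a0 ab] [b_gt0 bc bdl bL].
have c0 : 0 < c by lra.
have k0 : 0 <= 2 * b / c by rewrite divr_ge0//; lra.
have Lk0 : 0 <= L * (2 * b / c) by rewrite mulr_ge0.
have Lk1 : L * (2 * b / c) <= 1 by rewrite mulrA ler_pdivrMr//; lra.
have B0 : 0 <= 40 * b0 ^+ 2 by rewrite mulr_ge0// sqr_ge0.
have K1 : 1 <= (1 + L * (2 * b / c)) ^+ 2 by rewrite exprn_ege1//; lra.
move: ab; rewrite le_eqVlt => /predU1P[ab|ab].
  rewrite -ab; split; rewrite -[leLHS]addr0 lerD// ler_peMl// ?W_ge0// ab//.
move: a0; rewrite le_eqVlt => /predU1P[a0|a0]; last first.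
  split.
    apply: (le_trans (W_compare_near_interior mp p_ge0 p_leb L_ge0 p_dil a0 ab bc bdl)).
    by rewrite lerDl.
  by apply: (W_compare_far_interior mp b0_gt0 p_ge0 p_leb p_lin L_ge0 p_dil a0 ab bc bdl).
rewrite -a0.
have h := @p_sqrt_dilate b c b_gt0 (_ : 2 * b <= c) bdl.
have {}h := h ltac:(lra).
have bltc : b < c by lra.
have hs (u : R) : p u <= (1 + L * (2 * b / c)) * p u by rewrite ler_peMl//; lra.
have i0 : 0 <= (Num.sqrt (b * c))^-1 by rewrite invr_ge0 sqrtr_ge0.
split.
- rewrite /W !(mulr0, mul0r) ltxx eqxx b_gt0 c0/= (gt_eqF b_gt0)/= bltc/=.
  apply: (@le_trans _ _ ((1 + L * (2 * b / c)) ^+ 2 * Phi p (Num.sqrt (2 * b)) (Num.sqrt (2 * (c - b))) / Num.sqrt (b * c))).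
    by rewrite ler_wpM2r// Phi_dilate.
  by rewrite -mulrA lerDl.
- rewrite /W !(mulr0, mul0r) ltxx eqxx b_gt0 c0/= (gt_eqF b_gt0) (gt_eqF c0)/= bltc/=.
  rewrite [c * b]mulrC.
  apply: (@le_trans _ _ ((1 + L * (2 * b / c)) ^+ 2 * Phi p (Num.sqrt (2 * (c - b))) (Num.sqrt (2 * b)) / Num.sqrt (b * c))).
    by rewrite ler_wpM2r// Phi_dilate.
  by rewrite -mulrA lerDl.
Qed.

(** The two larger arguments may sit in any two slots. The estimate for that pair is divided by
    [sqrt c], using [min 1 (2 c) <= 2 c] for the first bound and [min 1 (2 c) <= 2 sqrt c] for the
    second. *)
Lemma W_pair_le (x y z b c : R) : 0 < b -> b <= c ->
  [\/ [/\ x <= c, y = b & z = c], [/\ x <= c, z = b & y = c],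
      [/\ y <= c, x = b & z = c] | [\/ [/\ y <= c, z = b & x = c],
      [/\ z <= c, x = b & y = c] | [/\ z <= c, y = b & x = c] ] ] ->
  W p x y z * Num.sqrt b <= 2 * C0 * Num.sqrt c /\ W p x y z * Num.sqrt b <= 2 * C0.
Proof.
move=> b_gt0 bc hp.
have c0 : 0 < c by lra.
have sc0 : 0 < Num.sqrt c by rewrite sqrtr_gt0.
case: (W_bound_C0 x y z) => [->|].
  by rewrite mul0r !mulr_ge0 ?ltW.
move=> [[x0 y0 z0 xyz] h1 h2 h3 _].
have h : W p x y z * (Num.sqrt b * Num.sqrt c) <= C0 * Num.min 1 (2 * c).
  have hm : C0 * Num.min 1 (y + z) <= C0 * Num.min 1 (2 * c).
    rewrite ler_pM2l// le_min ge_min lexx/= ge_min; apply/orP; right.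
    by case: hp => [[? ? ?]|[? ? ?]|[? ? ?]|[[? ? ?]|[? ? ?]|[? ? ?]]]; lra.
  apply: le_trans hm.
  case: hp => [[? yE zE]|[? zE yE]|[? xE zE]|[[? zE xE]|[? xE yE]|[? yE xE]]].
  - by rewrite -yE -zE.
  - by rewrite -zE -yE mulrC [Num.sqrt z * _]mulrC mulrC.
  - by rewrite -xE -zE.
  - by rewrite -xE -zE [Num.sqrt z * _]mulrC.
  - by rewrite -xE -yE.
  - by rewrite -xE -yE [Num.sqrt y * _]mulrC.
rewrite mulrA in h; split.
  rewrite -(ler_pM2r sc0) (le_trans h)//.
  have -> : 2 * C0 * Num.sqrt c * Num.sqrt c = C0 * (2 * Num.sqrt c ^+ 2) by ring.
  rewrite sqr_sqrtr ?(ltW c0)//.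
  by rewrite ler_pM2l// ge_min lexx orbT.
rewrite -(ler_pM2r sc0) (le_trans h)//.
have -> : 2 * C0 * Num.sqrt c = C0 * (2 * Num.sqrt c) by ring.
by rewrite ler_pM2l// min1_le_sqrt// ltW.
Qed.

(** The relative error of order [b / c] meets a kernel of size at most [sqrt (c / b)], and
    [sqrt (b / c) <= 1]. *)
Lemma W_diff_le (a b c w1 w2 : R) : 0 <= a <= b -> near_ok b c ->
  w1 <= (1 + L * (2 * b / c)) ^+ 2 * w2 + 40 * b0 ^+ 2 ->
  0 <= w2 -> w2 * Num.sqrt b <= 2 * C0 * Num.sqrt c ->
  w1 - w2 <= 12 * L * C0 + 40 * b0 ^+ 2.
Proof.
move=> _ [b_gt0 bc bdl bL] h1 w20 h2.
have c0 : 0 < c by lra.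
have k0 : 0 <= 2 * b / c by rewrite divr_ge0//; lra.
have Lk0 : 0 <= L * (2 * b / c) by rewrite mulr_ge0.
have Lk1 : L * (2 * b / c) <= 1 by rewrite mulrA ler_pdivrMr//; lra.
set k := L * (2 * b / c) in h1 Lk0 Lk1.
suff h3 : 3 * k * w2 <= 12 * L * C0.
  rewrite lerBlDr (le_trans h1)//.
  have : (1 + k) ^+ 2 * w2 <= (1 + 3 * k) * w2.
    by rewrite ler_wpM2r//; nra.
  by move: h3; lra.
have sb0 : 0 < Num.sqrt b by rewrite sqrtr_gt0.
have sc0 : 0 < Num.sqrt c by rewrite sqrtr_gt0.
have sb2 := sqr_sqrtr (ltW b_gt0); have sc2 := sqr_sqrtr (ltW c0).
rewrite -(ler_pM2r sb0) -[leLHS]mulrA.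
apply: (@le_trans _ _ (3 * k * (2 * C0 * Num.sqrt c))).
  by rewrite ler_wpM2l// mulr_ge0.
have -> : 3 * k * (2 * C0 * Num.sqrt c) = 12 * L * C0 * (b / Num.sqrt c).
  by rewrite /k -[in X in L * (_ / X)]sc2; field; rewrite gt_eqF.
rewrite ler_wpM2l ?mulr_ge0 ?(ltW C0_gt0)//.
rewrite ler_pdivrMr// -{1}sb2 expr2 ler_pM2l// ler_wsqrtr//; lra.
Qed.

Section test_function.
(** The properties assumed below are those of [(e + x)^(-1/2)]; none of them carries a constant
    depending on [e], so the resulting bound is uniform in the regularization. *)
Variable f : R -> R.
Hypothesis f_gt0 : forall x, 0 < f x.
Hypothesis f_decr : forall x y, 0 <= x <= y -> f y <= f x.
Hypothesis f_conv : forall x y z, 0 <= x <= y -> y <= z -> f y + f (x + z - y) <= f x + f z.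
Hypothesis f_sqrt : forall x y, 0 <= x <= y -> Num.sqrt x * f x <= Num.sqrt y * f y.
Hypothesis f_slope : forall h c, 0 <= h -> 2 * h <= c -> 0 < c -> f (c - h) - f c <= 2 * h / c * f c.

(** Sum of the three thresholds of [near_ok], so that its failure forces [c <= LL * b]. *)
Variable LL : R.
Hypothesis LLE : LL = 16 + 2 / dl + 2 * L.

Let LL1 : 16 <= LL.
Proof.
have h1 : 0 <= 2 / dl by rewrite divr_ge0// ltW.
by rewrite LLE; move: L_ge0; lra.
Qed.

(** The output is the largest argument, and its partner [d = a + b - c] may be arbitrarily close to
    0, where [f] is large. The factor [sqrt d] of the kernel and the monotonicity of [sqrt x * f x]
    move the value from [d] to [a]. *)
Lemma third_term_le (w a b c : R) : 0 <= a -> a <= b -> b <= c -> 0 <= w -> c < a + b ->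
  w * (Num.sqrt a * Num.sqrt b * Num.sqrt c) <= C0 * Num.min 1 (a + b) * Num.sqrt (a + b - c) ->
  w * (f c + f (a + b - c) - f a - f b) <= 4 * C0 * f a.
Proof.
move=> a0 ab bc w0 cab h.
have a1 : 0 < a by lra.
have d0 : 0 < a + b - c by lra.
set d := a + b - c in h d0 *.
have sa0 : 0 < Num.sqrt a by rewrite sqrtr_gt0.
have sb0 : 0 < Num.sqrt b by rewrite sqrtr_gt0; lra.
have sc0 : 0 < Num.sqrt c by rewrite sqrtr_gt0; lra.
have fa := f_gt0 a; have fd := f_gt0 d.
have da : 0 <= d <= a by rewrite /d; lra.
have fcb : f c <= f b by apply: f_decr; lra.
apply: (@le_trans _ _ (w * f d)); first by rewrite ler_wpM2l//; lra.
have P0 : 0 < Num.sqrt a * Num.sqrt b * Num.sqrt c by rewrite !mulr_gt0.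
rewrite -(ler_pM2r P0) mulrAC.
apply: (@le_trans _ _ (C0 * Num.min 1 (a + b) * Num.sqrt d * f d)).
  by rewrite ler_wpM2r// ltW.
have m0 : 0 <= Num.min 1 (a + b) by rewrite le_min ler01; lra.
apply: (@le_trans _ _ (C0 * (2 * c) * (Num.sqrt a * f a))).
  rewrite -mulrA ler_pM ?mulr_ge0 ?(ltW C0_gt0) ?sqrtr_ge0 ?(ltW fd)//.
    by rewrite ler_pM2l// ge_min; apply/orP; right; lra.
  exact: f_sqrt.
have -> : 4 * C0 * f a * (Num.sqrt a * Num.sqrt b * Num.sqrt c) =
  C0 * (4 * Num.sqrt b * Num.sqrt c) * (Num.sqrt a * f a) by ring.
rewrite ler_wpM2r ?mulr_ge0 ?(ltW sa0) ?(ltW fa)// ler_pM2l//.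
have c2 : Num.sqrt c ^+ 2 = c by rewrite sqr_sqrtr//; lra.
have b2 : Num.sqrt b ^+ 2 = b by rewrite sqr_sqrtr//; lra.
rewrite -{1}c2 expr2 mulrA ler_pM2r//.
have : Num.sqrt c <= 2 * Num.sqrt b.
  by rewrite -ler_sqr ?nnegrE ?mulr_ge0 ?ltW// exprMn c2 b2; lra.
by lra.
Qed.

(** By convexity the first bracket is a gain [D1 >= 0] and the second a loss [- D2 <= 0]. For
    comparable [b] and [c] the kernel is bounded and the loss is dropped; otherwise the loss must
    cancel the singular part of the gain. *)
Lemma pair_term_le (w1 w2 a b c : R) : 0 <= a -> a <= b -> b <= c -> 0 <= w1 -> 0 <= w2 ->
  (b = 0 -> w1 = 0 /\ w2 = 0) ->
  (0 < b -> w1 * Num.sqrt b <= 2 * C0 * Num.sqrt c) ->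
  (0 < b -> w2 * Num.sqrt b <= 2 * C0 * Num.sqrt c) ->
  (near_ok b c -> w1 <= (1 + L * (2 * b / c)) ^+ 2 * w2 + 40 * b0 ^+ 2) ->
  w1 * (f a + f (b + c - a) - f b - f c) + w2 * (f b + f (a + c - b) - f a - f c) <=
  (12 * L * C0 + 40 * b0 ^+ 2 + 4 * C0 + 2 * C0 * LL) * (f a + f c).
Proof.
move=> a0 ab bc w10 w20 hb hw1 hw2 hn.
have fa := f_gt0 a; have fc := f_gt0 c; have fb := f_gt0 b.
have q1 : 0 <= 12 * L * C0 + 40 * b0 ^+ 2.
  by rewrite addr_ge0 ?mulr_ge0 ?sqr_ge0 ?(ltW C0_gt0)// ltW.
have q2 : 0 <= 2 * C0 * LL by rewrite mulr_ge0 ?mulr_ge0 ?(ltW C0_gt0)//; move: LL1; lra.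
have q3 : 0 <= 4 * C0 by rewrite mulr_ge0 ?(ltW C0_gt0).
have b_ge0 : 0 <= b by lra.
move: (b_ge0); rewrite le_eqVlt => /predU1P[b00|b_gt0].
  have [-> ->] := hb (esym b00); rewrite !mul0r addr0.
  by apply: mulr_ge0; lra.
have c_gt0 : 0 < c by lra.
have {}hw1 := hw1 b_gt0; have {}hw2 := hw2 b_gt0.
have sb0 : 0 < Num.sqrt b by rewrite sqrtr_gt0.
have sc0 : 0 < Num.sqrt c by rewrite sqrtr_gt0.
have sb2 : Num.sqrt b ^+ 2 = b by rewrite sqr_sqrtr.
have sc2 : Num.sqrt c ^+ 2 = c by rewrite sqr_sqrtr// ltW.
set D1 := f a + f (b + c - a) - f b - f c.
set D2 := f a + f c - f b - f (a + c - b).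
have D10 : 0 <= D1.
  have := @f_conv a b (b + c - a); rewrite (_ : a + (b + c - a) - b = c); last by ring.
  by move=> /(_ _ _); rewrite /D1 => h; have := h ltac:(lra) ltac:(lra); lra.
have D20 : 0 <= D2 by have := @f_conv a b c ltac:(lra) ltac:(lra); rewrite /D2; lra.
have D1a : D1 <= f a.
  by have : f (b + c - a) <= f c; [apply: f_decr; lra|rewrite /D1; lra].
have -> : f b + f (a + c - b) - f a - f c = - D2 by rewrite /D2; ring.
have [nr|nnr] := pselect (near_ok b c); last first.
  have cLb : c <= LL * b.
    have h1 : 0 <= 2 / dl by rewrite divr_ge0// ltW.
    rewrite leNgt; apply/negP => lt; apply: nnr; split => //.
    - have : 16 * b <= LL * b by rewrite ler_wpM2r.
      by lra.
    - have : 2 / dl * b <= LL * b by rewrite ler_wpM2r// LLE; move: L_ge0; lra.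
      move=> h2; have : 2 / dl * b <= c by lra.
      by rewrite mulrAC ler_pdivrMr// [c * _]mulrC.
    - have : 2 * L * b <= LL * b by rewrite ler_wpM2r// LLE; lra.
      by lra.
  have scb : Num.sqrt c <= LL * Num.sqrt b.
    have L0 : 0 <= LL by move: LL1; lra.
    rewrite -ler_sqr ?nnegrE ?mulr_ge0 ?(ltW sb0) ?(ltW sc0)// exprMn sb2 sc2.
    apply: (le_trans cLb); rewrite ler_wpM2r// expr2 ler_peMr//; move: LL1; lra.
  have w1l : w1 <= 2 * C0 * LL.
    rewrite -(ler_pM2r sb0) (le_trans hw1)// -[leRHS]mulrA ler_wpM2l//.
    by rewrite mulr_ge0 ?(ltW C0_gt0).
  have : w1 * D1 <= 2 * C0 * LL * f a.
    by rewrite ler_pM// ltW.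
  have : 0 <= w2 * D2 by rewrite mulr_ge0.
  have : 0 <= (12 * L * C0 + 40 * b0 ^+ 2 + 4 * C0) * (f a + f c).
    by apply: mulr_ge0; lra.
  have : 0 <= 2 * C0 * LL * f c by rewrite mulr_ge0// ltW.
  by rewrite mulrN; lra.
have [_ bc16 _ _] := nr.
have d := @W_diff_le a b c w1 w2 ltac:(lra) nr (hn nr) w20 hw2.
(* The kernel difference is bounded and multiplies [D1 <= f a]. The rest, [D1 - D2], is the second
   difference of [f] at [c] with step [b - a]; its bound [2 * b / c * f c] compensates the size
   [sqrt (c / b)] of [w2]. *)
have e1 : w1 * D1 + w2 * - D2 = (w1 - w2) * D1 + w2 * (D1 - D2) by ring.
rewrite e1.
have t1 : (w1 - w2) * D1 <= (12 * L * C0 + 40 * b0 ^+ 2) * f a.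
  by apply: (le_trans (ler_wpM2r D10 d)); rewrite ler_wpM2l.
have t2 : w2 * (D1 - D2) <= 4 * C0 * f c.
  have h : D1 - D2 <= 2 * (b - a) / c * f c.
    have e2 : b + c - a = c + (b - a) by ring.
    have e3 : a + c - b = c - (b - a) by ring.
    have := @f_slope (b - a) c ltac:(lra) ltac:(lra) c_gt0.
    have : f (c + (b - a)) <= f c by apply: f_decr; lra.
    by rewrite /D1 /D2 e2 e3; lra.
  have h' : D1 - D2 <= 2 * b / c * f c.
    apply: (le_trans h); rewrite ler_pM2r// ler_pM2r ?invr_gt0//; lra.
  apply: (le_trans (ler_wpM2l w20 h')).
  rewrite mulrA ler_pM2r// -(ler_pM2r sb0).
  have k0 : 0 <= 2 * b / c by rewrite divr_ge0//; lra.
  rewrite mulrAC; apply: (@le_trans _ _ (2 * C0 * Num.sqrt c * (2 * b / c))).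
    by rewrite ler_wpM2r.
  have -> : 2 * C0 * Num.sqrt c * (2 * b / c) = 4 * C0 * (b / Num.sqrt c).
    by rewrite -[in X in _ / X]sc2; field; rewrite gt_eqF.
  rewrite ler_pM2l ?mulr_gt0// ler_pdivrMr// -{1}sb2 expr2 ler_pM2l// ler_wsqrtr//.
have : 0 <= (12 * L * C0 + 40 * b0 ^+ 2) * f c by rewrite mulr_ge0// ltW.
have : 0 <= 4 * C0 * f a by rewrite mulr_ge0// ltW.
have : 0 <= 2 * C0 * LL * (f a + f c) by rewrite mulr_ge0// addr_ge0// ltW.
by lra.
Qed.

Definition Ksum (x y z : R) :=
  Kop p f x y z + Kop p f x z y + Kop p f y x z + Kop p f y z x +
  Kop p f z x y + Kop p f z y x.

(** Two pairs of permutations, plus [4 * C0] for each of the two permutations whose output is the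
    largest argument. *)
Definition Ksum_cst := 2 * (12 * L * C0 + 40 * b0 ^+ 2 + 4 * C0 + 2 * C0 * LL) + 8 * C0.

Lemma Ksum_sorted (a b c : R) : 0 <= a -> a <= b -> b <= c ->
  Ksum a b c <= Ksum_cst * (f a + f b + f c).
Proof.
move=> a0 ab bc.
have fa := f_gt0 a; have fc := f_gt0 c; have fb := f_gt0 b.
have W0 := W_ge0 p.
have xe (x y z : R) : x <= y + z -> xstar x y z = y + z - x.
  by move=> h; rewrite /xstar (max_idPl _)//; lra.
have T1 : Kop p f a b c + Kop p f b a c <=
    (12 * L * C0 + 40 * b0 ^+ 2 + 4 * C0 + 2 * C0 * LL) * (f a + f c).
  rewrite /Kop !xe; [|lra..]; apply: pair_term_le => //.
  - by move=> b00; rewrite !W_zero2//; [constructor 1|constructor 1]; lra.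
  - move=> b_gt0; apply: (W_pair_le b_gt0 bc _).1; constructor 1; split => //; lra.
  - move=> b_gt0; apply: (W_pair_le b_gt0 bc _).1; constructor 3; split => //; lra.
  - by move=> nr; apply: (W_compare _ nr).1; lra.
have T2 : Kop p f a c b + Kop p f b c a <=
    (12 * L * C0 + 40 * b0 ^+ 2 + 4 * C0 + 2 * C0 * LL) * (f a + f c).
  rewrite /Kop !xe; [|lra..].
  have -> : f a + f (c + b - a) - f c - f b = f a + f (b + c - a) - f b - f c.
    by rewrite [c + b]addrC; ring.
  have -> : f b + f (c + a - b) - f c - f a = f b + f (a + c - b) - f a - f c.
    by rewrite [c + a]addrC; ring.
  apply: pair_term_le => //.
  - by move=> b00; rewrite !W_zero2//; [constructor 2|constructor 2]; lra.
  - move=> b_gt0; apply: (W_pair_le b_gt0 bc _).1; constructor 2; split => //; lra.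
  - move=> b_gt0; apply: (W_pair_le b_gt0 bc _).1; constructor 4; constructor 2; split => //; lra.
  - by move=> nr; apply: (W_compare _ nr).2; lra.
have r0 : 0 <= 4 * C0 * f a by rewrite mulr_ge0 ?mulr_ge0// ltW.
have T3 : Kop p f c a b <= 4 * C0 * f a.
  rewrite /Kop; case: (W_bound_C0 c a b) => [->|]; first by rewrite mul0r.
  move=> [[_ _ _ cab] _ _ _ h4]; rewrite xe ?(ltW cab)//.
  apply: third_term_le => //.
  by rewrite (_ : Num.sqrt a * _ * _ = Num.sqrt c * Num.sqrt a * Num.sqrt b)//; ring.
have T4 : Kop p f c b a <= 4 * C0 * f a.
  rewrite /Kop; case: (W_bound_C0 c b a) => [->|]; first by rewrite mul0r.
  move=> [[_ _ _ cab] _ _ _ h4]; rewrite xe ?(ltW cab)//.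
  have -> : f c + f (b + a - c) - f b - f a = f c + f (a + b - c) - f a - f b.
    by rewrite [b + a]addrC; ring.
  apply: third_term_le => //; first by rewrite addrC.
  rewrite [a + b]addrC (_ : Num.sqrt a * Num.sqrt b * Num.sqrt c = Num.sqrt c * Num.sqrt b * Num.sqrt a)//; by ring.
rewrite /Ksum /Ksum_cst.
set Q := 12 * L * C0 + 40 * b0 ^+ 2 + 4 * C0 + 2 * C0 * LL in T1 T2 *.
have Q0 : 0 <= Q.
  rewrite /Q !addr_ge0 ?mulr_ge0 ?(ltW C0_gt0) ?(ltW b0_gt0)//; move: LL1; lra.
have : 0 <= Q * f b by rewrite mulr_ge0// ltW.
have : 0 <= C0 * (f b + f c) by rewrite mulr_ge0 ?addr_ge0// ltW.
by lra.
Qed.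

Lemma Ksum_le (x y z : R) : Ksum x y z <= Ksum_cst * (f x + f y + f z).
Proof.
have s12 (a b c : R) : Ksum a b c = Ksum b a c by rewrite /Ksum; ring.
have s23 (a b c : R) : Ksum a b c = Ksum a c b by rewrite /Ksum; ring.
have cst0 : 0 <= Ksum_cst.
  have L0 : 0 <= LL by move: LL1; lra.
  by rewrite /Ksum_cst addr_ge0 ?mulr_ge0 ?addr_ge0 ?mulr_ge0 ?(ltW C0_gt0) ?(ltW b0_gt0).
have neg (a b c : R) : a < 0 -> Ksum a b c <= Ksum_cst * (f a + f b + f c).
  move=> a0; rewrite /Ksum /Kop !W_neg ?mul0r ?addr0;
    do ?[by constructor 1|by constructor 2|by constructor 3].
  by rewrite mulr_ge0// !addr_ge0// ltW.
have [x0|x0] := ltP x 0; first exact: neg.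
have [y0|y0] := ltP y 0; first by rewrite s12 [f x + f y]addrC; exact: neg.
have [z0|z0] := ltP z 0.
  by rewrite s23 s12; apply: (le_trans (neg _ _ _ z0)); apply: eq_ler; ring.
have [xy|xy] := leP x y; have [yz|yz] := leP y z; have [xz|xz] := leP x z.
- exact: Ksum_sorted.
- lra.
- by rewrite s23 (le_trans (Ksum_sorted _ _ _))//; [lra|apply: eq_ler; ring].
- by rewrite s23 s12 (le_trans (Ksum_sorted _ _ _))//; [lra|apply: eq_ler; ring].
- by rewrite s12 (le_trans (Ksum_sorted _ _ _))//; [lra|apply: eq_ler; ring].
- by rewrite s12 s23 (le_trans (Ksum_sorted _ _ _))//; [lra|apply: eq_ler; ring].
- lra.
- by rewrite s12 s23 s12 (le_trans (Ksum_sorted _ _ _))//; [lra|lra|apply: eq_ler; ring].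
Qed.

End test_function.

(** Let [b] be the middle argument. The bracket is at most [4 * M1] and at most [2 * Lg * b], hence
    at most a multiple of [sqrt b], while [W * sqrt b <= 2 * C0]. When [b = 0], two arguments vanish
    and so does [W]. *)
Lemma Kop_bounded (g : R -> R) (M1 Lg x y z : R) :
  (forall u, 0 <= u -> `|g u| <= M1) ->
  (forall u v, 0 <= u -> 0 <= v -> `|g u - g v| <= Lg * `|u - v|) ->
  `|Kop p g x y z| <= 2 * C0 * (4 * M1 + 2 * Lg).
Proof.
move=> gM gL.
have M10 : 0 <= M1 by apply: le_trans (gM 0 _).
have Lg0 : 0 <= Lg.
  by have := gL 1 0 ler01 (lexx _); rewrite subr0 normr1 mulr1; apply: le_trans.
have A0 : 0 <= 4 * M1 + 2 * Lg by rewrite addr_ge0// mulr_ge0.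
have r0 : 0 <= 2 * C0 * (4 * M1 + 2 * Lg) by rewrite mulr_ge0// mulr_ge0// ltW.
rewrite /Kop.
case: (W_bound_C0 x y z) => [->|]; first by rewrite mul0r normr0.
move=> [[x0 y0 z0 xyz] _ _ _ _].
have xs : xstar x y z = y + z - x by rewrite /xstar (max_idPl _)//; lra.
rewrite xs normrM (ger0_norm (W_ge0 p _ _ _)).
set Dt := `|_|.
have d1 : Dt <= 4 * M1.
  rewrite /Dt (le_trans (ler_normB _ _))// (le_trans (lerD (ler_normB _ _) (lexx _)))//.
  have := gM x x0; have := gM y y0; have := gM z z0; have := gM (y + z - x) ltac:(lra).
  have := ler_normD (g x) (g (y + z - x)); lra.
have d2 : Dt <= 2 * Lg * `|x - y|.
  rewrite /Dt (_ : _ - _ - _ = (g x - g y) + (g (y + z - x) - g z)); last by ring.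
  apply: (le_trans (ler_normD _ _)).
  have h1 := gL x y x0 y0; have h2 := gL (y + z - x) z ltac:(lra) z0.
  move: h2; rewrite (_ : y + z - x - z = - (x - y)); last by ring.
  by rewrite normrN; lra.
have d3 : Dt <= 2 * Lg * `|x - z|.
  rewrite /Dt (_ : _ - _ - _ = (g x - g z) + (g (y + z - x) - g y)); last by ring.
  apply: (le_trans (ler_normD _ _)).
  have h1 := gL x z x0 z0; have h2 := gL (y + z - x) y ltac:(lra) y0.
  move: h2; rewrite (_ : y + z - x - y = - (x - z)); last by ring.
  by rewrite normrN; lra.
have Dt0 : 0 <= Dt by exact: normr_ge0.
have key (b : R) : 0 < b -> Dt <= 2 * Lg * b -> W p x y z * Num.sqrt b <= 2 * C0 ->
    W p x y z * Dt <= 2 * C0 * (4 * M1 + 2 * Lg).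
  move=> b1 Db Wb.
  have sb0 : 0 < Num.sqrt b by rewrite sqrtr_gt0.
  have sb2 : Num.sqrt b ^+ 2 = b by rewrite sqr_sqrtr// ltW.
  have DA : Dt <= (4 * M1 + 2 * Lg) * Num.sqrt b.
    rewrite mulrDl; have [s1|s1] := leP 1 (Num.sqrt b).
      apply: (le_trans d1); apply: (@le_trans _ _ (4 * M1 * Num.sqrt b)).
        by rewrite ler_peMr// mulr_ge0.
      by rewrite lerDl !mulr_ge0// ltW.
    apply: (le_trans Db); apply: (@le_trans _ _ (2 * Lg * Num.sqrt b)).
      by rewrite ler_wpM2l ?mulr_ge0// -{1}sb2 expr2 ler_piMr// ltW.
    by rewrite lerDr !mulr_ge0// ltW.
  apply: (le_trans (ler_wpM2l (W_ge0 p _ _ _) DA)).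
  by rewrite mulrCA mulrC ler_wpM2r.
have med (b c : R) : 0 <= b -> b <= c -> (b = 0 -> W p x y z = 0) -> Dt <= 2 * Lg * b ->
    [\/ [/\ x <= c, y = b & z = c], [/\ x <= c, z = b & y = c],
      [/\ y <= c, x = b & z = c] | [\/ [/\ y <= c, z = b & x = c],
      [/\ z <= c, x = b & y = c] | [/\ z <= c, y = b & x = c] ] ] ->
    W p x y z * Dt <= 2 * C0 * (4 * M1 + 2 * Lg).
  move=> b_ge0 bc wz Db h; move: b_ge0; rewrite le_eqVlt => /predU1P[b00|b1].
    by rewrite wz ?mul0r.
  exact: (key b b1 Db (W_pair_le b1 bc h).2).
have mono (u v : R) : `|u| <= v -> 2 * Lg * `|u| <= 2 * Lg * v.
  by move=> uv; rewrite ler_wpM2l// mulr_ge0.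
have [xy|xy] := leP x y; have [yz|yz] := leP y z; have [xz|xz] := leP x z.
- apply: (med y z) => //.
  + by move=> e; apply: W_zero2; constructor 1; lra.
  + by apply: (le_trans d2); apply: mono; rewrite ler0_norm; lra.
  + by constructor 1.
- lra.
- apply: (med z y); [lra|lra|..].
  + by move=> e; apply: W_zero2; constructor 2; lra.
  + by apply: (le_trans d3); apply: mono; rewrite ler0_norm; lra.
  + by constructor 2.
- apply: (med x y); [lra|lra|..].
  + by move=> e; apply: W_zero2; constructor 2; lra.
  + by apply: (le_trans d3); apply: mono; rewrite ger0_norm; lra.
  + by constructor 4; constructor 2; split => //; lra.
- apply: (med x z); [lra|lra|..].
  + by move=> e; apply: W_zero2; constructor 1; lra.
  + by apply: (le_trans d2); apply: mono; rewrite ger0_norm; lra.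
  + by constructor 3; split => //; lra.
- apply: (med z x); [lra|lra|..].
  + by move=> e; apply: W_zero2; constructor 3; lra.
  + by apply: (le_trans d3); apply: mono; rewrite ger0_norm; lra.
  + by constructor 4; constructor 1; split => //; lra.
- lra.
- apply: (med y x); [lra|lra|..].
  + by move=> e; apply: W_zero2; constructor 3; lra.
  + by apply: (le_trans d2); apply: mono; rewrite ger0_norm; lra.
  + by constructor 4; constructor 3; split => //; lra.
Qed.

End Symmetrized.

(** * One-sided derivatives, a Gronwall inequality for families, and the regularized inverse root *)

Section Calculus.
Variable R : realType.

Lemma is_derive_has_deriv_within (A : set R) (g u : R -> R) (t d : R) :
  is_derive t 1 g d -> (forall x, A x -> g x = u x) -> A t ->
  has_deriv_within A u t d.
Proof.
move=> [dg gd] gu At; rewrite /has_deriv_within.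
have : h^-1 *: ((g \o shift t) (h *: (1 : R)) - g t) @[h --> 0^'] --> d.
  by rewrite -gd; exact: dg.
move/cvgrPdist_le => H; apply/cvgrPdist_le => e e0.
have [r /= r0 hr] := H e e0.
exists r => //= h hrr [h0 Ah].
have := hr h hrr h0.
by rewrite /= /shift /GRing.scale/= mulr1 mulrC (addrC h) gu// gu.
Qed.

Lemma has_deriv_withinB (A : set R) (u v : R -> R) (t d e : R) :
  has_deriv_within A u t d -> has_deriv_within A v t e ->
  has_deriv_within A (fun x => u x - v x) t (d - e).
Proof.
rewrite /has_deriv_within => hu hv.
rewrite (_ : (fun h => _) = (fun h => (u (t + h) - u t) / h - (v (t + h) - v t) / h)).
  exact: cvgB.
by apply/funext => h; rewrite -mulrBl; congr (_ / _); ring.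
Qed.

Lemma has_deriv_within_is_derive (u : R -> R) (t d : R) : 0 < t ->
  has_deriv_within (@nonneg R) u t d -> is_derive t 1 u d.
Proof.
move=> t0; rewrite /has_deriv_within => H.
have {}H : h^-1 *: ((u \o shift t) (h *: (1 : R)) - u t) @[h --> 0^'] --> d.
  have -> : (fun h : R => h^-1 *: ((u \o shift t) (h *: (1 : R)) - u t)) =
     (fun h : R => (u (t + h) - u t) / h).
    apply/funext => h; rewrite /= /shift /GRing.scale/= mulr1 mulrC.
    by rewrite [h + t]addrC.
  apply: cvg_trans H; apply: cvg_app => P [e e0 /= he].
  near=> h; apply: he.
    rewrite /ball_/= sub0r normrN; near: h; apply: dnbhs0_lt => //.
  split; first by near: h; exact: nbhs_dnbhs_neq.
  rewrite /nonneg/= -lerBlDl sub0r lerNl.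
  rewrite (le_trans (ler_norm _))// normrN ltW//; near: h; exact: dnbhs0_lt.
by split; [apply/cvg_ex; exists d|exact: cvg_lim H].
Unshelve. all: by end_near. Qed.

Lemma has_deriv_within_continuous (u : R -> R) (t d : R) : 0 <= t ->
  has_deriv_within (@nonneg R) u t d ->
  u x @[x --> within (@nonneg R) (nbhs t)] --> u t.
Proof.
move=> t0 H; apply/cvgrPdist_le => e e0.
have H1 : \forall h \near within [set h : R | h != 0 /\ (@nonneg R) (t + h)] (nbhs (0 : R)),
    `|d - (u (t + h) - u t) / h| <= 1.
  by move/cvgrPdist_le : H; apply.
have [r /= r0 hr] := H1.
have K0 : 0 < `|d| + 1 by rewrite ltr_wpDl.
exists (Num.min r (e / (`|d| + 1))) => /=; first by rewrite lt_min r0 divr_gt0.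
move=> x /=; rewrite lt_min => /andP[xr xe] x0.
have [->|xt] := eqVneq x t; first by rewrite subrr normr0 ltW.
have := hr (x - t); rewrite /= sub0r normrN distrC => /(_ xr).
rewrite subrKC subr_eq0 xt => /(_ (conj isT x0)) h.
have : `|(u x - u t) / (x - t)| <= `|d| + 1.
  rewrite -[X in `|X|](subKr d) (le_trans (ler_normB _ _))// lerD2l//.
rewrite normrM normfV ler_pdivrMr ?normr_gt0 ?subr_eq0// => h2.
rewrite distrC (le_trans h2)// mulrC -ler_pdivlMr// distrC ltW//.
Qed.

Lemma deriv_within_nonincr (u d : R -> R) (T : R) : 0 <= T ->
  (forall t : R, 0 <= t -> has_deriv_within (@nonneg R) u t (d t)) ->
  (forall t : R, 0 <= t <= T -> d t <= 0) -> u T <= u 0.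
Proof.
rewrite le_eqVlt => /predU1P[<-//|T0] ud d0.
have dv (t : R) : 0 < t -> is_derive t 1 u (d t).
  by move=> t0; apply: has_deriv_within_is_derive => //; apply: ud; exact: ltW.
apply: (@ler0_derive1_le_cc R u 0 T) => //; rewrite ?in_itv/= ?lexx ?(ltW T0)//.
- by move=> x; rewrite in_itv/= => /andP[x0 _]; exact: (@ex_derive _ _ _ _ _ _ _ (dv x x0)).
- move=> x; rewrite in_itv/= => /andP[x0 xT].
  by rewrite derive1E (@derive_val _ _ _ _ _ _ _ (dv x x0)) d0// !ltW.
- apply/(continuous_within_itvP _ T0); split.
  + move=> x; rewrite in_itv/= => /andP[x0 _].
    apply: differentiable_continuous; apply/derivable1_diffP.
    exact: (@ex_derive _ _ _ _ _ _ _ (dv x x0)).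
  + have /cvgrPdist_le H := has_deriv_within_continuous (lexx 0) (ud 0 (lexx _)).
    apply/cvgrPdist_le => e e0; have [r /= r0 hr] := H e e0.
    by exists r => //= x xr x0; apply: hr => //; exact: ltW.
  + apply: cvg_at_left_filter.
    apply: differentiable_continuous; apply/derivable1_diffP.
    exact: (@ex_derive _ _ _ _ _ _ _ (dv T T0)).
Qed.

(** Comparison with the primitive of the right-hand side. The exponent is [2 * C] rather than [C] so
    that integration halves [m]. *)
Lemma deriv_within_gronwall_step (u d : R -> R) (T C m ka : R) : 0 < C ->
  (forall t : R, 0 <= t -> has_deriv_within (@nonneg R) u t (d t)) ->
  (forall t : R, 0 <= t <= T -> d t <= C * m * expR (2 * C * t) + ka) ->
  forall t : R, 0 <= t <= T -> u t <= u 0 + ka * t + m / 2 * (expR (2 * C * t) - 1).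
Proof.
move=> C0 ud du t /andP[t0 tT].
pose v (s : R) := ka * s + m / 2 * expR (2 * C * s).
have dv (s : R) : is_derive s 1 v (ka + C * m * expR (2 * C * s)).
  rewrite /v; apply: is_derive_eq.
  by rewrite /GRing.scale/=; field.
have := @deriv_within_nonincr (fun s => u s - v s)
  (fun s => d s - (ka + C * m * expR (2 * C * s))) t t0.
move=> H; have {}H : u t - v t <= u 0 - v 0.
  apply: H => s.
    move=> s0; apply: has_deriv_withinB; first exact: ud.
    by apply: (is_derive_has_deriv_within (dv s)).
  by move=> /andP[s0 st]; have := du s; rewrite s0 (le_trans st tT) => /(_ isT); lra.
move: H; rewrite /v mulr0 mulr0 expR0; lra.
Qed.

(** The derivative of one member is controlled by bounds on all members, and their supremum need not
    be differentiable. Instead of it, the bound [m * expR (2 * C * t)] is improved repeatedly: one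
    step replaces [m] by [al + ka * T + m / 2]. Started from the crude bound [B], this converges to
    the fixed point [2 * (al + ka * T)]. *)
Lemma gronwall_family (I : Type) (u d : I -> R -> R) (T C al ka B : R) :
  0 < C -> 0 <= T -> 0 <= al -> 0 <= ka ->
  (forall i t, 0 <= t -> has_deriv_within (@nonneg R) (u i) t (d i t)) ->
  (forall i, u i 0 <= al) ->
  (forall i t, 0 <= t <= T -> u i t <= B) ->
  (forall m, 0 <= m -> (forall i t, 0 <= t <= T -> u i t <= m * expR (2 * C * t)) ->
     forall i t, 0 <= t <= T -> d i t <= C * m * expR (2 * C * t) + ka) ->
  forall i t, 0 <= t <= T -> u i t <= 2 * (al + ka * T) * expR (2 * C * t).
Proof.
move=> C0 T0 al0 ka0 ud u0 uB step.
pose A := al + ka * T.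
have A0 : 0 <= A by rewrite addr_ge0// mulr_ge0.
have B0 : 0 <= Num.max B 0 by rewrite le_max lexx orbT.
have ex1 (t : R) : 0 <= t -> 1 <= expR (2 * C * t).
  by move=> t0; rewrite -expR0 ler_expR mulr_ge0// mulr_ge0// ltW.
have main (n : nat) : forall i t, 0 <= t <= T ->
    u i t <= (2 * A + Num.max B 0 / 2 ^+ n) * expR (2 * C * t).
  elim: n => [|n IH] i t /[dup] tT /andP[t0 tT'].
    rewrite expr0 divr1 (le_trans (uB i t tT))//.
    apply: (@le_trans _ _ (2 * A + Num.max B 0)).
      by rewrite -[leLHS]add0r lerD ?mulr_ge0// le_max lexx.
    by rewrite ler_peMr ?ex1// addr_ge0// mulr_ge0.
  set m := 2 * A + Num.max B 0 / 2 ^+ n in IH *.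
  have m0 : 0 <= m by rewrite addr_ge0 ?mulr_ge0// divr_ge0// exprn_ge0.
  have := @deriv_within_gronwall_step (u i) (d i) T C m ka C0 (ud i) (step m m0 IH i) t tT.
  move=> h; apply: (le_trans h).
  have e1 := ex1 t t0.
  have -> : 2 * A + Num.max B 0 / 2 ^+ n.+1 = A + m / 2.
    by rewrite /m exprS; field; rewrite expf_neq0.
  have h1 : u i 0 + ka * t <= A.
    by rewrite /A lerD// ?u0// ler_wpM2l.
  have h2 : A <= A * expR (2 * C * t) by rewrite ler_peMr.
  have h3 : 0 <= m / 2 by rewrite divr_ge0.
  have aux (a b U E : R) : U <= a -> a <= a * E -> 0 <= b -> U + b * (E - 1) <= (a + b) * E.
    by move=> *; lra.
  exact: aux.
move=> i t tT; rewrite -/A.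
apply/ler_addgt0Pr => e e0.
have E0 : 0 < expR (2 * C * t) by exact: expR_gt0.
have M0 : 0 <= Num.max B 0 * expR (2 * C * t) by rewrite mulr_ge0// ltW.
have [n hn] : exists n : nat, Num.max B 0 * expR (2 * C * t) / 2 ^+ n <= e.
  have := @cvg_geometric R (Num.max B 0 * expR (2 * C * t)) (2^-1).
  rewrite gtr0_norm ?invr_gt0// invf_lt1// ltr1n => /(_ isT).
  move/cvgrPdist_le => /(_ e e0) [n _ /(_ n (leqnn n))].
  rewrite /= sub0r normrN /geometric/= ger0_norm; last by rewrite mulr_ge0// exprn_ge0// invr_ge0.
  by move=> h; exists n; rewrite -exprVn.
apply: (le_trans (main n i t tT)).
rewrite mulrDl lerD2l; apply: le_trans hn.
by apply: eq_ler; ring.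
Qed.

Section inverse_sqrt.
Variable e : R.
Hypothesis e0 : 0 < e.

(** Regularization of [x^(-1/2)], extended by a constant to negative [x] so that it is positive and
    measurable on the whole line. *)
Definition isq (x : R) := (Num.sqrt (e + Num.max x 0))^-1.

Let s (x : R) := Num.sqrt (e + Num.max x 0).
Let s_gt0 x : 0 < s x.
Proof. by rewrite sqrtr_gt0 ltr_wpDr// le_max lexx orbT. Qed.
Let s2 (x : R) : 0 <= x -> s x ^+ 2 = e + x.
Proof. by move=> x0; rewrite /s (max_idPl _)// sqr_sqrtr// addr_ge0// ltW. Qed.
Let s_ge x : Num.sqrt e <= s x.
Proof. by rewrite ler_wsqrtr// lerDl le_max lexx orbT. Qed.

Lemma isq_gt0 x : 0 < isq x. Proof. by rewrite /isq invr_gt0; exact: s_gt0. Qed.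

Lemma isq_le x : isq x <= (Num.sqrt e)^-1.
Proof. by rewrite /isq -/(s x) lef_pV2 ?s_ge// posrE ?s_gt0 ?sqrtr_gt0. Qed.

Lemma isq_decr (x y : R) : 0 <= x <= y -> isq y <= isq x.
Proof.
move=> /andP[x0 xy]; rewrite lef_pV2 ?posrE ?s_gt0// ler_wsqrtr// lerD2l.
by rewrite !(max_idPl _)// (le_trans x0).
Qed.

Let isqB (x y : R) : 0 <= x -> 0 <= y ->
  isq x - isq y = (y - x) * (isq x * isq y * (s x + s y)^-1).
Proof.
move=> x0 y0; have := s_gt0 x; have := s_gt0 y => hy hx.
have -> : y - x = (s y - s x) * (s y + s x).
  by rewrite -subr_sqr !s2//; ring.
rewrite /isq -/(s x) -/(s y); field.
by rewrite !gt_eqF// addr_gt0.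
Qed.

(** Both sides become increments over the same length [y - x]; the quotient of such an increment by
    its length, as factored in [isqB], decreases with the position. *)
Lemma isq_conv (x y z : R) : 0 <= x <= y -> y <= z ->
  isq y + isq (x + z - y) <= isq x + isq z.
Proof.
move=> /andP[x0 xy] yz.
suff : isq (x + z - y) - isq z <= isq x - isq y by lra.
rewrite !isqB; [|lra..].
rewrite (_ : z - (x + z - y) = y - x); last by ring.
apply: ler_wpM2l; first by lra.
have i0 u : 0 <= isq u by rewrite ltW// isq_gt0.
apply: ler_pM; rewrite ?mulr_ge0 ?invr_ge0 ?addr_ge0 ?(ltW (s_gt0 _))//.
  by apply: ler_pM => //; apply: isq_decr; lra.
rewrite lef_pV2 ?posrE ?addr_gt0//; apply: lerD; rewrite /s ler_wsqrtr// lerD2l.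
  by rewrite !(max_idPl _); lra.
by rewrite !(max_idPl _); lra.
Qed.

Lemma isq_sqrt (x y : R) : 0 <= x <= y -> Num.sqrt x * isq x <= Num.sqrt y * isq y.
Proof.
move=> /andP[x0 xy]; have y0 : 0 <= y by lra.
rewrite /isq -/(s x) -/(s y) ler_pdivrMr// mulrAC ler_pdivlMr//.
rewrite -ler_sqr ?nnegrE ?mulr_ge0 ?sqrtr_ge0 ?(ltW (s_gt0 _))//.
rewrite !exprMn !s2// !sqr_sqrtr//.
by have : x * e <= y * e; [rewrite ler_pM2r|lra].
Qed.

Lemma isq_slope (h c : R) : 0 <= h -> 2 * h <= c -> 0 < c ->
  isq (c - h) - isq c <= 2 * h / c * isq c.
Proof.
move=> h0 hc c0; rewrite isqB; [|lra..].
rewrite (_ : c - (c - h) = h); last by ring.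
have := s_gt0 (c - h); have := s_gt0 c => p1 p2.
have -> : 2 * h / c * isq c = h * (isq c * (2 / c)) by ring.
rewrite ler_wpM2l//.
rewrite [isq _ * isq c]mulrC -mulrA ler_pM2l ?isq_gt0//.
rewrite /isq -/(s (c - h)) -invfM -[leLHS]mul1r ler_pdivrMr ?mulr_gt0 ?addr_gt0//.
rewrite mulrAC ler_pdivlMr// mul1r mulrDr -expr2 s2; last lra.
have : 0 <= s (c - h) * s c by rewrite mulr_ge0// ltW.
by move: e0; lra.
Qed.

Lemma isq_lip (x y : R) : 0 <= x -> 0 <= y ->
  `|isq x - isq y| <= (Num.sqrt e)^-1 ^+ 3 * `|x - y|.
Proof.
move=> x0 y0; rewrite isqB// normrM distrC mulrC ler_wpM2r//.
have se : 0 < Num.sqrt e by rewrite sqrtr_gt0.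
have i0 u : 0 <= isq u by rewrite ltW// isq_gt0.
rewrite ger0_norm ?mulr_ge0 ?invr_ge0 ?addr_ge0 ?(ltW (s_gt0 _))//.
rewrite exprSr expr2 ler_pM ?mulr_ge0 ?invr_ge0 ?addr_ge0 ?(ltW (s_gt0 _))//.
  by rewrite ler_pM// isq_le.
rewrite lef_pV2 ?posrE ?addr_gt0// (le_trans (s_ge x))// lerDl ltW//.
Qed.

Lemma isq_C11b : C11b isq.
Proof.
have se : 0 < Num.sqrt e by rewrite sqrtr_gt0.
pose M := (Num.sqrt e)^-1.
have M0 : 0 < M by rewrite invr_gt0.
have i0 u : 0 <= isq u by rewrite ltW// isq_gt0.
exists (fun x => - (2^-1 * isq x ^+ 3)); split; last split.
- move=> x x0.
  pose g (y : R) := (Num.sqrt (e + y))^-1.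
  apply: (@is_derive_has_deriv_within _ g); last exact: x0.
    have ex : 0 < e + x by rewrite ltr_pwDl.
    have sx0 : 0 < Num.sqrt (e + x) by rewrite sqrtr_gt0.
    have d1 : is_derive x 1 (fun y : R => e + y) 1.
      by apply: (is_derive_eq (is_deriveD (is_derive_cst e x 1) (is_derive_id x 1))); rewrite add0r.
    have d2 : is_derive (e + x) 1 (@Num.sqrt R) (2 * Num.sqrt (e + x))^-1.
      exact: is_derive1_sqrt.
    have d3 := @is_derive1_comp R (@Num.sqrt R) (fun y : R => e + y) x _ _ d2 d1.
    have d4 := @is_deriveV R (fun y => Num.sqrt (e + y)) x _ 1 (lt0r_neq0 sx0) d3.
    apply: (is_derive_eq d4).
    rewrite /isq (max_idPl x0) /GRing.scale/=.
    by field; rewrite gt_eqF.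
  by move=> y y0; rewrite /g /isq (max_idPl y0).
- exists (M + M ^+ 3) => x x0.
  have := isq_le x; rewrite -/M => h.
  have h3 : isq x ^+ 3 <= M ^+ 3 by rewrite lerXn2r ?nnegrE// ltW.
  have h30 : 0 <= isq x ^+ 3 by rewrite exprn_ge0.
  have M30 : 0 <= M ^+ 3 by rewrite exprn_ge0// ltW.
  rewrite ger0_norm// normrN ger0_norm ?mulr_ge0//; split; lra.
- exists (2 * M ^+ 2 * M ^+ 3) => x y x0 y0.
  have h := isq_lip x0 y0.
  pose Q := 2^-1 * (isq x ^+ 2 + isq x * isq y + isq y ^+ 2).
  have hx := isq_le x; have hy := isq_le y; rewrite -/M in hx hy.
  have a1 : isq x ^+ 2 <= M ^+ 2 by rewrite lerXn2r ?nnegrE// ltW.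
  have a2 : isq y ^+ 2 <= M ^+ 2 by rewrite lerXn2r ?nnegrE// ltW.
  have a3 : isq x * isq y <= M ^+ 2 by rewrite expr2 ler_pM.
  have b1 : 0 <= isq x ^+ 2 by exact: sqr_ge0.
  have b2 : 0 <= isq y ^+ 2 by exact: sqr_ge0.
  have b3 : 0 <= isq x * isq y by rewrite mulr_ge0.
  have Q0 : 0 <= Q by rewrite /Q; lra.
  have QM : Q <= 2 * M ^+ 2 by rewrite /Q; lra.
  rewrite (_ : _ - _ = - Q * (isq x - isq y)); last by rewrite /Q; ring.
  by rewrite normrM normrN (ger0_norm Q0) -[leRHS]mulrA; apply: ler_pM.
Qed.

Lemma measurable_isq : measurable_fun setT isq.
Proof. by rewrite /isq; meas. Qed.

End inverse_sqrt.
End Calculus.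

(** * Integrals over double and triple products of a finite measure *)

Section Product.
Variable R : realType.
Notation RB := (measurableTypeR R).
Local Open Scope ereal_scope.

(** Integrability of [f] is not assumed: its positive part is dominated by [g], and if its negative
    part has infinite integral then [fine] of minus infinity is 0, still at most the right-hand
    side. One-sided bounds on the collision terms are therefore enough. *)
Lemma fine_integral_le d (T : measurableType d) (mu : {measure set T -> \bar R})
    (D : set T) (f g : T -> \bar R) : measurable D ->
  measurable_fun D f -> measurable_fun D g -> (forall x, D x -> 0 <= g x) ->
  (forall x, D x -> f x <= g x) -> \int[mu]_(x in D) g x < +oo ->
  (fine (\int[mu]_(x in D) f x) <= fine (\int[mu]_(x in D) g x))%R.
Proof.
move=> mD mf mg g0 fg goo.
have gi0 : 0 <= \int[mu]_(x in D) g x by exact: integral_ge0.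
have gfin : \int[mu]_(x in D) g x \is a fin_num by rewrite ge0_fin_numE.
rewrite integralE.
have pl : \int[mu]_(x in D) f^\+ x <= \int[mu]_(x in D) g x.
  apply: ge0_le_integral => //; first exact: measurable_funepos.
  by move=> x Dx; rewrite funeposE ge_max fg// g0.
have p0 : 0 <= \int[mu]_(x in D) f^\+ x by exact: integral_ge0.
have n0 : 0 <= \int[mu]_(x in D) f^\- x by exact: integral_ge0.
have pf : \int[mu]_(x in D) f^\+ x \is a fin_num by rewrite ge0_fin_numE// (le_lt_trans pl).
have : \int[mu]_(x in D) f^\- x <= +oo by rewrite leey.
rewrite le_eqVlt => /predU1P[->|nf].
  by rewrite -(fineK pf)/= fine_ge0.
rewrite fineB ?ge0_fin_numE//; last by rewrite (le_lt_trans pl).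
rewrite (@le_trans _ _ (fine (\int[mu]_(x in D) f^\+ x)))//.
  by rewrite lerBlDr lerDl fine_ge0.
by rewrite fine_le.
Qed.

Variable mu : {finite_measure set RB -> \bar R}.
Notation P2 := (mu \x mu).
Notation P3 := ((mu \x mu) \x mu).

Section nonneg3.
Variable h : RB -> RB -> RB -> \bar R.
Hypothesis mh : measurable_fun setT (fun q : RB * RB * RB => h q.1.1 q.1.2 q.2).
Hypothesis h0 : forall x y z, 0 <= h x y z.

Let mh1 (x : RB) : measurable_fun setT (fun q : RB * RB => h x q.1 q.2).
Proof.
apply: (@measurableT_comp _ _ _ _ _ _ (fun q : RB * RB * RB => h q.1.1 q.1.2 q.2) _
  (fun q : RB * RB => (x, q.1, q.2))) => //; meas.
Qed.
Let mh2 (y : RB) : measurable_fun setT (fun q : RB * RB => h q.1 y q.2).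
Proof.
apply: (@measurableT_comp _ _ _ _ _ _ (fun q : RB * RB * RB => h q.1.1 q.1.2 q.2) _
  (fun q : RB * RB => (q.1, y, q.2))) => //; meas.
Qed.
Let mhz : measurable_fun setT (fun q : RB * RB => \int[mu]_z h q.1 q.2 z).
Proof.
exact: (@measurable_fun_fubini_tonelli_F _ _ _ _ _ mu (fun q : RB * RB * RB => h q.1.1 q.1.2 q.2)).
Qed.

Lemma integral3E : \int[P3]_q h q.1.1 q.1.2 q.2 =
  \int[mu]_x \int[mu]_y \int[mu]_z h x y z.
Proof.
transitivity (\int[mu \x mu]_q \int[mu]_z h q.1 q.2 z).
  (* Tonelli is applied with [mu \x mu] as the first factor, which has to be packed as a finite
     measure. *)
  have fin : fin_num_fun (mu \x mu).
    move=> A mA; rewrite ge0_fin_numE//.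
    apply: (@le_lt_trans _ _ ((mu \x mu) setT)); first by rewrite le_measure ?inE.
    rewrite -setXTT product_measure1E// lte_mul_pinfty//; first exact: fin_num_measure.
    by rewrite -ge0_fin_numE//; exact: fin_num_measure.
  pose m2f : {finite_measure set (RB * RB)%type -> \bar R} :=
    HB.pack (mu \x mu)%E (Measure_isFinite.Build _ _ _ (mu \x mu)%E fin).
  exact: (@fubini_tonelli1 _ _ _ _ _ m2f mu (fun q : RB * RB * RB => h q.1.1 q.1.2 q.2) mh
    (fun q => h0 _ _ _)).
by apply: (@fubini_tonelli1 _ _ _ _ _ mu mu (fun q => \int[mu]_z h q.1 q.2 z)) => // q; exact: integral_ge0.
Qed.

Lemma integral3_swap12 : \int[P3]_q h q.1.1 q.1.2 q.2 =
  \int[mu]_x \int[mu]_y \int[mu]_z h y x z.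
Proof.
rewrite integral3E.
by apply: (@fubini_tonelli _ _ _ _ _ mu mu (fun q => \int[mu]_z h q.1 q.2 z)) => // q; exact: integral_ge0.
Qed.

Lemma integral3_swap23 : \int[P3]_q h q.1.1 q.1.2 q.2 =
  \int[mu]_x \int[mu]_y \int[mu]_z h x z y.
Proof.
rewrite integral3E; apply: eq_integral => x _.
by apply: (@fubini_tonelli _ _ _ _ _ mu mu (fun q => h x q.1 q.2)).
Qed.

End nonneg3.

(** Together with [integral3_perm23], the adjacent transpositions that generate the six permutations
    occurring in [Ksum]. *)
Lemma integral3_perm12 (h : RB -> RB -> RB -> \bar R) :
  measurable_fun setT (fun q : RB * RB * RB => h q.1.1 q.1.2 q.2) ->
  (forall x y z, 0 <= h x y z) ->
  \int[P3]_q h q.1.2 q.1.1 q.2 = \int[P3]_q h q.1.1 q.1.2 q.2.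
Proof.
move=> mh h0; rewrite [RHS]integral3_swap12//.
rewrite (@integral3E (fun x y z => h y x z))//.
apply: (@measurableT_comp _ _ _ _ _ _ (fun q : RB * RB * RB => h q.1.1 q.1.2 q.2) _
  (fun q : RB * RB * RB => (q.1.2, q.1.1, q.2))) => //; meas.
Qed.

Lemma integral3_perm23 (h : RB -> RB -> RB -> \bar R) :
  measurable_fun setT (fun q : RB * RB * RB => h q.1.1 q.1.2 q.2) ->
  (forall x y z, 0 <= h x y z) ->
  \int[P3]_q h q.1.1 q.2 q.1.2 = \int[P3]_q h q.1.1 q.1.2 q.2.
Proof.
move=> mh h0; rewrite [RHS]integral3_swap23//.
rewrite (@integral3E (fun x y z => h x z y))//.
apply: (@measurableT_comp _ _ _ _ _ _ (fun q : RB * RB * RB => h q.1.1 q.1.2 q.2) _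
  (fun q : RB * RB * RB => (q.1.1, q.2, q.1.2))) => //; meas.
Qed.

Lemma integral2_tensor (a b : RB -> \bar R) :
  measurable_fun setT a -> measurable_fun setT b ->
  (forall x, 0 <= a x) -> (forall x, 0 <= b x) ->
  \int[P2]_q (a q.1 * b q.2) = \int[mu]_x a x * \int[mu]_x b x.
Proof.
move=> ma mb a0 b0.
have mab : measurable_fun setT (fun q : RB * RB => a q.1 * b q.2).
  apply: emeasurable_funM.
    by apply: (measurableT_comp ma); exact: measurable_fst.
  by apply: (measurableT_comp mb); exact: measurable_snd.
have ab0 (q : RB * RB) : 0 <= a q.1 * b q.2 by rewrite mule_ge0.
have Ib0 : 0 <= \int[mu]_x b x by exact: integral_ge0.
transitivity (\int[mu]_x \int[mu]_y (a x * b y)).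
  exact: (@fubini_tonelli1 _ _ _ _ _ mu mu (fun q : RB * RB => a q.1 * b q.2) mab ab0).
transitivity (\int[mu]_x (a x * \int[mu]_y b y)).
  by apply: eq_integral => x _; rewrite ge0_integralZl.
by rewrite ge0_integralZr.
Qed.

Lemma integral3_tensor (a b c : RB -> \bar R) :
  measurable_fun setT a -> measurable_fun setT b -> measurable_fun setT c ->
  (forall x, 0 <= a x) -> (forall x, 0 <= b x) -> (forall x, 0 <= c x) ->
  \int[P3]_q (a q.1.1 * b q.1.2 * c q.2) =
    \int[mu]_x a x * \int[mu]_x b x * \int[mu]_x c x.
Proof.
move=> ma mb mc a0 b0 c0.
have mab : measurable_fun setT (fun q : RB * RB => a q.1 * b q.2).
  apply: emeasurable_funM.
    by apply: (measurableT_comp ma); exact: measurable_fst.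
  by apply: (measurableT_comp mb); exact: measurable_snd.
have mabc : measurable_fun setT (fun q : RB * RB * RB => a q.1.1 * b q.1.2 * c q.2).
  apply: emeasurable_funM.
    by apply: (measurableT_comp mab); exact: measurable_fst.
  by apply: (measurableT_comp mc); exact: measurable_snd.
rewrite (@integral3E (fun x y z => a x * b y * c z))//; last first.
  by move=> *; rewrite !mule_ge0.
have Ic0 : 0 <= \int[mu]_x c x by exact: integral_ge0.
have Ib0 : 0 <= \int[mu]_x b x by exact: integral_ge0.
transitivity (\int[mu]_x (a x * (\int[mu]_y b y * \int[mu]_z c z))).
  apply: eq_integral => x _.
  transitivity (\int[mu]_y (a x * b y * \int[mu]_z c z)).
    by apply: eq_integral => y _; rewrite ge0_integralZl// mule_ge0.
  rewrite ge0_integralZr//.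
  - by rewrite ge0_integralZl// muleA.
  - by apply: emeasurable_funM.
  - by move=> y _; rewrite mule_ge0.
by rewrite ge0_integralZr// ?mule_ge0// muleA.
Qed.

End Product.

(** * Collision integrals of the regularized moment *)

Section MomentStep.
Variable R : realType.
Notation RB := (measurableTypeR R).
Notation leb := (@lebesgue_measure R).
Variables (p : R -> R) (b0 : R).
Hypothesis mp : measurable_fun setT p.
Hypothesis b0_gt0 : 0 < b0.
Hypothesis p_ge0 : forall r, 0 <= p r.
Hypothesis p_leb : forall r, p r <= b0.
Hypothesis p_lin : forall r : R, 0 <= r -> p r <= b0 * r.
Variables (L dl : R).
Hypothesis L_ge0 : 0 <= L.
Hypothesis dl_gt0 : 0 < dl.
Hypothesis p_dil : forall r al : R, 0 < r -> 1 <= al <= 1 + dl ->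
  p (al * r) <= (1 + L * (al - 1)) * p r.
Variable C0 : R.
Hypothesis C0E : C0 = 32 * b0 ^+ 2.
Variable LL : R.
Hypothesis LLE : LL = 16 + 2 / dl + 2 * L.
Let C0_gt0 : 0 < C0. Proof. by rewrite C0E mulr_gt0// exprn_gt0. Qed.
Variable mu : {finite_measure set RB -> \bar R}.
Notation P2 := (mu \x mu)%E.
Notation P3 := ((mu \x mu) \x mu)%E.

Lemma le_sum6 (S : \bar R) : (0 <= S -> S <= S + S + S + S + S + S)%E.
Proof. by move=> S0; rewrite -!addeA leeDl// !adde_ge0. Qed.

Lemma measurable_Kop (f : R -> R) d (T : measurableType d) (x y z : T -> R) :
  measurable_fun setT f ->
  measurable_fun setT x -> measurable_fun setT y -> measurable_fun setT z ->
  measurable_fun setT (fun t => Kop p f (x t) (y t) (z t)).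
Proof.
move=> mf mx my mz; rewrite /Kop.
have c (g : T -> R) : measurable_fun setT g -> measurable_fun setT (fun t => f (g t)).
  by move=> mg; apply: (measurableT_comp mf).
apply: measurable_funM; first exact: measurable_W.
apply: measurable_funB; last exact: c.
apply: measurable_funB; last exact: c.
apply: measurable_funD; first exact: c.
by apply: c; exact: measurable_xstar.
Qed.

Let N := fine (mu setT).
Let muN : mu setT = N%:E.
Proof. by rewrite /N fineK//; exact: fin_num_measure. Qed.
Let N0 : 0 <= N. Proof. by rewrite fine_ge0. Qed.

Let integral_cstN (c : R) : (\int[mu]_x c%:E = (c * N)%:E)%E.
Proof. by rewrite integral_cst// EFinM -muN. Qed.

Let P3T : P3 setT = (N ^+ 3)%:E.
Proof.
have o0 (x : RB) : (0 <= cst 1 x :> \bar R)%E by [].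
have mo : measurable_fun setT (cst 1%E : RB -> \bar R) by exact: measurable_cst.
have := @integral3_tensor _ mu (cst 1%E) (cst 1%E) (cst 1%E) mo mo mo o0 o0 o0.
rewrite /cst; under eq_integral do rewrite !mule1.
rewrite !integral_cstN mul1r -!EFinM integral_cst// mul1e => H.
by rewrite [LHS]H; congr EFin; ring.
Qed.

Let P3lty : (P3 setT < +oo)%E.
Proof. by have := ltry (N ^+ 3); rewrite -P3T. Qed.

Let integral_cstP3 (c : R) : (\int[P3]_q c%:E = (c * N ^+ 3)%:E)%E.
Proof. by rewrite integral_cst// EFinM -P3T. Qed.

Section K_part.
Variables (f : R -> R) (M1 Lg : R).
Hypothesis mf : measurable_fun setT f.
Hypothesis f_gt0 : forall x, 0 < f x.
Hypothesis f_decr : forall x y : R, 0 <= x <= y -> f y <= f x.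
Hypothesis f_conv : forall x y z : R, 0 <= x <= y -> y <= z -> f y + f (x + z - y) <= f x + f z.
Hypothesis f_sqrt : forall x y : R, 0 <= x <= y -> Num.sqrt x * f x <= Num.sqrt y * f y.
Hypothesis f_slope : forall h c : R, 0 <= h -> 2 * h <= c -> 0 < c -> f (c - h) - f c <= 2 * h / c * f c.
Hypothesis f_M1 : forall u : R, f u <= M1.
Hypothesis f_lip : forall u v : R, 0 <= u -> 0 <= v -> `|f u - f v| <= Lg * `|u - v|.

Let U := fine (\int[mu]_x (f x)%:E)%E.
Let UE : (\int[mu]_x (f x)%:E)%E = U%:E.
Proof.
rewrite /U fineK// ge0_fin_numE; last by apply: integral_ge0 => x _; rewrite lee_fin ltW.
apply: (@le_lt_trans _ _ (\int[mu]_x M1%:E)%E).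
  apply: ge0_le_integral => //; [by move=> x _; rewrite lee_fin ltW|exact/measurable_EFinP|].
  by move=> x _; rewrite lee_fin.
by rewrite integral_cstN ltry.
Qed.

Let M := 2 * C0 * (4 * M1 + 2 * Lg).
Let K_M x y z : `|Kop p f x y z| <= M.
Proof.
apply: (Kop_bounded mp b0_gt0 p_ge0 p_leb p_lin C0E) => // u u0.
by rewrite ger0_norm// ltW.
Qed.
Let M0 : 0 <= M. Proof. exact: le_trans (normr_ge0 _) (K_M 0 0 0). Qed.

(** [Kop] has no sign, but permuting variables by Tonelli needs one. Adding the uniform bound [M]
    provides it, and [M * N^3] is removed at the end. *)
Let h x y z := (Kop p f x y z + M)%:E.
Let h0 x y z : (0 <= h x y z)%E.
Proof. by rewrite lee_fin; have := K_M x y z; rewrite ler_norml => /andP[]; lra. Qed.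
Let mh d (T : measurableType d) (x y z : T -> R) :
  measurable_fun setT x -> measurable_fun setT y -> measurable_fun setT z ->
  measurable_fun setT (fun t => h (x t) (y t) (z t)).
Proof.
move=> mx my mz; apply/measurable_EFinP; apply: measurable_funD; last exact: measurable_cst.
exact: measurable_Kop.
Qed.

(** The six permuted integrals are equal, and their sum is the integral of [Ksum]. Each of the three
    terms [f x], [f y], [f z] contributes [N^2 * U], whence [3 / 6 = 1 / 2]. *)
Lemma integral_Kop_le : fine (\int[P3]_q (Kop p f q.1.1 q.1.2 q.2)%:E)%E <=
  Ksum_cst b0 L C0 LL * N ^+ 2 * U / 2.
Proof.
pose S := (\int[P3]_q h q.1.1 q.1.2 q.2)%E.
have ih (a b c : RB * RB * RB -> R) :
    measurable_fun setT a -> measurable_fun setT b -> measurable_fun setT c ->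
    measurable_fun setT (fun q => h (a q) (b q) (c q)) by exact: mh.
have m1 : measurable_fun setT (fun q : RB * RB * RB => q.1.1) by meas.
have m2 : measurable_fun setT (fun q : RB * RB * RB => q.1.2) by meas.
have m3 : measurable_fun setT (fun q : RB * RB * RB => q.2) by meas.
have e1 : (\int[P3]_q h q.1.1 q.2 q.1.2 = S)%E.
  by apply: (@integral3_perm23 _ mu h) => //; exact: ih.
have e2 : (\int[P3]_q h q.1.2 q.1.1 q.2 = S)%E.
  by apply: (@integral3_perm12 _ mu h) => //; exact: ih.
have e3 : (\int[P3]_q h q.1.2 q.2 q.1.1 = S)%E.
  rewrite -e1; apply: (@integral3_perm12 _ mu (fun a b c => h a c b)) => //; exact: ih.
have e4 : (\int[P3]_q h q.2 q.1.1 q.1.2 = S)%E.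
  rewrite -e2; apply: (@integral3_perm23 _ mu (fun a b c => h b a c)) => //; exact: ih.
have e5 : (\int[P3]_q h q.2 q.1.2 q.1.1 = S)%E.
  rewrite -e3; apply: (@integral3_perm23 _ mu (fun a b c => h b c a)) => //; exact: ih.
pose c := Ksum_cst b0 L C0 LL.
have c0 : 0 <= c.
  have := Ksum_le mp b0_gt0 p_ge0 p_leb p_lin L_ge0 dl_gt0 p_dil C0E f_gt0 f_decr f_conv f_sqrt f_slope LLE 0 0 0.
  rewrite /Ksum /Kop !W_zero2; do ?[by constructor 1].
  rewrite !mul0r !addr0 => h1.
  rewrite leNgt; apply/negP => cn.
  have : c * (f 0 + f 0 + f 0) < 0 by rewrite nmulr_rlt0// !addr_gt0.
  by rewrite /c ltNge h1.
have sum6 : (S + S + S + S + S + S <= (c * N ^+ 2 * U * 3 + 6 * M * N ^+ 3)%:E)%E.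
  pose s2 q := (h q.1.1 q.1.2 q.2 + h q.1.1 q.2 q.1.2)%E.
  pose s3 q := (s2 q + h q.1.2 q.1.1 q.2)%E.
  pose s4 q := (s3 q + h q.1.2 q.2 q.1.1)%E.
  pose s5 q := (s4 q + h q.2 q.1.1 q.1.2)%E.
  pose s6 (q : RB * RB * RB) := (s5 q + h q.2 q.1.2 q.1.1)%E.
  have ms2 : measurable_fun setT s2 by apply: emeasurable_funD; exact: ih.
  have ms3 : measurable_fun setT s3 by apply: emeasurable_funD => //; exact: ih.
  have ms4 : measurable_fun setT s4 by apply: emeasurable_funD => //; exact: ih.
  have ms5 : measurable_fun setT s5 by apply: emeasurable_funD => //; exact: ih.
  have s20 q : (0 <= s2 q)%E by rewrite adde_ge0.
  have s30 q : (0 <= s3 q)%E by rewrite adde_ge0.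
  have s40 q : (0 <= s4 q)%E by rewrite adde_ge0.
  have s50 q : (0 <= s5 q)%E by rewrite adde_ge0.
  have -> : (S + S + S + S + S + S = \int[P3]_q s6 q)%E.
    rewrite ge0_integralD//; [|exact: ih].
    rewrite e5 ge0_integralD//; [|exact: ih].
    rewrite e4 ge0_integralD//; [|exact: ih].
    rewrite e3 ge0_integralD//; [|exact: ih].
    rewrite e2 ge0_integralD//; [|exact: ih|exact: ih].
    by rewrite e1.
  pose cf x := (c * f x)%:E.
  have mcf : measurable_fun setT cf.
    by apply/measurable_EFinP; apply: measurable_funM => //; exact: measurable_cst.
  have cf0 x : (0 <= cf x)%E by rewrite lee_fin mulr_ge0// ltW.
  have icf : (\int[mu]_x cf x = (c * U)%:E)%E.
    rewrite /cf; under eq_integral do rewrite EFinM.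
    rewrite ge0_integralZl_EFin//; first by rewrite UE -EFinM.
      by move=> x _; rewrite lee_fin ltW.
    exact/measurable_EFinP.
  have i1 : (\int[mu]_x cst 1 x = N%:E)%E by rewrite integral_cstN mul1r.
  have ot0 (x : RB) : (0 <= cst 1 x :> \bar R)%E by [].
  have mo : measurable_fun setT (cst 1%E : RB -> \bar R) by exact: measurable_cst.
  have t1 := @integral3_tensor _ mu cf (cst 1%E) (cst 1%E) mcf mo mo cf0 ot0 ot0.
  have t2 := @integral3_tensor _ mu (cst 1%E) cf (cst 1%E) mo mcf mo ot0 cf0 ot0.
  have t3 := @integral3_tensor _ mu (cst 1%E) (cst 1%E) cf mo mo mcf ot0 ot0 cf0.
  rewrite !icf !i1 in t1 t2 t3.
  pose g1 (q : RB * RB * RB) := (cf q.1.1 * cst 1 q.1.2 * cst 1 q.2)%E.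
  pose g2 (q : RB * RB * RB) := (cst 1 q.1.1 * cf q.1.2 * cst 1 q.2)%E.
  pose g3 (q : RB * RB * RB) := (cst 1 q.1.1 * cst 1 q.1.2 * cf q.2)%E.
  have mg1 : measurable_fun setT g1.
    rewrite /g1 /cst; under eq_fun do rewrite !mule1; exact: (measurableT_comp mcf).
  have mg2 : measurable_fun setT g2.
    rewrite /g2 /cst; under eq_fun do rewrite mule1 mul1e; exact: (measurableT_comp mcf).
  have mg3 : measurable_fun setT g3.
    rewrite /g3 /cst; under eq_fun do rewrite !mul1e; exact: (measurableT_comp mcf).
  have g10 q : (0 <= g1 q)%E by rewrite !mule_ge0.
  have g20 q : (0 <= g2 q)%E by rewrite !mule_ge0.
  have g30 q : (0 <= g3 q)%E by rewrite !mule_ge0.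
  have gE : (\int[P3]_q (g1 q + g2 q + g3 q + (6 * M)%:E) =
      (c * N ^+ 2 * U * 3 + 6 * M * N ^+ 3)%:E)%E.
    rewrite ge0_integralD//; last 3 first.
    - by move=> q _; rewrite !adde_ge0.
    - by apply: emeasurable_funD => //; exact: emeasurable_funD.
    - by move=> q _; rewrite lee_fin mulr_ge0.
    rewrite ge0_integralD//; last 2 first.
    - by move=> q _; rewrite !adde_ge0.
    - exact: emeasurable_funD.
    rewrite ge0_integralD// t1 t2 t3 integral_cstP3 -!EFinM -!EFinD.
    by congr EFin; ring.
  rewrite -gE; apply: ge0_le_integral => //.
  - by move=> q _; rewrite adde_ge0.
  - by apply: emeasurable_funD => //; exact: ih.
  - by do 2 apply: emeasurable_funD => //; exact: emeasurable_funD.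
  move=> q _.
  rewrite /s6 /s5 /s4 /s3 /s2 /h /g1 /g2 /g3 /cst !mule1 !mul1e /cf -!EFinD lee_fin.
  have := Ksum_le mp b0_gt0 p_ge0 p_leb p_lin L_ge0 dl_gt0 p_dil C0E f_gt0 f_decr f_conv f_sqrt f_slope LLE q.1.1 q.1.2 q.2.
  rewrite /Ksum -/c; lra.
have S0 : (0 <= S)%E by apply: integral_ge0 => q _.
have Sfin : S \is a fin_num.
  rewrite ge0_fin_numE//; apply: le_lt_trans (_ : (_ < +oo)%E); last exact: (ltry (c * N ^+ 2 * U * 3 + 6 * M * N ^+ 3)).
  exact: (le_trans (le_sum6 S0) sum6).
move: sum6; rewrite -(fineK Sfin) -!EFinD lee_fin => sum6.
have mK : measurable_fun setT (fun q : RB * RB * RB => Kop p f q.1.1 q.1.2 q.2).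
  exact: measurable_Kop.
have iK : P3.-integrable setT (fun q => (Kop p f q.1.1 q.1.2 q.2)%:E).
  apply: (@measurable_bounded_integrable _ _ _ _ (fun q : RB * RB * RB => Kop p f q.1.1 q.1.2 q.2)) => //.
  - by exists M; split; [exact: num_real|move=> B MB q _ /=; exact: (le_trans (K_M _ _ _) (ltW MB))].
have iM : P3.-integrable setT (fun _ : RB * RB * RB => M%:E).
  apply: (@measurable_bounded_integrable _ _ _ _ (fun _ : RB * RB * RB => M)) => //.
  - by exists M; split; [exact: num_real|move=> B MB q _ /=; rewrite ger0_norm// ltW].
have SE : S = (\int[P3]_q (Kop p f q.1.1 q.1.2 q.2)%:E + (M * N ^+ 3)%:E)%E.
  rewrite /S /h; under eq_integral do rewrite EFinD.
  by rewrite integralD// integral_cstP3.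
have Kfin : (\int[P3]_q (Kop p f q.1.1 q.1.2 q.2)%:E)%E \is a fin_num.
  exact: integrable_fin_num.
have : fine S = fine (\int[P3]_q (Kop p f q.1.1 q.1.2 q.2)%:E)%E + M * N ^+ 3.
  by rewrite SE fineD.
by move: sum6; rewrite -/c; lra.
Qed.


(** To the right of [y] the function [f] is smaller than at [y]; to the left, [sqrt x * f x] is. In
    the second case the missing root comes from another pair estimate for [x], and from the factor
    [sqrt d] for the partner. *)
Lemma gain_sqrt_le (w x d y z : R) : 0 <= w -> 0 <= x -> 0 <= d -> 0 <= y -> 0 <= z ->
  w * (Num.sqrt x * Num.sqrt z) <= C0 -> w * (Num.sqrt y * Num.sqrt z) <= C0 ->
  w * (Num.sqrt x * Num.sqrt y * Num.sqrt z) <= C0 * Num.sqrt d ->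
  w * Num.sqrt x * Num.sqrt z * (f x + f d) <= 2 * C0 * f y.
Proof.
move=> w0 x0 d0 y0 z0 h1 h2 h3.
have fy := f_gt0 y; have fx := f_gt0 x; have fd := f_gt0 d.
have sx := sqrtr_ge0 x; have sy := sqrtr_ge0 y; have sz := sqrtr_ge0 z.
have t1 : w * Num.sqrt x * Num.sqrt z * f x <= C0 * f y.
  have [yx|xy] := leP y x.
    rewrite -[_ * _ * Num.sqrt z]mulrA ler_pM ?mulr_ge0// ?(ltW fx)//.
    by apply: f_decr; rewrite y0.
  apply: (@le_trans _ _ (w * (Num.sqrt y * Num.sqrt z) * f y)); last by rewrite ler_pM2r.
  have -> : w * Num.sqrt x * Num.sqrt z * f x = w * Num.sqrt z * (Num.sqrt x * f x) by ring.
  have -> : w * (Num.sqrt y * Num.sqrt z) * f y = w * Num.sqrt z * (Num.sqrt y * f y) by ring.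
  by rewrite ler_wpM2l ?mulr_ge0//; apply: f_sqrt; rewrite x0 ltW.
have t2 : w * Num.sqrt x * Num.sqrt z * f d <= C0 * f y.
  have [yd|dy] := leP y d.
    rewrite -[_ * _ * Num.sqrt z]mulrA ler_pM ?mulr_ge0// ?(ltW fd)//.
    by apply: f_decr; rewrite y0.
  have y1 : 0 < y by lra.
  have sy1 : 0 < Num.sqrt y by rewrite sqrtr_gt0.
  rewrite -(ler_pM2r sy1).
  have -> : w * Num.sqrt x * Num.sqrt z * f d * Num.sqrt y =
    w * (Num.sqrt x * Num.sqrt y * Num.sqrt z) * f d by ring.
  apply: (@le_trans _ _ (C0 * Num.sqrt d * f d)); first by rewrite ler_pM2r.
  have -> : C0 * f y * Num.sqrt y = C0 * (Num.sqrt y * f y) by ring.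
  by rewrite -mulrA ler_pM2l//; apply: f_sqrt; rewrite d0 ltW.
by rewrite mulrDr; lra.
Qed.

Let min1 (u : R) : C0 * Num.min 1 u <= C0.
Proof. by rewrite -[leRHS]mulr1 ler_pM2l// ge_min lexx. Qed.

Lemma Kop_sqrt_le (x y z : R) : y <= z ->
  Kop p f x y z * Num.sqrt x * Num.sqrt z <= 2 * C0 * f y /\
  Kop p f x z y * Num.sqrt x * Num.sqrt z <= 2 * C0 * f y.
Proof.
move=> yz; have fy := f_gt0 y; have fz := f_gt0 z.
have sx := sqrtr_ge0 x; have sz := sqrtr_ge0 z.
have r0 : 0 <= 2 * C0 * f y by rewrite mulr_ge0 ?mulr_ge0// ltW.
split; rewrite /Kop.
- case: (W_bound_C0 mp b0_gt0 p_ge0 p_leb p_lin C0E x y z) => [->|]; first by rewrite !mul0r.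
  move=> [[x0 y0 z0 xyz] h1 h2 h3 h4].
  have xs : xstar x y z = y + z - x by rewrite /xstar (max_idPl _)//; lra.
  rewrite xs; set w := W p x y z in h1 h2 h3 h4 *.
  have w0 : 0 <= w by exact: W_ge0.
  apply: (@le_trans _ _ (w * Num.sqrt x * Num.sqrt z * (f x + f (y + z - x)))).
    have -> : w * (f x + f (y + z - x) - f y - f z) * Num.sqrt x * Num.sqrt z =
       w * Num.sqrt x * Num.sqrt z * (f x + f (y + z - x) - f y - f z) by ring.
    by rewrite ler_wpM2l ?mulr_ge0//; lra.
  apply: gain_sqrt_le => //; [lra|exact: (le_trans h2 (min1 _))|exact: (le_trans h3 (min1 _))|].
  by apply: (le_trans h4); rewrite ler_wpM2r ?sqrtr_ge0.
- case: (W_bound_C0 mp b0_gt0 p_ge0 p_leb p_lin C0E x z y) => [->|]; first by rewrite !mul0r.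
  move=> [[x0 z0 y0 xyz] h1 h2 h3 h4].
  have xs : xstar x z y = z + y - x by rewrite /xstar (max_idPl _)//; lra.
  rewrite xs; set w := W p x z y in h1 h2 h3 h4 *.
  have w0 : 0 <= w by exact: W_ge0.
  apply: (@le_trans _ _ (w * Num.sqrt x * Num.sqrt z * (f x + f (z + y - x)))).
    have -> : w * (f x + f (z + y - x) - f z - f y) * Num.sqrt x * Num.sqrt z =
       w * Num.sqrt x * Num.sqrt z * (f x + f (z + y - x) - f z - f y) by ring.
    by rewrite ler_wpM2l ?mulr_ge0//; lra.
  apply: gain_sqrt_le => //; [lra|exact: (le_trans h1 (min1 _))| |].
    by rewrite [Num.sqrt y * _]mulrC; exact: (le_trans h3 (min1 _)).
  rewrite (_ : Num.sqrt x * Num.sqrt y * Num.sqrt z = Num.sqrt x * Num.sqrt z * Num.sqrt y); last by ring.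
  by apply: (le_trans h4); rewrite ler_wpM2r ?sqrtr_ge0.
Qed.

(** With [a <= b] the two incoming arguments, the integrand is at most [2 * C0 * f a / sqrt b] on an
    interval of length at most [2 * b], and [sqrt b <= 1 + b]. Only one factor of [f] and one of
    [1 + x] remain, so this term is linear in the moment. *)
Lemma Jop_le (y z : R) : Jop p f y z <=
  2 * C0 * ((1 + Num.max z 0) * f y + (1 + Num.max y 0) * f z).
Proof.
have fy := f_gt0 y; have fz := f_gt0 z.
have my : 0 <= Num.max y 0 by rewrite le_max lexx orbT.
have mz : 0 <= Num.max z 0 by rewrite le_max lexx orbT.
have t1 : 0 <= (1 + Num.max z 0) * f y by rewrite mulr_ge0 ?addr_ge0// ltW.
have t2 : 0 <= (1 + Num.max y 0) * f z by rewrite mulr_ge0 ?addr_ge0// ltW.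
have C00 : 0 <= 2 * C0 by rewrite mulr_ge0// ltW.
have r0 : 0 <= 2 * C0 * ((1 + Num.max z 0) * f y + (1 + Num.max y 0) * f z).
  by rewrite mulr_ge0// addr_ge0.
have neg : y < 0 \/ z < 0 -> Jop p f y z = 0.
  move=> h'; rewrite /Jop (_ : Rintegral _ _ _ = 0) ?mulr0//.
  rewrite /Rintegral integral0_eq// => x _; rewrite /Kop (W_neg mp b0_gt0 p_ge0 p_leb p_lin C0E) ?mul0r//.
  by case: h' => ?; [constructor 2|constructor 3].
have [y0|] := boolP (y < 0); first by rewrite (neg (or_introl y0)).
rewrite -leNgt => y0; have [z0|] := boolP (z < 0); first by rewrite (neg (or_intror z0)).
rewrite -leNgt => z0.
have mK : measurable_fun setT (fun x : R => Kop p f x y z * Num.sqrt x).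
  apply: measurable_funM; last exact: (@measurable_sqrt _ _ RB setT (fun x => x)).
  by apply: measurable_Kop => //; exact: measurable_cst.
have key (a b : R) : 0 <= a -> a <= b -> y + z = a + b ->
    (forall x, Kop p f x y z * Num.sqrt x * Num.sqrt b <= 2 * C0 * f a) ->
    Jop p f y z <= 2 * C0 * ((1 + b) * f a).
  move=> a0 ab yzab hK; have fa := f_gt0 a.
  rewrite /Jop; have [b00|b1] := leP b 0.
    rewrite (_ : Rintegral _ _ _ = 0) ?mulr0 ?mulr_ge0 ?addr_ge0//; [lra|lra|exact: ltW|].
    by apply: Rintegral_itv_eq0; lra.
  have sb : 0 < Num.sqrt b by rewrite sqrtr_gt0.
  have sb2 : Num.sqrt b ^+ 2 = b by rewrite sqr_sqrtr// ltW.
  set c := 2 * C0 * f a / Num.sqrt b.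
  have c0 : 0 <= c by rewrite divr_ge0 ?mulr_ge0 ?ltW.
  have : Rintegral leb `[0, y + z] (fun x => Kop p f x y z * Num.sqrt x) <= (y + z) * c.
    have := @fine_integral_le R _ RB leb `[0, y + z]
      (fun x => (Kop p f x y z * Num.sqrt x)%:E) (cst c%:E).
    have -> : fine (\int[leb]_(x in `[0, y + z]) cst c%:E x) = (y + z) * c.
      rewrite integral_cst//= lebesgue_measure_itv/= lte_fin.
      by rewrite (_ : 0 < y + z)%R; [rewrite -EFinD subr0 -EFinM/= mulrC|lra].
    apply => //.
    - exact/measurable_EFinP/measurable_funTS.
    - by move=> x _; rewrite lee_fin /c ler_pdivlMr.
    - rewrite integral_cst//= lebesgue_measure_itv/= lte_fin; case: ifPn => _.
        by rewrite -EFinB -EFinM ltry.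
      by rewrite mule0 ltry.
  move=> hJ; apply: (@le_trans _ _ (2^-1 * ((y + z) * c))); first by rewrite ler_pM2l.
  rewrite yzab /c.
  have -> : 2^-1 * ((a + b) * (2 * C0 * f a / Num.sqrt b)) = C0 * f a * ((a + b) / Num.sqrt b).
    by field; rewrite gt_eqF.
  have -> : 2 * C0 * ((1 + b) * f a) = C0 * f a * (2 * (1 + b)) by ring.
  rewrite ler_pM2l ?mulr_gt0// ler_pdivrMr//.
  apply: (@le_trans _ _ (2 * b)); first by lra.
  rewrite -mulrA ler_pM2l// -{1}sb2 expr2 ler_pM2r//.
  have := sqr_ge0 (Num.sqrt b - 1); rewrite sqrrB1 sb2 -mulr_natr; lra.
have [yz|zy] := leP y z.
- apply: (le_trans (key y z y0 yz erefl (fun x => (Kop_sqrt_le x yz).1))).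
  by rewrite (max_idPl z0) ler_wpM2l// lerDl.
- apply: (le_trans (key z y z0 (ltW zy) (addrC _ _) (fun x => (Kop_sqrt_le x (ltW zy)).2))).
  by rewrite (max_idPl y0) ler_wpM2l// lerDr.
Qed.

Variable E1 : R.
Hypothesis E1E : (\int[mu]_x (1 + Num.max x 0)%:E = E1%:E)%E.

Lemma measurable_Jop : measurable_fun setT (fun q : RB * RB => Jop p f q.1 q.2).
Proof.
rewrite /Jop; apply: measurable_funM; first exact: measurable_cst.
apply: (@measurable_Rintegral_param _ _ (RB * RB)%type (fun=> 0) (fun q => q.1 + q.2)
  (fun t : RB * RB * RB => Kop p f t.2 t.1.1 t.1.2 * Num.sqrt t.2)); [exact: measurable_cst|meas|].
apply: measurable_funM; last by meas.
by apply: measurable_Kop => //; meas.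
Qed.

Lemma integral_Jop_le : fine (\int[P2]_q (Jop p f q.1 q.2)%:E)%E <= 4 * C0 * E1 * U.
Proof.
pose a x := (2 * C0 * f x)%:E; pose b (x : R) := (1 + Num.max x 0)%:E.
have ma : measurable_fun setT a by apply/measurable_EFinP; meas.
have mb : measurable_fun setT b by apply/measurable_EFinP; meas.
have C00 : 0 <= 2 * C0 by rewrite mulr_ge0// ltW.
have a0 x : (0 <= a x)%E by rewrite lee_fin mulr_ge0// ltW.
have b00 x : (0 <= b x)%E by rewrite lee_fin addr_ge0// le_max lexx orbT.
have ia : (\int[mu]_x a x = (2 * C0 * U)%:E)%E.
  rewrite /a; under eq_integral do rewrite EFinM.
  rewrite ge0_integralZl_EFin//; first by rewrite UE -EFinM.
    by move=> x _; rewrite lee_fin ltW.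
  exact/measurable_EFinP.
have t1 := @integral2_tensor _ mu a b ma mb a0 b00.
have t2 := @integral2_tensor _ mu b a mb ma b00 a0.
rewrite E1E ia in t1 t2.
have m1 : measurable_fun setT (fun q : RB * RB => a q.1 * b q.2)%E.
  apply: emeasurable_funM.
    by apply: (measurableT_comp ma); exact: measurable_fst.
  by apply: (measurableT_comp mb); exact: measurable_snd.
have m2 : measurable_fun setT (fun q : RB * RB => b q.1 * a q.2)%E.
  apply: emeasurable_funM.
    by apply: (measurableT_comp mb); exact: measurable_fst.
  by apply: (measurableT_comp ma); exact: measurable_snd.
have iE : (\int[P2]_q (a q.1 * b q.2 + b q.1 * a q.2) = (4 * C0 * E1 * U)%:E)%E.
  rewrite ge0_integralD//; [|by move=> q _; rewrite mule_ge0|by move=> q _; rewrite mule_ge0].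
  by rewrite t1 t2 -!EFinM -EFinD; congr EFin; ring.
rewrite -[leRHS]/(fine (4 * C0 * E1 * U)%:E) -iE.
apply: fine_integral_le => //.
- by apply/measurable_EFinP; exact: measurable_Jop.
- exact: emeasurable_funD.
- by move=> q _; rewrite adde_ge0// mule_ge0.
- move=> q _; rewrite /a /b -!EFinM -EFinD lee_fin (le_trans (Jop_le _ _))//.
  by apply: eq_ler; ring.
- by rewrite iE ltry.
Qed.

End K_part.
End MomentStep.

(** * Measures carried by the half-line and the moment of order -1/2 *)

Section Carried.
Variable R : realType.
Notation RB := (measurableTypeR R).
Notation leb := (@lebesgue_measure R).

Lemma measurable_nonneg : measurable (@nonneg R).
Proof.
rewrite (_ : @nonneg R = `[0, +oo[%classic); first exact: measurable_itv.
by apply/seteqP; split => x /=; rewrite in_itv/= andbT.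
Qed.

Lemma setC_nonneg : ~` (@nonneg R) = [set x : RB | x < 0].
Proof. by apply/seteqP; split => x /=; rewrite ltNge => /negP. Qed.

Variable mu : {finite_measure set RB -> \bar R}.
Hypothesis mu_neg : mu [set x | x < 0] = 0%E.

Lemma integral_nonneg (g : RB -> \bar R) : measurable_fun setT g ->
  (forall x, 0 <= g x)%E -> (\int[mu]_(x in @nonneg R) g x = \int[mu]_x g x)%E.
Proof.
move=> mg g0; rewrite [RHS](@ge0_negligible_integral _ _ _ _ _ (~` (@nonneg R)))//.
- by rewrite setTD setCK.
- exact: measurableC measurable_nonneg.
- by rewrite setC_nonneg.
Qed.

End Carried.

Section Rinv.
Variable R : realType.
Notation RB := (measurableTypeR R).

(** The weight of the moment of order [-1/2], set to [+oo] also on the negative axis, which the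
    measures at hand do not charge. *)
Definition rinv (x : R) : \bar R := if x <= 0 then +oo%E else ((Num.sqrt x)^-1)%:E.

Lemma rinv_ge0 x : (0 <= rinv x)%E.
Proof. by rewrite /rinv; case: ifP => // _; rewrite lee_fin invr_ge0 sqrtr_ge0. Qed.

Lemma measurable_rinv : measurable_fun setT (rinv : RB -> \bar R).
Proof.
apply: measurable_fun_ifT; [meas|exact: measurable_cst|].
by apply/measurable_EFinP; meas.
Qed.

Lemma rinvE (x : R) : 0 <= x -> mom_fun (- (1 / 2)) x = rinv x.
Proof.
move=> x0; rewrite /mom_fun /rinv (_ : (x <= 0) = (x == 0)); last by rewrite eq_le x0 andbT.
rewrite (_ : - (1 / 2) < 0 :> R)%R ?andbT; last by lra.
by case: ifP => // _; rewrite powRN div1r powR12_sqrt.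
Qed.

Lemma isq_le_rinv (e x : R) : 0 < e -> ((isq e x)%:E <= rinv x)%E.
Proof.
move=> e0; rewrite /rinv; case: (boolP (x <= 0)) => [_|]; first by rewrite leey.
rewrite -ltNge => x0; rewrite lee_fin /isq lef_pV2 ?posrE ?sqrtr_gt0//; last by rewrite (max_idPl (ltW x0)) addr_gt0.
by rewrite (max_idPl (ltW x0)) ler_wsqrtr// lerDr ltW.
Qed.

Lemma isq_cvg_rinv (x : R) : 0 <= x ->
  (isq (n.+1%:R^-1) x)%:E @[n --> \oo] --> rinv x.
Proof.
move=> x0; rewrite /rinv; case: (boolP (x <= 0)) => [x1|].
  have -> : x = 0 by lra.
  rewrite /isq maxxx; under eq_fun do rewrite addr0 sqrtrV// invrK.
  apply/cvgeyPge => A; near=> n; rewrite lee_fin.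
  apply: (@le_trans _ _ (Num.max A 0)); first by rewrite le_max lexx.
  rewrite -[leLHS]ger0_norm; last by rewrite le_max lexx orbT.
  rewrite -sqrtr_sqr ler_wsqrtr//.
  apply: (@le_trans _ _ n%:R); last by rewrite ler_nat.
  by near: n; exact: nbhs_infty_ger.
rewrite -ltNge => x1; apply: cvg_EFin; first exact: nearW.
rewrite /isq (max_idPl x0); apply: cvgV; first by rewrite gt_eqF// sqrtr_gt0.
have h : (n.+1%:R^-1 + x)%R @[n --> \oo] --> x.
  rewrite -[X in _ --> X]add0r; apply: cvgD; [exact: cvg_harmonic|exact: cvg_cst].
by apply: (cvg_comp _ _ h); exact: sqrt_continuous.
Unshelve. all: by end_near. Qed.

Lemma isq_antimono (e e' x : R) : 0 < e -> e <= e' -> isq e' x <= isq e x.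
Proof.
move=> e0 ee; have m0 : 0 <= Num.max x 0 by rewrite le_max lexx orbT.
have h1 : 0 < e + Num.max x 0 by lra.
have h2 : 0 < e' + Num.max x 0 by lra.
by rewrite /isq lef_pV2 ?posrE ?sqrtr_gt0// ler_wsqrtr// lerD2r.
Qed.

(** Monotone convergence along [e = 1 / (n + 1)], the regularizations increasing to [rinv] on the
    half-line. *)
Lemma integral_rinv_le (mu : {finite_measure set RB -> \bar R}) (K : \bar R) :
  mu [set x | x < 0] = 0%E ->
  (forall e : R, 0 < e -> (\int[mu]_x (isq e x)%:E <= K)%E) -> (\int[mu]_x rinv x <= K)%E.
Proof.
move=> mun H; have mn := @measurable_nonneg R.
rewrite -(integral_nonneg mun); [|exact: measurable_rinv|exact: rinv_ge0].
pose g n (x : R) := (isq (n.+1%:R^-1) x)%:E.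
have e0 n : 0 < n.+1%:R^-1 :> R by rewrite invr_gt0.
have mg n : measurable_fun setT (g n) by apply/measurable_EFinP; exact: measurable_isq.
have g0 n x : (0 <= g n x)%E by rewrite lee_fin; apply: ltW; exact: isq_gt0.
have c := @cvg_monotone_convergence _ _ _ mu _ mn g (fun n => measurable_funTS (mg n))
  (fun n x _ => g0 n x).
have nd (x : RB) : (@nonneg R) x -> {homo g^~ x : n m / (n <= m)%N >-> (n <= m)%E}.
  move=> _ n m nm; rewrite lee_fin; apply: isq_antimono => //.
  by rewrite lef_pV2 ?posrE// ler_nat ltnS.
have {}c := c nd.
have -> : (\int[mu]_(x in @nonneg R) rinv x =
    \int[mu]_(x in @nonneg R) (limn (g ^~ x)))%E.
  apply: eq_integral => x; rewrite inE => x0; apply/esym/cvg_lim => //.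
  exact: isq_cvg_rinv.
rewrite -(cvg_lim _ c)//; apply: lime_le; first by apply/cvg_ex; eexists; exact: c.
apply: nearW => n; rewrite (integral_nonneg mun (mg n) (g0 n)); exact: (H _ (e0 n)).
Qed.

End Rinv.

(** * Propagation of the negative moment *)

Section MomentBound.
Variable R : realType.
Notation RB := (measurableTypeR R).
Notation leb := (@lebesgue_measure R).
Variables (p : R -> R) (b0 : R).
Hypothesis mp : measurable_fun setT p.
Hypothesis b0_gt0 : 0 < b0.
Hypothesis p_ge0 : forall r, 0 <= p r.
Hypothesis p_leb : forall r, p r <= b0.
Hypothesis p_lin : forall r : R, 0 <= r -> p r <= b0 * r.
Variables (L dl : R).
Hypothesis L_ge0 : 0 <= L.
Hypothesis dl_gt0 : 0 < dl.
Hypothesis p_dil : forall r al : R, 0 < r -> 1 <= al <= 1 + dl ->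
  p (al * r) <= (1 + L * (al - 1)) * p r.
Variable C0 : R.
Hypothesis C0E : C0 = 32 * b0 ^+ 2.
Variable F : R -> {finite_measure set RB -> \bar R}.
Hypothesis sol : cons_measure_solution p F.

Lemma sol_neg (t : R) : 0 <= t -> F t [set x | x < 0] = 0%E.
Proof. by case: sol => + _ t0 => /(_ t t0)[]. Qed.

Definition massF := fine (F 0 setT).

Lemma sol_mass (t : R) : 0 <= t -> F t setT = massF%:E.
Proof.
have E (s : R) : 0 <= s -> moment 0 (F s) = F s setT.
  move=> s0; rewrite /moment; under eq_integral do rewrite /mom_fun ltxx andbF powRr0.
  by rewrite (integral_nonneg (sol_neg s0))// integral_cst// mul1e.
move=> t0; case: sol => _ [/(_ t t0)[+ _] _]; rewrite !E// => ->.
by rewrite /massF fineK// fin_num_measure.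
Qed.

Let ma : measurable_fun setT (fun x : RB => (1 + Num.max x 0)%:E).
Proof. by apply/measurable_EFinP; meas. Qed.
Let mm : measurable_fun setT (fun x : RB => (Num.max x 0)%:E).
Proof. by apply/measurable_EFinP; meas. Qed.
Let m0 (x : R) : (0 <= (Num.max x 0)%:E)%E.
Proof. by rewrite lee_fin le_max lexx orbT. Qed.
Let a0 (x : R) : (0 <= (1 + Num.max x 0)%:E)%E.
Proof. by rewrite lee_fin addr_ge0// le_max lexx orbT. Qed.

(** Mass plus energy, with [x] cut at 0 so that the integrand is nonnegative on the whole line. *)
Definition energyF := fine (\int[F 0]_x (1 + Num.max x 0)%:E)%E.

Lemma sol_energy (t : R) : 0 <= t -> (\int[F t]_x (1 + Num.max x 0)%:E = energyF%:E)%E.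
Proof.
have E (s : R) : 0 <= s -> (\int[F s]_x (1 + Num.max x 0)%:E = F s setT + moment 1 (F s))%E.
  move=> s0; under eq_integral do rewrite EFinD.
  rewrite ge0_integralD// integral_cst// mul1e; congr (_ + _)%E.
  rewrite -(integral_nonneg (sol_neg s0))//; apply: eq_integral => x; rewrite inE => x0.
  by rewrite /mom_fun ltr10 andbF powRr1// (max_idPl x0).
have fin0 : (\int[F 0]_x (1 + Num.max x 0)%:E)%E \is a fin_num.
  rewrite ge0_fin_numE; last by apply: integral_ge0.
  case: sol => /(_ 0 (lexx _))[_ h] _; apply: le_lt_trans h.
  rewrite -(integral_nonneg (sol_neg (lexx _)))//.
  by rewrite le_eqVlt; apply/orP; left; apply/eqP; apply: eq_integral => x; rewrite inE => x0; rewrite (max_idPl x0).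
move=> t0; rewrite /energyF fineK// !E// !sol_mass//.
by case: sol => _ [/(_ t t0)[_ ->] _].
Qed.

Lemma intFE (t : R) (g : R -> R) : 0 <= t -> measurable_fun setT g -> (forall x, 0 <= g x) ->
  intF (F t) g = fine (\int[F t]_x (g x)%:E)%E.
Proof.
by move=> t0 mg g0; rewrite /intF (integral_nonneg (sol_neg t0))//; apply/measurable_EFinP.
Qed.

Lemma massF_ge0 : 0 <= massF. Proof. exact: fine_ge0. Qed.
Lemma energyF_ge0 : 0 <= energyF. Proof. by apply: fine_ge0; exact: integral_ge0. Qed.

Lemma integral_bounded_fin (t M : R) (g : R -> R) : 0 <= t -> measurable_fun setT g ->
  (forall x, 0 <= g x <= M) ->
  (\int[F t]_x (g x)%:E)%E = (fine (\int[F t]_x (g x)%:E)%E)%:E /\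
  0 <= fine (\int[F t]_x (g x)%:E)%E <= M * massF.
Proof.
move=> t0 mg gM.
have g0 x : (0 <= (g x)%:E)%E by rewrite lee_fin; case/andP: (gM x).
have i0 : (0 <= \int[F t]_x (g x)%:E)%E by exact: integral_ge0.
have i1 : (\int[F t]_x (g x)%:E <= (M * massF)%:E)%E.
  have -> : ((M * massF)%:E = \int[F t]_x M%:E)%E by rewrite integral_cst// EFinM -(sol_mass t0).
  apply: ge0_le_integral => //; first exact/measurable_EFinP.
  by move=> x _; rewrite lee_fin; case/andP: (gM x).
have fi : (\int[F t]_x (g x)%:E)%E \is a fin_num.
  by rewrite ge0_fin_numE//; apply: le_lt_trans i1 (ltry _).
by rewrite fineK//; split => //; rewrite fine_ge0//= -lee_fin fineK.
Qed.

Let LL := 16 + 2 / dl + 2 * L.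

(** The constant precedes [e] in the quantifiers: both collision terms are linear in the regularized
    moment with coefficients depending only on the kernel, mass and energy, so the differential
    inequality [u' <= C * u] is uniform in the regularization. *)
Lemma moment_isq_le : exists2 C : R, 0 < C & forall e : R, 0 < e ->
  forall T : R, 0 <= T ->
  (\int[F T]_x (isq e x)%:E <= (2 * expR (2 * C * T))%:E * \int[F 0]_x (isq e x)%:E)%E.
Proof.
pose N := massF; pose K := Ksum_cst b0 L C0 LL.
have C0_gt0 : 0 < C0 by rewrite C0E mulr_gt0// exprn_gt0.
have LL0 : 0 <= LL by rewrite /LL; have := @divr_ge0 R 2 dl (ler0n _ 2) (ltW dl_gt0); move: L_ge0; lra.
have K0 : 0 <= K.
  have b2 := sqr_ge0 b0; have := mulr_ge0 L_ge0 (ltW C0_gt0); have := mulr_ge0 (ltW C0_gt0) LL0.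
  by rewrite /K /Ksum_cst; lra.
(* The second summand comes from [Jop] and the third from [Kop]; the 1 ensures that [C] is
   positive. *)
pose C := 1 + 4 * C0 * energyF + K * N ^+ 2 / 2.
have E0 := energyF_ge0.
have C1 : 0 <= 4 * C0 * energyF by rewrite mulr_ge0 ?mulr_ge0// ltW.
have C2 : 0 <= K * N ^+ 2 / 2 by apply: divr_ge0 => //; apply: mulr_ge0 => //; exact: sqr_ge0.
have Cgt0 : 0 < C by rewrite /C; lra.
exists C => // e e0 T T0.
have C11 := isq_C11b e0; have mq := measurable_isq e.
have q0 x : 0 < isq e x := isq_gt0 e0 x.
pose q := (Num.sqrt e)^-1.
have qb x : 0 <= isq e x <= q by rewrite ltW//= isq_le.
pose u t := intF (F t) (isq e).
have uE t : 0 <= t -> (\int[F t]_x (isq e x)%:E)%E = (u t)%:E.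
  by move=> t0; rewrite /u intFE//; [case: (integral_bounded_fin t0 mq qb)|move=> x; exact: ltW].
have ub t : 0 <= t -> 0 <= u t <= q * massF.
  by move=> t0; rewrite /u intFE//; [case: (integral_bounded_fin t0 mq qb)|move=> x; exact: ltW].
case: sol => _ [_ /(_ _ C11)[_ der]].
pose d (t : R) := fine (\int[(F t \x F t)%E]_q (Jop p (isq e) q.1 q.2)%:E)%E +
  fine (\int[((F t \x F t) \x F t)%E]_q (Kop p (isq e) q.1.1 q.1.2 q.2)%:E)%E.
rewrite -/u in der.
have dle t : 0 <= t -> d t <= C * u t.
  move=> t0; have Ft := sol_mass t0.
  have UE : fine (\int[F t]_x (isq e x)%:E)%E = u t by rewrite uE.
  have NE : fine (F t setT) = N by rewrite Ft.
  have := @integral_Jop_le R p b0 mp b0_gt0 p_ge0 p_leb p_lin C0 C0E (F t) (isq e) q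
    mq q0 (isq_decr e0) (isq_sqrt e0) (isq_le e0) energyF (sol_energy t0).
  have := @integral_Kop_le R p b0 mp b0_gt0 p_ge0 p_leb p_lin L dl L_ge0 dl_gt0 p_dil C0 C0E LL erefl
    (F t) (isq e) q _ mq q0 (isq_decr e0) (isq_conv e0) (isq_sqrt e0) (isq_slope e0) (isq_le e0) (isq_lip e0).
  rewrite UE NE -/K /d => h1 h2.
  apply: (le_trans (lerD h2 h1)); rewrite /C.
  have /andP[u0 _] := ub _ t0.
  by rewrite -subr_ge0 [leRHS](_ : _ = u t)//; ring.
(* A family with a single member and no inhomogeneous term. *)
have := @gronwall_family R unit (fun _ => u) (fun _ => d) T C (u 0) 0 (q * massF)
  Cgt0 T0 _ (lexx _) (fun _ => der) (fun _ => lexx _) _ _ tt T.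
rewrite mul0r addr0 lexx T0 => H.
rewrite !uE// -EFinM lee_fin [leRHS](_ : _ = 2 * u 0 * expR (2 * C * T)); last by ring.
apply: H => //.
- by case/andP: (ub 0 (lexx _)).
- by move=> _ t /andP[t0 _]; case/andP: (ub t t0).
- move=> m m_ge0 hm _ t /andP[t0 tT]; rewrite addr0 (le_trans (dle t t0))//.
  by rewrite -mulrA ler_pM2l//; apply: (hm tt); rewrite t0.
Qed.

Hypothesis rinv0 : (\int[F 0]_x rinv x < +oo)%E.

Lemma moment_rinv_bound (T : R) : 0 <= T ->
  exists2 K : R, 0 <= K & forall t : R, 0 <= t <= T -> (\int[F t]_x rinv x <= K%:E)%E.
Proof.
move=> T0; have [C C_gt0 H] := moment_isq_le.
pose m := fine (\int[F 0]_x rinv x)%E.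
have r0 : (0 <= \int[F 0]_x rinv x)%E by apply: integral_ge0 => x _; exact: rinv_ge0.
have mE : (\int[F 0]_x rinv x = m%:E)%E by rewrite /m fineK// ge0_fin_numE.
have m_ge0 : 0 <= m by rewrite /m fine_ge0.
exists (2 * expR (2 * C * T) * m); first by rewrite !mulr_ge0// expR_ge0.
move=> t /andP[t0 tT]; apply: integral_rinv_le; first exact: sol_neg.
move=> e e0; apply: (le_trans (H e e0 t t0)).
rewrite [X in (_ <= X)%E]EFinM -mE; apply: lee_pmul.
- by rewrite lee_fin mulr_ge0// expR_ge0.
- by apply: integral_ge0 => x _; rewrite lee_fin ltW// isq_gt0.
- by rewrite lee_fin ler_pM2l// ler_expR ler_pM2l// mulr_gt0.
- apply: ge0_le_integral => //.
  + by move=> x _; rewrite lee_fin ltW// isq_gt0.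
  + by apply/measurable_EFinP; exact: measurable_isq.
  + exact: measurable_rinv.
  + by move=> x _; exact: isq_le_rinv.
Qed.

End MomentBound.

(** * Bump functions with Lipschitz derivative *)

Section Bump.
Variable R : realType.
Notation RB := (measurableTypeR R).
Notation leb := (@lebesgue_measure R).

(** A version of [C11b] on the whole line with ordinary derivatives, stable under arbitrary
    translations and under [fjoin]. *)
Definition C11g (phi : R -> R) := exists dphi : R -> R, exists M : R,
  [/\ forall x : R, is_derive x 1 phi (dphi x), forall x, `|dphi x| <= M &
      forall x y : R, `|dphi x - dphi y| <= M * `|x - y|].

Lemma is_derive_lip (phi dphi : R -> R) (M : R) :
  (forall x : R, is_derive x 1 phi (dphi x)) -> (forall x, `|dphi x| <= M) ->
  forall x y : R, `|phi x - phi y| <= M * `|x - y|.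
Proof.
move=> H HM.
suff h (x y : R) : x <= y -> `|phi y - phi x| <= M * `|y - x|.
  move=> x y; have [xy|yx] := leP x y; last exact: h (ltW yx).
  by rewrite distrC [X in _ <= _ * X]distrC; exact: h.
move=> xy; have [c _ ->] := @MVT_segment R phi dphi x y xy (fun z _ => H z)
  (derivable_within_continuous (fun z _ => @ex_derive _ _ _ _ _ _ _ (H z))).
by rewrite normrM ler_wpM2r.
Qed.

Lemma C11g_continuous (phi : R -> R) : C11g phi -> continuous phi.
Proof.
move=> [d [M [H _ _]]] x; apply/differentiable_continuous/derivable1_diffP.
exact: (@ex_derive _ _ _ _ _ _ _ (H x)).
Qed.

Lemma C11g_measurable (phi : R -> R) : C11g phi -> measurable_fun setT phi.
Proof. by move=> /C11g_continuous; exact: continuous_measurable_fun. Qed.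

Lemma C11g_C11b (phi : R -> R) (B : R) : C11g phi -> (forall x, `|phi x| <= B) -> C11b phi.
Proof.
move=> [d [M [H1 H2 H3]]] HB; exists d; split.
  by move=> x x0; apply: (@is_derive_has_deriv_within R _ phi).
split; last by exists M.
exists (Num.max B M) => x _; split.
  by rewrite le_max HB.
by rewrite le_max H2 orbT.
Qed.

Lemma C11g_shift (phi : R -> R) (c : R) : C11g phi -> C11g (fun x => phi (x + c)).
Proof.
move=> [d [M [H1 H2 H3]]]; exists (fun x => d (x + c)), M; split => //.
- move=> x; have h : is_derive x 1 (fun x : R => x + c) 1.
    by apply: is_derive_eq; rewrite addr0.
  have := @is_derive1_comp R phi (fun x => x + c) x _ _ (H1 (x + c)) h.
  by rewrite mulr1.
- move=> x y; apply: (le_trans (H3 _ _)).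
  by rewrite (_ : x + c - (y + c) = x - y)//; ring.
Qed.

Lemma C11g_cst (c : R) : C11g (fun=> c).
Proof.
exists (fun=> 0), 0; split => [x|x|x y]; first exact: is_derive_cst.
  by rewrite normr0.
by rewrite subr0 normr0 mul0r.
Qed.

(** This is [1 - (1 - phi x) * (1 - psi x)]. Like a maximum it dominates both functions and
    preserves the range [[0, 1]], but it also preserves Lipschitz derivatives. *)
Definition fjoin (phi psi : R -> R) (x : R) := phi x + psi x - phi x * psi x.

Lemma C11g_join (phi psi : R -> R) : C11g phi -> C11g psi ->
  (forall x, 0 <= phi x <= 1) -> (forall x, 0 <= psi x <= 1) -> C11g (fjoin phi psi).
Proof.
move=> Cphi Cpsi p1 q1.
have [d [M [H1 H2 H3]]] := Cphi; have [e [L [K1 K2 K3]]] := Cpsi.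
have M0 : 0 <= M := le_trans (normr_ge0 _) (H2 0).
have L0 : 0 <= L := le_trans (normr_ge0 _) (K2 0).
have term (a b : R -> R) (A B : R) : 0 <= A -> 0 <= B -> (forall x, `|a x| <= A) ->
  (forall x y, `|a x - a y| <= A * `|x - y|) -> (forall x, 0 <= b x <= 1) ->
  (forall x y, `|b x - b y| <= B * `|x - y|) -> forall x y,
  `|a x * (1 - b x)| <= A /\
  `|a x * (1 - b x) - a y * (1 - b y)| <= (A + A * B) * `|x - y|.
  move=> A0 B0 hA lA b01 lB x y; have /andP[bx0 bx1] := b01 x; split.
    rewrite normrM -[leRHS]mulr1 ler_pM// ger0_norm; lra.
  have -> : a x * (1 - b x) - a y * (1 - b y) = (a x - a y) * (1 - b x) + a y * (b y - b x) by ring.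
  apply: (le_trans (ler_normD _ _)); rewrite !normrM mulrDl lerD//.
    rewrite -[leRHS]mulr1 ler_pM//; rewrite ger0_norm; lra.
  by rewrite -mulrA ler_pM// distrC.
have lp := is_derive_lip H1 H2; have lq := is_derive_lip K1 K2.
exists (fun x => d x * (1 - psi x) + e x * (1 - phi x)), ((M + M * L) + (L + L * M)); split.
- move=> x; have h1 := H1 x; have h2 := K1 x.
  have h3 := is_deriveB (is_deriveD h1 h2) (is_deriveM h1 h2).
  have -> : d x * (1 - psi x) + e x * (1 - phi x) =
      d x + e x - (phi x *: e x + psi x *: d x) by rewrite /GRing.scale/=; ring.
  exact: h3.
- move=> x; have [t1 _] := term d psi M L M0 L0 H2 H3 q1 lq x x.
  have [t2 _] := term e phi L M L0 M0 K2 K3 p1 lp x x.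
  apply: (le_trans (ler_normD _ _)); have := mulr_ge0 M0 L0; lra.
- move=> x y; have [_ t1] := term d psi M L M0 L0 H2 H3 q1 lq x y.
  have [_ t2] := term e phi L M L0 M0 K2 K3 p1 lp x y.
  rewrite opprD addrACA mulrDl; exact: (le_trans (ler_normD _ _) (lerD t1 t2)).
Qed.

Definition ppos2 (s : R) := (Num.max s 0) ^+ 2.

(** The remainder of the first-order expansion is at most [(z - x)^2], on either side of the kink of
    the positive part. *)
Lemma is_derive_ppos2 (x : R) : is_derive x 1 ppos2 (2 * Num.max x 0).
Proof.
pose a := Num.max x 0.
pose g z := 2 * a + (ppos2 z - ppos2 x - 2 * a * (z - x)) / (z - x).
have key z : `|ppos2 z - ppos2 x - 2 * a * (z - x)| <= (z - x) ^+ 2.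
  rewrite /a /ppos2 ler_norml; have zx2 := sqr_ge0 (z - x); have [x0|x0] := leP x 0; have [z0|z0] := leP z 0; apply/andP; split; nra.
have gx : g x = 2 * a by rewrite /g !subrr mulr0 subrr mul0r addr0.
apply/is_derive1_caratheodory; exists g; split => //.
  move=> z; have [->|zx] := eqVneq z x; first by rewrite !subrr mulr0.
  by rewrite /g; field; rewrite subr_eq0.
rewrite /prop_for /continuous_at gx.
apply/cvgrPdist_le => e e0; near=> z.
have [->|zx] := eqVneq z x; first by rewrite gx subrr normr0 ltW.
have zx0 : 0 < `|z - x| by rewrite normr_gt0 subr_eq0.
rewrite /g opprD addNKr normrN normrM normrV ?unitfE ?subr_eq0// ler_pdivrMr//.
have ze : `|z - x| <= e.
  by near: z; exists e => //= y /ltW; rewrite distrC.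
apply: (le_trans (key z)).
have -> : (z - x) ^+ 2 = `|z - x| * `|z - x| by rewrite -expr2 real_normK ?num_real.
by rewrite ler_pM2r.
Unshelve. all: by end_near. Qed.

(** With [u = (x - c) / r], the square of the positive part of [1 - u^2]; the outer square makes the
    derivative Lipschitz across the edge of the support. *)
Definition bump (c r x : R) := ppos2 (1 - ((x - c) / r) ^+ 2).

Lemma bump01 c r x : 0 <= bump c r x <= 1.
Proof.
rewrite /bump /ppos2; have := sqr_ge0 ((x - c) / r); set s := _ ^+ 2 => s0.
by have [h|h] := leP (1 - s) 0; apply/andP; split; nra.
Qed.

Lemma bump_out (c r x : R) : 0 < r -> r <= `|x - c| -> bump c r x = 0.
Proof.
move=> r0 h; rewrite /bump /ppos2 (max_idPr _) ?expr0n//.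
rewrite subr_le0 -real_normK ?num_real// exprn_ege1// normrM normfV (gtr0_norm r0).
by rewrite ler_pdivlMr// mul1r.
Qed.

(** At half the radius the base is [3 / 4], and its square is [9 / 16]. *)
Lemma bump_in (c r x : R) : 0 < r -> `|x - c| <= r / 2 -> 9 / 16 <= bump c r x.
Proof.
move=> r0 h; have u : `|(x - c) / r| <= 1 / 2.
  by rewrite normrM normfV (gtr0_norm r0) ler_pdivrMr//; lra.
have u2 : ((x - c) / r) ^+ 2 <= 1 / 4.
  rewrite -real_normK ?num_real//; have := normr_ge0 ((x - c) / r); nra.
rewrite /bump /ppos2 (max_idPl _); last by lra.
have := sqr_ge0 ((x - c) / r); nra.
Qed.

(** Up to the factor [- 4 / r], this is the derivative of [bump] in the rescaled variable. *)
Let clip_lip (u v : R) : `|Num.max (1 - u ^+ 2) 0 * u - Num.max (1 - v ^+ 2) 0 * v| <= 4 * `|u - v|.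
Proof.
wlog uv : u v / `|u| <= `|v|.
  move=> H; have [|/ltW] := leP `|u| `|v|; first exact: H.
  by move=> /H; rewrite distrC [X in _ <= _ * X]distrC.
have u2 : u ^+ 2 = `|u| ^+ 2 by rewrite real_normK ?num_real.
have v2 : v ^+ 2 = `|v| ^+ 2 by rewrite real_normK ?num_real.
have nu := normr_ge0 u; have nv := normr_ge0 v; have nd := normr_ge0 (u - v).
have [v1|v1] := leP `|v| 1.
  rewrite (max_idPl _); last by rewrite u2; nra.
  rewrite (max_idPl _); last by rewrite v2; nra.
  have -> : (1 - u ^+ 2) * u - (1 - v ^+ 2) * v = (u - v) * (1 - (u ^+ 2 + u * v + v ^+ 2)) by ring.
  rewrite normrM mulrC ler_wpM2r// ler_norml.
  have : `|u * v| <= 1 by rewrite normrM; nra.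
  by rewrite ler_norml => /andP[w1 w2]; rewrite u2 v2; apply/andP; split; nra.
rewrite [X in _ - X * v](max_idPr _); last by rewrite v2; nra.
rewrite mul0r subr0; have [u1|u1] := leP `|u| 1; last first.
  rewrite (max_idPr _); last by rewrite u2; nra.
  by rewrite mul0r normr0 mulr_ge0.
rewrite (max_idPl _); last by rewrite u2; nra.
rewrite normrM ger0_norm; last by rewrite u2; nra.
have d : `|v| - `|u| <= `|u - v| by rewrite distrC; exact: lerB_dist.
have h1 : 0 <= 2 - (1 + `|u|) * `|u| by nra.
have h2 : 0 <= 1 - `|u| by lra.
by have := mulr_ge0 h2 h1; rewrite u2; lra.
Qed.

Lemma C11g_bump (c r : R) : 0 < r -> C11g (bump c r).
Proof.
move=> r0.
pose u (x : R) := (x - c) / r.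
pose cl (v : R) := Num.max (1 - v ^+ 2) 0 * v.
pose d x := - 4 / r * cl (u x).
have r1 : 0 <= 4 / r by rewrite divr_ge0// ltW.
exists d, (Num.max (4 / r) (16 / r ^+ 2)); split.
- move=> x.
  have hu : is_derive x 1 u r^-1.
    have h1 : is_derive x 1 (fun y : R => y - c) 1 by apply: is_derive_eq; rewrite oppr0 addr0.
    have := @is_deriveZ R R R (fun y : R => y - c) r^-1 x 1 1 h1.
    rewrite /GRing.scale/= mulr1 (_ : r^-1 \*: _ = u)//.
    by apply/funext => y; rewrite /u mulrC.
  have hg : is_derive x 1 (fun y => 1 - u y ^+ 2) (- (2 * u x / r)).
    by apply: is_derive_eq; rewrite /GRing.scale/=; ring.
  have h2 := @is_derive1_comp R ppos2 (fun y => 1 - u y ^+ 2) x _ _ (is_derive_ppos2 _) hg.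
  have -> : d x = 2 * Num.max (1 - u x ^+ 2) 0 * - (2 * u x / r) by rewrite /d /cl; ring.
  exact: h2.
- move=> x; rewrite /d normrM le_max; apply/orP; left.
  rewrite mulNr normrN (ger0_norm r1).
  suff h : `|cl (u x)| <= 1.
    have h' : 0 <= 1 - `|cl (u x)| by lra.
    by have := mulr_ge0 r1 h'; rewrite mulrBr mulr1 subr_ge0.
  rewrite /cl; set v := u x; have v2 : v ^+ 2 = `|v| ^+ 2 by rewrite real_normK ?num_real.
  have nv := normr_ge0 v; rewrite v2 normrM.
  have [h|h] := leP (1 - `|v| ^+ 2) 0; first by rewrite normr0 mul0r.
  by rewrite gtr0_norm//; nra.
- move=> x y; rewrite /d -mulrBr normrM mulNr normrN (ger0_norm r1).
  apply: (@le_trans _ _ (16 / r ^+ 2 * `|x - y|)); last by rewrite ler_wpM2r// le_max lexx orbT.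
  have := clip_lip (u x) (u y).
  have -> : `|u x - u y| = `|x - y| / r.
    rewrite /u -mulrBl (_ : x - c - (y - c) = x - y); last by ring.
    by rewrite normrM normfV (gtr0_norm r0).
  move=> /(ler_wpM2l r1) h; apply: (le_trans h); apply: eq_ler.
  by field; rewrite gt_eqF.
Qed.

Lemma integral_indic_itv (a b : R) : a <= b ->
  (\int[leb]_x (\1_(`[a, b]%classic) x)%:E = (b - a)%:E)%E.
Proof.
move=> ab; transitivity (leb `[a, b]); first by rewrite integral_indic// setIT.
rewrite lebesgue_measure_itv/= lte_fin; case: ltP => // ba.
by rewrite (_ : b - a = 0)//; lra.
Qed.

Lemma integral_bump_le (c r : R) : 0 < r -> (\int[leb]_x (bump c r x)%:E <= (2 * r)%:E)%E.
Proof.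
move=> r0; have mb := C11g_measurable (C11g_bump c r0).
apply: (@le_trans _ _ (\int[leb]_x (\1_(`[c - r, c + r]%classic) x)%:E)%E).
  apply: ge0_le_integral => //.
  - by move=> x _; rewrite lee_fin; case/andP: (bump01 c r x).
  - exact/measurable_EFinP.
  - exact/measurable_EFinP/measurable_indic.
  - move=> x _; rewrite lee_fin indicE; case: (boolP (x \in _)) => h.
      by case/andP: (bump01 c r x).
    rewrite bump_out//; move: h; apply: contraNT; rewrite -ltNge => h.
    by rewrite inE/= in_itv/=; move: h; rewrite ltr_norml => /andP[h1 h2]; apply/andP; split; lra.
by rewrite integral_indic_itv ?lee_fin; lra.
Qed.

Lemma integral_bump_ge (c r : R) : 0 < r -> ((9 / 16 * r)%:E <= \int[leb]_x (bump c r x)%:E)%E.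
Proof.
move=> r0; have mb := C11g_measurable (C11g_bump c r0).
have rr : c - r / 2 < c + r / 2 by lra.
apply: (@le_trans _ _ (\int[leb]_x (9 / 16 * \1_(`[c - r / 2, c + r / 2]%classic) x)%:E)%E).
  under eq_integral do rewrite EFinM.
  rewrite ge0_integralZl_EFin//; last by apply/measurable_EFinP/measurable_indic.
  rewrite integral_indic_itv -?EFinM ?lee_fin; lra.
apply: ge0_le_integral => //.
- by apply/measurable_EFinP; apply: measurable_funM => //; exact: measurable_indic.
- exact/measurable_EFinP.
- move=> x _; rewrite lee_fin indicE; case: (boolP (x \in _)) => h.
    rewrite mulr1 bump_in//; move: h; rewrite inE/= in_itv/= ler_norml => /andP[h1 h2].
    by apply/andP; split; lra.
  by rewrite mulr0; case/andP: (bump01 c r x).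
Qed.

End Bump.

(** * Kernel bounds as extended-valued weights *)

Section RinvBounds.
Variable R : realType.
Notation RB := (measurableTypeR R).
Notation leb := (@lebesgue_measure R).

Lemma rinv_gt0 (x : R) : (0 < rinv x)%E.
Proof.
rewrite /rinv; case: (boolP (x <= 0)) => // x0.
by rewrite lte_fin invr_gt0 sqrtr_gt0 ltNge.
Qed.

Lemma le_rinv (w c x : R) : 0 < c -> w * Num.sqrt x <= c -> (w%:E <= c%:E * rinv x)%E.
Proof.
move=> c0 h; rewrite /rinv; case: (boolP (x <= 0)) => [_|].
  by rewrite gt0_muley ?lte_fin// leey.
by rewrite -ltNge => x0; rewrite -EFinM lee_fin ler_pdivlMr// sqrtr_gt0.
Qed.

Lemma le_rinv2 (w c x y : R) : 0 < c -> w * (Num.sqrt x * Num.sqrt y) <= c ->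
  (w%:E <= c%:E * (rinv x * rinv y))%E.
Proof.
move=> c0 h; have [x0|x0] := boolP (x <= 0).
  by rewrite {1}/rinv x0 gt0_mulye ?rinv_gt0// gt0_muley ?lte_fin// leey.
have sx : 0 < Num.sqrt x by rewrite sqrtr_gt0 ltNge.
rewrite {1}/rinv (negbTE x0) muleA -EFinM; apply: le_rinv; first by rewrite divr_gt0.
by rewrite ler_pdivlMr// -mulrA [Num.sqrt y * _]mulrC.
Qed.

Lemma measurable_rinv_comp d (T : measurableType d) (f : T -> R) :
  measurable_fun setT f -> measurable_fun setT (fun t => rinv (f t)).
Proof. by move=> mf; apply: (measurableT_comp (@measurable_rinv R)). Qed.
End RinvBounds.

(** * Collision integrals of tests with small Lebesgue integral *)

Section Dominated.
Variable R : realType.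
Notation RB := (measurableTypeR R).
Notation leb := (@lebesgue_measure R).
Variables (p : R -> R) (b0 : R).
Hypothesis mp : measurable_fun setT p.
Hypothesis b0_gt0 : 0 < b0.
Hypothesis p_ge0 : forall r, 0 <= p r.
Hypothesis p_leb : forall r, p r <= b0.
Hypothesis p_lin : forall r : R, 0 <= r -> p r <= b0 * r.
Variable C0 : R.
Hypothesis C0E : C0 = 32 * b0 ^+ 2.
Let C0_gt0 : 0 < C0. Proof. by rewrite C0E mulr_gt0// exprn_gt0. Qed.

Let min1 (u : R) : C0 * Num.min 1 u <= C0.
Proof. by rewrite -[leRHS]mulr1 ler_pM2l// ge_min lexx. Qed.

Lemma W_rinv (x y z : R) :
  [/\ W p x y z * (Num.sqrt x * Num.sqrt y) <= C0,
      W p x y z * (Num.sqrt x * Num.sqrt z) <= C0 &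
      W p x y z * (Num.sqrt y * Num.sqrt z) <= C0].
Proof.
case: (W_bound_C0 mp b0_gt0 p_ge0 p_leb p_lin C0E x y z) => [->|].
  by rewrite !mul0r; split; exact: ltW.
by move=> [_ h1 h2 h3 _]; split; [exact: le_trans h1 (min1 _)|exact: le_trans h2 (min1 _)|
  exact: le_trans h3 (min1 _)].
Qed.

(** Where [W] is nonzero, the truncation in [xstar] is inactive. *)
Lemma xstar_supp (phi : R -> R) (x y z : R) :
  W p x y z * phi (xstar x y z) = W p x y z * phi (y + z - x).
Proof.
case: (W_bound_C0 mp b0_gt0 p_ge0 p_leb p_lin C0E x y z) => [->|]; first by rewrite !mul0r.
by move=> [[_ _ _ h] _ _ _ _]; rewrite /xstar (max_idPl _)//; lra.
Qed.

Section test.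
Variables (phi : R -> R) (de : R).
Hypothesis mphi : measurable_fun setT phi.
Hypothesis phi01 : forall x, 0 <= phi x <= 1.
Hypothesis de0 : 0 < de.
Hypothesis phide : (\int[leb]_x (phi x)%:E <= de%:E)%E.

Let phi0 x : 0 <= phi x. Proof. by case/andP: (phi01 x). Qed.

Lemma Kop_test_le (x y z : R) : Kop p phi x y z <= W p x y z * (phi x + phi (y + z - x)).
Proof.
rewrite /Kop [leRHS]mulrDr -xstar_supp -mulrDr ler_wpM2l//; first exact: W_ge0.
have := phi0 y; have := phi0 z; lra.
Qed.

(** The bound [W * sqrt x <= C0 / sqrt y] leaves the Lebesgue integral of [phi x + phi (y + z - x)].
    Both terms integrate to at most [de], and the factor [1 / 2] of [Jop] absorbs the two. *)
Lemma Jop_test_le (y z : R) : ((Jop p phi y z)%:E <= (C0 * de)%:E * rinv y)%E.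
Proof.
apply: le_rinv; first exact: mulr_gt0.
have [y0|y0] := leP y 0; first by rewrite ler0_sqrtr// mulr0 mulr_ge0// ltW.
have sy : 0 < Num.sqrt y by rewrite sqrtr_gt0.
rewrite -ler_pdivlMr//.
pose c := C0 / Num.sqrt y.
have c0 : 0 < c by rewrite divr_gt0.
pose g (x : R) := (c * (phi x + phi (y + z - x)))%:E.
have mphi' : measurable_fun setT (fun x : RB => phi (y + z - x)).
  by apply: (measurableT_comp mphi); meas.
have mg : measurable_fun setT (g : RB -> _) by apply/measurable_EFinP; meas.
have g0 x : (0 <= g x)%E by rewrite lee_fin mulr_ge0 ?addr_ge0// ltW.
have ig : (\int[leb]_x g x <= (2 * c * de)%:E)%E.
  rewrite /g; under eq_integral do rewrite EFinM EFinD.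
  rewrite ge0_integralZl_EFin//; last 3 first.
  - by move=> x _; rewrite adde_ge0// lee_fin.
  - by apply: emeasurable_funD; apply/measurable_EFinP.
  - exact: ltW.
  rewrite ge0_integralD//; [|by move=> x _; rewrite lee_fin|exact/measurable_EFinP|by move=> x _; rewrite lee_fin|exact/measurable_EFinP].
  rewrite (@ge0_integral_reflect R (y + z) (fun x => (phi x)%:E)); last 2 first.
  - exact/measurable_EFinP.
  - by move=> x; rewrite lee_fin.
  rewrite (_ : 2 * c * de = c * (de + de)); last by ring.
  by rewrite (EFinM c) EFinD lee_wpmul2l// ?lee_fin ?(ltW c0)// leeD.
have mK : measurable_fun setT (fun x : RB => (Kop p phi x y z * Num.sqrt x)%:E).
  apply/measurable_EFinP/measurable_funM; last exact: (@measurable_sqrt _ _ RB setT (fun x => x)).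
  by apply: measurable_Kop => //; exact: measurable_cst.
have igi : (\int[leb]_(x in `[0%R, (y + z)%R]) g x <= \int[leb]_x g x)%E.
  by apply: ge0_subset_integral => //.
have glt : (\int[leb]_(x in `[0%R, (y + z)%R]) g x < +oo)%E.
  exact: (le_lt_trans igi (le_lt_trans ig (ltry _))).
rewrite /Jop; have : Rintegral leb `[0, y + z] (fun x => Kop p phi x y z * Num.sqrt x) <=
    fine (\int[leb]_(x in `[0%R, (y + z)%R]) g x).
  apply: fine_integral_le => //.
  - exact: measurable_funTS.
  - exact: measurable_funTS.
  move=> x _; rewrite lee_fin; have sx := sqrtr_ge0 x.
  apply: (@le_trans _ _ (W p x y z * (phi x + phi (y + z - x)) * Num.sqrt x)).
    by rewrite ler_wpM2r// Kop_test_le.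
  rewrite mulrAC ler_wpM2r ?addr_ge0// ler_pdivlMr// -mulrA.
  by case: (W_rinv x y z).
have : fine (\int[leb]_(x in `[0%R, (y + z)%R]) g x) <= 2 * c * de.
  rewrite -lee_fin fineK; first exact: le_trans igi ig.
  by rewrite ge0_fin_numE// integral_ge0.
move=> h1 h2; have := le_trans h2 h1; rewrite [C0 * de / _](_ : _ = c * de); last by rewrite /c; ring.
have half (u v : R) : u <= 2 * v -> 2^-1 * u <= v by lra.
by rewrite -mulrA; exact: half.
Qed.

Variable mu : {finite_measure set RB -> \bar R}.
Variables (N K m : R).
Hypothesis muN : mu setT = N%:E.
Hypothesis muK : (\int[mu]_x rinv x <= K%:E)%E.
Hypothesis m0 : 0 <= m.
Hypothesis phim : forall c : R, (\int[mu]_x (phi (x + c))%:E <= m%:E)%E.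

Let rinv0 (x : R) : (0 <= rinv x)%E := rinv_ge0 x.
Let N0 : 0 <= N. Proof. by rewrite -lee_fin -muN. Qed.
Let K0 : 0 <= K.
Proof. by rewrite -lee_fin; apply: le_trans muK; apply: integral_ge0 => x _. Qed.
Let mr : measurable_fun setT (@rinv R : RB -> \bar R) := @measurable_rinv R.

Lemma integral_Jop_test_le :
  fine (\int[(mu \x mu)%E]_q (Jop p phi q.1 q.2)%:E)%E <= C0 * de * K * N.
Proof.
pose a x := ((C0 * de)%:E * rinv x)%E.
have cd : 0 < C0 * de by rewrite mulr_gt0.
have a0 x : (0 <= a x)%E by rewrite mule_ge0// lee_fin ltW.
have ma : measurable_fun setT a by apply: emeasurable_funM => //; exact: measurable_cst.
have ia : (\int[mu]_x a x <= (C0 * de * K)%:E)%E.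
  rewrite ge0_integralZl_EFin// ?(ltW cd)// [leRHS](EFinM (C0 * de)).
  by apply: lee_pmul => //; [rewrite lee_fin ltW|exact: integral_ge0].
have mo : measurable_fun setT (cst 1%E : RB -> \bar R) by exact: measurable_cst.
have t := @integral2_tensor _ mu a (cst 1%E) ma mo a0 (fun x => lee01).
have i1 : (\int[mu]_x cst 1 x = N%:E)%E by rewrite integral_cst// mul1e.
rewrite i1 in t.
have it : (\int[(mu \x mu)%E]_q (a q.1 * cst 1 q.2) <= (C0 * de * K * N)%:E)%E.
  by rewrite t EFinM; apply: lee_pmul => //; exact: integral_ge0.
apply: (@le_trans _ _ (fine (\int[(mu \x mu)%E]_q (a q.1 * cst 1 q.2))%E)); last first.
  rewrite -lee_fin fineK// ge0_fin_numE; first exact: le_lt_trans it (ltry _).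
  by apply: integral_ge0 => q _; rewrite mule_ge0.
apply: fine_integral_le => //.
- by apply/measurable_EFinP; exact: measurable_Jop.
- apply: emeasurable_funM; last exact: measurable_cst.
  exact: (measurableT_comp ma (@measurable_fst _ _ RB RB)).
- by move=> q _; rewrite mule_ge0.
- by move=> q _; rewrite /cst mule1; exact: Jop_test_le.
- exact: le_lt_trans it (ltry _).
Qed.

(** Majorants of the two gain parts of [Kop]. The two arguments spent on [rinv] are chosen so that
    the third is free to integrate the test: [phi] itself in [x] for [G1], a translate of it in [z]
    for [G2]. The latter is why [phim] quantifies over all translations. *)
Let G1 (x y z : R) : \bar R := (C0%:E * ((phi x)%:E * rinv y * rinv z))%E.
Let G2 (x y z : R) : \bar R := (C0%:E * (rinv x * rinv y) * (phi (z + (y - x)))%:E)%E.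

Let G10 x y z : (0 <= G1 x y z)%E.
Proof. by rewrite /G1 !mule_ge0// lee_fin// ltW. Qed.
Let G20 x y z : (0 <= G2 x y z)%E.
Proof. by rewrite /G2 !mule_ge0// lee_fin// ltW. Qed.

Let mG1 : measurable_fun setT (fun q : RB * RB * RB => G1 q.1.1 q.1.2 q.2).
Proof.
apply: emeasurable_funM; first exact: measurable_cst.
apply: emeasurable_funM; last by apply: measurable_rinv_comp; meas.
apply: emeasurable_funM; last by apply: measurable_rinv_comp; meas.
by apply/measurable_EFinP; apply: (measurableT_comp mphi); meas.
Qed.
Let mG2 : measurable_fun setT (fun q : RB * RB * RB => G2 q.1.1 q.1.2 q.2).
Proof.
apply: emeasurable_funM; last by apply/measurable_EFinP; apply: (measurableT_comp mphi); meas.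
apply: emeasurable_funM; first exact: measurable_cst.
by apply: emeasurable_funM; apply: measurable_rinv_comp; meas.
Qed.

Let iG1 : (\int[((mu \x mu) \x mu)%E]_q G1 q.1.1 q.1.2 q.2 <= (C0 * (m * K * K))%:E)%E.
Proof.
have mf : measurable_fun setT (fun x : RB => (phi x)%:E) by apply/measurable_EFinP.
have f0 x : (0 <= (phi x)%:E)%E by rewrite lee_fin.
have t := @integral3_tensor _ mu (fun x => (phi x)%:E) (@rinv R) (@rinv R) mf mr mr f0 rinv0 rinv0.
have mt : measurable_fun setT (fun q : RB * RB * RB => ((phi q.1.1)%:E * rinv q.1.2 * rinv q.2)%E).
  apply: emeasurable_funM; last by apply: measurable_rinv_comp; meas.
  apply: emeasurable_funM; last by apply: measurable_rinv_comp; meas.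
  by apply/measurable_EFinP; apply: (measurableT_comp mphi); meas.
rewrite /G1 ge0_integralZl_EFin//; [|by move=> q _; rewrite !mule_ge0|exact: ltW].
rewrite t EFinM; apply: lee_pmul => //.
- by rewrite lee_fin ltW.
- by rewrite !mule_ge0// integral_ge0.
rewrite !EFinM; have fm : (\int[mu]_x (phi x)%:E <= m%:E)%E.
  by have := phim 0; under eq_integral do rewrite addr0.
by do 2 (apply: lee_pmul => //; do ?[by rewrite ?mule_ge0// integral_ge0]).
Qed.

Let iG2 : (\int[((mu \x mu) \x mu)%E]_q G2 q.1.1 q.1.2 q.2 <= (C0 * (m * K * K))%:E)%E.
Proof.
rewrite (@integral3E R mu G2 mG2 G20).
have C0e : (0 <= C0%:E)%E by rewrite lee_fin ltW.
have mz : measurable_fun setT (fun q : RB * RB => \int[mu]_z G2 q.1 q.2 z)%E.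
  exact: (@measurable_fun_fubini_tonelli_F _ _ (RB * RB)%type RB R mu
    (fun q => G2 q.1.1 q.1.2 q.2) mG2 (fun q => G20 _ _ _)).
have iz0 (q : RB * RB) : (0 <= \int[mu]_z G2 q.1 q.2 z)%E by exact: integral_ge0.
have inner x y : (\int[mu]_z G2 x y z <= (C0 * m)%:E * (rinv x * rinv y))%E.
  rewrite /G2; rewrite ge0_integralZl//; last 3 first.
  - by apply/measurable_EFinP; apply: (measurableT_comp mphi); meas.
  - by move=> z _; rewrite lee_fin.
  - by rewrite !mule_ge0.
  have -> : ((C0 * m)%:E * (rinv x * rinv y) = C0%:E * (rinv x * rinv y) * m%:E)%E.
    by rewrite EFinM -muleA [(m%:E * _)%E]muleC muleA.
  by apply: lee_wpmul2l => //; rewrite !mule_ge0.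
have Cm : 0 <= C0 * m by rewrite mulr_ge0// ltW.
have mri (x : R) : measurable_fun setT (fun y : RB => (rinv x * rinv y)%E).
  by apply: emeasurable_funM => //; exact: measurable_cst.
have step x : (\int[mu]_y \int[mu]_z G2 x y z <= (C0 * m)%:E * (rinv x * K%:E))%E.
  apply: (@le_trans _ _ (\int[mu]_y ((C0 * m)%:E * (rinv x * rinv y)))%E).
    apply: ge0_le_integral => //.
    - by move=> y _; exact: integral_ge0.
    - exact: (measurableT_comp mz (measurable_pair1 x)).
    - by apply: emeasurable_funM => //; exact: measurable_cst.
  rewrite ge0_integralZl_EFin//; last by move=> y _; rewrite mule_ge0.
  rewrite ge0_integralZl// lee_wpmul2l// ?lee_fin// lee_wpmul2l//.
apply: (@le_trans _ _ (\int[mu]_x ((C0 * m * K)%:E * rinv x))%E).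
  apply: ge0_le_integral => //.
  - by move=> x _; apply: integral_ge0 => y _; exact: integral_ge0.
  - exact: (@measurable_fun_fubini_tonelli_F _ _ RB RB R mu (fun q => \int[mu]_z G2 q.1 q.2 z)%E mz iz0).
  - by apply: emeasurable_funM => //; exact: measurable_cst.
  by move=> x _; apply: (le_trans (step x)); rewrite [in leRHS]EFinM -muleA [(K%:E * _)%E]muleC.
rewrite ge0_integralZl_EFin ?mulr_ge0//.
rewrite (_ : C0 * (m * K * K) = C0 * m * K * K); last by ring.
by rewrite [leRHS]EFinM lee_wpmul2l// lee_fin mulr_ge0.
Qed.

Lemma integral_Kop_test_le :
  fine (\int[((mu \x mu) \x mu)%E]_q (Kop p phi q.1.1 q.1.2 q.2)%:E)%E <= 2 * C0 * K ^+ 2 * m.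
Proof.
have it : (\int[((mu \x mu) \x mu)%E]_q (G1 q.1.1 q.1.2 q.2 + G2 q.1.1 q.1.2 q.2) <= (2 * C0 * K ^+ 2 * m)%:E)%E.
  rewrite ge0_integralD//.
  rewrite (_ : 2 * C0 * K ^+ 2 * m = C0 * (m * K * K) + C0 * (m * K * K)); last by ring.
  by rewrite EFinD leeD.
apply: (@le_trans _ _ (fine (\int[((mu \x mu) \x mu)%E]_q (G1 q.1.1 q.1.2 q.2 + G2 q.1.1 q.1.2 q.2))%E)); last first.
  rewrite -lee_fin fineK// ge0_fin_numE; first exact: le_lt_trans it (ltry _).
  by apply: integral_ge0 => q _; rewrite adde_ge0.
apply: fine_integral_le => //.
- by apply/measurable_EFinP; apply: measurable_Kop => //; meas.
- exact: emeasurable_funD.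
- by move=> q _; rewrite adde_ge0.
- move=> -[[x y] z] _ /=.
  apply: (@le_trans _ _ (W p x y z * (phi x + phi (y + z - x)))%:E).
    by rewrite lee_fin Kop_test_le.
  have [h1 h2 h3] := W_rinv x y z.
  rewrite mulrDr EFinD; apply: leeD.
    have -> : G1 x y z = (C0%:E * (rinv y * rinv z) * (phi x)%:E)%E.
      by rewrite /G1 -[X in (_ * X)%E]muleA [((phi x)%:E * _)%E]muleC muleA.
    by rewrite EFinM lee_wpmul2r// ?lee_fin//; apply: le_rinv2.
  rewrite /G2 (_ : z + (y - x) = y + z - x); last by ring.
  by rewrite EFinM lee_wpmul2r// ?lee_fin//; apply: le_rinv2.
- exact: le_lt_trans it (ltry _).
Qed.

End test.
End Dominated.

(** * Smooth tests covering a null set *)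

Section Tests.
Variable R : realType.
Notation RB := (measurableTypeR R).
Notation leb := (@lebesgue_measure R).

Lemma fjoin01 (phi psi : R -> R) (x : R) : 0 <= phi x <= 1 -> 0 <= psi x <= 1 ->
  [/\ 0 <= fjoin phi psi x <= 1, phi x <= fjoin phi psi x, psi x <= fjoin phi psi x &
      fjoin phi psi x <= phi x + psi x].
Proof.
rewrite /fjoin => /andP[a0 a1] /andP[b0 b1].
have h1 : 0 <= phi x * (1 - psi x) by apply: mulr_ge0 => //; lra.
have h2 : 0 <= psi x * (1 - phi x) by apply: mulr_ge0 => //; lra.
have h3 : 0 <= phi x * psi x by apply: mulr_ge0.
have h4 : 0 <= (1 - phi x) * (1 - psi x) by apply: mulr_ge0; lra.
by split; [apply/andP; split|..]; lra.
Qed.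

(** Lebesgue measure is an outer measure given by countable covers with open intervals. Pairs with
    [b k <= a k] stand for empty intervals and count as length 0. *)
Lemma null_itv_cover (A : set RB) (de : R) : measurable A -> leb A = 0%E -> 0 < de ->
  exists a : nat -> R, exists b : nat -> R,
   (forall x, A x -> exists k, a k < x < b k) /\
   (forall n, \sum_(k < n) (if a k < b k then b k - a k else 0) <= de).
Proof.
move=> mA A0 de0.
have [I AI Ide] : exists2 I_, open_itv_cover A I_ &
    (\sum_(0 <= k <oo) wlength idfun (I_ k) <= de%:E)%E.
  have A0' : ((wlength idfun)^* A)%mu = 0%E :> \bar R := A0.
  have : ((wlength idfun)^* A)%mu \is a fin_num by rewrite A0'.
  rewrite outer_measure_open_itv_cover.
  move=> /lb_ereal_inf_adherent-/(_ _ de0)[_/= [I]] AI <- Ie.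
  exists I => //; apply/ltW; apply: (lt_le_trans Ie).
  by rewrite -outer_measure_open_itv_cover A0' add0e.
case: AI => Iitv AI.
have /choice[ab abE] : forall k, exists ab : R * R, I k = `]ab.1, ab.2[%classic.
  by move=> k; have [ab] := Iitv k; exists ab.
exists (fun k => (ab k).1), (fun k => (ab k).2); split.
  by move=> x /AI[k _]; rewrite abE/= in_itv/=; exists k.
move=> n; rewrite -lee_fin; apply: le_trans Ide.
rewrite -sumEFin.
have -> : (\sum_(i < n) (if (ab i).1 < (ab i).2 then (ab i).2 - (ab i).1 else 0)%:E =
   \sum_(0 <= i < n) wlength idfun (I i))%E.
  rewrite big_mkord; apply: eq_bigr => i _; rewrite abE wlength_itv/= lte_fin.
  by case: ifP.
by apply: nneseries_lim_ge => k _ _; rewrite wlength_ge0.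
Qed.

Variables (a b : nat -> R).
(** The radius is the full length of the interval, so that the whole interval lies within half the
    radius of the midpoint, where the bump is at least [9 / 16]. *)
Definition itv_bump (k : nat) : R -> R :=
  if a k < b k then bump ((a k + b k) / 2) (b k - a k) else (fun=> 0).
Fixpoint itv_bumps (n : nat) : R -> R :=
  if n is k.+1 then fjoin (itv_bumps k) (itv_bump k) else (fun=> 0).

Lemma itv_bump01 k x : 0 <= itv_bump k x <= 1.
Proof. by rewrite /itv_bump; case: ifP => _; [exact: bump01|rewrite lexx ler01]. Qed.

Lemma itv_bumps01 n x : 0 <= itv_bumps n x <= 1.
Proof.
elim: n => [|n IH] /=; first by rewrite lexx ler01.
by case: (fjoin01 IH (itv_bump01 n x)).
Qed.

Lemma C11g_itv_bump k : C11g (itv_bump k).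
Proof.
rewrite /itv_bump; case: ifPn => ab; last exact: C11g_cst.
by apply: C11g_bump; rewrite subr_gt0.
Qed.

Lemma C11g_itv_bumps n : C11g (itv_bumps n).
Proof.
elim: n => [|n IH]; first exact: C11g_cst.
by apply: C11g_join => //; [exact: C11g_itv_bump|exact: itv_bumps01|exact: itv_bump01].
Qed.

Lemma itv_bumps_mono n x : itv_bumps n x <= itv_bumps n.+1 x.
Proof. by case: (fjoin01 (itv_bumps01 n x) (itv_bump01 n x)). Qed.

Lemma itv_bumps_ge k x : a k < x < b k -> 9 / 16 <= itv_bumps k.+1 x.
Proof.
move=> /andP[h1 h2]; case: (fjoin01 (itv_bumps01 k x) (itv_bump01 k x)) => _ _ + _.
apply: le_trans; have ab : a k < b k by lra.
by rewrite /itv_bump ab bump_in ?subr_gt0// ler_norml; apply/andP; split; lra.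
Qed.

Lemma integral_itv_bumps_le n : (\int[leb]_x (itv_bumps n x)%:E <=
  (\sum_(k < n) 2 * (if a k < b k then b k - a k else 0))%:E)%E.
Proof.
elim: n => [|n IH].
  by rewrite big_ord0 integral0_eq.
have m1 := C11g_measurable (C11g_itv_bumps n); have m2 := C11g_measurable (C11g_itv_bump n).
apply: (@le_trans _ _ (\int[leb]_x ((itv_bumps n x)%:E + (itv_bump n x)%:E))%E).
  apply: ge0_le_integral => //.
  - by move=> x _; rewrite lee_fin; case/andP: (itv_bumps01 n.+1 x).
  - by apply/measurable_EFinP; exact: (C11g_measurable (C11g_itv_bumps n.+1)).
  - by apply: emeasurable_funD; apply/measurable_EFinP.
  - move=> x _; rewrite -EFinD lee_fin.
    by case: (fjoin01 (itv_bumps01 n x) (itv_bump01 n x)).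
rewrite ge0_integralD//; last 4 first.
- by move=> x _; rewrite lee_fin; case/andP: (itv_bumps01 n x).
- exact/measurable_EFinP.
- by move=> x _; rewrite lee_fin; case/andP: (itv_bump01 n x).
- exact/measurable_EFinP.
rewrite big_ord_recr/= EFinD leeD//; rewrite /itv_bump.
case: ifPn => ab; first by apply: integral_bump_le; rewrite subr_gt0.
by rewrite integral0_eq ?mulr0.
Qed.

End Tests.

(** * Absolute continuity expressed through test functions *)

Section Equiint.
Variable R : realType.
Notation RB := (measurableTypeR R).
Notation leb := (@lebesgue_measure R).
Variable mu : {finite_measure set RB -> \bar R}.
Hypothesis mu_leb : mu `<< leb.

(** Split at a level [s]. Where [phi < s] the contribution is at most [s * N]; the set where
    [s <= phi] has small Lebesgue measure by Chebyshev, hence small [mu]-measure by absolute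
    continuity of the integral of the Radon-Nikodym density. *)
Lemma dominated_test_small (e : R) : 0 < e -> exists2 de : R, 0 < de &
  forall phi : R -> R, measurable_fun setT phi -> (forall x, 0 <= phi x <= 1) ->
  (\int[leb]_x (phi x)%:E <= de%:E)%E -> (\int[mu]_x (phi x)%:E <= e%:E)%E.
Proof.
move=> e0; pose nu : {charge set RB -> \bar R} := charge_of_finite_measure mu.
have nul : nu `<< leb by exact: mu_leb.
pose h := Radon_Nikodym nu leb.
have hi : leb.-integrable setT h := Radon_Nikodym_integrable nul.
have hf x : h x \is a fin_num := Radon_Nikodym_fin_num x nul.
pose f x := fine (h x).
have fE : EFin \o f = h by apply/funext => x /=; rewrite fineK.
have fi : leb.-integrable setT (EFin \o f) by rewrite fE.
have e2 : 0 < e / 2 by lra.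
have [d [d0 Hd]] := integral_normr_continuous fi e2.
pose N := fine (mu setT).
have muN : mu setT = N%:E by rewrite /N fineK// fin_num_measure.
have N0 : 0 <= N by exact: fine_ge0.
(* Chosen so that [s * N <= e / 2]; the [+ 1] keeps the quotient meaningful when [N = 0]. *)
pose s := e / (2 * (N + 1)).
have s0 : 0 < s by rewrite divr_gt0// mulr_gt0//; lra.
have sN : s * N <= e / 2.
  rewrite /s (_ : e / (2 * (N + 1)) * N = e / 2 * (N / (N + 1))); last by field; rewrite gt_eqF//; lra.
  rewrite -[leRHS]mulr1 ler_pM2l// ler_pdivrMr; lra.
exists (s * (d / 2)); first by rewrite mulr_gt0// divr_gt0.
move=> phi mphi p01 hphi.
pose A := [set x : RB | s <= phi x].
have mA : measurable A.
  rewrite (_ : A = phi @^-1` `[s, +oo[%classic); last first.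
    by apply/seteqP; split => x /=; rewrite in_itv/= andbT.
  by rewrite -[_ @^-1` _]setTI; exact: mphi.
have lA : (leb A <= (d / 2)%:E)%E.
  have : (s%:E * leb A <= s%:E * (d / 2)%:E)%E.
    rewrite -EFinM; apply: le_trans hphi.
    have -> : (s%:E * leb A = \int[leb]_x (s * \1_A x)%:E)%E.
      under eq_integral do rewrite EFinM.
      rewrite ge0_integralZl_EFin//; [|by apply/measurable_EFinP/measurable_indic|exact: ltW].
      by rewrite integral_indic// setIT.
    apply: ge0_le_integral => //.
    - by move=> x _; rewrite lee_fin mulr_ge0// ltW.
    - by apply/measurable_EFinP; apply: measurable_funM => //; exact: measurable_indic.
    - exact/measurable_EFinP.
    move=> x _; rewrite lee_fin indicE; case: (boolP (x \in A)) => xA.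
      by rewrite mulr1; move: xA; rewrite inE.
    by rewrite mulr0; case/andP: (p01 x).
  by rewrite lee_pmul2l// ?lte_fin.
have muA : (mu A <= (e / 2)%:E)%E.
  have hA := Hd A mA (le_lt_trans lA _).
  have -> : mu A = (\int[leb]_(x in A) (f x)%:E)%E.
    rewrite -[LHS]/(nu A) (Radon_Nikodym_integral nul mA).
    by apply: eq_integral => x _; rewrite -[RHS]/((EFin \o f) x) fE.
  have fiA : leb.-integrable A (EFin \o f) by apply: (integrableS measurableT).
  apply: (@le_trans _ _ (\int[leb]_(x in A) `|(f x)%:E|)%E).
    apply: le_integral => //; first exact: integrable_abse.
    by move=> x _; rewrite lee_abs.
  rewrite -[leLHS]fineK; last exact: (integrable_fin_num mA (integrable_abse fiA)).
  by rewrite lee_fin; apply/ltW/hA; rewrite lte_fin; lra.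
apply: (@le_trans _ _ (\int[mu]_x ((\1_A x)%:E + s%:E))%E).
  apply: ge0_le_integral => //.
  - by move=> x _; rewrite lee_fin; case/andP: (p01 x).
  - exact/measurable_EFinP.
  - apply: emeasurable_funD; last exact: measurable_cst.
    by apply/measurable_EFinP/measurable_indic.
  move=> x _; rewrite -EFinD lee_fin indicE; case: (boolP (x \in A)) => xA.
    by have /andP[_ ?] := p01 x; rewrite /=; move: s0; lra.
  rewrite add0r; apply: ltW; rewrite ltNge; apply/negP => h'; move/negP: xA; apply; rewrite inE//.
rewrite ge0_integralD//; last 2 first.
- by apply/measurable_EFinP/measurable_indic.
- by move=> x _; rewrite lee_fin ltW.
rewrite integral_indic// setIT integral_cst//.
have sNE : (s%:E * mu setT = (s * N)%:E)%E by rewrite (EFinM s N) -muN.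
rewrite [X in (_ + X)%E]sNE (_ : e = e / 2 + e / 2); last by lra.
by rewrite EFinD leeD// lee_fin.
Qed.

End Equiint.

(** * Propagation of absolute continuity *)

Section SolDominated.
Variable R : realType.
Notation RB := (measurableTypeR R).
Notation leb := (@lebesgue_measure R).
Variables (p : R -> R) (b0 : R).
Hypothesis mp : measurable_fun setT p.
Hypothesis b0_gt0 : 0 < b0.
Hypothesis p_ge0 : forall r, 0 <= p r.
Hypothesis p_leb : forall r, p r <= b0.
Hypothesis p_lin : forall r : R, 0 <= r -> p r <= b0 * r.
Variable C0 : R.
Hypothesis C0E : C0 = 32 * b0 ^+ 2.
Let C0_gt0 : 0 < C0. Proof. by rewrite C0E mulr_gt0// exprn_gt0. Qed.
Variable F : R -> {finite_measure set RB -> \bar R}.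
Hypothesis sol : cons_measure_solution p F.
Hypothesis rbound : forall T : R, 0 <= T ->
  exists2 K : R, 0 <= K & forall t : R, 0 <= t <= T -> (\int[F t]_x rinv x <= K%:E)%E.

(** The family in the Gronwall estimate consists of all translates of [phi]. A common bound on them
    controls the cubic term of each, because translates of a translate belong to the family; the
    quadratic term contributes a constant proportional to [de]. *)
Lemma sol_test_bound (T : R) : 0 <= T -> exists2 C : R, 0 < C &
  forall (phi : R -> R) (de al : R), C11g phi -> (forall x, 0 <= phi x <= 1) ->
  0 < de -> 0 <= al -> (\int[leb]_x (phi x)%:E <= de%:E)%E ->
  (forall c : R, (\int[F 0]_x (phi (x + c))%:E <= al%:E)%E) ->
  forall t : R, 0 <= t <= T -> (\int[F t]_x (phi x)%:E <= (C * (al + C * de))%:E)%E.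
Proof.
move=> T0; have [K K0 HK] := rbound T0.
pose N := massF F; have N0 : 0 <= N := massF_ge0 F.
pose C1 := 2 * C0 * K ^+ 2 + 1.
have C10 : 0 < C1.
  have : 0 <= 2 * C0 * K ^+ 2 by apply: mulr_ge0; [rewrite mulr_ge0// ltW|exact: sqr_ge0].
  by rewrite /C1; lra.
(* One constant dominates both the exponential factor and the coefficient of [de] accumulated over
   [[0, T]]. *)
pose C := Num.max (2 * expR (2 * C1 * T)) (C0 * K * N * T + 1).
have C2e : 2 * expR (2 * C1 * T) <= C by rewrite le_max lexx.
have C3e : C0 * K * N * T + 1 <= C by rewrite le_max lexx orbT.
have e0 := expR_gt0 (2 * C1 * T).
exists C; first by move: C2e; lra.
move=> phi de al Cphi p01 de0 al0 phide hal.
have mphi := C11g_measurable Cphi.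
pose psi c x := phi (x + c).
have Cpsi c : C11g (psi c) by exact: C11g_shift.
have mpsi c : measurable_fun setT (psi c) := C11g_measurable (Cpsi c).
have psi01 c x : 0 <= psi c x <= 1 by exact: p01.
have psi0 c x : 0 <= psi c x by case/andP: (psi01 c x).
have Cb c : C11b (psi c).
  by apply: (@C11g_C11b _ _ 1) => // x; rewrite ger0_norm//; case/andP: (psi01 c x).
pose u c t := intF (F t) (psi c).
have uE c t : 0 <= t -> (\int[F t]_x (psi c x)%:E = (u c t)%:E)%E.
  by move=> t0; rewrite /u (intFE sol)//; case: (integral_bounded_fin sol t0 (mpsi c) (psi01 c)).
have u1 c t : 0 <= t -> 0 <= u c t <= 1 * N.
  by move=> t0; rewrite /u (intFE sol)//; case: (integral_bounded_fin sol t0 (mpsi c) (psi01 c)).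
have pside c : (\int[leb]_x (psi c x)%:E <= de%:E)%E.
  rewrite /psi (@ge0_integral_shift R c (fun x => (phi x)%:E))//.
    exact/measurable_EFinP.
  by move=> x; rewrite lee_fin; case/andP: (p01 x).
pose d c (t : R) := fine (\int[(F t \x F t)%E]_q (Jop p (psi c) q.1 q.2)%:E)%E +
  fine (\int[((F t \x F t) \x F t)%E]_q (Kop p (psi c) q.1.1 q.1.2 q.2)%:E)%E.
have der c (t : R) : 0 <= t -> has_deriv_within (@nonneg R) (u c) t (d c t).
  by move=> t0; case: sol => _ [_ /(_ _ (Cb c))[_ /(_ t t0)]].
have step (m : R) : 0 <= m -> (forall c t, 0 <= t <= T -> u c t <= m * expR (2 * C1 * t)) ->
     forall c t, 0 <= t <= T -> d c t <= C1 * m * expR (2 * C1 * t) + C0 * de * K * N.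
  move=> m0 hm c t tT; have /andP[t0 _] := tT.
  pose m' := m * expR (2 * C1 * t).
  have m'0 : 0 <= m' by rewrite mulr_ge0// expR_ge0.
  have hm' c' : (\int[F t]_x (psi c (x + c'))%:E <= m'%:E)%E.
    rewrite (_ : (\int[F t]_x (psi c (x + c'))%:E = \int[F t]_x (psi (c' + c) x)%:E)%E).
      by rewrite uE// lee_fin; exact: hm.
    by apply: eq_integral => x _; rewrite /psi addrA.
  have j := integral_Jop_test_le mp b0_gt0 p_ge0 p_leb p_lin C0E (mpsi c) (psi01 c) de0 (pside c)
    (sol_mass sol t0) (HK _ tT).
  have k := integral_Kop_test_le mp b0_gt0 p_ge0 p_leb p_lin C0E (mpsi c) (psi01 c)
    (HK _ tT) m'0 hm'.
  have e1 : C1 * m' = 2 * C0 * K ^+ 2 * m' + m' by rewrite {1}/C1 mulrDl mul1r.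
  apply: (le_trans (lerD j k)); rewrite -[X in _ <= X + _]mulrA -/m' e1 -/N.
  by rewrite addrC lerD2r lerDl.
move=> t tT; have /andP[t0 tT'] := tT.
have ka0 : 0 <= C0 * de * K * N by rewrite !mulr_ge0// ltW.
have := @gronwall_family R R u d T C1 al (C0 * de * K * N) (1 * N) C10 T0 al0 ka0 der.
have a1 c : u c 0 <= al by rewrite -lee_fin -uE//; exact: hal.
have a2 c s : 0 <= s <= T -> u c s <= 1 * N by move=> /andP[/(u1 c)/andP[]].
move=> /(_ a1 a2 step 0 t tT) H.
have -> : (\int[F t]_x (phi x)%:E = (u 0 t)%:E)%E.
  by rewrite -uE//; apply: eq_integral => x _; rewrite /psi addr0.
rewrite lee_fin; apply: (le_trans H).
have h1 : expR (2 * C1 * t) <= expR (2 * C1 * T) by rewrite ler_expR ler_pM2l// mulr_gt0.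
have h0 := expR_ge0 (2 * C1 * t).
have s1 : al + C0 * de * K * N * T <= al + C * de.
  rewrite lerD2l (_ : C0 * de * K * N * T = C0 * K * N * T * de); last by ring.
  by rewrite ler_pM2r//; move: C3e; lra.
have s0 : 0 <= al + C0 * de * K * N * T by rewrite addr_ge0// mulr_ge0.
rewrite (_ : 2 * _ * _ = 2 * expR (2 * C1 * t) * (al + C0 * de * K * N * T)); last by ring.
by apply: ler_pM => //; apply: le_trans C2e; rewrite ler_pM2l.
Qed.

Hypothesis F0_leb : F 0 `<< leb.

(** A null set is covered by the increasing sets where the joins of bumps are at least [9 / 16]. The
    bound on the tests is uniform in the number of bumps and passes to the union by continuity from
    below. *)
Lemma sol_dominated (t : R) : 0 <= t -> F t `<< leb.
Proof.
move=> t0; apply/null_content_dominatesP => A mA A0.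
have [C C_gt0 HC] := sol_test_bound t0.
apply/eqP; rewrite eq_le measure_ge0 andbT; apply/lee_addgt0Pr => e e0; rewrite add0e.
(* With [de <= al / C] the propagated bound [C * (al + C * de)] is at most [2 * C * al = e / 2], and
   [8 / 9 <= 1] absorbs the level [9 / 16]. *)
pose al := e / (4 * C).
have al0 : 0 < al by rewrite divr_gt0// mulr_gt0.
have [d1 d10 Hd1] := dominated_test_small F0_leb al0.
pose de := Num.min d1 (al / C).
have de0 : 0 < de by rewrite lt_min d10 divr_gt0.
(* The cover gets total length [de / 2] because a bump has integral up to twice the length of its
   interval. *)
have de20 : 0 < de / 2 by rewrite divr_gt0.
have [a [b [Aab sab]]] := null_itv_cover mA A0 de20.
pose Ph := itv_bumps a b.
have CP n : C11g (Ph n) := C11g_itv_bumps a b n.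
have mP n : measurable_fun setT (Ph n) := C11g_measurable (CP n).
have P01 n x : 0 <= Ph n x <= 1 := itv_bumps01 a b n x.
have Pde n : (\int[leb]_x (Ph n x)%:E <= de%:E)%E.
  apply: (le_trans (integral_itv_bumps_le a b n)); rewrite lee_fin -mulr_sumr.
  by have := sab n; lra.
have bnd n : (\int[F t]_x (Ph n x)%:E <= (e / 2)%:E)%E.
  (* Uniform in [c]: every translate has the same Lebesgue integral. *)
  have h c : (\int[F 0]_x (Ph n (x + c))%:E <= al%:E)%E.
    apply: Hd1.
    - by apply: (measurableT_comp (mP n)); meas.
    - by move=> x; exact: P01.
    - rewrite (@ge0_integral_shift R c (fun x => (Ph n x)%:E)).
      + by apply: (le_trans (Pde n)); rewrite lee_fin ge_min lexx.
      + by apply/measurable_EFinP; exact: mP.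
      + by move=> x; rewrite lee_fin; case/andP: (P01 n x).
  have tt' : 0 <= t <= t by rewrite t0 lexx.
  apply: (le_trans (HC _ _ _ (CP n) (P01 n) de0 (ltW al0) (Pde n) h t tt')).
  have de1 : C * de <= al.
    by rewrite -ler_pdivlMl// mulrC ge_min lexx orbT.
  rewrite lee_fin; apply: (@le_trans _ _ (C * (2 * al))); first by rewrite ler_pM2l//; lra.
  by rewrite /al; apply: eq_ler; field; rewrite gt_eqF.
pose U n := [set x : RB | 9 / 16 <= Ph n x].
have mU n : measurable (U n).
  rewrite (_ : U n = Ph n @^-1` `[9 / 16, +oo[%classic); last first.
    by apply/seteqP; split => x /=; rewrite in_itv/= andbT.
  by rewrite -[_ @^-1` _]setTI; exact: mP.
have FU n : (F t (U n) <= e%:E)%E.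
  have q0 : 0 < 9 / 16 :> R by lra.
  have h : ((9 / 16)%:E * F t (U n) <= (e / 2)%:E)%E.
    apply: le_trans (bnd n).
    have -> : ((9 / 16)%:E * F t (U n) = \int[F t]_x (9 / 16 * \1_(U n) x)%:E)%E.
      under eq_integral do rewrite EFinM.
      rewrite ge0_integralZl_EFin//; [|by apply/measurable_EFinP/measurable_indic].
      by rewrite integral_indic// setIT.
    apply: ge0_le_integral => //.
    - by apply/measurable_EFinP; apply: measurable_funM => //; exact: measurable_indic.
    - by apply/measurable_EFinP; exact: mP.
    move=> x _; rewrite lee_fin indicE; case: (boolP (x \in U n)) => xA.
      by rewrite mulr1; move: xA; rewrite inE.
    by rewrite mulr0; case/andP: (P01 n x).
  have : ((9 / 16)%:E * F t (U n) <= (9 / 16)%:E * e%:E)%E.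
    by apply: (le_trans h); rewrite -EFinM lee_fin; lra.
  by rewrite lee_pmul2l.
have ndU : nondecreasing_seq U.
  apply/nondecreasing_seqP => n; apply/subsetPset => x /= h.
  exact: le_trans h (itv_bumps_mono a b n x).
have cU : F t (U n) @[n --> \oo] --> F t (\bigcup_n U n).
  by apply: nondecreasing_cvg_mu => //; exact: bigcupT_measurable.
apply: (@le_trans _ _ (F t (\bigcup_n U n))).
  apply: le_measure; rewrite ?inE//; first exact: bigcupT_measurable.
  by move=> x /Aab[k abk]; exists k.+1 => //=; exact: itv_bumps_ge.
rewrite -(cvg_lim _ cU)//; apply: lime_le; first by apply/cvg_ex; eexists; exact: cU.
by apply: nearW => n; exact: FU.
Qed.

End SolDominated.

(** * Lebesgue differentiation along bump averages *)

Section Differentiation.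
Variable R : realType.
Notation RB := (measurableTypeR R).
Notation leb := (@lebesgue_measure R).

Lemma ae_imp (P Q : R -> Prop) : {ae leb, forall x, P x} -> (forall x, P x -> Q x) ->
  {ae leb, forall x, Q x}.
Proof. by move=> h PQ; apply: negligibleS h => x /=; exact: contra_not (PQ x). Qed.

Lemma ae_imp2 (P Q S : R -> Prop) : {ae leb, forall x, P x} -> {ae leb, forall x, Q x} ->
  (forall x, P x -> Q x -> S x) -> {ae leb, forall x, S x}.
Proof.
move=> h1 h2 PQ; apply: (negligibleS _ (negligibleU h1 h2)) => x /= nS.
by have [p|np] := pselect (P x); [right => q; exact: nS (PQ x p q)|left].
Qed.

Definition rad (n : nat) : R := n.+1%:R^-1.
Definition bmass (n : nat) : R := fine (\int[leb]_y (bump 0 (rad n) y)%:E)%E.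
Definition bavg (g : R -> R) n x := fine (\int[leb]_y (bump x (rad n) y * g y)%:E)%E / bmass n.

Lemma rad_gt0 n : 0 < rad n. Proof. by rewrite invr_gt0. Qed.

Lemma measurable_bump c n : measurable_fun setT (bump c (rad n)).
Proof. by apply: C11g_measurable; apply: C11g_bump; exact: rad_gt0. Qed.

Lemma bump0 c r x : (0 <= (bump c r x : R)%:E)%E.
Proof. by rewrite lee_fin; case/andP: (bump01 c r x). Qed.

Lemma bmassE n (x : R) : (\int[leb]_y (bump x (rad n) y)%:E = (bmass n)%:E)%E.
Proof.
have -> : (\int[leb]_y (bump x (rad n) y)%:E = \int[leb]_y (bump 0 (rad n) y)%:E)%E.
  rewrite -(@ge0_integral_shift R (- x) (fun y => (bump 0 (rad n) y)%:E)).
  - by apply: eq_integral => y _; rewrite /bump subr0.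
  - by apply/measurable_EFinP; exact: measurable_bump.
  - by move=> y; exact: bump0.
rewrite /bmass fineK// ge0_fin_numE; last by apply: integral_ge0 => y _; exact: bump0.
exact: le_lt_trans (integral_bump_le 0 (rad_gt0 n)) (ltry _).
Qed.

Lemma bmass_ge n : 9 / 16 * rad n <= bmass n.
Proof. by rewrite -lee_fin -(bmassE n 0); apply: integral_bump_ge; exact: rad_gt0. Qed.

Lemma bmass_gt0 n : 0 < bmass n.
Proof. by apply: lt_le_trans (bmass_ge n); rewrite mulr_gt0 ?rad_gt0//; lra. Qed.

Lemma bump_mul_integrable (g : R -> R) c r : 0 < r -> leb.-integrable setT (EFin \o g) ->
  leb.-integrable setT (EFin \o (fun y => bump c r y * g y)).
Proof.
move=> r0 ig; have mg : measurable_fun setT g by apply/measurable_EFinP; exact: (measurable_int _ ig).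
have mb := C11g_measurable (C11g_bump c r0).
apply: (le_integrable measurableT _ _ ig); first by apply/measurable_EFinP; exact: measurable_funM.
move=> y _ /=; rewrite lee_fin normrM ler_piMl//.
by have /andP[h0 h1] := bump01 c r y; rewrite ger0_norm.
Qed.

(** The bump is at most the indicator of the ball, of measure [2 * r], and has mass at least
    [9 / 16 * r]; the quotient of the two is [32 / 9]. *)
Lemma bavg_dist (g : R -> R) n x : leb.-integrable setT (EFin \o g) ->
  (`|bavg g n x - g x|%:E <= (32 / 9)%:E * davg g x (rad n))%E.
Proof.
move=> ig; have r0 := rad_gt0 n; have I0 := bmass_gt0 n; have Ige := bmass_ge n.
set r := rad n in r0 Ige *; set I := bmass n in I0 Ige *.
have mg : measurable_fun setT g by apply/measurable_EFinP; exact: (measurable_int _ ig).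
have mb : measurable_fun setT (bump x r) := measurable_bump x n.
have ibg := bump_mul_integrable x r0 ig.
have ib : leb.-integrable setT (EFin \o bump x r).
  apply/integrableP; split; first exact/measurable_EFinP.
  have -> : (\int[leb]_y `|(EFin \o bump x r) y| = I%:E)%E.
    rewrite -(bmassE n x); apply: eq_integral => y _ /=.
    by rewrite ger0_norm//; case/andP: (bump01 x r y).
  exact: ltry.
have ibc : leb.-integrable setT (EFin \o (fun y => bump x r y * g x)).
  rewrite (_ : EFin \o _ = (fun y => (g x)%:E * (EFin \o bump x r) y)%E).
    exact: integrableZl.
  by apply/funext => y /=; rewrite -EFinM mulrC.
have E : bavg g n x - g x = I^-1 * fine (\int[leb]_y (bump x r y * (g y - g x))%:E)%E.
  have -> : (\int[leb]_y (bump x r y * (g y - g x))%:E =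
     \int[leb]_y (bump x r y * g y)%:E - (I * g x)%:E)%E.
    have -> : ((I * g x)%:E = \int[leb]_y (bump x r y * g x)%:E)%E.
      under eq_integral do rewrite EFinM muleC.
      by rewrite integralZl// bmassE -EFinM mulrC.
    rewrite -integralB_EFin//; apply: eq_integral => y _.
    by rewrite -EFinB mulrBr.
  rewrite fineB//; last exact: (integrable_fin_num measurableT ibg).
  by rewrite /bavg -/r -/I /=; field; rewrite gt_eqF.
have mbg : measurable_fun setT (fun y => bump x r y * (g y - g x)).
  by apply: measurable_funM => //; apply: measurable_funB => //; exact: measurable_cst.
pose D := (\int[leb]_(y in ball x r) `|(g y - g x)%:E|)%E.
have Dle : (\int[leb]_y `|(bump x r y * (g y - g x))%:E| <= D)%E.
  rewrite /D [leRHS]integral_mkcond; apply: ge0_le_integral => //.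
  - by apply: measurableT_comp => //; apply/measurable_EFinP.
  - apply/(measurable_restrictT _ _).1; first exact: measurable_ball.
    apply: measurableT_comp => //; apply/measurable_EFinP/measurable_funTS.
    by apply: measurable_funB => //; exact: measurable_cst.
  - move=> y _; rewrite patchE; case: ifPn => yb.
      rewrite lee_fin normrM ler_piMl//.
      by have /andP[h0 h1] := bump01 x r y; rewrite ger0_norm.
    have bo : bump x r y = 0.
      apply: bump_out => //; rewrite leNgt; apply/negP => h; move/negP: yb; apply.
      by rewrite inE /ball/= distrC.
    by rewrite bo mul0r abse0.
have davgE : davg g x r = ((2 * r)^-1%:E * D)%E.
  have r2 : r *+ 2 = 2 * r by rewrite mulr_natl.
  by rewrite /davg /iavg lebesgue_measure_ball ?(ltW r0)// r2 inver gt_eqF ?mulr_gt0.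
rewrite E normrM ger0_norm ?invr_ge0 ?(ltW I0)// EFinM.
have iabs : (`|fine (\int[leb]_y (bump x r y * (g y - g x))%:E)%E|%:E <= D)%E.
  have ibd : leb.-integrable setT (EFin \o (fun y => bump x r y * (g y - g x))).
    rewrite (_ : EFin \o _ = (fun y => (EFin \o (fun y => (bump x r y * g y)%R)) y -
      (EFin \o (fun y => (bump x r y * g x)%R)) y)%E); first exact: integrableB.
    by apply/funext => y /=; rewrite -EFinB mulrBr.
  rewrite -[leLHS]/(`|(fine (\int[leb]_y (bump x r y * (g y - g x))%:E))%:E|%E) fineK; last first.
    exact: (integrable_fin_num measurableT ibd).
  apply: le_trans Dle; apply: le_abse_integral => //; exact/measurable_EFinP.
have D0 : (0 <= D)%E by apply: integral_ge0.
apply: (@le_trans _ _ (I^-1%:E * D)%E); first by apply: lee_wpmul2l => //; rewrite lee_fin invr_ge0 ltW.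
rewrite davgE muleA -EFinM; apply: lee_wpmul2r => //; rewrite lee_fin.
rewrite -[X in _ <= X](_ : (9 / 16 * r)^-1 = _); last by field; rewrite gt_eqF.
by rewrite lef_pV2 ?posrE// mulr_gt0//; lra.
Qed.

Lemma bavg_cvg (g : R -> R) : leb.-integrable setT (EFin \o g) ->
  {ae leb, forall x, bavg g n x @[n --> \oo] --> g x}.
Proof.
move=> ig.
have lg : locally_integrable setT g by apply: open_integrable_locally => //; exact: openT.
apply: (ae_imp (lebesgue_differentiation lg)) => x /fine_cvgP[hf hc].
apply/cvgrPdist_le => e e0.
have e1 : 0 < e / 4 by lra.
have hc1 : \forall r \near (0 : R)^'+, fine (davg g x r) <= e / 4.
  have /cvgrPdist_le/(_ _ e1) := hc; apply: filterS => r; rewrite sub0r normrN.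
  by apply: le_trans; exact: ler_norm.
have : \forall r \near (0 : R)^'+, (davg g x r <= (e / 4)%:E)%E.
  move: hf hc1; apply: filterS2 => r h1 h2.
  by rewrite -(fineK h1) lee_fin.
move=> [d /= d0 Hd]; near=> n.
have h := bavg_dist n x ig.
have : (davg g x (rad n) <= (e / 4)%:E)%E.
  apply: Hd; last exact: rad_gt0.
  rewrite /= sub0r normrN gtr0_norm ?rad_gt0//; near: n.
  exact: (near_infty_natSinv_lt (PosNum d0)).
move=> /(@lee_wpmul2l _ (32 / 9)%:E) h2; rewrite distrC -lee_fin.
apply: (le_trans h); apply: (le_trans (h2 _)); first by rewrite lee_fin; lra.
by rewrite -EFinM lee_fin; lra.
Unshelve. all: by end_near. Qed.

Lemma bump_test_unique (g : R -> R) : leb.-integrable setT (EFin \o g) ->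
  (forall x n, (\int[leb]_y (bump x (rad n) y * g y)%:E = 0)%E) ->
  {ae leb, forall x, g x = 0}.
Proof.
move=> ig H; apply: (ae_imp (bavg_cvg ig)) => x.
rewrite (_ : (fun n => bavg g n x) = (fun=> 0)); last first.
  by apply/funext => n; rewrite /bavg H mul0r.
by move=> h; apply: (cvg_unique _ h (cvg_cst 0)).
Qed.

End Differentiation.

(** * A density given by an explicit formula *)

Section Density.
Variable R : realType.
Notation RB := (measurableTypeR R).
Notation leb := (@lebesgue_measure R).

Definition mavg (mu : {finite_measure set RB -> \bar R}) n x :=
  fine (\int[mu]_y (bump x (rad R n) y)%:E)%E / bmass R n.
(** A Radon-Nikodym derivative is chosen separately for each measure and gives no measurability in a
    further parameter. An upper limit of averages does, and it equals the derivative almost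
    everywhere. The value 0 on the closed negative axis makes the support condition hold at every
    point. *)
Definition dens (mu : {finite_measure set RB -> \bar R}) x : R :=
  if x <= 0 then 0 else fine (limn_esup (fun n => (mavg mu n x)%:E)).

Variable mu : {finite_measure set RB -> \bar R}.

Lemma dens_ge0 x : 0 <= dens mu x.
Proof.
rewrite /dens; case: ifP => // _; apply: fine_ge0; rewrite limn_esup_lim.
apply: lime_ge; first exact: is_cvg_esups.
apply: nearW => n; apply: (@le_trans _ _ (mavg mu n x)%:E); last by apply: ereal_sup_ubound; exists n => /=.
rewrite lee_fin divr_ge0//; last exact: ltW (bmass_gt0 _ _).
by apply: fine_ge0; apply: integral_ge0 => y _; exact: bump0.
Qed.

Lemma dens_neg x : x <= 0 -> dens mu x = 0.
Proof. by rewrite /dens => ->. Qed.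

Lemma measurable_mavg n : measurable_fun setT (mavg mu n).
Proof.
apply: measurable_funM; last exact: measurable_cst.
apply: measurableT_comp => //.
apply: (@measurable_fun_fubini_tonelli_F _ _ RB RB R mu (fun q => (bump q.1 (rad R n) q.2)%:E)).
  apply/measurable_EFinP; rewrite /bump /ppos2; meas.
by move=> q; exact: bump0.
Qed.

Lemma measurable_dens : measurable_fun setT (dens mu).
Proof.
apply: measurable_fun_ifT; [meas|exact: measurable_cst|].
apply: measurableT_comp => //.
by apply: measurable_fun_limn_esup => n; apply/measurable_EFinP; exact: measurable_mavg.
Qed.

Hypothesis mu_leb : mu `<< leb.
Hypothesis mu_neg : mu [set x | x < 0] = 0%E.

Let h := Radon_Nikodym_SigmaFinite.f mu leb.
Let h0 x : (0 <= h x)%E := Radon_Nikodym_SigmaFinite.f_ge0 mu_leb x.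
Let hfin x : h x \is a fin_num := Radon_Nikodym_SigmaFinite.f_fin_num mu_leb x.
Let hi : leb.-integrable setT h := Radon_Nikodym_SigmaFinite.f_integrable mu_leb.
Let mh : measurable_fun setT h := measurable_int _ hi.

(** The averages of [mu] are the bump averages of its Radon-Nikodym density, which converge almost
    everywhere. On the negative axis that density vanishes almost everywhere because [mu] does not
    charge it. *)
Lemma dens_ae : {ae leb, forall x, (dens mu x)%:E = h x}.
Proof.
pose gh x := fine (h x).
have ghE : EFin \o gh = h by apply/funext => x /=; rewrite fineK.
have igh : leb.-integrable setT (EFin \o gh) by rewrite ghE.
have mE n x : mavg mu n x = bavg gh n x.
  rewrite /mavg /bavg; congr (fine _ / _).
  rewrite -(Radon_Nikodym_SigmaFinite.change_of_variables mu_leb)//.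
  - by apply: eq_integral => y _; rewrite [RHS]EFinM; congr (_ * _)%E; exact/esym/fineK/hfin.
  - by move=> y; exact: bump0.
  - by apply/measurable_EFinP; exact: measurable_bump.
have mneg : measurable [set x : RB | x < 0].
  by rewrite -setC_nonneg; exact: measurableC (@measurable_nonneg R).
have a1 := bavg_cvg igh.
have a2 : {ae leb, forall x, x < 0 -> h x = 0%E}.
  have : ae_eq leb [set x : RB | x < 0] h (cst 0%E).
    apply/(ae_eq_integral_abs leb mneg); first exact: measurable_funTS.
    rewrite -mu_neg (Radon_Nikodym_SigmaFinite.f_integral mu_leb mneg).
    by apply: eq_integral => x _; rewrite gee0_abs.
  exact.
have a3 : {ae leb, forall x : R, x <> 0}.
  exists [set 0]; split => //; first exact: lebesgue_measure_set1.
  by move=> x /= /contrapT.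
have a23 := ae_imp2 a2 a3 (fun x h1 h2 => conj h1 h2).
apply: (ae_imp2 a1 a23) => x c1 [c2 c3]; rewrite /dens.
case: (boolP (x <= 0)) => [x0|_]; first by rewrite c2// lt_neqAle x0 andbT; apply/eqP.
have c4 : (mavg mu n x)%:E @[n --> \oo] --> (gh x)%:E.
  apply: cvg_EFin; first exact: nearW.
  by under eq_fun do rewrite mE.
by rewrite (cvg_limn_einf_sup c4).2 /= -[RHS]/(h x) -ghE.
Qed.

Lemma integral_dens (psi : R -> \bar R) : measurable_fun setT psi -> (forall x, 0 <= psi x)%E ->
  (\int[mu]_x psi x = \int[leb]_x (psi x * (dens mu x)%:E))%E.
Proof.
move=> mpsi psi0; rewrite -(Radon_Nikodym_SigmaFinite.change_of_variables mu_leb)//.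
apply: ge0_ae_eq_integral => //.
- exact: emeasurable_funM.
- by apply: emeasurable_funM => //; apply/measurable_EFinP; exact: measurable_dens.
- by move=> x _; rewrite mule_ge0.
- by move=> x _; rewrite mule_ge0// lee_fin dens_ge0.
- by apply: (ae_imp dens_ae) => x E _ /=; rewrite E.
Qed.

End Density.

(** * Joint measurability from continuity in time *)

Section Caratheodory.
Variable R : realType.
Notation RB := (measurableTypeR R).

Lemma caratheodory_measurable (G : R -> R -> R) :
  (forall t : R, 0 <= t -> measurable_fun setT (G^~ t)) ->
  (forall x t : R, 0 <= t -> G x s @[s --> within (@nonneg R) (nbhs t)] --> G x t) ->
  measurable_fun [set q : RB * RB | 0 <= q.2] (fun q => G q.1 q.2).
Proof.
move=> mG cG.
(* Time is rounded down to a grid of step [1 / (k + 1)]: on each of countably many strips the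
   function then depends on [x] only, and continuity in time recovers [G] in the limit. *)
pose tk k (t : R) : R := (Num.truncn (k.+1%:R * t))%:R / k.+1%:R.
pose hk k (q : RB * RB) := G q.1 (tk k q.2).
have k0 k : 0 < k.+1%:R :> R by [].
have tk_le k (t : R) : 0 <= t -> 0 <= tk k t /\ t - k.+1%:R^-1 <= tk k t <= t.
  move=> t0; have kt0 : 0 <= k.+1%:R * t by rewrite mulr_ge0.
  split; first by rewrite divr_ge0.
  have /andP[h1 h2] := truncn_itv kt0.
  rewrite /tk ler_pdivrMr// [t * _]mulrC h1 andbT ler_pdivlMr// mulrBl mulVf ?gt_eqF//.
  by rewrite lerBlDr natr1 mulrC; exact: ltW.
apply: (@measurable_fun_cvg _ _ _ _ hk); last first.
  move=> [x t] /= t0; rewrite /hk/=.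
  have ct : tk k t @[k --> \oo] --> within (@nonneg R) (nbhs t).
    move=> A /= [e /= e0 He]; suff : \forall k \near \oo, A (tk k t) by [].
    near=> k; apply: He; last by case: (tk_le k t t0).
    have [_ /andP[h1 h2]] := tk_le k t t0.
    rewrite /= ger0_norm ?subr_ge0//; apply: (@le_lt_trans _ _ k.+1%:R^-1); first by rewrite lerBlDl -lerBlDr.
    near: k; exact: (near_infty_natSinv_lt (PosNum e0)).
  exact: (cvg_comp _ _ ct (cG x t t0)).
move=> k.
pose E j := [set q : RB * RB | j%:R <= k.+1%:R * q.2 < j.+1%:R].
have mE j : measurable (E j).
  pose b (q : RB * RB) := (j%:R <= k.+1%:R * q.2) && (k.+1%:R * q.2 < j.+1%:R).
  have mb : measurable_fun setT b.
    apply: measurable_and; [apply: measurable_fun_ler|apply: measurable_fun_ltr]; meas.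
  rewrite (_ : E j = setT `&` b @^-1` [set true]).
    by apply: mb.
  by rewrite setTI; apply/seteqP; split.
rewrite (_ : [set q : RB * RB | 0 <= q.2] = \bigcup_j E j); last first.
  apply/seteqP; split => q /=.
    move=> q0; exists (Num.truncn (k.+1%:R * q.2)) => //=.
    by apply: truncn_itv; rewrite mulr_ge0.
  move=> [j _ /= /andP[h _]]; rewrite -(pmulr_rge0 _ (k0 k)); exact: le_trans h.
apply/measurable_fun_bigcup => // j.
apply: (eq_measurable_fun (fun q : RB * RB => G q.1 (j%:R / k.+1%:R))).
  move=> q; rewrite inE /= => jq; rewrite /hk /tk; congr (G _ (_%:R / _)).
  by apply/esym; apply: truncn_def.
apply: measurable_funTS.
by apply: (measurableT_comp (mG _ _)) => //; rewrite divr_ge0.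
Unshelve. all: by end_near. Qed.

End Caratheodory.

(** * Changes of variables in iterated Lebesgue integrals *)

Section Iterated.
Variable R : realType.
Notation RB := (measurableTypeR R).
Notation leb := (@lebesgue_measure R).
Local Open Scope ereal_scope.

Section nonneg3.
Variable k : R -> R -> R -> \bar R.
Hypothesis mk : measurable_fun setT (fun q : RB * RB * RB => k q.1.1 q.1.2 q.2).
Hypothesis k0 : forall x y z, 0 <= k x y z.

Lemma measurable_comp3 d (T : measurableType d) (a b c : T -> R) :
  measurable_fun setT a -> measurable_fun setT b -> measurable_fun setT c ->
  measurable_fun setT (fun t => k (a t) (b t) (c t)).
Proof.
move=> ma mb mc; apply: (measurableT_comp mk (g := fun t => ((a t, b t), c t))).
by apply: measurable_fun_pair => //; apply: measurable_fun_pair.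
Qed.

Lemma measurable_iter1 d (T : measurableType d) (a b : T -> R) :
  measurable_fun setT a -> measurable_fun setT b ->
  measurable_fun setT (fun t => \int[leb]_z k (a t) (b t) z).
Proof.
move=> ma mb.
apply: (@measurable_fun_fubini_tonelli_F _ _ T RB R leb (fun q => k (a q.1) (b q.1) q.2)) => //.
apply: measurable_comp3; [exact: (measurableT_comp ma measurable_fst)|
  exact: (measurableT_comp mb measurable_fst)|exact: measurable_snd].
Qed.

Lemma measurable_iter2 d (T : measurableType d) (a : T -> R) :
  measurable_fun setT a ->
  measurable_fun setT (fun t => \int[leb]_y \int[leb]_z k (a t) y z).
Proof.
move=> ma.
apply: (@measurable_fun_fubini_tonelli_F _ _ T RB R leb (fun q => \int[leb]_z k (a q.1) q.2 z)).
  by apply: measurable_iter1; [exact: (measurableT_comp ma measurable_fst)|exact: measurable_snd].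
by move=> q; exact: integral_ge0.
Qed.

Lemma iter_swap12 :
  \int[leb]_x \int[leb]_y \int[leb]_z k x y z = \int[leb]_x \int[leb]_y \int[leb]_z k y x z.
Proof.
apply: (@fubini_tonelli _ _ RB RB R leb leb (fun q => \int[leb]_z k q.1 q.2 z)).
  by apply: measurable_iter1; [exact: measurable_fst|exact: measurable_snd].
by move=> q; exact: integral_ge0.
Qed.

Lemma iter_swap23 :
  \int[leb]_x \int[leb]_y \int[leb]_z k x y z = \int[leb]_x \int[leb]_y \int[leb]_z k x z y.
Proof.
apply: eq_integral => x _.
apply: (@fubini_tonelli _ _ RB RB R leb leb (fun q => k x q.1 q.2)) => //.
by apply: measurable_comp3; [exact: measurable_cst|exact: measurable_fst|exact: measurable_snd].
Qed.

End nonneg3.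

Section rotate.
Variable k : R -> R -> R -> \bar R.
Hypothesis mk : measurable_fun setT (fun q : RB * RB * RB => k q.1.1 q.1.2 q.2).
Hypothesis k0 : forall x y z, 0 <= k x y z.
Let m3 := measurable_comp3 mk.

Lemma iter_rotate :
  \int[leb]_x \int[leb]_y \int[leb]_z k x y z = \int[leb]_x \int[leb]_y \int[leb]_z k z x y.
Proof.
apply: (etrans (iter_swap12 mk k0)).
have m : measurable_fun setT (fun q : RB * RB * RB => k q.1.2 q.1.1 q.2) by apply: m3; meas.
exact: (@iter_swap23 (fun x y z => k y x z) m (fun _ _ _ => k0 _ _ _)).
Qed.

End rotate.

Section change.
Variable k : R -> R -> R -> \bar R.
Hypothesis mk : measurable_fun setT (fun q : RB * RB * RB => k q.1.1 q.1.2 q.2).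
Hypothesis k0 : forall x y z, 0 <= k x y z.
Let m3 := measurable_comp3 mk.

(** Realizes the substitution [(x, y, z) -> (y + z - x, z, y)] by reflecting one variable, at fixed
    values of the others, and permuting. *)
Lemma iter_reflect :
  \int[leb]_x \int[leb]_y \int[leb]_z k x y z =
  \int[leb]_x \int[leb]_y \int[leb]_z k (y + z - x)%R z y.
Proof.
have a1 := iter_rotate mk k0.
have a2 : \int[leb]_x \int[leb]_y \int[leb]_z k z x y =
   \int[leb]_x \int[leb]_y \int[leb]_z k (x + y - z)%R x y.
  have refl (x y : R) : \int[leb]_z k z x y = \int[leb]_z k (x + y - z)%R x y.
    have mz : measurable_fun setT (fun z : R => k z x y) by apply: m3; meas.
    exact/esym/(@ge0_integral_reflect R (x + y)%R (fun z => k z x y) mz (fun z => k0 z x y)).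
  by apply: eq_integral => x _; apply: eq_integral => y _; exact: refl.
have m1 : measurable_fun setT (fun q : RB * RB * RB => k (q.1.1 + q.1.2 - q.2)%R q.1.1 q.1.2).
  by apply: m3; meas.
have a3 := @iter_swap12 (fun x y z => k (x + y - z)%R x y) m1 (fun _ _ _ => k0 _ _ _).
have m2 : measurable_fun setT (fun q : RB * RB * RB => k (q.1.2 + q.2 - q.1.1)%R q.2 q.1.2).
  by apply: m3; meas.
have a4 := @iter_rotate (fun a b c => k (b + c - a)%R c b) m2 (fun _ _ _ => k0 _ _ _).
have a5 : \int[leb]_x \int[leb]_y \int[leb]_z k (y + x - z)%R y x =
  \int[leb]_x \int[leb]_y \int[leb]_z k (x + y - z)%R y x.
  apply: eq_integral => x _; apply: eq_integral => y _; apply: eq_integral => z _.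
  by rewrite [(y + x)%R]addrC.
exact: (etrans a1 (etrans a2 (etrans a3 (etrans a5 (esym a4))))).
Qed.

(** Realizes the substitution [(x, y, z) -> (y, x, y + z - x)]: translate [z] by [x - y], then
    exchange [x] and [y]. *)
Lemma iter_shift :
  \int[leb]_x \int[leb]_y \int[leb]_z k x y z =
  \int[leb]_x \int[leb]_y \int[leb]_z k y x (y + z - x)%R.
Proof.
have a1 : \int[leb]_x \int[leb]_y \int[leb]_z k x y z =
   \int[leb]_x \int[leb]_y \int[leb]_z k x y (z + (x - y))%R.
  have shift (x y : R) : \int[leb]_z k x y z = \int[leb]_z k x y (z + (x - y))%R.
    have mz : measurable_fun setT (fun z : R => k x y z) by apply: m3; meas.
    exact/esym/(@ge0_integral_shift R (x - y)%R (fun z => k x y z) mz (fun z => k0 x y z)).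
  by apply: eq_integral => x _; apply: eq_integral => y _; exact: shift.
have m1 : measurable_fun setT (fun q : RB * RB * RB => k q.1.1 q.1.2 (q.2 + (q.1.1 - q.1.2))%R).
  by apply: m3; meas.
have a2 := @iter_swap12 (fun x y z => k x y (z + (x - y))%R) m1 (fun _ _ _ => k0 _ _ _).
apply: (etrans a1 (etrans a2 _)).
apply: eq_integral => x _; apply: eq_integral => y _; apply: eq_integral => z _.
by rewrite (_ : (z + (y - x) = y + z - x)%R); last by ring.
Qed.

End change.
End Iterated.

(** * Symmetries of the collision kernel *)

Section KernelSym.
Variable R : realType.
Notation RB := (measurableTypeR R).
Notation leb := (@lebesgue_measure R).
Variables (p : R -> R) (b0 : R).
Hypothesis mp : measurable_fun setT p.
Hypothesis b0_gt0 : 0 < b0.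
Hypothesis p_ge0 : forall r, 0 <= p r.
Hypothesis p_leb : forall r, p r <= b0.
Hypothesis p_lin : forall r : R, 0 <= r -> p r <= b0 * r.
Variable C0 : R.
Hypothesis C0E : C0 = 32 * b0 ^+ 2.

(** This product, rather than [W], is invariant under the collision symmetries: the three roots
    cancel those in the prefactor of [W]. *)
Definition Bk (x y z : R) := W p x y z * (Num.sqrt x * Num.sqrt y * Num.sqrt z).

Lemma Bk_ge0 x y z : 0 <= Bk x y z.
Proof. by rewrite mulr_ge0 ?mulr_ge0 ?sqrtr_ge0//; exact: W_ge0. Qed.

Lemma measurable_Bk d (T : measurableType d) (x y z : T -> R) :
  measurable_fun setT x -> measurable_fun setT y -> measurable_fun setT z ->
  measurable_fun setT (fun t => Bk (x t) (y t) (z t)).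
Proof. by move=> mx my mz; apply: measurable_funM; [exact: measurable_W|meas]. Qed.

(** The roots vanish on the faces, so the separate values that [W] takes there disappear. *)
Lemma Bk_off (x y z : R) : ~ [/\ 0 < x, 0 < y, 0 < z & x < y + z] -> Bk x y z = 0.
Proof.
move=> h; rewrite /Bk.
have [x0|x0] := leP x 0; first by rewrite (ler0_sqrtr x0) !mul0r mulr0.
have [y0|y0] := leP y 0; first by rewrite (ler0_sqrtr y0) mulr0 mul0r mulr0.
have [z0|z0] := leP z 0; first by rewrite (ler0_sqrtr z0) !mulr0.
have [xyz|xyz] := leP (y + z) x; last by case: h.
by rewrite (W_sum_le mp b0_gt0 p_ge0 p_leb p_lin C0E)// mul0r.
Qed.

Lemma Bk_cone (x y z : R) : 0 < x -> 0 < y -> 0 < z -> x < y + z ->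
  Bk x y z = (4 * pi)^-1 * Rintegral leb `[lo x y z, hi x y z] (inner p x y z).
Proof.
move=> x0 y0 z0 xyz; rewrite /Bk W_posE//.
set s := Num.sqrt x * Num.sqrt y * Num.sqrt z.
have s0 : s != 0 by rewrite gt_eqF// !mulr_gt0// sqrtr_gt0.
have p0 : (pi : R) != 0 by rewrite gt_eqF// pi_gt0.
by rewrite mulrAC; congr (_ * _); rewrite invfM mulfVK.
Qed.

Let q_shift (x y s : R) : s != 0 ->
  (y - x + s ^+ 2) ^+ 2 / (4 * s ^+ 2) = (x - y + s ^+ 2) ^+ 2 / (4 * s ^+ 2) + (y - x).
Proof. by move=> s0; field. Qed.

(** The two legs [u] and [v] are exchanged, and the modulus of [u + e^(i th) v] is symmetric in
    them. *)
Lemma Ystar_sym1 (x y z s th : R) : Ystar (y + z - x) z y s th = Ystar x y z s th.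
Proof.
rewrite /Ystar; case: eqVneq => // s0.
rewrite (_ : y + z - x - z = y - x); last by ring.
rewrite q_shift//; set q := (x - y + s ^+ 2) ^+ 2 / (4 * s ^+ 2).
rewrite (_ : y - (q + (y - x)) = x - q); last by ring.
rewrite (_ : y + z - x - (q + (y - x)) = z - q); last by ring.
by rewrite !modulus_sqr; congr Num.sqrt; ring.
Qed.

Lemma Ystar_sym2 (x y z s th : R) : Ystar y x (y + z - x) s th = Ystar x y z s th.
Proof.
rewrite /Ystar; case: eqVneq => // s0.
rewrite q_shift//; set q := (x - y + s ^+ 2) ^+ 2 / (4 * s ^+ 2).
rewrite (_ : y - (q + (y - x)) = x - q); last by ring.
by rewrite (_ : y + z - x - (q + (y - x)) = z - q); last by ring.
Qed.

(** Relabelling of particles: both pairs are swapped, which only exchanges the two entries in [lo]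
    and in [hi]. *)
Lemma Bk_sym1 (x y z : R) : Bk (y + z - x) z y = Bk x y z.
Proof.
have [[x0 y0 z0 xyz]|h] := pselect [/\ 0 < x, 0 < y, 0 < z & x < y + z]; last first.
  by rewrite !Bk_off// => -[h1 h2 h3 h4]; apply: h; split => //; lra.
have d0 : 0 < y + z - x by lra.
have d1 : y + z - x < z + y by lra.
rewrite (Bk_cone x0 y0 z0 xyz) (Bk_cone d0 z0 y0 d1).
have xs1 : xstar x y z = y + z - x by rewrite /xstar (max_idPl _)//; lra.
have xs2 : xstar (y + z - x) z y = x by rewrite /xstar (max_idPl _); lra.
have lE : lo (y + z - x) z y = lo x y z by rewrite /lo xs1 xs2 maxC.
have hE : hi (y + z - x) z y = hi x y z by rewrite /hi xs1 xs2 minC.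
have iE : inner p (y + z - x) z y = inner p x y z.
  by apply/funext => s; rewrite /inner; apply: eq_Rintegral => th _; rewrite Ystar_sym1.
by rewrite lE hE iE.
Qed.

(** Reversal of the collision: the pairs before and after are exchanged, which leaves each entry of
    [lo] and [hi] as it is. *)
Lemma Bk_sym2 (x y z : R) : Bk y x (y + z - x) = Bk x y z.
Proof.
have [[x0 y0 z0 xyz]|h] := pselect [/\ 0 < x, 0 < y, 0 < z & x < y + z]; last first.
  by rewrite !Bk_off// => -[h1 h2 h3 h4]; apply: h; split => //; lra.
have d0 : 0 < y + z - x by lra.
have d1 : y < x + (y + z - x) by lra.
rewrite (Bk_cone x0 y0 z0 xyz) (Bk_cone y0 x0 d0 d1).
have xs1 : xstar x y z = y + z - x by rewrite /xstar (max_idPl _)//; lra.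
have xs2 : xstar y x (y + z - x) = z by rewrite /xstar (max_idPl _); lra.
have lE : lo y x (y + z - x) = lo x y z.
  by rewrite /lo xs1 xs2 [`|Num.sqrt y - _|]distrC [`|Num.sqrt z - _|]distrC.
have hE : hi y x (y + z - x) = hi x y z.
  by rewrite /hi xs1 xs2 [Num.sqrt y + _]addrC [Num.sqrt z + _]addrC.
have iE : inner p y x (y + z - x) = inner p x y z.
  by apply/funext => s; rewrite /inner; apply: eq_Rintegral => th _; rewrite Ystar_sym2.
by rewrite lE hE iE.
Qed.

(** The four slots of [h] hold [x], [y], [z] and the fourth energy. The last is written without the
    truncation of [xstar], which makes the changes of variables linear; where [Bk] is nonzero the
    two agree. *)
Definition TT (h : R -> R -> R -> R -> \bar R) : \bar R :=
  (\int[leb]_x \int[leb]_y \int[leb]_z ((Bk x y z)%:E * h x y z (y + z - x)%R))%E.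

Definition mh4 (h : R -> R -> R -> R -> \bar R) :=
  measurable_fun setT (fun q : RB * RB * RB * RB => h q.1.1.1 q.1.1.2 q.1.2 q.2) /\
  (forall a b c d, 0 <= h a b c d)%E.

Lemma mh4_comp (h : R -> R -> R -> R -> \bar R) d (T : measurableType d) (x y z v : T -> R) :
  mh4 h -> measurable_fun setT x -> measurable_fun setT y -> measurable_fun setT z ->
  measurable_fun setT v -> measurable_fun setT (fun t => h (x t) (y t) (z t) (v t)).
Proof.
move=> [mh _] mx my mz mv.
apply: (measurableT_comp mh (g := fun t => (((x t, y t), z t), v t))).
by do 3 (apply: measurable_fun_pair => //).
Qed.

Section fixh.
Variable h : R -> R -> R -> R -> \bar R.
Hypothesis hh : mh4 h.
Let k x y z := ((Bk x y z)%:E * h x y z (y + z - x)%R)%E.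

Lemma measurable_TTk : measurable_fun setT (fun q : RB * RB * RB => k q.1.1 q.1.2 q.2).
Proof.
apply: emeasurable_funM; first by apply/measurable_EFinP; apply: measurable_Bk; meas.
by apply: mh4_comp => //; meas.
Qed.

Lemma measurable_TTk1 (x y : R) : measurable_fun setT (fun z : RB => k x y z).
Proof.
apply: emeasurable_funM; first by apply/measurable_EFinP; apply: measurable_Bk; meas.
by apply: mh4_comp => //; meas.
Qed.

Lemma TTk_ge0 x y z : (0 <= k x y z)%E.
Proof. by rewrite mule_ge0 ?lee_fin ?Bk_ge0//; case: hh. Qed.

Lemma TT_ge0 : (0 <= TT h)%E.
Proof. by do 3 (apply: integral_ge0 => ? _); exact: TTk_ge0. Qed.

Lemma TT_sym1 : TT h = TT (fun a b c d => h d c b a).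
Proof.
apply: (etrans (iter_reflect measurable_TTk TTk_ge0)).
apply: eq_integral => x _; apply: eq_integral => y _; apply: eq_integral => z _.
by rewrite /k Bk_sym1 (_ : z + y - (y + z - x) = x)//; ring.
Qed.

Lemma TT_sym2 : TT h = TT (fun a b c d => h b a d c).
Proof.
apply: (etrans (iter_shift measurable_TTk TTk_ge0)).
apply: eq_integral => x _; apply: eq_integral => y _; apply: eq_integral => z _.
by rewrite /k Bk_sym2 (_ : x + (y + z - x) - y = z)//; ring.
Qed.

End fixh.

Lemma TT_sym3 (h : R -> R -> R -> R -> \bar R) : mh4 h -> TT h = TT (fun a b c d => h c d a b).
Proof.
move=> hh; apply: (etrans (TT_sym1 hh)).
have hh' : mh4 (fun a b c d => h d c b a).
  by split; [apply: (mh4_comp hh); meas|move=> *; case: hh].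
exact: (TT_sym2 hh').
Qed.

Lemma TT_le (h h' : R -> R -> R -> R -> \bar R) : mh4 h -> mh4 h' ->
  (forall a b c d, h a b c d <= h' a b c d)%E -> (TT h <= TT h')%E.
Proof.
move=> hh hh' le; rewrite /TT.
have m1 := measurable_TTk hh; have m2 := measurable_TTk hh'.
have k1 := TTk_ge0 hh; have k2 := TTk_ge0 hh'.
have i1 := measurable_iter1 m1 k1; have i1' := measurable_iter1 m2 k2.
have i2 := measurable_iter2 m1 k1; have i2' := measurable_iter2 m2 k2.
apply: ge0_le_integral => //.
- by move=> x _; do 2 (apply: integral_ge0 => ? _); exact: k1.
- exact: i2.
- exact: i2'.
move=> x _; apply: ge0_le_integral => //.
- by move=> y _; apply: integral_ge0 => ? _; exact: k1.
- by apply: i1; meas.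
- by apply: i1'; meas.
move=> y _; apply: ge0_le_integral => //.
- exact: (measurable_TTk1 hh x y).
- exact: (measurable_TTk1 hh' x y).
by move=> z _; apply: lee_wpmul2l => //; rewrite lee_fin Bk_ge0.
Qed.

Lemma TTD (h h' : R -> R -> R -> R -> \bar R) : mh4 h -> mh4 h' ->
  (TT (fun a b c d => h a b c d + h' a b c d) = TT h + TT h')%E.
Proof.
move=> hh hh'; rewrite /TT.
have m1 := measurable_TTk hh; have m2 := measurable_TTk hh'.
have k1 := TTk_ge0 hh; have k2 := TTk_ge0 hh'.
have i1 := measurable_iter1 m1 k1; have i1' := measurable_iter1 m2 k2.
have i2 := measurable_iter2 m1 k1; have i2' := measurable_iter2 m2 k2.
rewrite -ge0_integralD//; last 4 first.
- by move=> x _; do 2 (apply: integral_ge0 => ? _); exact: k1.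
- exact: i2.
- by move=> x _; do 2 (apply: integral_ge0 => ? _); exact: k2.
- exact: i2'.
apply: eq_integral => x _; rewrite -ge0_integralD//; last 4 first.
- by move=> y _; apply: integral_ge0 => ? _; exact: k1.
- by apply: i1; meas.
- by move=> y _; apply: integral_ge0 => ? _; exact: k2.
- by apply: i1'; meas.
apply: eq_integral => y _; rewrite -ge0_integralD//; last 2 first.
- exact: (measurable_TTk1 hh x y).
- exact: (measurable_TTk1 hh' x y).
apply: eq_integral => z _; rewrite ge0_muleDr//; first by case: hh.
by case: hh'.
Qed.

End KernelSym.

(** * Kernel bounds with the weight 1 + x^(-1/2) *)

Section Weights.
Variable R : realType.
Notation RB := (measurableTypeR R).
Notation leb := (@lebesgue_measure R).

(** Dominates both the tests bounded by 1 and the weight [1 / sqrt x] by which densities with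
    respect to [dx] and [sqrt x dx] differ. *)
Definition rho (x : R) : \bar R := (1 + rinv x)%E.

Lemma rho_ge0 x : (0 <= rho x)%E. Proof. by rewrite adde_ge0// rinv_ge0. Qed.
Lemma rho_ge1 x : (1 <= rho x)%E. Proof. by rewrite leeDl// rinv_ge0. Qed.
Lemma rinv_le_rho x : (rinv x <= rho x)%E. Proof. by rewrite leeDr. Qed.
Lemma measurable_rho : measurable_fun setT (rho : RB -> \bar R).
Proof. by apply: emeasurable_funD; [exact: measurable_cst|exact: measurable_rinv]. Qed.

Lemma rinv_pos (x : R) : 0 < x -> rinv x = ((Num.sqrt x)^-1)%:E.
Proof. by move=> x0; rewrite /rinv leNgt x0. Qed.

Lemma le_rinv3 (w c x y z : R) : 0 < c -> w * (Num.sqrt x * Num.sqrt y * Num.sqrt z) <= c ->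
  (w%:E <= c%:E * (rinv x * rinv y * rinv z))%E.
Proof.
move=> c0 h; have [x0|x0] := boolP (x <= 0).
  rewrite {1}/rinv x0 gt0_mulye ?rinv_gt0// gt0_mulye ?rinv_gt0//.
  by rewrite gt0_muley ?lte_fin// leey.
have sx : 0 < Num.sqrt x by rewrite sqrtr_gt0 ltNge.
have -> : (c%:E * (rinv x * rinv y * rinv z) = (c / Num.sqrt x)%:E * (rinv y * rinv z))%E.
  by rewrite [rinv x]/rinv (negbTE x0) EFinM -!muleA.
apply: le_rinv2; first by rewrite divr_gt0.
rewrite ler_pdivlMr//; apply: le_trans h; apply: eq_ler; ring.
Qed.

Variables (p : R -> R) (b0 : R).
Hypothesis mp : measurable_fun setT p.
Hypothesis b0_gt0 : 0 < b0.
Hypothesis p_ge0 : forall r, 0 <= p r.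
Hypothesis p_leb : forall r, p r <= b0.
Hypothesis p_lin : forall r : R, 0 <= r -> p r <= b0 * r.
Variable C0 : R.
Hypothesis C0E : C0 = 32 * b0 ^+ 2.
Let C0_gt0 : 0 < C0. Proof. by rewrite C0E mulr_gt0// exprn_gt0. Qed.
Let C00 : (0 <= C0%:E)%E. Proof. by rewrite lee_fin ltW. Qed.

(** The root of the fourth argument in the last of the [W_estimates] cancels the singularity of
    [rinv] there. *)
Lemma W_rinv_d (x y z : R) :
  ((W p x y z)%:E * rinv (y + z - x) <= C0%:E * (rinv x * rinv y * rinv z))%E.
Proof.
have r0 : (0 <= C0%:E * (rinv x * rinv y * rinv z))%E.
  by rewrite !mule_ge0// rinv_ge0.
case: (W_bound_C0 mp b0_gt0 p_ge0 p_leb p_lin C0E x y z) => [->|]; first by rewrite mul0e.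
move=> [[x0 y0 z0 xyz] _ _ _ h4]; have d0 : 0 < y + z - x by lra.
have sd : 0 < Num.sqrt (y + z - x) by rewrite sqrtr_gt0.
rewrite (rinv_pos d0) -EFinM; apply: le_rinv3 => //.
rewrite mulrAC ler_pdivrMr//; apply: (le_trans h4).
by rewrite ler_pM2r// -[leRHS]mulr1 ler_pM2l// ge_min lexx.
Qed.

(** For [s] among [x], [y], [z], the kernel is bounded through the two other arguments, leaving
    [rho s] as third factor. The fourth slot needs the estimate with all three roots. *)
Lemma W_rho_le (x y z s : R) : s \in [:: x; y; z; y + z - x] ->
  ((W p x y z)%:E * rho s <= C0%:E * (rho x * rho y * rho z))%E.
Proof.
have [h1 h2 h3] := W_rinv mp b0_gt0 p_ge0 p_leb p_lin C0E x y z.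
have w1 := le_rinv2 C0_gt0 h1; have w2 := le_rinv2 C0_gt0 h2; have w3 := le_rinv2 C0_gt0 h3.
have i0 := @rinv_ge0 R; have o0 := rho_ge0; have io := rinv_le_rho.
have key (a b c : R) : ((W p x y z)%:E <= C0%:E * (rinv a * rinv b))%E ->
    ((W p x y z)%:E * rho c <= C0%:E * (rho a * rho b * rho c))%E.
  move=> h; apply: (@le_trans _ _ (C0%:E * (rinv a * rinv b) * rho c)%E).
    exact: lee_wpmul2r.
  rewrite -muleA lee_wpmul2l// lee_wpmul2r//.
  exact: lee_pmul.
rewrite !inE => /or4P[]/eqP->.
- by apply: (le_trans (key y z x w3)); rewrite (muleC (rho y * rho z)%E) (muleA (rho x)).
- by apply: (le_trans (key x z y w2)); rewrite (muleAC (rho x)).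
- exact: key.
rewrite /rho ge0_muleDr ?rinv_ge0// mule1 -!/(rho _).
apply: (@le_trans _ _ (C0%:E * (rinv x * rinv y) + C0%:E * (rinv x * rinv y * rinv z))%E).
  by apply: leeD => //; exact: W_rinv_d.
rewrite -ge0_muleDr ?mule_ge0// -[X in (X + _)%E]mule1 -ge0_muleDr// lee_wpmul2l//.
by apply: lee_wpmul2r; [exact: o0|exact: lee_pmul].
Qed.

Lemma W_rho_sqrt_le (x y z s : R) : 0 < y -> 0 < z -> s \in [:: x; y] ->
  ((W p x y z * Num.sqrt x)%:E * rho s <=
   (C0 * ((Num.sqrt z)^-1 * (1 + (Num.sqrt y)^-1)))%:E)%E.
Proof.
move=> y0 z0; have [h1 h2 h3] := W_rinv mp b0_gt0 p_ge0 p_leb p_lin C0E x y z.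
have sy : 0 < Num.sqrt y by rewrite sqrtr_gt0.
have sz : 0 < Num.sqrt z by rewrite sqrtr_gt0.
have W0 : 0 <= W p x y z by exact: W_ge0.
have wx : W p x y z * Num.sqrt x <= C0 / Num.sqrt z by rewrite ler_pdivlMr// -mulrA.
have w : W p x y z <= C0 / (Num.sqrt y * Num.sqrt z) by rewrite ler_pdivlMr// mulr_gt0.
have iy : 0 <= (Num.sqrt y)^-1 by rewrite invr_ge0 ltW.
have iz : 0 <= (Num.sqrt z)^-1 by rewrite invr_ge0 ltW.
rewrite !inE => /orP[]/eqP->.
- have [x0|x0] := boolP (x <= 0).
    by rewrite (ler0_sqrtr x0) mulr0 mul0e lee_fin !mulr_ge0 ?addr_ge0// ltW.
  have sx : 0 < Num.sqrt x by rewrite sqrtr_gt0 ltNge.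
  rewrite /rho /rinv (negbTE x0) -EFinD -EFinM lee_fin mulrDr mulr1 mulfK ?gt_eqF//.
  apply: (le_trans (lerD wx w)); rewrite invfM; apply: eq_ler; ring.
- rewrite /rho (rinv_pos y0) -EFinD -EFinM lee_fin [leRHS]mulrA ler_wpM2r// addr_ge0.
Qed.

End Weights.

Lemma ereal_rearr (R : realType) (a b c d : R) (X : \bar R) : a * b = c * d ->
  (a%:E * (X * b%:E) = c%:E * X * d%:E)%E.
Proof. by move=> e; rewrite [LHS]muleC -muleA -EFinM [b * a]mulrC e muleAC -EFinM muleC. Qed.

(** [w] is a density with respect to [dx], and [dq w] the one with respect to [sqrt x dx]. [Gam] and
    [Lam] are the gain and loss factors of the collision term, in the slot order of [TT]. *)
Definition dq (R : realType) (w : R -> R) (x : R) := w x / Num.sqrt x.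
Definition Gam (R : realType) (g : R -> R) (a b c d : R) := g b * g c * (1 + g a + g d).
Definition Lam (R : realType) (g : R -> R) (a b c d : R) := g a * g d * (1 + g b + g c).

(** * Collision integrals in terms of the density *)

Section Weak.
Variable R : realType.
Notation RB := (measurableTypeR R).
Notation leb := (@lebesgue_measure R).
Variables (p : R -> R) (b0 : R).
Hypothesis mp : measurable_fun setT p.
Hypothesis b0_gt0 : 0 < b0.
Hypothesis p_ge0 : forall r, 0 <= p r.
Hypothesis p_leb : forall r, p r <= b0.
Hypothesis p_lin : forall r : R, 0 <= r -> p r <= b0 * r.
Variable C0 : R.
Hypothesis C0E : C0 = 32 * b0 ^+ 2.
Let C0_gt0 : 0 < C0. Proof. by rewrite C0E mulr_gt0// exprn_gt0. Qed.
Variable mu : {finite_measure set RB -> \bar R}.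
Variable w : R -> R.
Hypothesis mw : measurable_fun setT w.
Hypothesis w0 : forall x, 0 <= w x.
Hypothesis wneg : forall x, x <= 0 -> w x = 0.
Hypothesis muw : forall psi : R -> \bar R, measurable_fun setT psi -> (forall x, 0 <= psi x)%E ->
  (\int[mu]_x psi x = \int[leb]_x (psi x * (w x)%:E))%E.
Variables (N K E1 : R).
Hypothesis muN : mu setT = N%:E.
Hypothesis muK : (\int[mu]_x rinv x <= K%:E)%E.
Hypothesis muE1 : (\int[mu]_x (1 + Num.max x 0)%:E = E1%:E)%E.
Notation B := (Bk p).
Notation T := (TT p).

Notation g := (dq w).
Let gw x : g x * Num.sqrt x = w x.
Proof.
rewrite /dq; have [x0|x0] := leP x 0; first by rewrite ler0_sqrtr// mulr0 wneg.
by rewrite mulfVK// gt_eqF// sqrtr_gt0.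
Qed.
Let g0 x : 0 <= g x. Proof. by rewrite divr_ge0 ?sqrtr_ge0. Qed.
Let mg : measurable_fun setT g.
Proof. by apply: measurable_funM => //; apply: measurable_inv; apply: measurable_sqrt. Qed.
Let mgc d (S : measurableType d) (a : S -> R) : measurable_fun setT a ->
  measurable_fun setT (fun t => g (a t)).
Proof. by move=> ma; apply: (measurableT_comp mg). Qed.
Let mwc d (S : measurableType d) (a : S -> R) : measurable_fun setT a ->
  measurable_fun setT (fun t => w (a t)).
Proof. by move=> ma; apply: (measurableT_comp mw). Qed.

Lemma density2 (F : R -> R -> \bar R) :
  measurable_fun setT (fun q : RB * RB => F q.1 q.2) -> (forall x y, 0 <= F x y)%E ->
  (\int[(mu \x mu)%E]_q F q.1 q.2 = \int[leb]_x \int[leb]_y (F x y * (w x * w y)%:E))%E.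
Proof.
move=> mF F0.
transitivity (\int[mu]_x \int[mu]_y F x y)%E.
  exact: (@fubini_tonelli1 _ _ _ _ _ mu mu (fun q => F q.1 q.2) mF (fun q => F0 _ _)).
have mFx (x : R) : measurable_fun setT (fun y : R => F x y).
  exact: (measurableT_comp mF (measurable_pair1 (x : RB))).
rewrite muw; last 2 first.
- exact: (@measurable_fun_fubini_tonelli_F _ _ RB RB R mu (fun q => F q.1 q.2) mF (fun q => F0 _ _)).
- by move=> x; apply: integral_ge0 => y _.
apply: eq_integral => x _; rewrite muw// -ge0_integralZr//.
- by apply: eq_integral => y _; rewrite -muleA -EFinM [w y * _]mulrC.
- by apply: emeasurable_funM; [exact: mFx|exact/measurable_EFinP].
- by move=> y _; rewrite mule_ge0// lee_fin.
- by rewrite lee_fin.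
Qed.

Lemma density3 (F : R -> R -> R -> \bar R) :
  measurable_fun setT (fun q : RB * RB * RB => F q.1.1 q.1.2 q.2) ->
  (forall x y z, 0 <= F x y z)%E ->
  (\int[((mu \x mu) \x mu)%E]_q F q.1.1 q.1.2 q.2 =
   \int[leb]_x \int[leb]_y \int[leb]_z (F x y z * (w x * w y * w z)%:E))%E.
Proof.
move=> mF F0; rewrite (@integral3E R mu F mF F0).
have mFz : measurable_fun setT (fun q : RB * RB => \int[mu]_z F q.1 q.2 z)%E.
  exact: (@measurable_fun_fubini_tonelli_F _ _ (RB * RB)%type RB R mu
    (fun q => F q.1.1 q.1.2 q.2) mF (fun q => F0 _ _ _)).
have Fz0 x y : (0 <= \int[mu]_z F x y z)%E by exact: integral_ge0.
transitivity (\int[(mu \x mu)%E]_q \int[mu]_z F q.1 q.2 z)%E.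
  exact/esym/(@fubini_tonelli1 _ _ _ _ _ mu mu (fun q => \int[mu]_z F q.1 q.2 z)%E mFz (fun q => Fz0 _ _)).
rewrite (@density2 (fun x y => \int[mu]_z F x y z)%E mFz Fz0).
apply: eq_integral => x _; apply: eq_integral => y _.
have mF1 : measurable_fun setT (fun z : R => F x y z).
  by apply: (measurable_comp3 mF); meas.
rewrite muw// -ge0_integralZr//.
- by apply: eq_integral => z _; rewrite -muleA -EFinM; congr (_ * _%:E)%E; ring.
- by apply: emeasurable_funM; [exact: mF1|exact/measurable_EFinP].
- by move=> z _; rewrite mule_ge0// lee_fin.
- by rewrite lee_fin mulr_ge0.
Qed.

(** Integral over the outgoing energy for a nonnegative weight in four slots; [Jop] will be half the
    difference of two of these. *)
Definition Qd (h : R -> R -> R -> R -> \bar R) (y z : R) : \bar R :=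
  (\int[leb]_x ((W p x y z * Num.sqrt x)%:E * h x y z (y + z - x)%R))%E.

Let mWx (h : R -> R -> R -> R -> \bar R) : mh4 h ->
  measurable_fun setT (fun q : RB * RB * RB =>
   ((W p q.2 q.1.1 q.1.2 * Num.sqrt q.2)%:E * h q.2 q.1.1 q.1.2 (q.1.1 + q.1.2 - q.2)%R)%E).
Proof.
move=> hh; apply: emeasurable_funM; last by apply: (mh4_comp hh); meas.
by apply/measurable_EFinP; apply: measurable_funM; [apply: measurable_W => //; meas|meas].
Qed.

Let Wx0 (h : R -> R -> R -> R -> \bar R) x y z : mh4 h ->
  (0 <= (W p x y z * Num.sqrt x)%:E * h x y z (y + z - x)%R)%E.
Proof.
move=> [_ hh]; rewrite mule_ge0// lee_fin mulr_ge0 ?sqrtr_ge0//; exact: W_ge0.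
Qed.

Lemma measurable_Qd (h : R -> R -> R -> R -> \bar R) : mh4 h ->
  measurable_fun setT (fun q : RB * RB => Qd h q.1 q.2).
Proof.
move=> hh; rewrite /Qd.
apply: (@measurable_fun_fubini_tonelli_F _ _ (RB * RB)%type RB R leb
  (fun q => (W p q.2 q.1.1 q.1.2 * Num.sqrt q.2)%:E * h q.2 q.1.1 q.1.2 (q.1.1 + q.1.2 - q.2)%R)%E).
  exact: mWx.
by move=> q; exact: Wx0.
Qed.

Lemma Qd_ge0 (h : R -> R -> R -> R -> \bar R) y z : mh4 h -> (0 <= Qd h y z)%E.
Proof. by move=> hh; apply: integral_ge0 => x _; exact: Wx0. Qed.

Lemma Qd_mul (h : R -> R -> R -> R -> \bar R) (y z : R) : mh4 h ->
  (\int[leb]_x ((W p x y z * Num.sqrt x)%:E * h x y z (y + z - x)%R * (w y * w z)%:E) =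
   Qd h y z * (w y * w z)%:E)%E.
Proof.
move=> hh.
have m := measurable_comp3 (k := fun y z x => ((W p x y z * Num.sqrt x)%:E * h x y z (y + z - x)%R)%E) (mWx hh).
have mx : measurable_fun setT (fun x : RB => ((W p x y z * Num.sqrt x)%:E * h x y z (y + z - x)%R)%E).
  by apply: m; meas.
have c0 : (0 <= (w y * w z)%:E)%E by rewrite lee_fin mulr_ge0.
apply: ge0_integralZr; do ?[exact: measurableT|exact: mx|exact: c0].
by move=> x _; exact: Wx0.
Qed.

Lemma mh4_mul (h : R -> R -> R -> R -> \bar R) (G : R -> R -> R -> R -> R) : mh4 h ->
  measurable_fun setT (fun q : RB * RB * RB * RB => G q.1.1.1 q.1.1.2 q.1.2 q.2) ->
  (forall a b c d, 0 <= G a b c d) ->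
  mh4 (fun a b c d => h a b c d * (G a b c d)%:E)%E.
Proof.
move=> [h1 h2] mG G0; split; last by move=> *; rewrite mule_ge0// lee_fin.
by apply: emeasurable_funM => //; apply/measurable_EFinP.
Qed.

Lemma mh4_bc (h : R -> R -> R -> R -> \bar R) : mh4 h ->
  mh4 (fun a b c d => h a b c d * (g b * g c)%:E)%E.
Proof.
move=> hh; apply: mh4_mul => //; last by move=> *; rewrite mulr_ge0.
by apply: measurable_funM; apply: mgc; meas.
Qed.

Lemma mh4_abc (h : R -> R -> R -> R -> \bar R) : mh4 h ->
  mh4 (fun a b c d => h a b c d * (g a * g b * g c)%:E)%E.
Proof.
move=> hh; apply: mh4_mul => //; last by move=> *; rewrite !mulr_ge0.
by apply: measurable_funM; [apply: measurable_funM|]; apply: mgc; meas.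
Qed.

(** Two of the three roots of [Bk] turn [g y] and [g z] into Lebesgue densities; the third stays
    with [W] inside [Qd]. *)
Lemma TT_quad (h : R -> R -> R -> R -> \bar R) : mh4 h ->
  T (fun a b c d => h a b c d * (g b * g c)%:E)%E = (\int[(mu \x mu)%E]_q Qd h q.1 q.2)%E.
Proof.
move=> hh; have hh' := mh4_bc hh.
have e1 := density2 (measurable_Qd hh) (fun y z => Qd_ge0 y z hh).
rewrite e1; have e2 := iter_rotate (measurable_TTk mp hh') (TTk_ge0 p hh').
apply: (etrans e2); apply: eq_integral => y _; apply: eq_integral => z _.
apply: (etrans _ (Qd_mul y z hh)); apply: eq_integral => x _; apply: ereal_rearr.
by rewrite /Bk -(gw y) -(gw z); ring.
Qed.

Lemma measurable_Wh (h : R -> R -> R -> R -> \bar R) : mh4 h ->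
  measurable_fun setT (fun q : RB * RB * RB =>
   ((W p q.1.1 q.1.2 q.2)%:E * h q.1.1 q.1.2 q.2 (q.1.2 + q.2 - q.1.1)%R)%E).
Proof.
move=> hh; apply: emeasurable_funM; last by apply: (mh4_comp hh); meas.
by apply/measurable_EFinP; apply: measurable_W => //; meas.
Qed.

Lemma TT_cub (h : R -> R -> R -> R -> \bar R) : mh4 h ->
  T (fun a b c d => h a b c d * (g a * g b * g c)%:E)%E =
  (\int[((mu \x mu) \x mu)%E]_q
    ((W p q.1.1 q.1.2 q.2)%:E * h q.1.1 q.1.2 q.2 (q.1.2 + q.2 - q.1.1)%R))%E.
Proof.
move=> hh; have [_ h0] := hh.
rewrite (@density3 (fun x y z => (W p x y z)%:E * h x y z (y + z - x)%R)%E (measurable_Wh hh)); last first.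
  by move=> x y z; rewrite mule_ge0// lee_fin; exact: W_ge0.
apply: eq_integral => x _; apply: eq_integral => y _; apply: eq_integral => z _.
apply: ereal_rearr; by rewrite /Bk -(gw x) -(gw y) -(gw z); ring.
Qed.


Lemma TT_ext (h h' : R -> R -> R -> R -> \bar R) :
  (forall a b c d, h a b c d = h' a b c d) -> T h = T h'.
Proof.
by move=> e; congr TT; do 4 (apply/funext => ?); exact: e.
Qed.

Section slots.
Variable psi : R -> \bar R.
Hypothesis mpsi : measurable_fun setT psi.
Hypothesis psi0 : forall x, (0 <= psi x)%E.

Let mc d (S : measurableType d) (a : S -> R) : measurable_fun setT a ->
  measurable_fun setT (fun t => psi (a t)).
Proof. by move=> ma; apply: (measurableT_comp mpsi). Qed.
Lemma mh4_slota : mh4 (fun a b c d => psi a). Proof. by split => //; apply: mc; meas. Qed.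
Lemma mh4_slotb : mh4 (fun a b c d => psi b). Proof. by split => //; apply: mc; meas. Qed.
Lemma mh4_slotc : mh4 (fun a b c d => psi c). Proof. by split => //; apply: mc; meas. Qed.
Lemma mh4_slotd : mh4 (fun a b c d => psi d). Proof. by split => //; apply: mc; meas. Qed.

Let ss1 := @TT_sym1 R p b0 mp b0_gt0 p_ge0 p_leb p_lin C0 C0E.
Let ss2 := @TT_sym2 R p b0 mp b0_gt0 p_ge0 p_leb p_lin C0 C0E.
Let ss3 := @TT_sym3 R p b0 mp b0_gt0 p_ge0 p_leb p_lin C0 C0E.

Lemma TT_quad_d : T (fun a b c d => psi d * (g b * g c)%:E)%E = T (fun a b c d => psi a * (g b * g c)%:E)%E.
Proof.
apply: (etrans (ss1 (mh4_bc mh4_slotd))); apply: TT_ext => a b c d.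
by rewrite [g c * _]mulrC.
Qed.

Lemma TT_quad_c : T (fun a b c d => psi c * (g b * g c)%:E)%E = T (fun a b c d => psi b * (g b * g c)%:E)%E.
Proof.
apply: (etrans (ss1 (mh4_bc mh4_slotc))); apply: TT_ext => a b c d.
by rewrite [g c * _]mulrC.
Qed.

Let split_eq (X : \bar R) (m a b : R) : (0 <= X)%E -> 0 <= m -> 0 <= a -> 0 <= b ->
  (X * (m * (1 + a + b))%:E = X * m%:E + X * (m * a)%:E + X * (m * b)%:E)%E.
Proof.
move=> X0 m0 a0 b00.
have ma : 0 <= m * a by rewrite mulr_ge0.
have mb : 0 <= m * b by rewrite mulr_ge0.
rewrite -ge0_muleDr ?lee_fin// -EFinD -ge0_muleDr ?lee_fin ?addr_ge0// -EFinD.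
by congr (_ * _%:E)%E; ring.
Qed.

(** Expansion of the factor [1 + g a + g d]; the last term is brought to the product
    [g a * g b * g c] by relabelling, which moves the weight to the slot [d]. *)
Lemma TT_gain : T (fun a b c d => psi a * (Gam g a b c d)%:E)%E =
  (T (fun a b c d => psi a * (g b * g c)%:E) + T (fun a b c d => psi a * (g a * g b * g c)%:E) +
   T (fun a b c d => psi d * (g a * g b * g c)%:E))%E.
Proof.
pose h1 (a b c d : R) := (psi a * (g b * g c)%:E)%E.
pose h2 (a b c d : R) := (psi a * (g b * g c * g a)%:E)%E.
pose h3 (a b c d : R) := (psi a * (g b * g c * g d)%:E)%E.
have hh1 : mh4 h1 by exact: mh4_bc mh4_slota.
have hh2 : mh4 h2.
  apply: mh4_mul; [exact: mh4_slota| |by move=> *; rewrite !mulr_ge0].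
  by apply: measurable_funM; [apply: measurable_funM|]; apply: mgc; meas.
have hh3 : mh4 h3.
  apply: mh4_mul; [exact: mh4_slota| |by move=> *; rewrite !mulr_ge0].
  by apply: measurable_funM; [apply: measurable_funM|]; apply: mgc; meas.
have hh12 : mh4 (fun a b c d => h1 a b c d + h2 a b c d)%E.
  split; last by move=> *; rewrite adde_ge0//; [case: hh1|case: hh2].
  by apply: emeasurable_funD; [case: hh1|case: hh2].
have e0 : T (fun a b c d => psi a * (Gam g a b c d)%:E)%E = T (fun a b c d => h1 a b c d + h2 a b c d + h3 a b c d)%E.
  by apply: TT_ext => a b c d; rewrite /Gam split_eq ?mulr_ge0.
have e1 := TTD mp hh12 hh3; have e2 := TTD mp hh1 hh2.
have e3 : T h2 = T (fun a b c d => psi a * (g a * g b * g c)%:E)%E.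
  by apply: TT_ext => a b c d; rewrite /h2; congr (_ * _%:E)%E; ring.
have e4 : T h3 = T (fun a b c d => psi d * (g a * g b * g c)%:E)%E.
  apply: (etrans (ss1 hh3)); apply: TT_ext => a b c d; rewrite /h3.
  by congr (_ * _%:E)%E; ring.
by rewrite e0 -e3 -e4; apply: (etrans e1); congr (_ + _)%E.
Qed.

(** Reversal of the collision carries [g a * g d] to [g b * g c] and the weight from [a] to [b].
    This is how a loss located at [x], as in the mild equation, matches the losses located at [y]
    and [z] in the weak one. *)
Lemma TT_loss : T (fun a b c d => psi a * (Lam g a b c d)%:E)%E =
  (T (fun a b c d => psi b * (g b * g c)%:E) + T (fun a b c d => psi b * (g a * g b * g c)%:E) +
   T (fun a b c d => psi c * (g a * g b * g c)%:E))%E.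
Proof.
pose h1 (a b c d : R) := (psi a * (g a * g d)%:E)%E.
pose h2 (a b c d : R) := (psi a * (g a * g d * g b)%:E)%E.
pose h3 (a b c d : R) := (psi a * (g a * g d * g c)%:E)%E.
have hh1 : mh4 h1.
  apply: mh4_mul; [exact: mh4_slota| |by move=> *; rewrite !mulr_ge0].
  by apply: measurable_funM; apply: mgc; meas.
have hh2 : mh4 h2.
  apply: mh4_mul; [exact: mh4_slota| |by move=> *; rewrite !mulr_ge0].
  by apply: measurable_funM; [apply: measurable_funM|]; apply: mgc; meas.
have hh3 : mh4 h3.
  apply: mh4_mul; [exact: mh4_slota| |by move=> *; rewrite !mulr_ge0].
  by apply: measurable_funM; [apply: measurable_funM|]; apply: mgc; meas.
have hh12 : mh4 (fun a b c d => h1 a b c d + h2 a b c d)%E.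
  split; last by move=> *; rewrite adde_ge0//; [case: hh1|case: hh2].
  by apply: emeasurable_funD; [case: hh1|case: hh2].
have e0 : T (fun a b c d => psi a * (Lam g a b c d)%:E)%E = T (fun a b c d => h1 a b c d + h2 a b c d + h3 a b c d)%E.
  by apply: TT_ext => a b c d; rewrite /Lam split_eq ?mulr_ge0.
have e1 := TTD mp hh12 hh3; have e2 := TTD mp hh1 hh2.
have e3 : T h1 = T (fun a b c d => psi b * (g b * g c)%:E)%E := ss2 hh1.
have e4 : T h2 = T (fun a b c d => psi b * (g a * g b * g c)%:E)%E.
  apply: (etrans (ss2 hh2)); apply: TT_ext => a b c d; rewrite /h2.
  by congr (_ * _%:E)%E; ring.
have e5 : T h3 = T (fun a b c d => psi c * (g a * g b * g c)%:E)%E.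
  apply: (etrans (ss3 hh3)); apply: TT_ext => a b c d; rewrite /h3.
  by congr (_ * _%:E)%E; ring.
by rewrite e0 -e3 -e4 -e5; apply: (etrans e1); congr (_ + _)%E.
Qed.

End slots.

Definition Cc := C0 * (N + K) ^+ 3.
Definition Cq := C0 * (2 * E1 * K + E1 * (N + K)).

Let N0 : 0 <= N. Proof. by rewrite -lee_fin -muN. Qed.
Let K0 : 0 <= K.
Proof. by rewrite -lee_fin; apply: le_trans muK; apply: integral_ge0 => x _; exact: rinv_ge0. Qed.
Let E10 : 0 <= E1.
Proof.
rewrite -lee_fin -muE1; apply: integral_ge0 => x _.
by rewrite lee_fin addr_ge0// le_max lexx orbT.
Qed.

Let irho : (\int[mu]_x rho x <= (N + K)%:E)%E.
Proof.
rewrite /rho ge0_integralD//; [|by move=> x _; exact: rinv_ge0|exact: measurable_rinv].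
rewrite EFinD leeD//; have -> : N%:E = (\int[mu]_x 1%:E)%E by rewrite integral_cst// mul1e.
exact: lexx.
Qed.
Let irho0 : (0 <= \int[mu]_x rho x)%E.
Proof. by apply: integral_ge0 => x _; exact: rho_ge0. Qed.

Lemma TT_cub_bound (h : R -> R -> R -> R -> \bar R) : mh4 h ->
  (forall x y z, (W p x y z)%:E * h x y z (y + z - x)%R <= C0%:E * (rho x * rho y * rho z))%E ->
  (T (fun a b c d => h a b c d * (g a * g b * g c)%:E)%E <= Cc%:E)%E.
Proof.
move=> hh le; have [_ h0] := hh; rewrite TT_cub//.
have mr := @measurable_rho R; have r0 := @rho_ge0 R.
have mrrr : measurable_fun setT (fun q : RB * RB * RB => rho q.1.1 * rho q.1.2 * rho q.2)%E.
  apply: emeasurable_funM; [apply: emeasurable_funM|]; apply: (measurableT_comp mr); meas.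
have rrr0 (x y z : R) : (0 <= rho x * rho y * rho z)%E by rewrite !mule_ge0.
apply: (@le_trans _ _ (\int[((mu \x mu) \x mu)%E]_q (C0%:E * (rho q.1.1 * rho q.1.2 * rho q.2)))%E).
  apply: ge0_le_integral => //.
  - by move=> q _; rewrite mule_ge0// lee_fin; exact: W_ge0.
  - exact: measurable_Wh.
  - by apply: emeasurable_funM => //; exact: measurable_cst.
rewrite ge0_integralZl_EFin// ?(ltW C0_gt0)//.
have t := @integral3_tensor R mu (@rho R) (@rho R) (@rho R) mr mr mr r0 r0 r0.
rewrite t /Cc EFinM lee_wpmul2l// ?lee_fin ?(ltW C0_gt0)//.
rewrite exprSr expr2 !EFinM; apply: lee_pmul => //; first by rewrite mule_ge0.
exact: lee_pmul.
Qed.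

Let Hq (y z : R) : \bar R :=
  (C0%:E * ((2 * (1 + Num.max y 0))%:E * rinv z + (1 + Num.max z 0)%:E * rho y))%E.

(** With [a = sqrt y] and [b = sqrt z]: the length [y + z] of the range of [x], times the pointwise
    bound of the integrand, splits into products of one factor with at most linear growth and one
    with at most an inverse root. *)
Let quad_real (a b : R) : 0 < a -> 0 < b ->
  (a ^+ 2 + b ^+ 2) * (b^-1 * (1 + a^-1)) <= 2 * (1 + a ^+ 2) * b^-1 + (1 + b ^+ 2) * (1 + a^-1).
Proof.
move=> a0 b00; have ia : 0 < a^-1 by rewrite invr_gt0.
have ib : 0 < b^-1 by rewrite invr_gt0.
have -> : (a ^+ 2 + b ^+ 2) * (b^-1 * (1 + a^-1)) = (a ^+ 2 + a) * b^-1 + b * (1 + a^-1).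
  by field; rewrite !gt_eqF.
apply: lerD; rewrite ler_pM2r//; first by have := sqr_ge0 (a - 1); rewrite expr2; nra.
  by have := sqr_ge0 (b - 1); rewrite expr2; nra.
by rewrite addr_gt0.
Qed.

Lemma TT_quad_bound (h : R -> R -> R -> R -> \bar R) : mh4 h ->
  (forall x y z, 0 < y -> 0 < z -> ((W p x y z * Num.sqrt x)%:E * h x y z (y + z - x)%R <=
     (C0 * ((Num.sqrt z)^-1 * (1 + (Num.sqrt y)^-1)))%:E)%E) ->
  (T (fun a b c d => h a b c d * (g b * g c)%:E)%E <= Cq%:E)%E.
Proof.
move=> hh le; have [_ h0] := hh.
have mHq : measurable_fun setT (fun q : RB * RB => Hq q.1 q.2).
  apply: emeasurable_funM; first exact: measurable_cst.
  apply: emeasurable_funD; apply: emeasurable_funM.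
  - by apply/measurable_EFinP; meas.
  - by apply: measurable_rinv_comp; meas.
  - by apply/measurable_EFinP; meas.
  - by apply: (measurableT_comp (@measurable_rho R)); meas.
have mx0 (y : R) : 0 <= 1 + Num.max y 0 by rewrite addr_ge0// le_max lexx orbT.
have Hq0 y z : (0 <= Hq y z)%E.
  rewrite mule_ge0 ?lee_fin ?(ltW C0_gt0)// adde_ge0// mule_ge0 ?rinv_ge0 ?rho_ge0// lee_fin//.
  by rewrite mulr_ge0.
have QH y z : (Qd h y z * (w y * w z)%:E <= Hq y z * (w y * w z)%:E)%E.
  have [y0|y0] := leP y 0; first by rewrite (wneg y0) mul0r !mule0.
  have [z0|z0] := leP z 0; first by rewrite (wneg z0) mulr0 !mule0.
  apply: lee_wpmul2r; first by rewrite lee_fin mulr_ge0.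
  have sy : 0 < Num.sqrt y by rewrite sqrtr_gt0.
  have sz : 0 < Num.sqrt z by rewrite sqrtr_gt0.
  pose c := C0 * ((Num.sqrt z)^-1 * (1 + (Num.sqrt y)^-1)).
  have c0 : 0 <= c by rewrite !mulr_ge0 ?addr_ge0 ?invr_ge0 ?(ltW C0_gt0) ?(ltW sy) ?(ltW sz).
  apply: (@le_trans _ _ (\int[leb]_x (c * \1_(`[0, y + z]%classic) x)%:E)%E).
    apply: ge0_le_integral => //.
    - by move=> x _; exact: Wx0.
    - have m := measurable_comp3 (k := fun y z x => ((W p x y z * Num.sqrt x)%:E * h x y z (y + z - x)%R)%E) (mWx hh).
      by apply: m; meas.
    - by apply/measurable_EFinP; apply: measurable_funM => //; exact: measurable_indic.
    move=> x _; rewrite indicE; case: (boolP (x \in _)) => hx.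
      by rewrite mulr1; exact: le.
    rewrite mulr0 (_ : W p x y z = 0) ?mul0r ?mul0e//.
    move/negP: hx; rewrite inE/= in_itv/= => hx.
    have [x0|x0] := ltP x 0; first by apply: (W_neg mp b0_gt0 p_ge0 p_leb p_lin C0E); constructor 1.
    have [xyz|xyz] := ltP (y + z) x; first by apply: (W_sum_le mp b0_gt0 p_ge0 p_leb p_lin C0E); exact: ltW.
    by exfalso; apply: hx; rewrite x0.
  under eq_integral do rewrite EFinM.
  rewrite ge0_integralZl_EFin//; last by apply/measurable_EFinP/measurable_indic.
  rewrite integral_indic_itv; last by rewrite addr_ge0// ltW.
  rewrite /Hq (rinv_pos z0) /rho (rinv_pos y0) (max_idPl (ltW y0)) (max_idPl (ltW z0)).
  rewrite -[X in (_ <= X)%E]/((C0 * (2 * (1 + y) * (Num.sqrt z)^-1 + (1 + z) * (1 + (Num.sqrt y)^-1)))%:E).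
  rewrite -EFinM lee_fin subr0.
  rewrite (_ : c * (y + z) = C0 * ((y + z) * ((Num.sqrt z)^-1 * (1 + (Num.sqrt y)^-1)))); last by rewrite /c; ring.
  rewrite ler_pM2l//.
  have := quad_real sy sz; rewrite !sqr_sqrtr ?(ltW y0) ?(ltW z0)//.
rewrite TT_quad// (density2 (measurable_Qd hh) (fun y z => Qd_ge0 y z hh)).
apply: (@le_trans _ _ (\int[leb]_x \int[leb]_y (Hq x y * (w x * w y)%:E))%E).
  have mm (F : R -> R -> \bar R) : measurable_fun setT (fun q : RB * RB => F q.1 q.2) ->
      measurable_fun setT (fun q : RB * RB => F q.1 q.2 * (w q.1 * w q.2)%:E)%E.
    move=> mF; apply: emeasurable_funM => //; apply/measurable_EFinP.
    by apply: measurable_funM; apply: mwc; meas.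
  have nn (F : R -> R -> \bar R) x y : (0 <= F x y)%E -> (0 <= F x y * (w x * w y)%:E)%E.
    by move=> F0; rewrite mule_ge0// lee_fin mulr_ge0.
  have m1 := mm _ (measurable_Qd hh); have m2 := mm _ mHq.
  have n1 x y := nn _ x y (Qd_ge0 x y hh); have n2 x y := nn _ x y (Hq0 x y).
  apply: ge0_le_integral => //.
  - by move=> x _; apply: integral_ge0 => y _; exact: n1.
  - exact: (@measurable_fun_fubini_tonelli_F _ _ RB RB R leb (fun q => Qd h q.1 q.2 * (w q.1 * w q.2)%:E)%E m1 (fun q => n1 _ _)).
  - exact: (@measurable_fun_fubini_tonelli_F _ _ RB RB R leb (fun q => Hq q.1 q.2 * (w q.1 * w q.2)%:E)%E m2 (fun q => n2 _ _)).
  move=> x _; apply: ge0_le_integral => //.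
  - exact: (measurableT_comp m1 (measurable_pair1 (x : RB))).
  - exact: (measurableT_comp m2 (measurable_pair1 (x : RB))).
rewrite -(density2 mHq Hq0).
pose a1 (x : R) := (2 * (1 + Num.max x 0))%:E; pose a2 (x : R) := (1 + Num.max x 0)%:E.
have ma2 : measurable_fun setT a2 by apply/measurable_EFinP; meas.
have ma1 : measurable_fun setT a1 by apply/measurable_EFinP; meas.
have a20 x : (0 <= a2 x)%E by rewrite lee_fin.
have a10 x : (0 <= a1 x)%E by rewrite lee_fin mulr_ge0.
have ia1 : (\int[mu]_x a1 x = (2 * E1)%:E)%E.
  rewrite /a1; under eq_integral do rewrite EFinM.
  rewrite ge0_integralZl_EFin//; do ?[exact: ma2|by move=> x _; exact: a20|by rewrite [RHS]EFinM; congr (_ * _)%E; exact: muE1].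
have ia2 : (\int[mu]_x a2 x = E1%:E)%E by exact: muE1.
have mr := @measurable_rho R; have r0 := @rho_ge0 R.
have mi := @measurable_rinv R; have i0 := @rinv_ge0 R.
have t1 := @integral2_tensor R mu a1 (@rinv R) ma1 mi a10 i0.
have t2 := @integral2_tensor R mu (@rho R) a2 mr ma2 r0 a20.
have mA : measurable_fun setT (fun q : RB * RB => a1 q.1 * rinv q.2)%E.
  by apply: emeasurable_funM; [apply: (measurableT_comp ma1); meas|apply: measurable_rinv_comp; meas].
have mB : measurable_fun setT (fun q : RB * RB => rho q.1 * a2 q.2)%E.
  by apply: emeasurable_funM; [apply: (measurableT_comp mr); meas|apply: (measurableT_comp ma2); meas].
have -> : (\int[(mu \x mu)%E]_q Hq q.1 q.2 =
   \int[(mu \x mu)%E]_q (C0%:E * (a1 q.1 * rinv q.2 + rho q.1 * a2 q.2)))%E.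
  by apply: eq_integral => q _; rewrite /Hq /a1 /a2 [(rho _ * _)%E]muleC.
rewrite ge0_integralZl_EFin//; last 3 first.
- by move=> q _; rewrite adde_ge0// mule_ge0.
- exact: emeasurable_funD.
- exact: ltW.
rewrite ge0_integralD//; [|by move=> q _; rewrite mule_ge0|by move=> q _; rewrite mule_ge0].
rewrite t1 t2 ia1 ia2 /Cq [leRHS]EFinM lee_wpmul2l// ?lee_fin ?(ltW C0_gt0)//.
rewrite EFinD [((2 * E1 * K)%:E)%E]EFinM [(E1 * _)%:E]EFinM; apply: leeD.
  by rewrite lee_wpmul2l// lee_fin mulr_ge0.
by rewrite muleC lee_wpmul2l// lee_fin.
Qed.

Let Wrho := @W_rho_le R p b0 mp b0_gt0 p_ge0 p_leb p_lin C0 C0E.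
Let Wrhos := @W_rho_sqrt_le R p b0 mp b0_gt0 p_ge0 p_leb p_lin C0 C0E.

Lemma TT_rho_bounds :
  [/\ T (fun a b c d => rho a * (g b * g c)%:E)%E <= Cq%:E,
      T (fun a b c d => rho b * (g b * g c)%:E)%E <= Cq%:E &
   [/\ T (fun a b c d => rho a * (g a * g b * g c)%:E)%E <= Cc%:E,
      T (fun a b c d => rho b * (g a * g b * g c)%:E)%E <= Cc%:E,
      T (fun a b c d => rho c * (g a * g b * g c)%:E)%E <= Cc%:E &
      T (fun a b c d => rho d * (g a * g b * g c)%:E)%E <= Cc%:E]]%E.
Proof.
have mr := @measurable_rho R; have r0 := @rho_ge0 R.
have sa := mh4_slota mr r0; have sb := mh4_slotb mr r0.
have sc := mh4_slotc mr r0; have sd := mh4_slotd mr r0.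
split.
- by apply: (TT_quad_bound sa) => x y z y0 z0; apply: Wrhos; rewrite ?inE ?eqxx.
- by apply: (TT_quad_bound sb) => x y z y0 z0; apply: Wrhos; rewrite ?inE ?eqxx ?orbT.
split.
- by apply: (TT_cub_bound sa) => x y z; apply: Wrho; rewrite !inE eqxx.
- by apply: (TT_cub_bound sb) => x y z; apply: Wrho; rewrite !inE eqxx ?orbT.
- by apply: (TT_cub_bound sc) => x y z; apply: Wrho; rewrite !inE eqxx ?orbT.
- by apply: (TT_cub_bound sd) => x y z; apply: Wrho; rewrite !inE eqxx ?orbT.
Qed.

Lemma TT_rho_gain : (T (fun a b c d => rho a * (Gam g a b c d)%:E)%E <= (Cq + Cc + Cc)%:E)%E.
Proof.
rewrite (TT_gain (@measurable_rho R) (@rho_ge0 R)); have [h1 _ [h2 _ _ h3]] := TT_rho_bounds.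
by rewrite (EFinD (Cq + Cc) Cc) (EFinD Cq Cc); exact: (leeD (leeD h1 h2) h3).
Qed.

Lemma TT_rho_loss : (T (fun a b c d => rho a * (Lam g a b c d)%:E)%E <= (Cq + Cc + Cc)%:E)%E.
Proof.
rewrite (TT_loss (@measurable_rho R) (@rho_ge0 R)); have [_ h1 [_ h2 h3 _]] := TT_rho_bounds.
by rewrite (EFinD (Cq + Cc) Cc) (EFinD Cq Cc); exact: (leeD (leeD h1 h2) h3).
Qed.

End Weak.

(** * The weak equation as gain minus loss *)

Section WeakDerivative.
Variable R : realType.
Notation RB := (measurableTypeR R).
Notation leb := (@lebesgue_measure R).
Variables (p : R -> R) (b0 : R).
Hypothesis mp : measurable_fun setT p.
Hypothesis b0_gt0 : 0 < b0.
Hypothesis p_ge0 : forall r, 0 <= p r.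
Hypothesis p_leb : forall r, p r <= b0.
Hypothesis p_lin : forall r : R, 0 <= r -> p r <= b0 * r.
Variable C0 : R.
Hypothesis C0E : C0 = 32 * b0 ^+ 2.
Let C0_gt0 : 0 < C0. Proof. by rewrite C0E mulr_gt0// exprn_gt0. Qed.

Lemma W_supp (x y z : R) : ~ (0 <= x <= y + z) -> W p x y z = 0.
Proof.
move=> hx; have [x0|x0] := ltP x 0.
  by apply: (W_neg mp b0_gt0 p_ge0 p_leb p_lin C0E); constructor 1.
have [xyz|xyz] := ltP (y + z) x; last by exfalso; apply: hx; rewrite x0.
by apply: (W_sum_le mp b0_gt0 p_ge0 p_leb p_lin C0E); exact: ltW.
Qed.

Lemma W_sqrt_bounded (y z : R) : exists2 M : R, 0 <= M & forall x, W p x y z * Num.sqrt x <= M.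
Proof.
have [y0|y0] := leP y 0; last first.
  have sy : 0 < Num.sqrt y by rewrite sqrtr_gt0.
  exists (C0 / Num.sqrt y) => [|x]; first by rewrite divr_ge0 ?ltW.
  have [h _ _] := W_rinv mp b0_gt0 p_ge0 p_leb p_lin C0E x y z.
  by rewrite ler_pdivlMr// -mulrA.
have [z0|z0] := leP z 0; last first.
  have sz : 0 < Num.sqrt z by rewrite sqrtr_gt0.
  exists (C0 / Num.sqrt z) => [|x]; first by rewrite divr_ge0 ?ltW.
  have [_ h _] := W_rinv mp b0_gt0 p_ge0 p_leb p_lin C0E x y z.
  by rewrite ler_pdivlMr// -mulrA.
exists 0 => // x; rewrite (_ : W p x y z = 0) ?mul0r//.
have [x0|x0] := ltP x 0; first by apply: (W_neg mp b0_gt0 p_ge0 p_leb p_lin C0E); constructor 1.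
by apply: (W_sum_le mp b0_gt0 p_ge0 p_leb p_lin C0E); lra.
Qed.

Section oneslice.
Variable k : R -> R.
Hypothesis mk : measurable_fun setT k.
Hypothesis k02 : forall x, 0 <= k x <= 2.

Lemma W_slice_integrable (y z : R) :
  leb.-integrable setT (EFin \o (fun x => W p x y z * Num.sqrt x * k x)).
Proof.
have [M M0 HM] := W_sqrt_bounded y z.
have W0 x : 0 <= W p x y z by exact: W_ge0.
have mW : measurable_fun setT (fun x : R => W p x y z * Num.sqrt x * k x).
  apply: measurable_funM => //; apply: measurable_funM.
    by apply: measurable_W => //; meas.
  exact: (@measurable_sqrt _ _ RB setT (fun x => x)).
apply/integrableP; split; first exact/measurable_EFinP.
apply: (@le_lt_trans _ _ (\int[leb]_x (M * 2 * \1_(`[0, y + z]%classic) x)%:E)%E).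
  apply: ge0_le_integral => //.
  - by apply: measurableT_comp => //; apply/measurable_EFinP.
  - by apply/measurable_EFinP; apply: measurable_funM => //; exact: measurable_indic.
  move=> x _ /=; have /andP[k0 k2] := k02 x.
  have s0 := sqrtr_ge0 x.
  rewrite lee_fin ger0_norm ?mulr_ge0// indicE; case: (boolP (x \in _)) => hx.
    by rewrite mulr1 ler_pM// mulr_ge0.
  rewrite W_supp ?mul0r ?mulr0//.
  by move/negP: hx; rewrite inE/= in_itv/=.
under eq_integral do rewrite EFinM.
rewrite ge0_integralZl_EFin//; [|by apply/measurable_EFinP/measurable_indic|by rewrite mulr_ge0].
have [yz|yz] := leP 0 (y + z); first by rewrite integral_indic_itv// -EFinM ltry.
rewrite (_ : `[0, y + z]%classic = set0); last first.
  by apply/seteqP; split => x //=; rewrite in_itv/= => /andP[? ?]; move: yz; rewrite ltNge => /negP; apply; lra.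
by under eq_integral do rewrite indic0/=; rewrite integral0 mule0.
Qed.

End oneslice.

Section test.
Variable phi : R -> R.
Hypothesis mphi : measurable_fun setT phi.
Hypothesis phi01 : forall x, 0 <= phi x <= 1.

Let hp (a b c d : R) := (phi a + phi d)%:E.
Let hm (a b c d : R) := (phi b + phi c)%:E.
Let pc d (S : measurableType d) (a : S -> R) : measurable_fun setT a ->
  measurable_fun setT (fun t => phi (a t)).
Proof. by move=> ma; apply: (measurableT_comp mphi). Qed.
Let phi0 x : 0 <= phi x. Proof. by case/andP: (phi01 x). Qed.
Let hhp : mh4 hp.
Proof.
split; last by move=> *; rewrite lee_fin addr_ge0.
by apply/measurable_EFinP; apply: measurable_funD; apply: pc; meas.
Qed.
Let hhm : mh4 hm.
Proof.
split; last by move=> *; rewrite lee_fin addr_ge0.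
by apply/measurable_EFinP; apply: measurable_funD; apply: pc; meas.
Qed.

Let Kop_rearr (W0 s a b b' c d : R) : W0 * b = W0 * b' ->
  W0 * (a + b - c - d) * s = W0 * s * (a + b' - (c + d)).
Proof.
move=> e; transitivity (s * (W0 * a + W0 * b - W0 * c - W0 * d)); first by ring.
by rewrite e; ring.
Qed.

Lemma Jop_Qd (y z : R) : [/\ Qd p hp y z \is a fin_num, Qd p hm y z \is a fin_num &
  Jop p phi y z = 2^-1 * (fine (Qd p hp y z) - fine (Qd p hm y z))].
Proof.
have mr : measurable_fun setT (fun x : R => y + z - x) by meas.
have k1m : measurable_fun setT (fun x => phi x + phi (y + z - x)).
  by apply: measurable_funD => //; exact: pc.
have k1b x : 0 <= phi x + phi (y + z - x) <= 2.
  by have /andP[? ?] := phi01 x; have /andP[? ?] := phi01 (y + z - x); apply/andP; split; lra.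
have k2b (x : R) : 0 <= phi y + phi z <= 2.
  by have /andP[? ?] := phi01 y; have /andP[? ?] := phi01 z; apply/andP; split; lra.
have k2m : measurable_fun setT (fun x : R => phi y + phi z) by exact: measurable_cst.
have i1 := @W_slice_integrable (fun x => phi x + phi (y + z - x)) k1m k1b y z.
have i2 := @W_slice_integrable (fun x => phi y + phi z) k2m k2b y z.
have e1 : (Qd p hp y z = \int[leb]_x (W p x y z * Num.sqrt x * (phi x + phi (y + z - x)))%:E)%E by [].
have e2 : (Qd p hm y z = \int[leb]_x (W p x y z * Num.sqrt x * (phi y + phi z))%:E)%E by [].
have f1 : Qd p hp y z \is a fin_num by rewrite e1; exact: (integrable_fin_num measurableT i1).
have f2 : Qd p hm y z \is a fin_num by rewrite e2; exact: (integrable_fin_num measurableT i2).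
split => //; rewrite /Jop; congr (_ * _); rewrite -fineB// e1 e2 -integralB_EFin//.
rewrite /Rintegral integral_mkcond; congr fine; apply: eq_integral => x _.
rewrite -EFinB -mulrBr patchE; case: ifPn => hx.
  congr EFin; rewrite /Kop.
  have e := @xstar_supp R p b0 mp b0_gt0 p_ge0 p_leb p_lin C0 C0E phi x y z.
  exact: Kop_rearr e.
rewrite W_supp ?mul0r//.
by move/negP: hx; rewrite inE/= in_itv/=.
Qed.

Variable mu : {finite_measure set RB -> \bar R}.
Variable w : R -> R.
Hypothesis mw : measurable_fun setT w.
Hypothesis w0 : forall x, 0 <= w x.
Hypothesis wneg : forall x, x <= 0 -> w x = 0.
Hypothesis muw : forall psi : R -> \bar R, measurable_fun setT psi -> (forall x, 0 <= psi x)%E ->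
  (\int[mu]_x psi x = \int[leb]_x (psi x * (w x)%:E))%E.
Variables (N K E1 : R).
Hypothesis muN : mu setT = N%:E.
Hypothesis muK : (\int[mu]_x rinv x <= K%:E)%E.
Hypothesis muE1 : (\int[mu]_x (1 + Num.max x 0)%:E = E1%:E)%E.
Notation g := (dq w).
Notation T := (TT p).

Let psi (x : R) := (phi x)%:E.
Let mpsi : measurable_fun setT psi. Proof. exact/measurable_EFinP. Qed.
Let psi0 x : (0 <= psi x)%E. Proof. by rewrite lee_fin. Qed.
Let psir x : (psi x <= rho x)%E.
Proof. by apply: le_trans (rho_ge1 x); rewrite lee_fin; case/andP: (phi01 x). Qed.

Let bnds := @TT_rho_bounds R p b0 mp b0_gt0 p_ge0 p_leb p_lin C0 C0E mu w mw w0 wneg muw N K E1 muN muK muE1.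

Let fin (h h' : R -> R -> R -> R -> \bar R) (C : R) : mh4 h -> mh4 h' ->
  (forall a b c d, h a b c d <= h' a b c d)%E -> (T h' <= C%:E)%E -> T h \is a fin_num.
Proof.
move=> hh hh' le lC; rewrite ge0_fin_numE; last exact: TT_ge0.
exact: (le_lt_trans (le_trans (TT_le mp hh hh' le) lC) (ltry _)).
Qed.

Let mr := @measurable_rho R.
Let r0 := @rho_ge0 R.
Let bc := @mh4_bc R w mw w0.
Let abc := @mh4_abc R w mw w0.
Let gbc0 b c : (0 <= (g b * g c)%:E)%E.
Proof. by rewrite lee_fin mulr_ge0// divr_ge0 ?sqrtr_ge0. Qed.
Let gabc0 a b c : (0 <= (g a * g b * g c)%:E)%E.
Proof. by rewrite lee_fin !mulr_ge0// divr_ge0 ?sqrtr_ge0. Qed.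

Let q1 := T (fun a b c d => psi a * (g b * g c)%:E)%E.
Let l1 := T (fun a b c d => psi b * (g b * g c)%:E)%E.
Let ca := T (fun a b c d => psi a * (g a * g b * g c)%:E)%E.
Let cb := T (fun a b c d => psi b * (g a * g b * g c)%:E)%E.
Let cc := T (fun a b c d => psi c * (g a * g b * g c)%:E)%E.
Let cd := T (fun a b c d => psi d * (g a * g b * g c)%:E)%E.

Let q1f : q1 \is a fin_num.
Proof.
case: bnds => b1 _ _; apply: (fin _ _ _ b1); [exact: bc (mh4_slota mpsi psi0)|exact: bc (mh4_slota mr r0)|].
by move=> a b c d; exact: lee_wpmul2r.
Qed.
Let l1f : l1 \is a fin_num.
Proof.
case: bnds => _ b1 _; apply: (fin _ _ _ b1); [exact: bc (mh4_slotb mpsi psi0)|exact: bc (mh4_slotb mr r0)|].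
by move=> a b c d; exact: lee_wpmul2r.
Qed.
Let caf : ca \is a fin_num.
Proof.
case: bnds => _ _ [b1 _ _ _]; apply: (fin _ _ _ b1); [exact: abc (mh4_slota mpsi psi0)|exact: abc (mh4_slota mr r0)|].
by move=> a b c d; exact: lee_wpmul2r.
Qed.
Let cbf : cb \is a fin_num.
Proof.
case: bnds => _ _ [_ b1 _ _]; apply: (fin _ _ _ b1); [exact: abc (mh4_slotb mpsi psi0)|exact: abc (mh4_slotb mr r0)|].
by move=> a b c d; exact: lee_wpmul2r.
Qed.
Let ccf : cc \is a fin_num.
Proof.
case: bnds => _ _ [_ _ b1 _]; apply: (fin _ _ _ b1); [exact: abc (mh4_slotc mpsi psi0)|exact: abc (mh4_slotc mr r0)|].
by move=> a b c d; exact: lee_wpmul2r.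
Qed.
Let cdf : cd \is a fin_num.
Proof.
case: bnds => _ _ [_ _ _ b1]; apply: (fin _ _ _ b1); [exact: abc (mh4_slotd mpsi psi0)|exact: abc (mh4_slotd mr r0)|].
by move=> a b c d; exact: lee_wpmul2r.
Qed.

Let two (h h' : R -> R -> R -> R -> \bar R) (k : R -> R -> R -> R -> \bar R) :
  mh4 h -> mh4 h' -> (forall a b c d, k a b c d = h a b c d + h' a b c d)%E -> T k = (T h + T h')%E.
Proof. by move=> hh hh' e; apply: (etrans (TT_ext p e)); exact: (TTD mp hh hh'). Qed.

Let distr (a b : R) (X : \bar R) : 0 <= a -> 0 <= b -> ((a + b)%:E * X = a%:E * X + b%:E * X)%E.
Proof. by move=> a0 b1; rewrite EFinD ge0_muleDl ?lee_fin. Qed.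

Let iJp : (\int[(mu \x mu)%E]_q Qd p hp q.1 q.2 = q1 + q1)%E.
Proof.
apply: (etrans (esym (TT_quad mp mw w0 wneg muw hhp))).
apply: (etrans (two (bc (mh4_slota mpsi psi0)) (bc (mh4_slotd mpsi psi0)) _)).
  by move=> a b c d; apply: distr.
exact: (f_equal2 adde (erefl q1) (@TT_quad_d R p b0 mp b0_gt0 p_ge0 p_leb p_lin C0 C0E w mw w0 psi mpsi psi0)).
Qed.
Let iJm : (\int[(mu \x mu)%E]_q Qd p hm q.1 q.2 = l1 + l1)%E.
Proof.
apply: (etrans (esym (TT_quad mp mw w0 wneg muw hhm))).
apply: (etrans (two (bc (mh4_slotb mpsi psi0)) (bc (mh4_slotc mpsi psi0)) _)).
  by move=> a b c d; apply: distr.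
exact: (f_equal2 adde (erefl l1) (@TT_quad_c R p b0 mp b0_gt0 p_ge0 p_leb p_lin C0 C0E w mw w0 psi mpsi psi0)).
Qed.
Let Kp (x y z : R) := ((W p x y z)%:E * hp x y z (y + z - x)%R)%E.
Let Km (x y z : R) := ((W p x y z)%:E * hm x y z (y + z - x)%R)%E.
Let iKp : (\int[((mu \x mu) \x mu)%E]_q Kp q.1.1 q.1.2 q.2 = ca + cd)%E.
Proof.
apply: (etrans (esym (TT_cub mp mw w0 wneg muw hhp))).
apply: (two (abc (mh4_slota mpsi psi0)) (abc (mh4_slotd mpsi psi0))).
by move=> a b c d; apply: distr.
Qed.
Let iKm : (\int[((mu \x mu) \x mu)%E]_q Km q.1.1 q.1.2 q.2 = cb + cc)%E.
Proof.
apply: (etrans (esym (TT_cub mp mw w0 wneg muw hhm))).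
apply: (two (abc (mh4_slotb mpsi psi0)) (abc (mh4_slotc mpsi psi0))).
by move=> a b c d; apply: distr.
Qed.

Let integ d (S : measurableType d) (m : {measure set S -> \bar R}) (f : S -> \bar R) :
  measurable_fun setT f -> (forall x, 0 <= f x)%E -> (\int[m]_x f x)%E \is a fin_num ->
  m.-integrable setT f.
Proof.
move=> mf f0 ff; apply/integrableP; split => //.
under eq_integral do rewrite gee0_abs//.
by rewrite -ge0_fin_numE// integral_ge0.
Qed.

(** Each slot integral is finite, being dominated by its version with [rho], so the signed integrals
    of [Jop] and [Kop] may be split. [Jop] yields one quadratic gain and one quadratic loss, each
    counted twice and halved; [Kop] yields the four cubic slots. *)
Lemma weak_deriv :
  fine (\int[(mu \x mu)%E]_q (Jop p phi q.1 q.2)%:E)%E +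
  fine (\int[((mu \x mu) \x mu)%E]_q (Kop p phi q.1.1 q.1.2 q.2)%:E)%E =
  fine (T (fun a b c d => psi a * (Gam g a b c d)%:E)%E) -
  fine (T (fun a b c d => psi a * (Lam g a b c d)%:E)%E).
Proof.
have i1 : ((mu \x mu)%E).-integrable setT (fun q : RB * RB => Qd p hp q.1 q.2).
  by apply: integ; [exact: measurable_Qd|move=> q; exact: Qd_ge0|rewrite iJp fin_numD q1f].
have i2 : ((mu \x mu)%E).-integrable setT (fun q : RB * RB => Qd p hm q.1 q.2).
  by apply: integ; [exact: measurable_Qd|move=> q; exact: Qd_ge0|rewrite iJm fin_numD l1f].
have addf (a b : \bar R) : a \is a fin_num -> b \is a fin_num -> (a + b)%E \is a fin_num.
  by move=> h1 h2; rewrite fin_numD h1 h2.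
have Kp0 x y z : (0 <= Kp x y z)%E.
  by rewrite mule_ge0 ?lee_fin ?addr_ge0//; exact: W_ge0.
have Km0 x y z : (0 <= Km x y z)%E.
  by rewrite mule_ge0 ?lee_fin ?addr_ge0//; exact: W_ge0.
have i3 : (((mu \x mu) \x mu)%E).-integrable setT (fun q : RB * RB * RB => Kp q.1.1 q.1.2 q.2).
  have m3 : measurable_fun setT (fun q : RB * RB * RB => Kp q.1.1 q.1.2 q.2) := measurable_Wh mp hhp.
  have f3 : (\int[((mu \x mu) \x mu)%E]_q Kp q.1.1 q.1.2 q.2)%E \is a fin_num.
    have f := addf _ _ caf cdf.
    exact: (eq_ind_r (fun X : \bar R => X \is a fin_num) f iKp).
  exact: (integ m3 (fun q => Kp0 _ _ _) f3).
have i4 : (((mu \x mu) \x mu)%E).-integrable setT (fun q : RB * RB * RB => Km q.1.1 q.1.2 q.2).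
  have m3 : measurable_fun setT (fun q : RB * RB * RB => Km q.1.1 q.1.2 q.2) := measurable_Wh mp hhm.
  have f3 : (\int[((mu \x mu) \x mu)%E]_q Km q.1.1 q.1.2 q.2)%E \is a fin_num.
    have f := addf _ _ cbf ccf.
    exact: (eq_ind_r (fun X : \bar R => X \is a fin_num) f iKm).
  exact: (integ m3 (fun q => Km0 _ _ _) f3).
have eJ : (\int[(mu \x mu)%E]_q (Jop p phi q.1 q.2)%:E = 2^-1%:E * ((q1 + q1) - (l1 + l1)))%E.
  have iB := integrableB measurableT i1 i2.
  apply: (etrans _ (etrans (integralZl measurableT iB 2^-1) (f_equal2 mule erefl
    (etrans (integralB measurableT i1 i2) (f_equal2 (fun a b => a - b)%E iJp iJm))))).
  apply: eq_integral => q _; have [f1 f2 ->] := Jop_Qd q.1 q.2.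
  by rewrite EFinM EFinB !fineK.
have eK : (\int[((mu \x mu) \x mu)%E]_q (Kop p phi q.1.1 q.1.2 q.2)%:E = (ca + cd) - (cb + cc))%E.
  apply: (etrans _ (etrans (integralB measurableT i3 i4) (f_equal2 (fun a b => a - b)%E iKp iKm))).
  apply: eq_integral => -[[x y] z] _ /=.
  rewrite /Kp /Km /hp /hm -!EFinM -EFinB; congr EFin; rewrite /Kop.
  have e := @xstar_supp R p b0 mp b0_gt0 p_ge0 p_leb p_lin C0 C0E phi x y z.
  by rewrite !mulrBr mulrDr e; ring.
have key (q l a b c d J K0 G L : \bar R) : q \is a fin_num -> l \is a fin_num -> a \is a fin_num ->
    b \is a fin_num -> c \is a fin_num -> d \is a fin_num ->
    J = (2^-1%:E * ((q + q) - (l + l)))%E -> K0 = ((a + d) - (b + c))%E ->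
    G = (q + a + d)%E -> L = (l + b + c)%E -> fine J + fine K0 = fine G - fine L.
  move=> qf lf af bf cf df -> -> -> ->.
  move: q l a b c d qf lf af bf cf df => [?||] [?||] [?||] [?||] [?||] [?||] //= _ _ _ _ _ _.
  lra.
have eG := @TT_gain R p b0 mp b0_gt0 p_ge0 p_leb p_lin C0 C0E w mw w0 psi mpsi psi0.
have eL := @TT_loss R p b0 mp b0_gt0 p_ge0 p_leb p_lin C0 C0E w mw w0 psi mpsi psi0.
exact: (key _ _ _ _ _ _ _ _ _ _ q1f l1f caf cbf ccf cdf eJ eK eG eL).
Qed.

End test.
End WeakDerivative.

(** * Integration in time and the equation at almost every point *)

Section TimeIntegration.
Variable R : realType.
Notation RB := (measurableTypeR R).
Notation leb := (@lebesgue_measure R).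
Variable p : R -> R.
Hypothesis mp : measurable_fun setT p.
Variable w : R -> R -> R.
Hypothesis mw : measurable_fun setT (fun q : RB * RB => w q.1 q.2).
Hypothesis w0 : forall x t, 0 <= w x t.
Notation g t := (dq (w^~ t)).

Let g0 t x : 0 <= g t x. Proof. by rewrite divr_ge0 ?sqrtr_ge0. Qed.

Let mgc d (S : measurableType d) (a t : S -> R) : measurable_fun setT a -> measurable_fun setT t ->
  measurable_fun setT (fun s => g (t s) (a s)).
Proof.
move=> ma mt; apply: measurable_funM; last by apply: measurable_inv; apply: measurable_sqrt.
apply: (measurableT_comp mw (g := fun s => (a s, t s))).
exact: measurable_fun_pair.
Qed.

Definition indc (t s : R) : R := \1_(`[0, t]%classic) s.
Lemma indc01 t s : 0 <= indc t s <= 1.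
Proof. by rewrite /indc indicE; case: (_ \in _); rewrite !lexx ler01. Qed.
Lemma indcE (t s : R) : indc t s = if 0 <= s <= t then 1 else 0.
Proof.
rewrite /indc indicE; case: ifPn => h; first by rewrite mem_set//= in_itv.
by rewrite memNset//= in_itv/=; exact/negP.
Qed.

Lemma integral_indc (t : R) (f : R -> \bar R) :
  (\int[leb]_(s in `[0%R, t]) f s = \int[leb]_s (f s * (indc t s)%:E))%E.
Proof.
rewrite integral_mkcond; apply: eq_integral => s _; rewrite patchE indcE.
case: ifPn => h; first by move: h; rewrite inE/= in_itv/= => ->; rewrite mule1.
by move: h; rewrite notin_setE/= in_itv/= => /negP/negbTE->; rewrite mule0.
Qed.

Lemma measurable_indc : measurable_fun setT (fun q : RB * RB => indc q.1 q.2).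
Proof.
under eq_fun do rewrite indcE.
by apply: measurable_fun_ifT; [apply: measurable_and; [apply: measurable_fun_ler|apply: measurable_fun_ler]; meas|exact: measurable_cst|exact: measurable_cst].
Qed.

Section kernel.
(** Stands for [Gam] or [Lam]; gain and loss are treated separately so that all integrands stay
    nonnegative. *)
Variable Gk : (R -> R) -> R -> R -> R -> R -> R.
Hypothesis Gk0 : forall t a b c d, 0 <= Gk (g t) a b c d.
Hypothesis mGk : forall d (S : measurableType d) (t a b c e : S -> R),
  measurable_fun setT t -> measurable_fun setT a -> measurable_fun setT b ->
  measurable_fun setT c -> measurable_fun setT e ->
  measurable_fun setT (fun s => Gk (g (t s)) (a s) (b s) (c s) (e s)).

(** The gain or loss half of the integrand of [Qop]. Its integral [qk] is a rate at [(x, t)], [Ak]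
    accumulates this rate over [[0, t]], and [ak] restores the factor [sqrt x] of the Lebesgue
    density. *)
Definition Zk (x t y z : R) : \bar R :=
  (W p x y z * Gk (g t) x y z (y + z - x) * Num.sqrt y * Num.sqrt z)%:E.
Definition qk (x t : R) : \bar R := (\int[leb]_y \int[leb]_z Zk x t y z)%E.

Lemma Zk0 x t y z : (0 <= Zk x t y z)%E.
Proof. by rewrite lee_fin !mulr_ge0 ?sqrtr_ge0//; exact: W_ge0. Qed.

Lemma mZk d (S : measurableType d) (x t y z : S -> R) :
  measurable_fun setT x -> measurable_fun setT t -> measurable_fun setT y -> measurable_fun setT z ->
  measurable_fun setT (fun s => Zk (x s) (t s) (y s) (z s)).
Proof.
move=> mx mt my mz; apply/measurable_EFinP; apply: measurable_funM; last by meas.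
apply: measurable_funM; last by meas.
by apply: measurable_funM; [apply: measurable_W|apply: mGk => //; meas].
Qed.

Lemma mZk1 d (S : measurableType d) (x t y : S -> R) :
  measurable_fun setT x -> measurable_fun setT t -> measurable_fun setT y ->
  measurable_fun setT (fun s => \int[leb]_z Zk (x s) (t s) (y s) z)%E.
Proof.
move=> mx mt my.
apply: (@measurable_fun_fubini_tonelli_F _ _ S RB R leb (fun q => Zk (x q.1) (t q.1) (y q.1) q.2)).
  by apply: mZk; [apply: (measurableT_comp mx)|apply: (measurableT_comp mt)|apply: (measurableT_comp my)|]; meas.
by move=> q; exact: Zk0.
Qed.

Lemma mqk d (S : measurableType d) (x t : S -> R) :
  measurable_fun setT x -> measurable_fun setT t -> measurable_fun setT (fun s => qk (x s) (t s)).
Proof.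
move=> mx mt.
apply: (@measurable_fun_fubini_tonelli_F _ _ S RB R leb (fun q => \int[leb]_z Zk (x q.1) (t q.1) q.2 z)%E).
  by apply: mZk1; [apply: (measurableT_comp mx)|apply: (measurableT_comp mt)|]; meas.
by move=> q; apply: integral_ge0 => z _; exact: Zk0.
Qed.

Lemma qk0 x t : (0 <= qk x t)%E.
Proof. by apply: integral_ge0 => y _; apply: integral_ge0 => z _; exact: Zk0. Qed.

Lemma TT_qk (psi : R -> \bar R) (t : R) : (forall x, 0 <= psi x)%E ->
  TT p (fun a b c d => psi a * (Gk (g t) a b c d)%:E)%E =
  (\int[leb]_x (psi x * (Num.sqrt x)%:E * qk x t))%E.
Proof.
move=> psi0; have fac (x : R) : (\int[leb]_y \int[leb]_z ((Bk p x y z)%:E * (psi x * (Gk (g t) x y z (y + z - x))%:E)) =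
   psi x * (Num.sqrt x)%:E * qk x t)%E.
  have k0 : (0 <= psi x * (Num.sqrt x)%:E)%E by rewrite mule_ge0// lee_fin sqrtr_ge0.
  have s1 : (psi x * (Num.sqrt x)%:E * qk x t =
      \int[leb]_y (psi x * (Num.sqrt x)%:E * \int[leb]_z Zk x t y z))%E.
    apply/esym; apply: ge0_integralZl; do ?[exact: measurableT|exact: k0].
      by apply: mZk1; meas.
    by move=> y _; apply: integral_ge0 => z _; exact: Zk0.
  rewrite s1; apply: eq_integral => y _.
  have s2 : (psi x * (Num.sqrt x)%:E * \int[leb]_z Zk x t y z =
      \int[leb]_z (psi x * (Num.sqrt x)%:E * Zk x t y z))%E.
    apply/esym; apply: ge0_integralZl; do ?[exact: measurableT|exact: k0].
      by apply: mZk; meas.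
    by move=> z _; exact: Zk0.
  rewrite s2; apply: eq_integral => z _.
  rewrite /Zk muleCA -EFinM -muleA -EFinM; congr (_ * _%:E)%E; rewrite /Bk; ring.
by apply: eq_integral => x _; exact: fac.
Qed.

Lemma TT_time_ge0 (t : R) (psi : R -> \bar R) : (forall x, 0 <= psi x)%E ->
  (0 <= TT p (fun a b c d => psi a * (Gk (g t) a b c d)%:E))%E.
Proof.
move=> psi0; rewrite (TT_qk t psi0); apply: integral_ge0 => x _.
by rewrite !mule_ge0 ?qk0// lee_fin sqrtr_ge0.
Qed.

Let mks (psi : R -> \bar R) : measurable_fun setT psi ->
  measurable_fun setT (fun x : R => psi x * (Num.sqrt x)%:E)%E.
Proof.
by move=> m; apply: emeasurable_funM => //; apply/measurable_EFinP; exact: (@measurable_sqrt _ _ RB setT (fun x => x)).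
Qed.

Lemma measurable_TTk_time (psi : R -> \bar R) : measurable_fun setT psi -> (forall x, 0 <= psi x)%E ->
  measurable_fun setT (fun s : R => TT p (fun a b c d => psi a * (Gk (g s) a b c d)%:E)%E).
Proof.
move=> mpsi psi0.
rewrite (_ : (fun s => _) = (fun s => \int[leb]_x (psi x * (Num.sqrt x)%:E * qk x s))%E).
  apply: (@measurable_fun_fubini_tonelli_F _ _ RB RB R leb (fun q => psi q.2 * (Num.sqrt q.2)%:E * qk q.2 q.1)%E).
    apply: emeasurable_funM; first exact: (measurableT_comp (mks mpsi) (@measurable_snd _ _ RB RB)).
    by apply: mqk; meas.
  by move=> q; rewrite !mule_ge0 ?qk0// lee_fin sqrtr_ge0.
by apply/funext => s; exact: TT_qk.
Qed.

Lemma TT_time_le (t : R) (psi psi' : R -> \bar R) : measurable_fun setT psi -> (forall x, 0 <= psi x)%E ->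
  measurable_fun setT psi' -> (forall x, 0 <= psi' x)%E -> (forall x, psi x <= psi' x)%E ->
  (TT p (fun a b c d => psi a * (Gk (g t) a b c d)%:E) <=
   TT p (fun a b c d => psi' a * (Gk (g t) a b c d)%:E))%E.
Proof.
move=> m h m' h' le; rewrite (TT_qk t h) (TT_qk t h').
have s0 (x : R) : (0 <= (Num.sqrt x)%:E :> \bar R)%E by rewrite lee_fin sqrtr_ge0.
apply: ge0_le_integral => //.
- by move=> x _; rewrite !mule_ge0 ?qk0.
- by apply: emeasurable_funM; [exact: mks|apply: mqk; meas].
- by apply: emeasurable_funM; [exact: mks|apply: mqk; meas].
by move=> x _; apply: lee_wpmul2r; [exact: qk0|apply: lee_wpmul2r].
Qed.

Definition Ak (t x : R) : \bar R := (\int[leb]_s (qk x s * (indc t s)%:E))%E.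

Lemma mAk d (S : measurableType d) (t x : S -> R) : measurable_fun setT t -> measurable_fun setT x ->
  measurable_fun setT (fun s => Ak (t s) (x s)).
Proof.
move=> mt mx.
apply: (@measurable_fun_fubini_tonelli_F _ _ S RB R leb (fun q => qk (x q.1) q.2 * (indc (t q.1) q.2)%:E)%E).
  apply: emeasurable_funM; first by apply: mqk; [apply: (measurableT_comp mx)|]; meas.
  apply/measurable_EFinP; apply: (measurableT_comp measurable_indc (g := fun q => (t q.1, q.2))).
  by apply: measurable_fun_pair; [apply: (measurableT_comp mt)|]; meas.
by move=> q; rewrite mule_ge0 ?qk0// lee_fin; case/andP: (indc01 (t q.1) q.2).
Qed.

Lemma Ak0 t x : (0 <= Ak t x)%E.
Proof. by apply: integral_ge0 => s _; rewrite mule_ge0 ?qk0// lee_fin; case/andP: (indc01 t s). Qed.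

(** Tonelli in [x] and time; the time interval enters as the factor [indc] so that both domains are
    the whole line. *)
Lemma integral_Ak (psi : R -> \bar R) (t : R) : measurable_fun setT psi -> (forall x, 0 <= psi x)%E ->
  (\int[leb]_x (psi x * (Num.sqrt x)%:E * Ak t x) =
   \int[leb]_s (TT p (fun a b c d => psi a * (Gk (g s) a b c d)%:E) * (indc t s)%:E))%E.
Proof.
move=> mpsi psi0.
have i0 s : (0 <= (indc t s)%:E)%E by rewrite lee_fin; case/andP: (indc01 t s).
have k0 x : (0 <= psi x * (Num.sqrt x)%:E)%E by rewrite mule_ge0// lee_fin sqrtr_ge0.
have mi : measurable_fun setT (fun s : R => (indc t s)%:E).
  apply/measurable_EFinP; apply: (measurableT_comp measurable_indc (g := fun s => (t, s))).
  by apply: measurable_fun_pair; meas.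
have mk : measurable_fun setT (fun x : R => psi x * (Num.sqrt x)%:E)%E.
  by apply: emeasurable_funM => //; apply/measurable_EFinP; exact: (@measurable_sqrt _ _ RB setT (fun x => x)).
pose H (q : RB * RB) := (psi q.1 * (Num.sqrt q.1)%:E * (qk q.1 q.2 * (indc t q.2)%:E))%E.
have mH : measurable_fun setT H.
  apply: emeasurable_funM; first exact: (measurableT_comp mk (@measurable_fst _ _ RB RB)).
  apply: emeasurable_funM; first by apply: mqk; meas.
  exact: (measurableT_comp mi (@measurable_snd _ _ RB RB)).
have H0 q : (0 <= H q)%E by rewrite mule_ge0// mule_ge0 ?qk0.
have e1 x : (psi x * (Num.sqrt x)%:E * Ak t x =
    \int[leb]_s (psi x * (Num.sqrt x)%:E * (qk x s * (indc t s)%:E)))%E.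
  apply/esym; apply: ge0_integralZl; do ?[exact: measurableT|exact: k0].
    by apply: emeasurable_funM => //; apply: mqk; meas.
  by move=> s _; rewrite mule_ge0 ?qk0.
have e2 s : (TT p (fun a b c d => psi a * (Gk (g s) a b c d)%:E) * (indc t s)%:E =
    \int[leb]_x H (x, s))%E.
  rewrite (TT_qk s psi0).
  have z : (\int[leb]_x (psi x * (Num.sqrt x)%:E * qk x s * (indc t s)%:E) =
     \int[leb]_x (psi x * (Num.sqrt x)%:E * qk x s) * (indc t s)%:E)%E.
    apply: ge0_integralZr; do ?[exact: measurableT|exact: i0].
      by apply: emeasurable_funM => //; apply: mqk; meas.
    by move=> x _; rewrite mule_ge0 ?qk0.
  by rewrite -z; apply: eq_integral => x _; rewrite /H/= muleA.
transitivity (\int[leb]_x \int[leb]_s H (x, s))%E.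
  by apply: eq_integral => x _; exact: e1.
transitivity (\int[leb]_s \int[leb]_x H (x, s))%E; last first.
  by apply: eq_integral => s _; rewrite e2.
exact: (@fubini_tonelli _ _ RB RB R leb leb H mH H0).
Qed.

Lemma integral_Ak_le (psi : R -> \bar R) (t C : R) : measurable_fun setT psi -> (forall x, 0 <= psi x)%E ->
  0 <= t -> 0 <= C ->
  (forall s : R, 0 <= s <= t -> (TT p (fun a b c d => psi a * (Gk (g s) a b c d)%:E) <= C%:E)%E) ->
  (\int[leb]_x (psi x * (Num.sqrt x)%:E * Ak t x) <= (C * t)%:E)%E.
Proof.
move=> mpsi psi0 t0 C00 hC; rewrite integral_Ak//.
have i0 s : (0 <= (indc t s)%:E)%E by rewrite lee_fin; case/andP: (indc01 t s).
have mi : measurable_fun setT (fun s : R => (indc t s)%:E).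
  apply/measurable_EFinP; apply: (measurableT_comp measurable_indc (g := fun s => (t, s))).
  by apply: measurable_fun_pair; meas.
have k0 x : (0 <= psi x * (Num.sqrt x)%:E)%E by rewrite mule_ge0// lee_fin sqrtr_ge0.
have mk : measurable_fun setT (fun x : R => psi x * (Num.sqrt x)%:E)%E.
  by apply: emeasurable_funM => //; apply/measurable_EFinP; exact: (@measurable_sqrt _ _ RB setT (fun x => x)).
have mT : measurable_fun setT (fun s : R => TT p (fun a b c d => psi a * (Gk (g s) a b c d)%:E)%E).
  rewrite (_ : (fun s => _) = (fun s => \int[leb]_x (psi x * (Num.sqrt x)%:E * qk x s))%E).
    apply: (@measurable_fun_fubini_tonelli_F _ _ RB RB R leb (fun q => psi q.2 * (Num.sqrt q.2)%:E * qk q.2 q.1)%E).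
      apply: emeasurable_funM; first exact: (measurableT_comp mk (@measurable_snd _ _ RB RB)).
      by apply: mqk; meas.
    by move=> q; rewrite mule_ge0 ?qk0.
  by apply/funext => s; exact: TT_qk.
apply: (@le_trans _ _ (\int[leb]_s (C%:E * (indc t s)%:E))%E).
  apply: ge0_le_integral => //.
  - move=> s _; rewrite mule_ge0// (TT_qk s psi0); apply: integral_ge0 => x _.
    by rewrite mule_ge0 ?qk0.
  - exact: emeasurable_funM.
  - by apply: emeasurable_funM => //; exact: measurable_cst.
  move=> s _; rewrite indcE; case: ifPn => hs; last by rewrite !mule0.
  by rewrite !mule1; exact: hC.
rewrite ge0_integralZl_EFin// (integral_indic_itv t0) subr0 -EFinM.
exact: lexx.
Qed.

Section bounded.
Variables (t C : R).
Hypothesis t0 : 0 <= t.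
Hypothesis C00 : 0 <= C.
Hypothesis hC : forall s : R, 0 <= s <= t ->
  (TT p (fun a b c d => rho a * (Gk (g s) a b c d)%:E) <= C%:E)%E.

Let mr := @measurable_rho R.
Let r0 := @rho_ge0 R.
Let ib := integral_Ak_le mr r0 t0 C00 hC.
Let ms : measurable_fun setT (fun x : R => (Num.sqrt x)%:E).
Proof. by apply/measurable_EFinP; exact: (@measurable_sqrt _ _ RB setT (fun x => x)). Qed.
Let mA : measurable_fun setT (Ak t).
Proof. by apply: mAk; meas. Qed.
Let s0 x : (0 <= (Num.sqrt x)%:E :> \bar R)%E. Proof. by rewrite lee_fin sqrtr_ge0. Qed.
Let mrA : measurable_fun setT (fun x : R => rho x * (Num.sqrt x)%:E * Ak t x)%E.
Proof. by apply: emeasurable_funM => //; exact: emeasurable_funM. Qed.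
Let rA0 x : (0 <= rho x * (Num.sqrt x)%:E * Ak t x)%E.
Proof. by rewrite !mule_ge0// Ak0. Qed.

(** The integral of [Ak t] against [rho x * sqrt x] is finite, and this weight is positive for
    [x > 0]. *)
Lemma Ak_ae_fin : {ae leb, forall x, 0 < x -> Ak t x \is a fin_num}.
Proof.
have i : leb.-integrable setT (fun x : R => rho x * (Num.sqrt x)%:E * Ak t x)%E.
  apply/integrableP; split => //; under eq_integral do rewrite gee0_abs//.
  exact: (le_lt_trans ib (ltry _)).
apply: (ae_imp (integrable_ae measurableT i)) => x h x0.
have := h I; rewrite ge0_fin_numE// => h1.
rewrite ge0_fin_numE ?Ak0// ltNge leye_eq; apply/negP => /eqP h2.
move: h1; rewrite h2 gt0_muley ?ltxx//.
rewrite mule_gt0//; first by apply: lt_le_trans (rho_ge1 x); exact: lte01.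
by rewrite lte_fin sqrtr_gt0.
Qed.

Definition ak (x : R) := Num.sqrt x * fine (Ak t x).

Lemma ak0 x : 0 <= ak x.
Proof. by rewrite mulr_ge0 ?sqrtr_ge0// fine_ge0// Ak0. Qed.

Lemma mak : measurable_fun setT ak.
Proof.
apply: measurable_funM; first exact: (@measurable_sqrt _ _ RB setT (fun x => x)).
exact: measurableT_comp.
Qed.

Lemma Ak_int (phi : R -> R) : measurable_fun setT phi -> (forall x, 0 <= phi x) ->
  (\int[leb]_x (phi x * ak x)%:E = \int[leb]_x ((phi x)%:E * (Num.sqrt x)%:E * Ak t x))%E.
Proof.
move=> mphi phi0; apply: ge0_ae_eq_integral => //.
- by apply/measurable_EFinP; apply: measurable_funM => //; exact: mak.
- by apply: emeasurable_funM => //; apply: emeasurable_funM => //; apply/measurable_EFinP.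
- by move=> x _; rewrite lee_fin mulr_ge0// ak0.
- by move=> x _; rewrite !mule_ge0 ?lee_fin// Ak0.
apply: (ae_imp Ak_ae_fin) => x h _; rewrite /ak.
have [x0|x0] := leP x 0; first by rewrite ler0_sqrtr// mul0r mulr0 mule0 mul0e.
by rewrite mulrA EFinM EFinM fineK// h.
Qed.

Lemma ak_integrable : leb.-integrable setT (EFin \o ak).
Proof.
apply/integrableP; split; first by apply/measurable_EFinP; exact: mak.
have -> : (\int[leb]_x `|(EFin \o ak) x| = \int[leb]_x ((cst 1 x)%R * ak x)%:E)%E.
  by apply: eq_integral => x _ /=; rewrite mul1r ger0_norm// ak0.
rewrite Ak_int//; apply: le_lt_trans (ltry (C * t)); apply: le_trans ib.
apply: ge0_le_integral => //.
- by move=> x _; rewrite !mule_ge0 ?lee_fin// Ak0.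
- apply: emeasurable_funM => //; apply: emeasurable_funM; last exact: ms.
  by apply/measurable_EFinP; exact: measurable_cst.
move=> x _; apply: lee_wpmul2r; first exact: Ak0.
by apply: lee_wpmul2r => //; exact: rho_ge1.
Qed.

End bounded.
End kernel.

(** The derivative [d] supplied by the collision terms is only known to be measurable. On positive
    times it equals the continuous derivative contained in [C1_on], to which the fundamental theorem
    applies. *)
Lemma ftc_within (u d : R -> R) (t : R) : 0 <= t -> C1_on (@nonneg R) u ->
  (forall s : R, 0 <= s -> has_deriv_within (@nonneg R) u s (d s)) -> measurable_fun setT d ->
  (\int[leb]_(s in `[0%R, t]) (d s)%:E = (u t - u 0)%:E)%E.
Proof.
rewrite le_eqVlt => /predU1P[<- _ _ _|t0]; first by rewrite set_itv1 integral_set1 subrr.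
move=> [du [cdu hdu]] hd md.
have e (s : R) : 0 < s -> du s = d s.
  move=> sp; have s0 := ltW sp.
  have h1 := has_deriv_within_is_derive sp (hdu s s0).
  have h2 := has_deriv_within_is_derive sp (hd s s0).
  by rewrite -(@derive_val _ _ _ _ _ _ _ h1) (@derive_val _ _ _ _ _ _ _ h2).
have is_d (s : R) : 0 < s -> is_derive s 1 u (du s).
  by move=> sp; apply: (has_deriv_within_is_derive sp); exact: hdu (ltW sp).
have mo : measurable_fun `]0, t] (EFin \o d) by apply/measurable_EFinP/measurable_funTS.
have mo' : measurable_fun `]0, t] (EFin \o du).
  apply: (eq_measurable_fun (EFin \o d)) => // s; rewrite inE/= in_itv/= => /andP[sp _].
  by rewrite e.
rewrite -(integral_itv_obnd_cbnd mo).
have -> : (\int[leb]_(s in `]0%R, t]) (EFin \o d) s = \int[leb]_(s in `]0%R, t]) (EFin \o du) s)%E.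
  by apply: eq_integral => s; rewrite inE/= in_itv/= => /andP[sp _]; rewrite e.
rewrite (integral_itv_obnd_cbnd mo') EFinB.
apply: (@continuous_FTC2 R du u 0 t t0).
- apply: continuous_subspaceW cdu => s /=; rewrite in_itv/= => /andP[]//.
- split.
  + move=> s; rewrite in_itv/= => /andP[sp _]; exact: (@ex_derive _ _ _ _ _ _ _ (is_d s sp)).
  + have := has_deriv_within_continuous (lexx 0) (hdu 0 (lexx 0)).
    apply: cvg_trans; apply: cvg_app.
    move=> A /= [eps /= e0 He]; exists eps => //= s hs sp; apply: He => //; exact: ltW.
  + apply: cvg_at_left_filter.
    apply/differentiable_continuous/derivable1_diffP.
    exact: (@ex_derive _ _ _ _ _ _ _ (is_d t t0)).
- move=> s; rewrite in_itv/= => /andP[sp _]; rewrite derive1E.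
  exact: (@derive_val _ _ _ _ _ _ _ (is_d s sp)).
Qed.

Lemma Gam0 t a b c d : 0 <= Gam (g t) a b c d.
Proof. by rewrite /Gam !mulr_ge0// !addr_ge0. Qed.
Lemma Lam0 t a b c d : 0 <= Lam (g t) a b c d.
Proof. by rewrite /Lam !mulr_ge0// !addr_ge0. Qed.
Lemma mGam d (S : measurableType d) (t a b c e : S -> R) :
  measurable_fun setT t -> measurable_fun setT a -> measurable_fun setT b ->
  measurable_fun setT c -> measurable_fun setT e ->
  measurable_fun setT (fun s => Gam (g (t s)) (a s) (b s) (c s) (e s)).
Proof.
move=> *; apply: measurable_funM; first by apply: measurable_funM; apply: mgc.
by apply: measurable_funD; [apply: measurable_funD; [exact: measurable_cst|apply: mgc]|apply: mgc].
Qed.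
Lemma mLam d (S : measurableType d) (t a b c e : S -> R) :
  measurable_fun setT t -> measurable_fun setT a -> measurable_fun setT b ->
  measurable_fun setT c -> measurable_fun setT e ->
  measurable_fun setT (fun s => Lam (g (t s)) (a s) (b s) (c s) (e s)).
Proof.
move=> *; apply: measurable_funM; first by apply: measurable_funM; apply: mgc.
by apply: measurable_funD; [apply: measurable_funD; [exact: measurable_cst|apply: mgc]|apply: mgc].
Qed.

Variable N : R.
Hypothesis HN : forall t : R, 0 <= t -> (\int[leb]_x (w x t)%:E = N%:E)%E.
Hypothesis HB : forall t : R, 0 <= t -> exists2 C : R, 0 <= C & forall s : R, 0 <= s <= t ->
  (TT p (fun a b c d => rho a * (Gam (g s) a b c d)%:E) <= C%:E)%E /\
  (TT p (fun a b c d => rho a * (Lam (g s) a b c d)%:E) <= C%:E)%E.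
Hypothesis Hu : forall (x0 : R) n, let phi := bump x0 (rad R n) in
  let u t := fine (\int[leb]_x (phi x * w x t)%:E)%E in
  C1_on (@nonneg R) u /\
  forall t : R, 0 <= t -> has_deriv_within (@nonneg R) u t
   (fine (TT p (fun a b c d => (phi a)%:E * (Gam (g t) a b c d)%:E)%E) -
    fine (TT p (fun a b c d => (phi a)%:E * (Lam (g t) a b c d)%:E)%E)).

Lemma mw1 (t : R) : measurable_fun setT (w^~ t).
Proof.
apply: (measurableT_comp mw (g := fun x : RB => (x, t))).
by apply: measurable_fun_pair; meas.
Qed.

Lemma w_integrable (t : R) : 0 <= t -> leb.-integrable setT (EFin \o w^~ t).
Proof.
move=> t0; apply/integrableP; split; first by apply/measurable_EFinP; exact: mw1.
have -> : (\int[leb]_x `|(EFin \o w^~ t) x| = N%:E)%E.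
  by rewrite -(HN t0); apply: eq_integral => x _ /=; rewrite ger0_norm.
exact: ltry.
Qed.

(** The difference of the two sides is integrable and has zero integral against every bump: the weak
    equation integrated over [[0, t]] gives one expression of the increment, Tonelli in time the
    other. *)
Lemma density_identity (t : R) : 0 <= t ->
  {ae leb, forall x, w x t - w x 0 = ak (@Gam R) t x - ak (@Lam R) t x}.
Proof.
move=> t0; have [C C00 hC] := HB t0.
have hG s h := (hC s h).1; have hL s h := (hC s h).2.
have ia := ak_integrable Gam0 mGam t0 C00 hG.
have ib := ak_integrable Lam0 mLam t0 C00 hL.
have i1 := w_integrable t0; have i2 := w_integrable (lexx 0).
pose D x := (w x t - w x 0) - (ak (@Gam R) t x - ak (@Lam R) t x).
have iD : leb.-integrable setT (EFin \o D).
  rewrite (_ : EFin \o D = (fun x => ((EFin \o w^~ t) x - (EFin \o w^~ 0%R) x) -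
     ((EFin \o ak (@Gam R) t) x - (EFin \o ak (@Lam R) t) x))%E); last by apply/funext.
  exact: (integrableB measurableT (integrableB measurableT i1 i2) (integrableB measurableT ia ib)).
suff HD x0 n : (\int[leb]_y (bump x0 (rad R n) y * D y)%:E = 0)%E.
  apply: (ae_imp (bump_test_unique iD HD)) => x; rewrite /D => h.
  by apply/eqP; rewrite -subr_eq0 h.
set phi := bump x0 (rad R n).
have mphi : measurable_fun setT phi by exact: measurable_bump.
have phi0 x : 0 <= phi x by case/andP: (bump01 x0 (rad R n) x).
have phi1 x : phi x <= 1 by case/andP: (bump01 x0 (rad R n) x).
have bm (h : R -> R) : leb.-integrable setT (EFin \o h) ->
    leb.-integrable setT (EFin \o (fun y => phi y * h y)).
  by move=> ih; apply: bump_mul_integrable => //; exact: rad_gt0.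
have j1 := bm _ i1; have j2 := bm _ i2; have j3 := bm _ ia; have j4 := bm _ ib.
pose I h := (\int[leb]_y (phi y * h y)%:E)%E.
have E : (\int[leb]_y (phi y * D y)%:E = (I (w^~ t) - I (w^~ 0%R)) - (I (ak (@Gam R) t) - I (ak (@Lam R) t)))%E.
  have j12 := integrableB measurableT j1 j2; have j34 := integrableB measurableT j3 j4.
  apply: (etrans _ (etrans (integralB measurableT j12 j34)
    (f_equal2 (fun a b => a - b)%E (integralB measurableT j1 j2) (integralB measurableT j3 j4)))).
  have pt y : phi y * D y = (phi y * w y t - phi y * w y 0) -
      (phi y * ak (@Gam R) t y - phi y * ak (@Lam R) t y) by rewrite /D !mulrBr.
  by apply: eq_integral => y _; exact: (congr1 EFin (pt y)).
have f1 : I (w^~ t) \is a fin_num := integrable_fin_num measurableT j1.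
have f2 : I (w^~ 0) \is a fin_num := integrable_fin_num measurableT j2.
have f3 : I (ak (@Gam R) t) \is a fin_num := integrable_fin_num measurableT j3.
have f4 : I (ak (@Lam R) t) \is a fin_num := integrable_fin_num measurableT j4.
pose psi x := (phi x)%:E.
have mpsi : measurable_fun setT psi by apply/measurable_EFinP.
have psi0 x : (0 <= psi x)%E by rewrite lee_fin.
pose TG s := TT p (fun a b c d => psi a * (Gam (g s) a b c d)%:E)%E.
pose TL s := TT p (fun a b c d => psi a * (Lam (g s) a b c d)%:E)%E.
have eG : (I (ak (@Gam R) t) = \int[leb]_s (TG s * (indc t s)%:E))%E.
  exact: (etrans (Ak_int Gam0 mGam t0 C00 hG mphi phi0) (integral_Ak Gam0 mGam t mpsi psi0)).
have eL : (I (ak (@Lam R) t) = \int[leb]_s (TL s * (indc t s)%:E))%E.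
  exact: (etrans (Ak_int Lam0 mLam t0 C00 hL mphi phi0) (integral_Ak Lam0 mLam t mpsi psi0)).
have mTG := measurable_TTk_time Gam0 mGam mpsi psi0.
have mTL := measurable_TTk_time Lam0 mLam mpsi psi0.
have TG0 s : (0 <= TG s)%E := TT_time_ge0 Gam0 mGam s psi0.
have TL0 s : (0 <= TL s)%E := TT_time_ge0 Lam0 mLam s psi0.
have psir x : (psi x <= rho x)%E by apply: le_trans (rho_ge1 x); rewrite lee_fin.
have finle (a b : \bar R) (c : R) : (0 <= a)%E -> (a <= b)%E -> (b <= c%:E)%E -> a \is a fin_num.
  by move=> a0 ab bc; rewrite ge0_fin_numE//; exact: le_lt_trans (le_trans ab bc) (ltry c).
have TGf s : 0 <= s <= t -> TG s \is a fin_num.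
  move=> hs; exact: (finle _ _ _ (TG0 s)
    (TT_time_le Gam0 mGam s mpsi psi0 (@measurable_rho R) (@rho_ge0 R) psir) (hG s hs)).
have TLf s : 0 <= s <= t -> TL s \is a fin_num.
  move=> hs; exact: (finle _ _ _ (TL0 s)
    (TT_time_le Lam0 mLam s mpsi psi0 (@measurable_rho R) (@rho_ge0 R) psir) (hL s hs)).
have [cu du] := Hu x0 n.
have md : measurable_fun setT (fun s => fine (TG s) - fine (TL s)).
  have mf (h : R -> \bar R) : measurable_fun setT h -> measurable_fun setT (fun s => fine (h s)).
    by move=> mh; apply: measurableT_comp.
  exact: (measurable_funB (mf _ mTG) (mf _ mTL)).
have ftc := ftc_within t0 cu du md.
have sub : (\int[leb]_(s in `[0%R, t]) (fine (TG s) - fine (TL s))%:E = I (ak (@Gam R) t) - I (ak (@Lam R) t))%E.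
  have mit : measurable (`[0, t]%classic : set RB) by exact: measurable_itv.
  have key (h : R -> \bar R) (J : \bar R) : (forall s, (0 <= h s)%E) -> measurable_fun setT h ->
      J \is a fin_num -> J = (\int[leb]_s (h s * (indc t s)%:E))%E ->
      (\int[leb]_(s in `[0%R, t]) h s)%E = J /\ leb.-integrable `[0, t] h.
    move=> h0 mh Jf JE; have e : (\int[leb]_(s in `[0%R, t]) h s)%E = J by rewrite integral_indc JE.
    split=> //; apply/integrableP; split; first exact: measurable_funTS.
    under eq_integral do rewrite gee0_abs//.
    by rewrite e ltey_eq Jf.
  have [kG1 kG] := key _ _ TG0 mTG f3 eG.
  have [kL1 kL] := key _ _ TL0 mTL f4 eL.
  apply: (etrans _ (etrans (integralB mit kG kL) (f_equal2 (fun a b => a - b)%E kG1 kL1))).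
  apply: eq_integral => s; rewrite inE/= in_itv/= => hs.
  exact: (etrans (EFinB _ _) (f_equal2 (fun a b => a - b)%E (fineK (TGf s hs)) (fineK (TLf s hs)))).
have fin3 (a b c : \bar R) : a \is a fin_num -> b \is a fin_num ->
    (fine a - fine b)%:E = c -> (a - b - c = 0)%E.
  by move=> af bf <-; rewrite EFinB !fineK// subee// fin_numB af bf.
exact: (etrans E (fin3 _ _ _ f1 f2 (etrans (esym ftc) sub))).
Qed.

End TimeIntegration.

(** * Consequences of the kernel assumption *)

Section KernelExtension.
Variable R : realType.
Notation RB := (measurableTypeR R).
Notation leb := (@lebesgue_measure R).

(* The kernel only sees [ph] on [0, oo); truncating the argument makes the bounds hold on all of R. *)
Definition pos_ext (ph : R -> R) (r : R) : R := ph (Num.max r 0).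

Lemma pos_extE ph (r : R) : 0 <= r -> pos_ext ph r = ph r.
Proof. by move=> r0; rewrite /pos_ext (max_idPl r0). Qed.

Lemma Phi_pos_ext ph (r s : R) : 0 <= r -> 0 <= s -> Phi (pos_ext ph) r s = Phi ph r s.
Proof. by move=> r0 s0; rewrite /Phi !pos_extE. Qed.

(** Every argument of [ph] inside [W] is nonnegative. *)
Lemma W_pos_ext ph : W ph = W (pos_ext ph).
Proof.
apply/funext => x; apply/funext => y; apply/funext => z; rewrite /W.
case: ifP => _.
  congr (_ * _); apply: eq_Rintegral => s; rewrite inE/= in_itv/= => /andP[s1 _].
  apply: eq_Rintegral => th _; rewrite Phi_pos_ext// mulr_ge0 ?sqrtr_ge0// ?Ystar_ge0//.
  by apply: le_trans s1; rewrite le_max normr_ge0.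
case: ifP => _; first by rewrite Phi_pos_ext// sqrtr_ge0.
case: ifP => _; first by rewrite Phi_pos_ext// sqrtr_ge0.
by case: ifP => _ //; rewrite Phi_pos_ext// sqrtr_ge0.
Qed.

Variables (ph : R -> R) (b0 eta : R) (k : R -> R).
Hypothesis KA : kernel_assumption ph b0 eta k.

Lemma measurable_pos_ext : measurable_fun setT (pos_ext ph).
Proof.
case: KA => cph _.
have mI : measurable (`[0, +oo[%classic : set R) by exact: measurable_itv.
have e : [set r : R | 0 <= r] = `[0, +oo[%classic.
  by apply/seteqP; split => x /=; rewrite in_itv/= andbT.
move: cph; rewrite e => cph.
rewrite (_ : pos_ext ph = ph \o (fun r : R => Num.max r 0)); last by [].
apply: (measurable_comp mI _ (subspace_continuous_measurable_fun mI cph)).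
- by move=> _ [r _ <-] /=; rewrite in_itv/= andbT le_max lexx orbT.
- by apply: measurable_maxr; meas.
Qed.

Lemma pos_ext_ge0 r : 0 <= pos_ext ph r.
Proof.
case: KA => _ [_ [_ [h _]]]; rewrite /pos_ext.
by have /h/andP[] : 0 <= Num.max r 0 by rewrite le_max lexx orbT.
Qed.

Lemma pos_ext_leb r : pos_ext ph r <= b0.
Proof.
case: KA => _ [b0_gt0 [_ [h _]]]; rewrite /pos_ext.
have /h/andP[_ h1] : 0 <= Num.max r 0 by rewrite le_max lexx orbT.
apply: le_trans h1 _; rewrite ger_pMr// ler_pdivrMr; last by rewrite ltr_pwDl ?powR_ge0.
by rewrite mul1r lerDr.
Qed.

Lemma pos_ext_lin r : 0 <= r -> pos_ext ph r <= b0 * r.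
Proof.
move=> r0; case: KA => _ [b0_gt0 [eta1 [h _]]]; rewrite pos_extE//.
have /andP[_ h1] := h r r0; apply: le_trans h1 _.
rewrite ler_pM2l//; have X0 : 0 <= r `^ eta by exact: powR_ge0.
have X1 : 0 < 1 + r `^ eta by rewrite ltr_pwDl.
rewrite ler_pdivrMr//.
have [r1|r1] := leP 1 r; first by nra.
suff : r `^ eta <= r by nra.
move: r0; rewrite le_eqVlt => /predU1P[<-|rp]; first by rewrite powR0//; lra.
have rr : 0 < r <= 1 by rewrite rp ltW.
by rewrite -[leRHS]powRr1 ?(ltW rp)//; exact: (ger_powR rr eta1).
Qed.

(** Near 1 the difference quotient of [k] is within 1 of [k'(1)], which gives [L = |k'(1)| + 1]
    since [k 1 = 1]. The radius [dl] also keeps [al] below [sqrt 2], where [k] is defined. *)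
Lemma pos_ext_dil : exists L dl : R, [/\ 0 <= L, 0 < dl & forall r al : R, 0 < r -> 1 <= al <= 1 + dl ->
  pos_ext ph (al * r) <= (1 + L * (al - 1)) * pos_ext ph r].
Proof.
case: KA => _ [_ [_ [h [[dk [_ hk]] [k1 dil]]]]].
have s2 : 1 < Num.sqrt 2 :> R by rewrite -[ltLHS]sqrtr1 ltr_sqrt//; lra.
have h1 : (1 : R) \in `[1, Num.sqrt 2] by rewrite in_itv/= lexx/= ltW.
have := hk 1 h1; rewrite /has_deriv_within k1 => /cvgrPdist_le /(_ 1 ltr01)[e /= e0 He].
exists (`|dk 1| + 1), (Num.min (e / 2) (Num.sqrt 2 - 1)); split.
- by rewrite addr_ge0.
- by rewrite lt_min divr_gt0//= subr_gt0.
move=> r al r0 /andP[a1 a2]; rewrite !pos_extE ?mulr_ge0 ?(ltW r0)//; last by apply: le_trans a1; exact: ler01.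
have p0 : 0 <= ph r by have /andP[] := h r (ltW r0).
have [al1|al1] := eqVneq al 1; first by rewrite al1 subrr mulr0 addr0 !mul1r.
have a3 : 1 < al by rewrite lt_neqAle eq_sym al1.
have m1 : al - 1 <= e / 2 by rewrite lerBlDl; apply: le_trans a2 _; rewrite lerD2l ge_min lexx.
have m2 : al <= Num.sqrt 2.
  apply: le_trans a2 _; rewrite -lerBrDl ge_min lexx orbT//.
have : `|dk 1 - (k (1 + (al - 1)) - 1) / (al - 1)| <= 1.
  apply: He => /=; first by rewrite sub0r normrN ger0_norm ?subr_ge0//; lra.
  by split; [rewrite subr_eq0|rewrite /= ?in_itv/= addrC subrK a1 m2].
rewrite (_ : 1 + (al - 1) = al) => [hq|]; last by ring.
have ka : k al <= 1 + (`|dk 1| + 1) * (al - 1).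
  rewrite -lerBlDl -ler_pdivrMr ?subr_gt0//.
  move: hq; rewrite ler_norml => /andP[hq _]; have := ler_norm (dk 1); lra.
apply: le_trans (dil r al r0 _) _; first by rewrite a3 m2.
exact: ler_wpM2r.
Qed.

End KernelExtension.

(** * The jointly measurable density of the solution *)

Section SolutionDensity.
Variable R : realType.
Notation RB := (measurableTypeR R).
Notation leb := (@lebesgue_measure R).
Variables (p : R -> R) (b0 : R).
Hypothesis mp : measurable_fun setT p.
Hypothesis b0_gt0 : 0 < b0.
Hypothesis p_ge0 : forall r, 0 <= p r.
Hypothesis p_leb : forall r, p r <= b0.
Hypothesis p_lin : forall r : R, 0 <= r -> p r <= b0 * r.
Variable C0 : R.
Hypothesis C0E : C0 = 32 * b0 ^+ 2.
Variable F : R -> {finite_measure set RB -> \bar R}.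
Hypothesis sol : cons_measure_solution p F.
Hypothesis rbound : forall T : R, 0 <= T ->
  exists2 K : R, 0 <= K & forall t : R, 0 <= t <= T -> (\int[F t]_x rinv x <= K%:E)%E.
Hypothesis F_leb : forall t : R, 0 <= t -> F t `<< leb.

(** Time is clamped at 0, so that measurability and positivity hold on the whole plane although the
    solution is only given for nonnegative times. *)
Definition wdens (x t : R) : R := dens (F (Num.max t 0)) x.

Lemma wdensE x (t : R) : 0 <= t -> wdens x t = dens (F t) x.
Proof. by move=> t0; rewrite /wdens (max_idPl t0). Qed.

Lemma wdens_ge0 x t : 0 <= wdens x t. Proof. exact: dens_ge0. Qed.
Lemma wdens_neg x t : x <= 0 -> wdens x t = 0. Proof. exact: dens_neg. Qed.

Lemma C11b_bump c n : C11b (bump c (rad R n)).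
Proof.
apply: (@C11g_C11b _ _ 1); first by apply: C11g_bump; exact: rad_gt0.
by move=> x; case/andP: (bump01 c (rad R n) x) => h1 h2; rewrite ger0_norm.
Qed.

Let bump_ge0 c n x : 0 <= bump c (rad R n) x. Proof. by case/andP: (bump01 c (rad R n) x). Qed.

Lemma measurable_wdens : measurable_fun setT (fun q : RB * RB => wdens q.1 q.2).
Proof.
pose G n (x s : R) := intF (F s) (bump x (rad R n)) / bmass R n.
have GE n x (t : R) : 0 <= t -> G n x t = mavg (F t) n x.
  by move=> t0; rewrite /G /mavg (intFE sol t0)//; exact: measurable_bump.
have mG n : measurable_fun [set q : RB * RB | 0 <= q.2] (fun q => G n q.1 q.2).
  apply: caratheodory_measurable.
    move=> t t0; rewrite (_ : (G n)^~ t = mavg (F t) n); first exact: measurable_mavg.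
    by apply/funext => x; exact: GE.
  move=> x t t0; apply: cvgM; last exact: cvg_cst.
  case: sol => _ [_ /(_ _ (C11b_bump x n))[_ hd]].
  exact: (has_deriv_within_continuous t0 (hd t t0)).
have mq2 : measurable_fun setT (fun q : RB * RB => Num.max q.2 0).
  by apply: measurable_maxr; meas.
have mG' n : measurable_fun setT (fun q : RB * RB => (mavg (F (Num.max q.2 0)) n q.1)%:E).
  apply/measurable_EFinP.
  rewrite (_ : (fun q : RB * RB => _) = (fun q : RB * RB => G n q.1 q.2) \o (fun q : RB * RB => (q.1, Num.max q.2 0))).
    apply: (measurable_comp (F := [set q : RB * RB | 0 <= q.2])) (mG n) _.
    - rewrite (_ : [set _ | _] = setT `*` `[0, +oo[%classic); first by apply: measurableX => //; exact: measurable_itv.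
      by apply/seteqP; split => -[a b] /=; rewrite in_itv/= andbT// => -[].
    - by move=> _ [q _ <-] /=; rewrite le_max lexx orbT.
    - by apply: measurable_fun_pair => //; meas.
  by apply/funext => q /=; rewrite GE// le_max lexx orbT.
apply: measurable_fun_ifT; [by apply: measurable_fun_ler; meas|exact: measurable_cst|].
apply: measurableT_comp => //.
exact: (measurable_fun_limn_esup mG').
Qed.

Lemma integral_wdens (t : R) (psi : R -> \bar R) : 0 <= t -> measurable_fun setT psi ->
  (forall x, 0 <= psi x)%E -> (\int[F t]_x psi x = \int[leb]_x (psi x * (wdens x t)%:E))%E.
Proof.
move=> t0 mpsi psi0; apply: (etrans (integral_dens (F_leb t0) (sol_neg sol t0) mpsi psi0)).
by apply: eq_integral => x _; rewrite wdensE.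
Qed.

Lemma wdens_mass (t : R) : 0 <= t -> (\int[leb]_x (wdens x t)%:E = (massF F)%:E)%E.
Proof.
move=> t0; have h := @integral_wdens t (fun=> 1%E) t0 (measurable_cst _) (fun=> lee01).
have e1 : (\int[leb]_x (wdens x t)%:E = \int[leb]_x (1 * (wdens x t)%:E))%E.
  by apply: eq_integral => x _; rewrite mul1e.
rewrite e1 -h -(sol_mass sol t0).
by rewrite (integral_cst (F t) measurableT) mul1e.
Qed.

Let mw (t : R) : measurable_fun setT (wdens^~ t).
Proof.
by apply: (measurableT_comp measurable_wdens (g := fun x : RB => (x, t))); apply: measurable_fun_pair; meas.
Qed.

Lemma wdens_collision_bound (t : R) : 0 <= t -> exists2 C : R, 0 <= C & forall s : R, 0 <= s <= t ->
  (TT p (fun a b c d => rho a * (Gam (dq (wdens^~ s)) a b c d)%:E) <= C%:E)%E /\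
  (TT p (fun a b c d => rho a * (Lam (dq (wdens^~ s)) a b c d)%:E) <= C%:E)%E.
Proof.
move=> t0; have [K K0 HK] := rbound t0.
exists (Cq C0 (massF F) K (energyF F) + Cc C0 (massF F) K + Cc C0 (massF F) K).
  have n0 := massF_ge0 F; have e0 := energyF_ge0 F.
  have c0 : 0 <= C0 by rewrite C0E mulr_ge0// sqr_ge0.
  by rewrite /Cq /Cc !addr_ge0// mulr_ge0// ?exprn_ge0 ?addr_ge0// ?mulr_ge0// addr_ge0.
move=> s /andP[s0 st]; have hK : (\int[F s]_x rinv x <= K%:E)%E by apply: HK; rewrite s0.
have hw psi mpsi psi0 := @integral_wdens s psi s0 mpsi psi0.
split.
  exact: (TT_rho_gain mp b0_gt0 p_ge0 p_leb p_lin C0E (mw s) (fun x => wdens_ge0 x s)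
    (fun x h => wdens_neg s h) hw (sol_mass sol s0) hK (sol_energy sol s0)).
exact: (TT_rho_loss mp b0_gt0 p_ge0 p_leb p_lin C0E (mw s) (fun x => wdens_ge0 x s)
  (fun x h => wdens_neg s h) hw (sol_mass sol s0) hK (sol_energy sol s0)).
Qed.

Lemma has_deriv_within_ext (u v : R -> R) (t d : R) : 0 <= t -> (forall s : R, 0 <= s -> u s = v s) ->
  has_deriv_within (@nonneg R) u t d -> has_deriv_within (@nonneg R) v t d.
Proof.
move=> t0 uv; rewrite /has_deriv_within; apply: cvg_trans; apply: near_eq_cvg.
rewrite near_withinE; near=> h => -[_ th]; rewrite !uv//.
Unshelve. all: by end_near. Qed.

Lemma wdens_bump_deriv (x0 : R) n : let phi := bump x0 (rad R n) in
  let u t := fine (\int[leb]_x (phi x * wdens x t)%:E)%E in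
  C1_on (@nonneg R) u /\
  forall t : R, 0 <= t -> has_deriv_within (@nonneg R) u t
   (fine (TT p (fun a b c d => (phi a)%:E * (Gam (dq (wdens^~ t)) a b c d)%:E)%E) -
    fine (TT p (fun a b c d => (phi a)%:E * (Lam (dq (wdens^~ t)) a b c d)%:E)%E)).
Proof.
move=> phi u.
have mphi : measurable_fun setT phi by exact: measurable_bump.
have phi01 x : 0 <= phi x <= 1 by exact: bump01.
have phi0 x : 0 <= phi x by case/andP: (phi01 x).
have uE (t : R) : 0 <= t -> intF (F t) phi = u t.
  move=> t0; rewrite (intFE sol t0)//; congr fine.
  have mpsi : measurable_fun setT (fun x => (phi x)%:E) by apply/measurable_EFinP.
  have psi0 x : (0 <= (phi x)%:E)%E by rewrite lee_fin.
  apply: (etrans (integral_wdens t0 mpsi psi0)).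
  by apply: eq_integral => x _; rewrite (EFinM (phi x)).
have [[du [cdu hdu]] hd] := (sol.2.2 phi (C11b_bump x0 n)).
split.
  exists du; split=> // t t0.
  exact: (has_deriv_within_ext t0 uE (hdu t t0)).
move=> t t0; have H := has_deriv_within_ext t0 uE (hd t t0).
have [K K0 HK] := rbound t0.
have hK : (\int[F t]_x rinv x <= K%:E)%E by apply: HK; rewrite t0 lexx.
have hw psi mpsi psi0 := @integral_wdens t psi t0 mpsi psi0.
have wd := weak_deriv mp b0_gt0 p_ge0 p_leb p_lin C0E mphi phi01 (mw t) (fun x => wdens_ge0 x t)
  (fun x h => wdens_neg t h) hw (sol_mass sol t0) hK (sol_energy sol t0).
exact: (eq_ind _ (fun X => has_deriv_within (@nonneg R) u t X) H _ wd).
Qed.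

Lemma wdens_identity (t : R) : 0 <= t ->
  {ae leb, forall x, wdens x t - wdens x 0 = ak p wdens (@Gam R) t x - ak p wdens (@Lam R) t x}.
Proof.
exact: (density_identity mp measurable_wdens wdens_ge0 wdens_mass wdens_collision_bound wdens_bump_deriv).
Qed.

(** The [L^1(dx)] norm of [w / sqrt x] is the moment of order [-1/2], already bounded on finite time
    intervals. *)
Lemma wdens_rinv (T : R) : 0 <= T -> exists2 K : R, 0 <= K & forall t : R, 0 <= t <= T ->
  (\int[leb]_x (dq (wdens^~ t) x)%:E <= K%:E)%E.
Proof.
move=> T0; have [K K0 HK] := rbound T0; exists K => // t ht; have t0 : 0 <= t by case/andP: ht.
apply: le_trans (HK t ht); rewrite (integral_wdens t0 (@measurable_rinv R) (@rinv_ge0 R)).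
have d0 x : 0 <= dq (wdens^~ t) x by rewrite divr_ge0 ?sqrtr_ge0 ?wdens_ge0.
have mdq : measurable_fun setT (dq (wdens^~ t)).
  by apply: measurable_funM; [exact: mw|apply: measurable_inv; apply: measurable_sqrt].
apply: ge0_le_integral => //.
- by move=> x _; rewrite lee_fin.
- by apply/measurable_EFinP.
- by apply: emeasurable_funM; [exact: measurable_rinv|apply/measurable_EFinP; exact: mw].
move=> x _; rewrite /dq /rinv; case: ifPn => [x0|_]; first by rewrite wdens_neg// mul0r mule0.
by rewrite -EFinM mulrC.
Qed.

End SolutionDensity.

(** * Null sets under translation, slicing and continuity *)

Section AlmostEverywhere.
Variable R : realType.
Notation RB := (measurableTypeR R).
Notation leb := (@lebesgue_measure R).

Lemma ae_shift (P : R -> Prop) (c : R) : {ae leb, forall x, P x} -> {ae leb, forall x, P (x + c)}.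
Proof.
move=> [A [mA A0 sA]].
have mt : measurable_fun setT (fun x : RB => x + c : RB) by meas.
have mB : measurable ((fun x : RB => x + c : RB) @^-1` A) by rewrite -[X in measurable X]setTI; exact: mt.
exists ((fun x : RB => x + c : RB) @^-1` A); split => //.
  have m1 : measurable_fun setT (fun x : R => (\1_A x)%:E : \bar R) by apply/measurable_EFinP.
  have e := @ge0_integral_shift R c (fun x => (\1_A x)%:E) m1 (fun x => ltac:(by rewrite lee_fin)).
  have e1 := integral_indic leb measurableT mA; have e2 := integral_indic leb measurableT mB.
  rewrite !setIT in e1 e2.
  by apply: (etrans (esym e2) (etrans _ (etrans e1 A0))); rewrite -e; apply: eq_integral => x _; rewrite !indicE.
by move=> x /= h; apply: sA.
Qed.

Lemma ae_exists_itv (P : R -> Prop) (a b : R) : {ae leb, forall x, P x} -> a < b ->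
  exists2 s, a < s < b & P s.
Proof.
move=> [A [mA A0 sA]] ab; apply: contrapT => hn.
have sub : (`]a, b[%classic : set RB) `<=` A.
  by move=> s /=; rewrite in_itv/= => hs; apply: sA => /= Ps; apply: hn; exists s.
have mI : measurable (`]a, b[%classic : set RB) by exact: measurable_itv.
have : (leb (`]a, b[%classic : set RB) <= leb A)%E.
  by apply: le_measure; rewrite ?inE.
rewrite A0 lebesgue_measure_itv/= lte_fin ab -EFinB lee_fin subr_le0 => ba.
by move: (lt_le_trans ab ba); rewrite ltxx.
Qed.

Lemma ae_neq0 : {ae leb, forall x : R, x <> 0}.
Proof.
exists [set 0]; split; [exact: measurable_set1|exact: lebesgue_measure_set1|].
by move=> x /= /contrapT.
Qed.

(** Tonelli for the indicator of [B] restricted to nonnegative times: if all its slices in [x] are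
    null, almost all its slices in time are. *)
Lemma ae_prod (B : set (RB * RB)) : measurable B ->
  (forall s : R, 0 <= s -> {ae leb, forall x, ~ B (x, s)}) ->
  {ae leb, forall x, {ae leb, forall s, 0 <= s -> ~ B (x, s)}}.
Proof.
move=> mB hB.
pose D : set (RB * RB) := B `&` (snd @^-1` `[0, +oo[%classic).
have mD : measurable D.
  apply: measurableI => //; rewrite -[X in measurable X]setTI.
  by apply: measurable_snd => //; exact: measurable_itv.
pose h (q : RB * RB) : \bar R := (\1_D q)%:E.
have mh : measurable_fun setT h by apply/measurable_EFinP.
have h0 q : (0 <= h q)%E by rewrite lee_fin.
have mh1 (x : R) : measurable_fun setT (fun s : RB => h (x, s)).
  by apply: (measurableT_comp mh); apply: measurable_fun_pair; meas.
have mh2 (s : R) : measurable_fun setT (fun x : RB => h (x, s)).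
  by apply: (measurableT_comp mh); apply: measurable_fun_pair; meas.
have hz (x s : R) : ~ D (x, s) -> h (x, s) = 0%E.
  by move=> n; rewrite /h indicE memNset.
have i2 (s : R) : (\int[leb]_x h (x, s) = 0)%E.
  rewrite -[RHS](@integral0 _ _ _ leb setT).
  apply: ge0_ae_eq_integral => //.
  have [s0|s0] := leP 0 s; last first.
    by apply: aeW => x _; apply: hz => -[_] /=; rewrite in_itv/= andbT leNgt s0.
  by apply: (ae_imp (hB s s0)) => x n _; apply: hz => -[].
have i1 : (\int[leb]_x \int[leb]_s h (x, s) = 0)%E.
  rewrite (@fubini_tonelli _ _ RB RB R leb leb h mh h0).
  by under eq_integral do rewrite i2; exact: integral0.
have mF : measurable_fun setT (fun x : RB => \int[leb]_s h (x, s))%E.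
  exact: (@measurable_fun_fubini_tonelli_F _ _ RB RB R leb h).
have F0 x : (0 <= \int[leb]_s h (x, s))%E by apply: integral_ge0.
have a1 : ae_eq leb setT (fun x : RB => \int[leb]_s h (x, s))%E (cst 0%E).
  apply/(ae_eq_integral_abs leb measurableT mF); rewrite -i1.
  by apply: eq_integral => x _; rewrite gee0_abs.
apply: (ae_imp a1) => x /(_ I) /= ex.
have a2 : ae_eq leb setT (fun s : RB => h (x, s))%E (cst 0%E).
  apply/(ae_eq_integral_abs leb measurableT (mh1 x)); rewrite -ex.
  by apply: eq_integral => s _; rewrite gee0_abs.
apply: (ae_imp a2) => s /(_ I) /= es s0 Bs.
have Ds : D (x, s) by split=> //=; rewrite in_itv/= s0.
by move: es; rewrite /h indicE mem_set// => -[] /eqP; rewrite oner_eq0.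
Qed.

(** A negative value would persist on an interval to the right of [t], and every such interval meets
    the set of full measure. *)
Lemma continuous_ae_ge0 (u : R -> R) (t T : R) : 0 <= t < T -> {within `[0, T], continuous u} ->
  {ae leb, forall s, 0 <= s -> 0 <= u s} -> 0 <= u t.
Proof.
move=> /andP[t0 tT] cu hu; rewrite leNgt; apply/negP => ut.
have ht : `[0, T]%classic t by rewrite /= in_itv/= t0 ltW.
have /subspace_continuousP/(_ t ht)/cvgrPdist_lt/(_ (- u t)) := cu.
rewrite oppr_gt0 => /(_ ut)[e /= e0 He].
have tb : t < Num.min (t + e) T by rewrite lt_min tT ltrDl e0.
have [s /andP[ts]] := ae_exists_itv hu tb.
rewrite lt_min => /andP[s1 s2] us.
have s0 : 0 <= s by exact: le_trans t0 (ltW ts).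
have : `|u t - u s| < - u t.
  apply: He; last by rewrite /= in_itv/= s0 ltW.
  by rewrite /= distrC gtr0_norm ?subr_gt0// ltrBlDl.
by have := us s0; rewrite ltr_norml => h1 /andP[h2 _]; lra.
Qed.
End AlmostEverywhere.

(** * Dependence of the rates on time and on the choice of density *)

Section KernelTime.
Variable R : realType.
Notation RB := (measurableTypeR R).
Notation leb := (@lebesgue_measure R).
Variable p : R -> R.
Hypothesis mp : measurable_fun setT p.
Variable Gk : (R -> R) -> R -> R -> R -> R -> R.

Section one.
Variable w : R -> R -> R.
Hypothesis Gk0 : forall t a b c d, 0 <= Gk (dq (w^~ t)) a b c d.
Hypothesis mGk : forall d (S : measurableType d) (t a b c e : S -> R),
  measurable_fun setT t -> measurable_fun setT a -> measurable_fun setT b ->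
  measurable_fun setT c -> measurable_fun setT e ->
  measurable_fun setT (fun s => Gk (dq (w^~ (t s))) (a s) (b s) (c s) (e s)).
Notation q := (qk p w Gk).
Notation A := (Ak p w Gk).

Lemma measurable_qk_time (x : R) : measurable_fun setT (fun s : R => q x s).
Proof. by apply: (mqk mp Gk0 mGk); meas. Qed.

Lemma measurable_qk_indc (t x : R) : measurable_fun setT (fun s : R => q x s * (indc t s)%:E)%E.
Proof.
apply: emeasurable_funM; first exact: measurable_qk_time.
apply/measurable_EFinP; apply: (measurableT_comp (@measurable_indc R) (g := fun s : RB => (t, s))).
by apply: measurable_fun_pair; meas.
Qed.

Lemma qk_indc_ge0 (t x s : R) : (0 <= q x s * (indc t s)%:E)%E.
Proof. by rewrite mule_ge0 ?(qk0 p Gk0)// lee_fin; case/andP: (indc01 t s). Qed.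

Lemma Ak_mono (t t' x : R) : t <= t' -> (A t x <= A t' x)%E.
Proof.
move=> tt; apply: ge0_le_integral => //.
- by move=> s _; exact: qk_indc_ge0.
- exact: measurable_qk_indc.
- exact: measurable_qk_indc.
move=> s _; apply: lee_wpmul2l; first exact: (qk0 p Gk0).
rewrite lee_fin !indcE; case: ifPn => [/andP[h1 h2]|_]; first by rewrite h1 (le_trans h2 tt).
by case: ifPn.
Qed.

Lemma AkE (t x : R) : (\int[leb]_(s in `[0%R, t]) q x s)%E = A t x.
Proof. exact: integral_indc. Qed.

Lemma Ak_at0 x : A 0 x = 0%E.
Proof. by rewrite -AkE set_itv1 integral_set1. Qed.

(** [fine] turns an infinite rate into 0; when the accumulated rate is finite this happens on a null
    set of times only and changes no integral. *)
Lemma Ak_fine (t x : R) : A t x \is a fin_num ->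
  leb.-integrable `[0, t] (fun s => (fine (q x s))%:E) /\
  (\int[leb]_(s in `[0%R, t]) (fine (q x s))%:E)%E = A t x /\
  {ae leb, forall s, `[0, t]%classic s -> q x s \is a fin_num}.
Proof.
move=> Af; have mI : measurable (`[0, t]%classic : set RB) by exact: measurable_itv.
have mq : measurable_fun (`[0, t]%classic : set RB) (q x) by apply: measurable_funTS; exact: measurable_qk_time.
have mfq : measurable_fun (`[0, t]%classic : set RB) (fun s => (fine (q x s))%:E).
  by apply/measurable_EFinP; apply: measurableT_comp.
have iq : leb.-integrable `[0, t] (q x).
  have e : (\int[leb]_(s in `[0%R, t]) `|q x s|)%E = A t x.
    by rewrite -AkE; apply: eq_integral => s _; rewrite gee0_abs// (qk0 p Gk0).
  by apply/integrableP; split => //; rewrite e ltey_eq Af.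
have aef := integrable_ae mI iq.
have e : (\int[leb]_(s in `[0%R, t]) (fine (q x s))%:E)%E = A t x.
  rewrite -AkE; apply: ge0_ae_eq_integral => //.
  - by move=> s _; rewrite lee_fin fine_ge0// (qk0 p Gk0).
  - by move=> s _; exact: (qk0 p Gk0).
  by apply: (ae_imp aef) => s h /h; exact: fineK.
have e' : (\int[leb]_(s in `[0%R, t]) `|(fine (q x s))%:E|)%E = A t x.
  by rewrite -e; apply: eq_integral => s _; rewrite gee0_abs// lee_fin fine_ge0// (qk0 p Gk0).
by split=> //; apply/integrableP; split=> //; rewrite e' ltey_eq Af.
Qed.

Lemma fine_Ak_continuous (T x : R) : 0 <= T -> A T x \is a fin_num ->
  {within `[0, T], continuous (fun t => fine (A t x))}.
Proof.
move=> T0 Af; have [iT _] := Ak_fine Af.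
have fin (t : R) : t <= T -> A t x \is a fin_num.
  move=> tT; rewrite ge0_fin_numE ?(Ak0 p Gk0)//; apply: le_lt_trans (Ak_mono x tT) _.
  by rewrite ltey_eq Af.
have := parameterized_integral_continuous T0 iT.
move/subspace_continuousP => h; apply/subspace_continuousP => t ht.
have eqt (s : R) : `[0, T]%classic s -> parameterized_integral leb 0 s (fun s => fine (q x s)) = fine (A s x).
  rewrite /= in_itv/= => /andP[_ sT]; rewrite /parameterized_integral /Rintegral.
  by rewrite (Ak_fine (fin s sT)).2.1.
pose P s := parameterized_integral leb 0 s (fun s => fine (q x s)).
have c1 : P s @[s --> within `[0, T] (nbhs t)] --> fine (A t x).
  by rewrite -(eqt t ht); exact: h.
suff : fine (A s x) @[s --> within `[0, T] (nbhs t)] --> fine (A t x) by [].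
apply: cvg_trans c1; apply: near_eq_cvg.
by rewrite near_withinE; near=> s => hs; exact: eqt.
Unshelve. all: by end_near. Qed.

(* [Zk] vanishes off the quadrant because [Num.sqrt] does on negative numbers. *)
Lemma integral_quadrant_Zk (x s : R) :
  (\int[(leb \x leb)%E]_(r in @quadrant R) Zk p w Gk x s r.1 r.2)%E = q x s.
Proof.
have mZ : measurable_fun setT (fun r : RB * RB => Zk p w Gk x s r.1 r.2).
  by apply: (mZk mp mGk); meas.
have Z0 (r : RB * RB) : (0 <= Zk p w Gk x s r.1 r.2)%E by exact: (Zk0 p Gk0).
have F := @fubini_tonelli1 _ _ RB RB R leb leb (fun r => Zk p w Gk x s r.1 r.2) mZ Z0.
apply: (etrans _ F); rewrite integral_mkcond; apply: eq_integral => -[y z] _.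
rewrite patchE; case: ifPn => //=; rewrite notin_setE /quadrant/= => h; rewrite /Zk.
have [y0|y0] := ltP y 0; first by rewrite (ler0_sqrtr (ltW y0)) mulr0 mul0r.
have [z0|z0] := ltP z 0; first by rewrite (ler0_sqrtr (ltW z0)) mulr0.
by case: h.
Qed.
End one.

Section two.
Variables w w' : R -> R -> R.
Hypothesis Gk0 : forall t a b c d, 0 <= Gk (dq (w^~ t)) a b c d.
Hypothesis mGk : forall d (S : measurableType d) (t a b c e : S -> R),
  measurable_fun setT t -> measurable_fun setT a -> measurable_fun setT b ->
  measurable_fun setT c -> measurable_fun setT e ->
  measurable_fun setT (fun s => Gk (dq (w^~ (t s))) (a s) (b s) (c s) (e s)).
Hypothesis Gk0' : forall t a b c d, 0 <= Gk (dq (w'^~ t)) a b c d.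
Hypothesis mGk' : forall d (S : measurableType d) (t a b c e : S -> R),
  measurable_fun setT t -> measurable_fun setT a -> measurable_fun setT b ->
  measurable_fun setT c -> measurable_fun setT e ->
  measurable_fun setT (fun s => Gk (dq (w'^~ (t s))) (a s) (b s) (c s) (e s)).
Hypothesis Gk_ext : forall (h h' : R -> R) (a b c d : R), h a = h' a -> h b = h' b ->
  h c = h' c -> h d = h' d -> Gk h a b c d = Gk h' a b c d.

(** Exact agreement is needed at [x] only. In [y] and [z] agreement almost everywhere suffices, and
    for the fourth argument too, since at fixed [x] and [y] it is a translate of [z]. *)
Lemma qk_ext (x s : R) : dq (w'^~ s) x = dq (w^~ s) x ->
  {ae leb, forall y, dq (w'^~ s) y = dq (w^~ s) y} -> qk p w' Gk x s = qk p w Gk x s.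
Proof.
move=> ex ey; apply: ge0_ae_eq_integral => //.
- by apply: (mZk1 mp Gk0' mGk'); meas.
- by apply: (mZk1 mp Gk0 mGk); meas.
- by move=> y _; apply: integral_ge0 => z _; exact: (Zk0 p Gk0').
- by move=> y _; apply: integral_ge0 => z _; exact: (Zk0 p Gk0).
apply: (ae_imp ey) => y hy _; apply: ge0_ae_eq_integral => //.
- have m : measurable_fun setT (fun z : RB => Zk p w' Gk x s y z) by apply: (mZk mp mGk'); meas.
  exact: m.
- have m : measurable_fun setT (fun z : RB => Zk p w Gk x s y z) by apply: (mZk mp mGk); meas.
  exact: m.
- by move=> z _; exact: (Zk0 p Gk0').
- by move=> z _; exact: (Zk0 p Gk0).
apply: (ae_imp2 ey (ae_shift (y - x) ey)) => z hz hd _; rewrite /Zk.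
have e : z + (y - x) = y + z - x by ring.
by move: hd; rewrite e => hd; rewrite (Gk_ext ex hy hz hd).
Qed.

Lemma Ak_ext (t x : R) : {ae leb, forall s, 0 <= s -> qk p w' Gk x s = qk p w Gk x s} ->
  Ak p w' Gk t x = Ak p w Gk t x.
Proof.
move=> h; apply: ge0_ae_eq_integral => //.
- exact: (measurable_qk_indc Gk0' mGk').
- exact: (measurable_qk_indc Gk0 mGk).
- by move=> s _; exact: (qk_indc_ge0 Gk0').
- by move=> s _; exact: (qk_indc_ge0 Gk0).
apply: (ae_imp h) => s hs _; rewrite indcE; case: ifPn => [/andP[s0 _]|_]; last by rewrite !mule0.
by rewrite hs.
Qed.
End two.
End KernelTime.

Lemma fin_num_le (R : realType) (a b : \bar R) : (0 <= a)%E -> (a <= b)%E -> b \is a fin_num ->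
  a \is a fin_num.
Proof. by move=> a0 ab bf; rewrite ge0_fin_numE//; apply: le_lt_trans ab _; rewrite ltey_eq bf. Qed.

Lemma add_fin_lty (R : realType) (a b : \bar R) : a \is a fin_num -> b \is a fin_num -> (a + b < +oo)%E.
Proof. by move=> af bf; rewrite ltey_eq fin_numD af bf. Qed.

Lemma measurable_fine_EFin (R : realType) (h : R -> \bar R) : measurable_fun setT h ->
  measurable_fun setT (fun s => (fine (h s))%:E).
Proof. by move=> mh; apply/measurable_EFinP; apply: measurableT_comp. Qed.

(** Stated additively, so that the inequality can be integrated without subtracting extended
    reals. *)
Lemma normr_increments (R : realType) (h a b c e D : R) : b <= a -> e <= c ->
  D <= `|(h + a - c) - (h + b - e)| -> D + (b + e) <= a + c.
Proof.
move=> ba ec hD.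
suff : `|(h + a - c) - (h + b - e)| <= (a - b) + (c - e) by move=> h1; lra.
by rewrite ler_norml; apply/andP; split; lra.
Qed.

Lemma measurable_integral_prod (R : realType)
    (K : measurableTypeR R * (measurableTypeR R * measurableTypeR R) -> \bar R) :
  measurable_fun setT K -> (forall q, 0 <= K q)%E ->
  measurable_fun setT (fun s : measurableTypeR R =>
    \int[(@lebesgue_measure R \x @lebesgue_measure R)%E]_r K (s, r))%E.
Proof.
move=> mK K0; pose RB := measurableTypeR R; pose leb := @lebesgue_measure R.
have mK1 (s : RB) : measurable_fun setT (fun r : RB * RB => K (s, r)).
  by apply: (measurableT_comp mK); apply: measurable_fun_pair; [exact: measurable_cst|exact: measurable_id].
have m2 : measurable_fun setT (fun q : RB * RB => \int[leb]_z K (q.1, (q.2, z)))%E.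
  apply: (@measurable_fun_fubini_tonelli_F _ _ (RB * RB)%type RB R leb (fun q => K (q.1.1, (q.1.2, q.2)))) => //.
  have m11 : measurable_fun setT (fun q : (RB * RB) * RB => q.1.1).
    exact: (measurableT_comp (@measurable_fst _ _ RB RB) (@measurable_fst _ _ (RB * RB)%type RB)).
  have m12 : measurable_fun setT (fun q : (RB * RB) * RB => q.1.2).
    exact: (measurableT_comp (@measurable_snd _ _ RB RB) (@measurable_fst _ _ (RB * RB)%type RB)).
  apply: (measurableT_comp mK (g := fun q : (RB * RB) * RB => (q.1.1, (q.1.2, q.2)))).
  apply: measurable_fun_pair; first exact: m11.
  by apply: measurable_fun_pair; [exact: m12|exact: measurable_snd].
have m1 : measurable_fun setT (fun s : RB => \int[leb]_y \int[leb]_z K (s, (y, z)))%E.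
  apply: (@measurable_fun_fubini_tonelli_F _ _ RB RB R leb (fun q => \int[leb]_z K (q.1, (q.2, z)))%E) => //.
  by move=> q; exact: integral_ge0.
apply: (eq_measurable_fun _ _ m1) => s _.
exact: (esym (@fubini_tonelli1 _ _ RB RB R leb leb (fun r => K (s, r)) (mK1 s) (fun r => K0 (s, r)))).
Qed.

Lemma max0_lip (R : realType) (a b : R) : `|Num.max 0 a - Num.max 0 b| <= `|a - b|.
Proof.
have h1 := ler_norm (a - b); have h2 := ler_norm (b - a); rewrite distrC in h2.
by rewrite ler_norml; case: (leP 0 a); case: (leP 0 b) => ? ?; apply/andP; split; lra.
Qed.

Lemma ereal_lip (R : realType) (X a0 b0 a b : \bar R) (c d : R) : a0 \is a fin_num -> b0 \is a fin_num ->
  a \is a fin_num -> b \is a fin_num -> (X + (a0 + b0) <= a + b)%E ->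
  (a + c%:E <= a0 + d%:E)%E -> (b + c%:E <= b0 + d%:E)%E -> (X <= (2 * (d - c))%:E)%E.
Proof.
move: a0 b0 a b => [a0||] [b0||] [a||] [b||] //= _ _ _ _; case: X => [X||].
- by rewrite -!EFinD !lee_fin => *; lra.
- by move=> /=; rewrite leye_eq.
- by move=> _ _ _; exact: leNye.
Qed.

(** * Construction of the mild solution *)

Section MildSolution.
Variable R : realType.
Notation RB := (measurableTypeR R).
Notation leb := (@lebesgue_measure R).
Variable p : R -> R.
Hypothesis mp : measurable_fun setT p.
Variable w : R -> R -> R.
Hypothesis mw : measurable_fun setT (fun q : RB * RB => w q.1 q.2).
Hypothesis w0 : forall x t, 0 <= w x t.
Hypothesis wneg : forall x t, x <= 0 -> w x t = 0.
Hypothesis HB : forall t : R, 0 <= t -> exists2 C : R, 0 <= C & forall s : R, 0 <= s <= t ->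
  (TT p (fun a b c d => rho a * (Gam (dq (w^~ s)) a b c d)%:E) <= C%:E)%E /\
  (TT p (fun a b c d => rho a * (Lam (dq (w^~ s)) a b c d)%:E) <= C%:E)%E.
Hypothesis DI : forall t : R, 0 <= t ->
  {ae leb, forall x, w x t - w x 0 = ak p w (@Gam R) t x - ak p w (@Lam R) t x}.
Notation g t := (dq (w^~ t)).
Notation AG := (Ak p w (@Gam R)).
Notation AL := (Ak p w (@Lam R)).

Let G0 := Gam0 w0. Let L0 := Lam0 w0. 
Let mG d S := @mGam R w mw d S. Let mL d S := @mLam R w mw d S.

(* The time-integrated equation defines the density at every time for almost every [x],
   whereas [w] is only determined up to a null set depending on [t]. *)
Definition Hm (x t : R) : R := g 0 x + fine (AG t x) - fine (AL t x).
(** The cut at 0 makes nonnegativity hold at every point; it is shown to be inactive at almost every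
    [x], for all times at once. [wm] is the associated Lebesgue density. *)
Definition fm (x t : R) : R := Num.max 0 (Hm x t).
Definition wm (x t : R) : R := fm x t * Num.sqrt x.

Lemma fm_ge0 x t : 0 <= fm x t. Proof. by rewrite le_max lexx. Qed.
Lemma wm_ge0 x t : 0 <= wm x t. Proof. by rewrite mulr_ge0 ?fm_ge0 ?sqrtr_ge0. Qed.

Let mgj : measurable_fun setT (fun q : RB * RB => g q.2 q.1).
Proof.
apply: measurable_funM; first exact: mw.
by apply: measurable_inv; apply: measurable_sqrt; meas.
Qed.

Let mg1 (t : R) : measurable_fun setT (g t).
Proof. by apply: (measurableT_comp mgj (g := fun x : RB => (x, t))); apply: measurable_fun_pair; meas. Qed.

Lemma measurable_Hm : measurable_fun setT (fun q : RB * RB => Hm q.1 q.2).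
Proof.
apply: measurable_funB; last by apply: measurableT_comp => //; apply: (mAk mp L0 mL); meas.
apply: measurable_funD; last by apply: measurableT_comp => //; apply: (mAk mp G0 mG); meas.
exact: (measurableT_comp (mg1 0) (@measurable_fst _ _ RB RB)).
Qed.

Lemma measurable_fm : measurable_fun setT (fun q : RB * RB => fm q.1 q.2).
Proof. by apply: measurable_maxr; [exact: measurable_cst|exact: measurable_Hm]. Qed.

Lemma measurable_wm : measurable_fun setT (fun q : RB * RB => wm q.1 q.2).
Proof. by apply: measurable_funM; [exact: measurable_fm|apply: measurable_sqrt; meas]. Qed.

Let G0' := Gam0 wm_ge0. Let L0' := Lam0 wm_ge0.
Let mG' d S := @mGam R wm measurable_wm d S. Let mL' d S := @mLam R wm measurable_wm d S.

Lemma mfm1 (t : R) : measurable_fun setT (fm^~ t).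
Proof. by apply: (measurableT_comp measurable_fm (g := fun x : RB => (x, t))); apply: measurable_fun_pair; meas. Qed.
Let mw1' (t : R) : measurable_fun setT (w^~ t).
Proof. by apply: (measurableT_comp mw (g := fun x : RB => (x, t))); apply: measurable_fun_pair; meas. Qed.

Lemma g_ge0 t x : 0 <= g t x. Proof. by rewrite divr_ge0 ?sqrtr_ge0. Qed.
Lemma g_neg t x : x <= 0 -> g t x = 0. Proof. by move=> x0; rewrite /dq wneg// mul0r. Qed.

Lemma wm_fm t x : 0 < x -> dq (wm^~ t) x = fm x t.
Proof. by move=> x0; rewrite /dq /wm mulfK// gt_eqF// sqrtr_gt0. Qed.
Lemma wm_neg t x : x <= 0 -> dq (wm^~ t) x = 0.
Proof. by move=> x0; rewrite /dq /wm ler0_sqrtr// mulr0 mul0r. Qed.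

Lemma Hm_ae (t : R) : 0 <= t -> {ae leb, forall x, 0 < x -> Hm x t = g t x}.
Proof.
move=> t0; apply: (ae_imp (DI t0)) => x h x0.
have s0 : Num.sqrt x != 0 by rewrite gt_eqF// sqrtr_gt0.
rewrite /Hm /dq; move: h; rewrite /ak -mulrBr; set d := _ - fine _ => h.
have -> : w x t = w x 0 + Num.sqrt x * d by rewrite -h addrC subrK.
by rewrite /d mulrDl mulrAC mulfV// mul1r addrA.
Qed.

Lemma fm_ae (t : R) : 0 <= t -> {ae leb, forall x, 0 < x -> fm x t = g t x}.
Proof.
by move=> t0; apply: (ae_imp (Hm_ae t0)) => x h x0; rewrite /fm h// (max_idPr (g_ge0 t x)).
Qed.

Lemma wm_ae (t : R) : 0 <= t -> {ae leb, forall x, dq (wm^~ t) x = g t x}.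
Proof.
move=> t0; apply: (ae_imp (fm_ae t0)) => x h.
by have [x0|x0] := leP x 0; [rewrite wm_neg// g_neg|rewrite wm_fm// h].
Qed.

(** Integer times suffice for finiteness because the accumulated rates increase with time, and they
    keep the exceptional set a countable union of null sets. *)
Definition good (x : R) : Prop := (forall n : nat, AG n%:R x \is a fin_num /\ AL n%:R x \is a fin_num) /\
  {ae leb, forall s, 0 <= s -> Hm x s = g s x}.

Lemma good_ae : {ae leb, forall x, 0 < x -> good x}.
Proof.
have h1 (n : nat) : {ae leb, forall x, 0 < x -> AG n%:R x \is a fin_num /\ AL n%:R x \is a fin_num}.
  have n0 : 0 <= n%:R :> R by [].
  have [C C00 hC] := HB n0.
  apply: (ae_imp2 (Ak_ae_fin mp G0 mG n0 C00 (fun s h => (hC s h).1))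
                  (Ak_ae_fin mp L0 mL n0 C00 (fun s h => (hC s h).2))).
  by move=> x a b x0; split; [exact: a|exact: b].
have h2 : {ae leb, forall x, forall n : nat, 0 < x -> AG n%:R x \is a fin_num /\ AL n%:R x \is a fin_num}.
  apply: (negligibleS _ (negligible_bigcup h1)) => x /= /existsNP[n hn].
  by exists n.
pose D (q : RB * RB) := Hm q.1 q.2 - g q.2 q.1.
have mD : measurable_fun setT D by apply: measurable_funB; [exact: measurable_Hm|exact: mgj].
(* The set of disagreement is null in [x] at each time; slicing it the other way gives agreement at
   almost every time for almost every [x]. *)
pose B : set (RB * RB) := (D @^-1` [set~ 0]) `&` (fst @^-1` `]0, +oo[%classic).
have mB : measurable B.
  apply: measurableI; rewrite -[X in measurable X]setTI.
    by apply: mD => //; apply: measurableC; exact: measurable_set1.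
  by apply: measurable_fst => //; exact: measurable_itv.
have hB (s : R) : 0 <= s -> {ae leb, forall x, ~ B (x, s)}.
  move=> s0; apply: (ae_imp (Hm_ae s0)) => x h [/= n]; rewrite in_itv/= andbT => x0.
  by apply: n; rewrite /D/= h// subrr.
apply: (ae_imp2 h2 (ae_prod mB hB)) => x a b x0; split; first by move=> n; exact: a.
apply: (ae_imp b) => s h s0; apply: contrapT => n; apply: (h s0); split; rewrite /= ?in_itv/= ?x0//.
by move/eqP; rewrite subr_eq0 => /eqP.
Qed.

Section good_point.
Variable x : R.
Hypothesis x0 : 0 < x.
Hypothesis gx : good x.

Lemma good_fin (t : R) : 0 <= t -> AG t x \is a fin_num /\ AL t x \is a fin_num.
Proof.
move=> t0; have tn : t <= (Num.bound t)%:R by apply/ltW/archi_boundP.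
case: gx => /(_ (Num.bound t))[a b] _.
split.
  exact: (fin_num_le (Ak0 p G0 t x) (Ak_mono mp G0 mG x tn) a).
exact: (fin_num_le (Ak0 p L0 t x) (Ak_mono mp L0 mL x tn) b).
Qed.

(** [Hm] is continuous in time at a good point and equals a nonnegative function at almost every
    time, so it is nonnegative at every time. *)
Lemma good_fm (t : R) : 0 <= t -> fm x t = Hm x t.
Proof.
move=> t0; rewrite /fm; apply/max_idPr.
have T0 : 0 <= t + 1 by rewrite addr_ge0.
apply: (@continuous_ae_ge0 R (Hm x) t (t + 1)); first by rewrite t0 ltrDl ltr01.
  have [a b] := good_fin T0.
  have /subspace_continuousP c1 := fine_Ak_continuous mp G0 mG T0 a.
  have /subspace_continuousP c2 := fine_Ak_continuous mp L0 mL T0 b.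
  apply/subspace_continuousP => s hs.
  apply: cvgB; last exact: c2.
  by apply: cvgD; [exact: cvg_cst|exact: c1].
case: gx => _ h; apply: (ae_imp h) => s e s0; rewrite e//; exact: g_ge0.
Qed.

Let qeq : {ae leb, forall s, 0 <= s -> qk p wm (@Gam R) x s = qk p w (@Gam R) x s /\
    qk p wm (@Lam R) x s = qk p w (@Lam R) x s}.
Proof.
case: gx => _ h; apply: (ae_imp h) => s e s0.
have ex : dq (wm^~ s) x = g s x.
  by rewrite wm_fm// /fm e// (max_idPr (g_ge0 s x)).
split.
  by apply: (qk_ext mp G0 mG G0' mG' _ ex (wm_ae s0)) => h1 h2 a b c d; rewrite /Gam => -> -> -> ->.
by apply: (qk_ext mp L0 mL L0' mL' _ ex (wm_ae s0)) => h1 h2 a b c d; rewrite /Lam => -> -> -> ->.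
Qed.

(** Closes the loop: [Hm] accumulates rates computed from [w], while the mild equation asks for the
    rates of the solution itself. At a good point the two agree at almost every time. *)
Lemma Ak_wm (t : R) : Ak p wm (@Gam R) t x = AG t x /\ Ak p wm (@Lam R) t x = AL t x.
Proof.
split.
  by apply: (Ak_ext mp G0 mG G0' mG'); apply: (ae_imp qeq) => s h s0; case: (h s0).
by apply: (Ak_ext mp L0 mL L0' mL'); apply: (ae_imp qeq) => s h s0; case: (h s0).
Qed.

Lemma W_xstar0 y z : 0 < y -> 0 < z -> y + z - x <= 0 -> W p x y z = 0.
Proof.
move=> y0 z0 h; rewrite /W /xstar (max_idPr h) !mul0r ltxx.
by rewrite (gt_eqF x0) (gt_eqF y0) (gt_eqF z0).
Qed.

(** [fm] and [dq] of [wm] may differ at nonpositive arguments, and the fourth argument may differ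
    from [xstar]; in each of these cases a root or [W] vanishes. *)
Lemma Zk_wm (Gk : (R -> R) -> R -> R -> R -> R -> R) (s y z : R) :
  (forall (h h' : R -> R) (a b c d : R), h a = h' a -> h b = h' b ->
    h c = h' c -> h d = h' d -> Gk h a b c d = Gk h' a b c d) -> 0 <= y -> 0 <= z ->
  Zk p wm Gk x s y z = (W p x y z * Gk (fm^~ s) x y z (xstar x y z) * Num.sqrt y * Num.sqrt z)%:E.
Proof.
move=> ext y0 z0; rewrite /Zk; congr EFin.
move: y0; rewrite le_eqVlt => /predU1P[<-|y0]; first by rewrite sqrtr0 !mulr0 !mul0r.
move: z0; rewrite le_eqVlt => /predU1P[<-|z0]; first by rewrite sqrtr0 !mulr0.
have [h|h] := leP (y + z - x) 0; first by rewrite W_xstar0// !mul0r.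
congr (_ * _ * _ * _); rewrite /xstar (max_idPl (ltW h)).
by apply: ext; rewrite wm_fm.
Qed.

Let extG (h h' : R -> R) (a b c d : R) : h a = h' a -> h b = h' b ->
    h c = h' c -> h d = h' d -> Gam h a b c d = Gam h' a b c d.
Proof. by rewrite /Gam => -> -> -> ->. Qed.
Let extL (h h' : R -> R) (a b c d : R) : h a = h' a -> h b = h' b ->
    h c = h' c -> h d = h' d -> Lam h a b c d = Lam h' a b c d.
Proof. by rewrite /Lam => -> -> -> ->. Qed.

Let ZG s (r : RB * RB) := Zk p wm (@Gam R) x s r.1 r.2.
Let ZL s (r : RB * RB) := Zk p wm (@Lam R) x s r.1 r.2.

Lemma measurable_quadrant : measurable (@quadrant R).
Proof.
rewrite (_ : @quadrant R = `[0, +oo[%classic `*` `[0, +oo[%classic).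
  by apply: measurableX; exact: measurable_itv.
by apply/seteqP; split => -[a b] /=; rewrite !in_itv/= !andbT.
Qed.

Let mZG s : measurable_fun setT (ZG s). Proof. by apply: (mZk mp mG'); meas. Qed.
Let mZL s : measurable_fun setT (ZL s). Proof. by apply: (mZk mp mL'); meas. Qed.

Let iZG s : (\int[(leb \x leb)%E]_(r in @quadrant R) ZG s r)%E = qk p wm (@Gam R) x s.
Proof. exact: (integral_quadrant_Zk mp G0' mG'). Qed.
Let iZL s : (\int[(leb \x leb)%E]_(r in @quadrant R) ZL s r)%E = qk p wm (@Lam R) x s.
Proof. exact: (integral_quadrant_Zk mp L0' mL'). Qed.

Lemma integral_gain_loss (s : R) :
  (\int[(leb \x leb)%E]_(r in @quadrant R)
     (W p x r.1 r.2 * (gain fm x r.1 r.2 s + loss fm x r.1 r.2 s) * Num.sqrt r.1 * Num.sqrt r.2)%:E =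
   qk p wm (@Gam R) x s + qk p wm (@Lam R) x s)%E.
Proof.
have D := ge0_integralD (leb \x leb)%E measurable_quadrant
  (fun r _ => Zk0 p G0' x s r.1 r.2) (measurable_funTS (mZG s))
  (fun r _ => Zk0 p L0' x s r.1 r.2) (measurable_funTS (mZL s)).
apply: (etrans _ (etrans D (f_equal2 adde (iZG s) (iZL s)))).
apply: eq_integral => -[y z]; rewrite inE /quadrant/= => -[y0 z0].
have e (W0 G L a b : R) : W0 * (G + L) * a * b = W0 * G * a * b + W0 * L * a * b by ring.
apply: (etrans _ (f_equal2 adde (esym (Zk_wm s extG y0 z0)) (esym (Zk_wm s extL y0 z0)))).
exact: (etrans (congr1 EFin (e _ _ _ _ _)) (EFinD _ _)).
Qed.

Let mqG : measurable_fun setT (fun s : R => qk p wm (@Gam R) x s).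
Proof. exact: (measurable_qk_time mp G0' mG'). Qed.
Let mqL : measurable_fun setT (fun s : R => qk p wm (@Lam R) x s).
Proof. exact: (measurable_qk_time mp L0' mL'). Qed.

Lemma good_finite (t : R) : 0 <= t ->
  (\int[leb]_(tau in `[0%R, t])
          \int[(leb \x leb)%E]_(r in @quadrant R)
             (W p x r.1 r.2 * (gain fm x r.1 r.2 tau + loss fm x r.1 r.2 tau)
               * Num.sqrt r.1 * Num.sqrt r.2)%:E < +oo)%E.
Proof.
move=> t0; have [a b] := good_fin t0; have [ea eb] := Ak_wm t.
have mI : measurable (`[0, t]%classic : set RB) by exact: measurable_itv.
have e : (\int[leb]_(tau in `[0%R, t]) (qk p wm (@Gam R) x tau + qk p wm (@Lam R) x tau) = AG t x + AL t x)%E.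
  have D := ge0_integralD leb mI (fun s _ => qk0 p G0' x s) (measurable_funTS mqG)
    (fun s _ => qk0 p L0' x s) (measurable_funTS mqL).
  apply: (etrans D (f_equal2 adde _ _)); first by rewrite -ea; exact: AkE.
  by rewrite -eb; exact: AkE.
have -> : (\int[leb]_(tau in `[0%R, t])
          \int[(leb \x leb)%E]_(r in @quadrant R)
             (W p x r.1 r.2 * (gain fm x r.1 r.2 tau + loss fm x r.1 r.2 tau)
               * Num.sqrt r.1 * Num.sqrt r.2)%:E = AG t x + AL t x)%E.
  by apply: (etrans _ e); apply: eq_integral => s _; exact: integral_gain_loss.
exact: add_fin_lty.
Qed.

Let Dq (s : R) := (\int[(leb \x leb)%E]_(r in @quadrant R) (ZG s r - ZL s r))%E.

Let QopD s : Qop p fm x s = fine (Dq s).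
Proof.
rewrite /Qop /Rintegral; congr fine; apply: eq_integral => -[y z]; rewrite inE /quadrant/= => -[y0 z0].
have e (W0 G L a b : R) : W0 * (G - L) * a * b = W0 * G * a * b - W0 * L * a * b by ring.
apply: (etrans _ (f_equal2 (fun a b => a - b)%E (esym (Zk_wm s extG y0 z0)) (esym (Zk_wm s extL y0 z0)))).
exact: (etrans (congr1 EFin (e _ _ _ _ _)) (EFinB _ _)).
Qed.

(** [Qop] has to be measurable in time before it can be replaced almost everywhere by the difference
    of the two rates. Its integrand is signed, so the positive and negative parts are treated one by
    one. *)
Let mDq : measurable_fun setT (Dq : RB -> \bar R).
Proof.
pose h (r : RB * (RB * RB)) := (ZG r.1 r.2 - ZL r.1 r.2)%E.
have mh : measurable_fun setT h.
  apply: emeasurable_funB; [apply: (mZk mp mG')|apply: (mZk mp mL')]; do ?exact: measurable_cst; do ?exact: measurable_fst.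
  - by apply: (measurableT_comp (@measurable_fst _ _ RB RB)); exact: measurable_snd.
  - by apply: (measurableT_comp (@measurable_snd _ _ RB RB)); exact: measurable_snd.
  - by apply: (measurableT_comp (@measurable_fst _ _ RB RB)); exact: measurable_snd.
  - by apply: (measurableT_comp (@measurable_snd _ _ RB RB)); exact: measurable_snd.
pose k (r : RB * (RB * RB)) : \bar R := (h r * (\1_(@quadrant R) r.2)%:E)%E.
have mk : measurable_fun setT k.
  apply: emeasurable_funM => //; apply/measurable_EFinP.
  have mi : measurable_fun setT (\1_(@quadrant R) : RB * RB -> R).
    by apply: measurable_indic; exact: measurable_quadrant.
  exact: (measurableT_comp mi (@measurable_snd _ _ RB (RB * RB)%type)).
have e s : Dq s = (\int[(leb \x leb)%E]_r (k^\+ (s, r)) - \int[(leb \x leb)%E]_r (k^\- (s, r)))%E.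
  have kE r : ((fun r => ZG s r - ZL s r)%E \_ (@quadrant R)) r = k (s, r).
    rewrite patchE /k indicE; case: (boolP (r \in @quadrant R)) => hr; first exact: (esym (mule1 _)).
    exact: (esym (mule0 _)).
  rewrite /Dq integral_mkcond integralE; apply: (f_equal2 (fun a b => a - b)%E); apply: eq_integral => r _.
    exact: (etrans (funeposE _ _) (etrans (congr1 (fun X => maxe X 0%E) (kE r)) (esym (funeposE _ _)))).
  exact: (etrans (funenegE _ _) (etrans (congr1 (fun X => maxe (- X)%E 0%E) (kE r)) (esym (funenegE _ _)))).
have kp0 q : (0 <= (k^\+)%E q)%E by exact: funepos_ge0.
have kn0 q : (0 <= (k^\-)%E q)%E by exact: funeneg_ge0.
have mp' := measurable_integral_prod (measurable_funepos mk) kp0.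
have mn' := measurable_integral_prod (measurable_funeneg mk) kn0.
by apply: (eq_measurable_fun _ _ (emeasurable_funB mp' mn')) => s _; exact: (esym (e s)).
Qed.

Let Dq_fin (s : R) : qk p wm (@Gam R) x s \is a fin_num -> qk p wm (@Lam R) x s \is a fin_num ->
  fine (Dq s) = fine (qk p wm (@Gam R) x s) - fine (qk p wm (@Lam R) x s).
Proof.
move=> a b.
have integ (Z : RB * RB -> \bar R) (Q : \bar R) : measurable_fun setT Z -> (forall r, 0 <= Z r)%E ->
    (\int[(leb \x leb)%E]_(r in @quadrant R) Z r)%E = Q -> Q \is a fin_num ->
    ((leb \x leb)%E).-integrable (@quadrant R) Z.
  move=> mZ Z0 e f; apply/integrableP; split; first exact: measurable_funTS.
  have -> : (\int[(leb \x leb)%E]_(r in @quadrant R) `|Z r|)%E = Q.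
    by rewrite -e; apply: eq_integral => r _; rewrite gee0_abs.
  by rewrite ltey_eq f.
have i1 := integ _ _ (mZG s) (fun r => Zk0 p G0' x s r.1 r.2) (iZG s) a.
have i2 := integ _ _ (mZL s) (fun r => Zk0 p L0' x s r.1 r.2) (iZL s) b.
have e : Dq s = (qk p wm (@Gam R) x s - qk p wm (@Lam R) x s)%E.
  exact: (etrans (integralB measurable_quadrant i1 i2) (f_equal2 (fun a b => a - b)%E (iZG s) (iZL s))).
exact: (etrans (congr1 fine e) (fineB a b)).
Qed.

(** [Qop] equals gain rate minus loss rate at the times where both are finite, which are almost all
    times because both accumulated rates are finite. *)
Lemma good_mild (t : R) : 0 <= t ->
  fm x t = fm x 0 + Rintegral leb `[0, t] (fun tau => Qop p fm x tau).
Proof.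
move=> t0; have [a b] := good_fin t0; have [ea eb] := Ak_wm t.
have mI : measurable (`[0, t]%classic : set RB) by exact: measurable_itv.
have e0 : Hm x 0 = g 0 x by rewrite /Hm !Ak_at0/= subr0 addr0.
rewrite (good_fm t0) (good_fm (lexx 0)) e0 /Hm -addrA; congr (_ + _).
have a' : Ak p wm (@Gam R) t x \is a fin_num by rewrite ea.
have b' : Ak p wm (@Lam R) t x \is a fin_num by rewrite eb.
have [i1 [e1 f1]] := Ak_fine mp G0' mG' a'.
have [i2 [e2 f2]] := Ak_fine mp L0' mL' b'.
have eI : (\int[leb]_(s in `[0%R, t]) (Qop p fm x s)%:E = AG t x - AL t x)%E.
  apply: (etrans _ (etrans (integralB mI i1 i2) (f_equal2 (fun a b => a - b)%E (etrans e1 ea) (etrans e2 eb)))).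
  have m1 : measurable_fun (`[0, t]%classic : set RB) (fun s => (Qop p fm x s)%:E).
    apply: (eq_measurable_fun (fun s => (fine (Dq s))%:E)) => [s _|]; first by rewrite QopD.
    exact: (measurable_funTS (measurable_fine_EFin mDq)).
  apply: (@ae_eq_integral _ _ _ leb _ _ _ mI m1).
    exact: (emeasurable_funB (measurable_funTS (measurable_fine_EFin mqG)) (measurable_funTS (measurable_fine_EFin mqL))).
  apply: (ae_imp2 f1 f2) => s h1 h2 hs.
  exact: (etrans (congr1 EFin (etrans (QopD s) (Dq_fin (h1 hs) (h2 hs)))) (EFinB _ _)).
exact: (esym (etrans (congr1 fine eI) (fineB a b))).
Qed.
End good_point.

Lemma integral_fm (psi : R -> R) (t : R) : 0 <= t -> measurable_fun setT psi -> (forall x, 0 <= psi x) ->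
  (\int[leb]_(x in @nonneg R) (psi x * fm x t)%:E = \int[leb]_x (psi x * g t x)%:E)%E.
Proof.
move=> t0 mpsi psi0; rewrite integral_mkcond; apply: ge0_ae_eq_integral => //.
- apply/(measurable_restrictT _ (@measurable_nonneg R)); apply: measurable_funTS; apply/measurable_EFinP.
  by apply: measurable_funM => //; exact: mfm1.
- by apply/measurable_EFinP; apply: measurable_funM => //; exact: mg1.
- by move=> x _; rewrite patchE; case: ifP => // _; rewrite lee_fin mulr_ge0// fm_ge0.
- by move=> x _; rewrite lee_fin mulr_ge0// g_ge0.
apply: (ae_imp2 (fm_ae t0) (@ae_neq0 R)) => x h x0 _; rewrite patchE.
case: ifPn => hx.
  move: hx; rewrite inE /nonneg/= => hx.
  by rewrite h// lt_neqAle hx andbT eq_sym; apply/eqP.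
move: hx; rewrite notin_setE /nonneg/= => /negP; rewrite -ltNge => hx.
by rewrite g_neg ?mulr0// ltW.
Qed.

Lemma integral_fm_sqrt (psi : R -> R) (t : R) : 0 <= t -> measurable_fun setT psi -> (forall x, 0 <= psi x) ->
  (\int[leb]_(x in @nonneg R) (psi x * (fm x t * Num.sqrt x))%:E = \int[leb]_x (psi x * w x t)%:E)%E.
Proof.
move=> t0 mpsi psi0.
have m : measurable_fun setT (fun x : RB => psi x * Num.sqrt x).
  by apply: measurable_funM => //; exact: (@measurable_sqrt _ _ RB setT (fun x => x)).
have c x : 0 <= psi x * Num.sqrt x by rewrite mulr_ge0 ?sqrtr_ge0.
apply: (etrans _ (etrans (integral_fm t0 m c) _)).
  by apply: eq_integral => x _; congr EFin; ring.
apply: eq_integral => x _; congr EFin.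
have [x0|x0] := leP x 0; first by rewrite g_neg// wneg// !mulr0.
by rewrite /dq -mulrA; congr (_ * _); rewrite mulrCA mulfV ?mulr1// gt_eqF// sqrtr_gt0.
Qed.

(** Strips the factor [sqrt x] from [ak] and so measures the accumulated rates in [L^1(dx)]; being
    below [rho], it inherits the collision bounds. *)
Let phi (x : R) : R := (Num.sqrt x)^-1.
Let mphi : measurable_fun setT (phi : RB -> R).
Proof. by apply: measurable_inv; exact: (@measurable_sqrt _ _ RB setT (fun x => x)). Qed.
Let phi0 x : 0 <= phi x. Proof. by rewrite invr_ge0 sqrtr_ge0. Qed.
Let psi x : \bar R := (phi x)%:E.
Let mpsi : measurable_fun setT (psi : RB -> \bar R). Proof. by apply/measurable_EFinP; exact: mphi. Qed.
Let psi0 x : (0 <= psi x)%E. Proof. by rewrite lee_fin. Qed.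
Let psi_rho x : (psi x <= rho x)%E.
Proof.
rewrite /psi /phi /rho /rinv; case: ifPn => [x0|_]; first by rewrite addey// leey.
by rewrite -EFinD lee_fin lerDr ler01.
Qed.

Let M Gk t := (\int[leb]_x (phi x * ak p w Gk t x)%:E)%E.

(** The weighted collision integral is at most [C] at each time of [[0, T]], so its time integral
    grows by at most [C * (t - t0)]. Both sides are arranged as sums of nonnegative integrands. *)
Lemma integral_ak_lip (Gk : (R -> R) -> R -> R -> R -> R -> R)
    (Gk0 : forall t a b c d, 0 <= Gk (g t) a b c d)
    (mGk : forall d (S : measurableType d) (t a b c e : S -> R),
      measurable_fun setT t -> measurable_fun setT a -> measurable_fun setT b ->
      measurable_fun setT c -> measurable_fun setT e ->
      measurable_fun setT (fun s => Gk (g (t s)) (a s) (b s) (c s) (e s)))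
    (T C t0 t : R) : 0 <= t0 -> t0 <= t -> t <= T -> 0 <= C ->
  (forall s : R, 0 <= s <= T -> (TT p (fun a b c d => rho a * (Gk (g s) a b c d)%:E) <= C%:E)%E) ->
  [/\ M Gk t0 \is a fin_num, M Gk t \is a fin_num & (M Gk t + (C * t0)%:E <= M Gk t0 + (C * t)%:E)%E].
Proof.
move=> t00 tt tT C00 hC.
pose TG s := TT p (fun a b c d => psi a * (Gk (g s) a b c d)%:E)%E.
have TG0 s : (0 <= TG s)%E := TT_time_ge0 mp Gk0 mGk s psi0.
have mTG := measurable_TTk_time mp Gk0 mGk mpsi psi0.
have TGC (s : R) : 0 <= s <= T -> (TG s <= C%:E)%E.
  move=> hs; exact: (le_trans (TT_time_le mp Gk0 mGk s mpsi psi0 (@measurable_rho R) (@rho_ge0 R) psi_rho) (hC s hs)).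
have ME (s : R) : 0 <= s -> s <= T -> M Gk s = (\int[leb]_r (TG r * (indc s r)%:E))%E /\ M Gk s \is a fin_num.
  move=> s0 sT.
  have hs (r : R) : 0 <= r <= s -> 0 <= r <= T by move=> /andP[-> rs]; exact: le_trans rs sT.
  have e1 := Ak_int mp Gk0 mGk s0 C00 (fun r h => hC r (hs r h)) mphi phi0.
  split; first exact: (etrans e1 (integral_Ak mp Gk0 mGk s mpsi psi0)).
  have le := integral_Ak_le mp Gk0 mGk mpsi psi0 s0 C00 (fun r h => TGC r (hs r h)).
  have le' : (M Gk s <= (C * s)%:E)%E := eq_ind_r (fun X => (X <= (C * s)%:E)%E) le e1.
  apply: (fin_num_le _ le') => //; apply: integral_ge0 => x _.
  by rewrite lee_fin mulr_ge0// (ak0 p Gk0).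
have [e1 f1] := ME t0 t00 (le_trans tt tT).
have t_ge0 := le_trans t00 tt.
have [e2 f2] := ME t t_ge0 tT.
split=> //.
have mi s : measurable_fun setT (fun r : R => (indc s r)%:E).
  apply/measurable_EFinP; apply: (measurableT_comp (@measurable_indc R) (g := fun r : RB => (s, r))).
  by apply: measurable_fun_pair; meas.
have i0 s r : (0 <= (indc s r)%:E :> \bar R)%E by rewrite lee_fin; case/andP: (indc01 s r).
have Ci (s : R) : 0 <= s -> (\int[leb]_r (C%:E * (indc s r)%:E) = (C * s)%:E)%E.
  move=> s0; rewrite ge0_integralZl_EFin//; last exact: (mi s).
  exact: (congr1 (fun X => (C%:E * X)%E) (etrans (integral_indic_itv s0) (congr1 EFin (subr0 s)))).
have mT s : measurable_fun setT (fun r : R => TG r * (indc s r)%:E)%E by exact: emeasurable_funM.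
have mC s : measurable_fun setT (fun r : R => C%:E * (indc s r)%:E)%E.
  by apply: emeasurable_funM => //; exact: measurable_cst.
have T0 s r : (0 <= TG r * (indc s r)%:E)%E by exact: mule_ge0.
have C1 s r : (0 <= C%:E * (indc s r)%:E)%E by apply: mule_ge0 => //; rewrite lee_fin.
have D1 := ge0_integralD leb measurableT (fun r _ => T0 t r) (mT t) (fun r _ => C1 t0 r) (mC t0).
have D2 := ge0_integralD leb measurableT (fun r _ => T0 t0 r) (mT t0) (fun r _ => C1 t r) (mC t).
have E1 := etrans D1 (f_equal2 adde (esym e2) (Ci t0 t00)).
have E2 := etrans D2 (f_equal2 adde (esym e1) (Ci t t_ge0)).
suff le : (\int[leb]_r (TG r * (indc t r)%:E + C%:E * (indc t0 r)%:E) <=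
           \int[leb]_r (TG r * (indc t0 r)%:E + C%:E * (indc t r)%:E))%E.
  exact: (eq_ind _ (fun X => (X <= _)%E) (eq_ind _ (fun X => (_ <= X)%E) le _ E2) _ E1).
apply: ge0_le_integral; first exact: measurableT.
- by move=> r _; apply: adde_ge0; [exact: T0|exact: C1].
- exact: (emeasurable_funD (mT t) (mC t0)).
- exact: (emeasurable_funD (mT t0) (mC t)).
move=> r _; rewrite !indcE; case: (boolP (0 <= r <= t0)) => [/andP[r0 rt]|hn].
  by rewrite r0 (le_trans rt tt)/= !mule1.
case: (boolP (0 <= r <= t)) => [/andP[r0 rt]|hn']; last by rewrite !mule0.
by rewrite !mule0 !mule1 adde0 add0e; apply: TGC; rewrite r0 (le_trans rt tT).
Qed.

(** The cut at 0 is a contraction and both accumulated rates are nondecreasing, so the change of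
    [fm] is at most the sum of their increments, each with Lipschitz integral in time. *)
Lemma fm_L1_lip (T : R) : 0 <= T -> exists2 C : R, 0 <= C & forall t0 t : R, 0 <= t0 -> t0 <= t -> t <= T ->
  (\int[leb]_(x in @nonneg R) `|(fm x t - fm x t0)%:E| <= (2 * (C * t - C * t0))%:E)%E.
Proof.
move=> T0; have [C C00 hC] := HB T0; exists C => // t0 t t00 tt tT.
have hG s h := (hC s h).1; have hL s h := (hC s h).2.
have [fG0 fG lG] := integral_ak_lip G0 mG t00 tt tT C00 hG.
have [fL0 fL lL] := integral_ak_lip L0 mL t00 tt tT C00 hL.
apply: (ereal_lip fG0 fL0 fG fL _ lG lL).
pose d (x : R) : \bar R := `|(fm x t - fm x t0)%:E|%E.
have md : measurable_fun setT d.
  apply: (measurableT_comp (f := abse)) => //; apply/measurable_EFinP.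
  by apply: measurable_funB; exact: mfm1.
pose P := d \_ (@nonneg R).
have mP : measurable_fun setT P.
  by apply/(measurable_restrictT _ (@measurable_nonneg R)); exact: measurable_funTS.
have P0 x : (0 <= P x)%E by rewrite /P patchE; case: ifP => // _; exact: abse_ge0.
pose aG s (x : R) : \bar R := (phi x * ak p w (@Gam R) s x)%:E.
pose aL s (x : R) : \bar R := (phi x * ak p w (@Lam R) s x)%:E.
have aG0 s x : (0 <= aG s x)%E by rewrite lee_fin mulr_ge0// (ak0 p G0).
have aL0 s x : (0 <= aL s x)%E by rewrite lee_fin mulr_ge0// (ak0 p L0).
have maG s : measurable_fun setT (aG s).
  by apply/measurable_EFinP; apply: (measurable_funM mphi); exact: (mak mp G0 mG).
have maL s : measurable_fun setT (aL s).
  by apply/measurable_EFinP; apply: (measurable_funM mphi); exact: (mak mp L0 mL).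
have D1 := ge0_integralD leb measurableT (fun x _ => aG0 t0 x) (maG t0) (fun x _ => aL0 t0 x) (maL t0).
have D2 := ge0_integralD leb measurableT (fun x _ => aG0 t x) (maG t) (fun x _ => aL0 t x) (maL t).
have m1 := emeasurable_funD (maG t0) (maL t0).
have D3 := ge0_integralD leb measurableT (fun x _ => P0 x) mP (fun x _ => adde_ge0 (aG0 t0 x) (aL0 t0 x)) m1.
have E3 := etrans D3 (f_equal2 adde (esym (integral_mkcond _ _)) D1).
apply: (eq_ind _ (fun X => (X <= _)%E) _ _ E3).
apply: (eq_ind _ (fun X => (_ <= X)%E) _ _ D2).
apply: ae_ge0_le_integral.
- exact: measurableT.
- move=> x _; exact: (adde_ge0 (P0 x) (adde_ge0 (aG0 t0 x) (aL0 t0 x))).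
- exact: (emeasurable_funD mP m1).
- move=> x _; exact: (adde_ge0 (aG0 t x) (aL0 t x)).
- exact: (emeasurable_funD (maG t) (maL t)).
have a1 := Ak_ae_fin mp G0 mG T0 C00 hG; have a2 := Ak_ae_fin mp L0 mL T0 C00 hL.
have a12 : {ae leb, forall x, 0 < x -> AG T x \is a fin_num /\ AL T x \is a fin_num}.
  by apply: (ae_imp2 a1 a2) => x h1 h2 x0; split; [exact: h1|exact: h2].
apply: (ae_imp2 a12 (@ae_neq0 R)) => x h xn0 _.
(* On the negative axis all terms vanish: the restriction excludes it on the left, and on the right
   [phi] is 0 there because the inverse of 0 is 0. *)
have [x0|x0] := leP x 0.
  have x1 : x < 0 by rewrite lt_neqAle x0 andbT; apply/eqP.
  have Px : P x = 0%E by rewrite /P patchE memNset// /nonneg/= leNgt x1.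
  have p0 : phi x = 0 by rewrite /phi ler0_sqrtr// invr0.
  have z (a : R) : (phi x * a)%:E = 0%E by rewrite p0 mul0r.
  have zz (A a b c e : \bar R) : A = 0%E -> a = 0%E -> b = 0%E -> c = 0%E -> e = 0%E ->
    (A + (a + b) <= c + e)%E by move=> -> -> -> -> ->; rewrite !adde0.
  exact: (zz _ _ _ _ _ Px (z _) (z _) (z _) (z _)).
have [fGT fLT] := h x0.
have ph s Gk : phi x * ak p w Gk s x = fine (Ak p w Gk s x).
  by rewrite /phi /ak mulKf// gt_eqF// sqrtr_gt0.
have fin1 := fin_num_le (Ak0 p G0 t x) (Ak_mono mp G0 mG x tT) fGT.
have fin2 := fin_num_le (Ak0 p L0 t x) (Ak_mono mp L0 mL x tT) fLT.
have g1 : fine (AG t0 x) <= fine (AG t x).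
  have le := Ak_mono mp G0 mG x tt.
  exact: (fine_le (fin_num_le (Ak0 p G0 t0 x) le fin1) fin1 le).
have g2 : fine (AL t0 x) <= fine (AL t x).
  have le := Ak_mono mp L0 mL x tt.
  exact: (fine_le (fin_num_le (Ak0 p L0 t0 x) le fin2) fin2 le).
have Px : P x = (`|fm x t - fm x t0|)%:E by rewrite /P patchE mem_set// /nonneg/= ltW.
have key (A : \bar R) (D a0 b0 a b a0' b0' a' b' : R) : A = D%:E -> a0' = a0 -> b0' = b0 -> a' = a -> b' = b ->
    D + (a0 + b0) <= a + b -> (A + (a0'%:E + b0'%:E) <= a'%:E + b'%:E)%E.
  by move=> -> -> -> -> ->; rewrite -!EFinD lee_fin.
apply: (key _ _ _ _ _ _ _ _ _ _ Px (ph _ _) (ph _ _) (ph _ _) (ph _ _)).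
exact: (normr_increments g1 g2 (max0_lip (Hm x t) (Hm x t0))).
Qed.

Lemma fm_C_L1 : (forall t : R, 0 <= t -> exists K : R, (\int[leb]_x (g t x)%:E <= K%:E)%E) -> C_L1 fm.
Proof.
move=> HK; split.
  move=> t t0; have [K hK] := HK t t0; apply/integrableP; split.
    by apply/measurable_EFinP; apply: measurable_funTS; exact: mfm1.
  have := @integral_fm (fun=> 1) t t0 (measurable_cst _) (fun=> ler01).
  have -> : (\int[leb]_x (1 * g t x)%:E)%E = (\int[leb]_x (g t x)%:E)%E.
    by apply: eq_integral => x _; rewrite mul1r.
  move=> e; apply: le_lt_trans (ltry K); apply: le_trans hK; rewrite -e.
  rewrite le_eqVlt; apply/orP; left; apply/eqP; apply: eq_integral => x _.
  by rewrite mul1r gee0_abs// lee_fin fm_ge0.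
move=> t0 t00; have T0 : 0 <= t0 + 1 by rewrite addr_ge0.
have [C C00 lip] := fm_L1_lip T0.
have bound (t : R) : 0 <= t -> `|t0 - t| < 1 ->
    (\int[leb]_(x in @nonneg R) `|(fm x t - fm x t0)%:E| <= (2 * C * `|t0 - t|)%:E)%E.
  move=> tp ht; have [tt|tt] := leP t0 t.
    apply: le_trans (lip t0 t t00 tt _) _.
      by move: ht; rewrite distrC ltr_norml => /andP[_ ?]; lra.
    rewrite lee_fin distrC ger0_norm ?subr_ge0//.
    by move: tt ht C00 => _ _ _; rewrite -mulrBr mulrA.
  have -> : (\int[leb]_(x in @nonneg R) `|(fm x t - fm x t0)%:E| = \int[leb]_(x in @nonneg R) `|(fm x t0 - fm x t)%:E|)%E.
    by apply: eq_integral => x _; rewrite /= distrC.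
  apply: le_trans (lip t t0 tp (ltW tt) _) _; first by rewrite lerDl.
  by rewrite lee_fin gtr0_norm ?subr_gt0// -mulrBr mulrA.
have pos t : (0 <= \int[leb]_(x in @nonneg R) `|(fm x t - fm x t0)%:E|)%E.
  by apply: integral_ge0 => x _; exact: abse_ge0.
apply: cvg_EFin.
  exists 1 => //= t ht tp; have b := bound t tp ht.
  rewrite ge0_fin_numE ?pos//; exact: le_lt_trans b (ltry _).
apply/cvgrPdist_le => e e0.
(* The distance 1 keeps [t] in the interval where the Lipschitz bound holds; [+ 1] in the
   denominator covers [C = 0]. *)
have d0 : 0 < Num.min 1 (e / (2 * C + 1)).
  by rewrite lt_min ltr01 divr_gt0//; lra.
exists (Num.min 1 (e / (2 * C + 1))) => //= t; rewrite /ball_/= lt_min => /andP[h1 h2] tp.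
have b := bound t tp h1.
have bf : (\int[leb]_(x in @nonneg R) `|(fm x t - fm x t0)%:E|)%E \is a fin_num.
  by rewrite ge0_fin_numE ?pos//; exact: le_lt_trans b (ltry _).
rewrite sub0r normrN ger0_norm ?fine_ge0 ?pos//.
rewrite -lee_fin fineK//; apply: le_trans b _; rewrite lee_fin.
move: h2; rewrite ltr_pdivlMr; last by lra.
have := normr_ge0 (t0 - t); move: `|t0 - t| => v v0; nra.
Qed.

End MildSolution.

(** * Assembly of the regularity result *)

Theorem theorem1p3 (R : realType) (ph : R -> R) (b0 eta : R) (k : R -> R)
    (F : R -> {finite_measure set (measurableTypeR R) -> \bar R})
    (f0 : R -> R) :
  kernel_assumption ph b0 eta k ->
  3 / 2 <= eta ->
  cons_measure_solution ph F ->
  measurable_fun ((@nonneg R)) f0 ->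
  (forall A, measurable A ->
     F 0%R A = (\int[@lebesgue_measure R]_(x in A `&` (@nonneg R))
                (f0 x * Num.sqrt x)%:E)%E) ->
  (moment (- (1 / 2))%R (F 0%R) < +oo)%E ->
  exists f : R -> R -> R,
    (forall t, 0 <= t -> forall A, measurable A ->
       F t A = (\int[@lebesgue_measure R]_(x in A `&` (@nonneg R))
                  (f x t * Num.sqrt x)%:E)%E) /\
    mild_solution ph f /\
    C_L1 f /\
    {ae @lebesgue_measure R, forall x, (@nonneg R) x -> f x 0 = f0 x} /\
    conservative f.
Proof.
move=> KA _ sol0 mf0 F0E mom.
pose p := pos_ext ph.
have eW : W ph = W p := W_pos_ext ph.
have sol : cons_measure_solution p F.
  by move: sol0; rewrite /cons_measure_solution /Jop /Kop eW.
have mp : measurable_fun setT p := measurable_pos_ext KA.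
have b0_gt0 : 0 < b0 by case: KA => _ [].
have p_ge0 := pos_ext_ge0 KA; have p_leb := pos_ext_leb KA; have p_lin := pos_ext_lin KA.
have [L [dl [L_ge0 dl_gt0 p_dil]]] := pos_ext_dil KA.
have C0E := erefl (32 * b0 ^+ 2).
have mnn := @measurable_nonneg R.
have ms : measurable_fun setT (fun x : R => Num.sqrt x) := @measurable_sqrt _ _ _ setT _ (@measurable_id _ _ _).
have mf0s : measurable_fun (@nonneg R) (fun x => (f0 x * Num.sqrt x)%:E).
  by apply/measurable_EFinP; apply: measurable_funM => //; exact: measurable_funTS.
have F0_leb : F 0 `<< (@lebesgue_measure R).
  apply/null_content_dominatesP => A mA A0; rewrite F0E//.
  have mAn : measurable (A `&` @nonneg R) by exact: measurableI.
  apply: null_set_integral => //; first by apply: (measurable_funS mnn _ mf0s); exact: subIsetr.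
  apply/eqP; rewrite -measure_le0 -A0; apply: le_measure; rewrite ?inE//; exact: subIsetl.
have rinv0 : (\int[F 0%R]_x rinv x < +oo)%E.
  have e := integral_nonneg (sol_neg sol (lexx 0)) (@measurable_rinv R) (@rinv_ge0 R).
  have e' : moment (- (1 / 2)) (F 0) = (\int[F 0%R]_(x in @nonneg R) rinv x)%E.
    by apply: eq_integral => x; rewrite inE => x0; exact: rinvE.
  exact: (eq_ind _ (fun X => (X < +oo)%E) mom _ (etrans e' e)).
have rbound := moment_rinv_bound mp b0_gt0 p_ge0 p_leb p_lin L_ge0 dl_gt0 p_dil C0E sol rinv0.
have rb (T : R) : 0 <= T -> exists2 K : R, 0 <= K & forall t : R, 0 <= t <= T -> (\int[F t]_x rinv x <= K%:E)%E.
  by move=> T0; exact: (rbound T T0).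
have F_leb (t : R) (t0 : 0 <= t) : F t `<< (@lebesgue_measure R) :=
  sol_dominated mp b0_gt0 p_ge0 p_leb p_lin C0E sol rb F0_leb t0.
pose w := wdens F.
have mw := measurable_wdens sol.
have w0 := wdens_ge0 F.
have wneg := @wdens_neg R F.
have HB := wdens_collision_bound mp b0_gt0 p_ge0 p_leb p_lin C0E sol rb F_leb.
have DI := wdens_identity mp b0_gt0 p_ge0 p_leb p_lin C0E sol rb F_leb.
pose f := fm p w.
(* One identity serves all integral statements: indicators give the representation of [F t], [1 + x]
   the weighted bound, and [x] the conservation of energy. *)
have key (t : R) (psi : R -> R) : 0 <= t -> measurable_fun setT psi -> (forall x, 0 <= psi x) ->
    (\int[F t]_x (psi x)%:E = \int[@lebesgue_measure R]_(x in @nonneg R) (psi x * (f x t * Num.sqrt x))%:E)%E.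
  move=> t0 mpsi psi0.
  have m1 : measurable_fun setT (fun x => (psi x)%:E) by apply/measurable_EFinP.
  have p1 x : (0 <= (psi x)%:E)%E by rewrite lee_fin.
  apply: (etrans (integral_wdens sol F_leb t0 m1 p1)).
  apply: (etrans _ (esym (integral_fm_sqrt mp mw w0 wneg DI t0 mpsi psi0))).
  by apply: eq_integral => x _; rewrite (EFinM (psi x)).
have rep (t : R) : 0 <= t -> forall A, measurable A ->
    F t A = (\int[@lebesgue_measure R]_(x in A `&` (@nonneg R)) (f x t * Num.sqrt x)%:E)%E.
  move=> t0 A mA.
  have e1 := integral_indic (F t) measurableT mA; rewrite setIT in e1.
  have m1 : measurable_fun setT (\1_A : R -> R) := measurable_indic mA.
  have i0 x : 0 <= (\1_A x : R) by rewrite indicE.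
  apply: (etrans (esym e1)); apply: (etrans (key t _ t0 m1 i0)).
  apply: (etrans (integral_mkcond _ _)); apply: (etrans _ (esym (integral_mkcond _ _))).
  apply: eq_integral => x _; rewrite !patchE in_setI indicE.
  case: (x \in A); case: (x \in @nonneg R) => //=; first by rewrite mul1r.
  by rewrite mul0r.
have mass (t : R) : 0 <= t -> (\int[@lebesgue_measure R]_(x in @nonneg R) (f x t * Num.sqrt x)%:E)%E = (massF F)%:E.
  by move=> t0; rewrite -(sol_mass sol t0) (rep t t0 _ measurableT) setTI.
have mmax : measurable_fun setT (fun x : R => Num.max x 0).
  by apply: measurable_maxr; [exact: measurable_id|exact: measurable_cst].
have max0 (x : R) : 0 <= Num.max x 0 by rewrite le_max lexx orbT.
have ener (t : R) : 0 <= t -> (\int[@lebesgue_measure R]_(x in @nonneg R) (x * f x t * Num.sqrt x)%:E)%E = moment 1 (F t).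
  move=> t0; apply/esym.
  have e1 : moment 1 (F t) = (\int[F t]_(x in @nonneg R) (Num.max x 0)%:E)%E.
    apply: eq_integral => x; rewrite inE /nonneg/= => x0.
    by rewrite /mom_fun ltNge ler01 andbF powRr1// (max_idPl x0).
  have mm : measurable_fun setT (fun x : R => (Num.max x 0)%:E) by apply/measurable_EFinP.
  have pp x : (0 <= (Num.max x 0 : R)%:E)%E by rewrite lee_fin.
  apply: (etrans e1); apply: (etrans (integral_nonneg (sol_neg sol t0) mm pp)).
  apply: (etrans (key t _ t0 mmax max0)); apply: eq_integral => x; rewrite inE /nonneg/= => x0.
  by rewrite (max_idPl x0) mulrA.
exists f; split; first exact: rep.
split; [|split; [|split]].
- rewrite /mild_solution /Qop eW; split; first by move=> x t _ _; exact: fm_ge0.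
  split; first by apply: measurable_funTS; exact: (measurable_fm mp mw w0).
  split.
    move=> T T0; exists (energyF F) => t /andP[t0 _].
    rewrite -(sol_energy sol t0).
    have m1 : measurable_fun setT (fun x : R => 1 + Num.max x 0) by apply: measurable_funD => //; exact: measurable_cst.
    have p1 x : 0 <= 1 + Num.max x 0 :> R by rewrite addr_ge0.
    have e := key t _ t0 m1 p1.
    apply: (eq_ind_r (fun X => (_ <= X)%E) _ e).
    rewrite le_eqVlt; apply/orP; left; apply/eqP; apply: eq_integral => x; rewrite inE /nonneg/= => x0.
    by rewrite (max_idPl x0) mulrA.
  have gae := good_ae mp mw w0 HB DI.
  (* The point 0 is put into the exceptional set, since good points are only exploited for positive
     [x]. *)
  have [Z [mZ Z0 sZ]] : {ae @lebesgue_measure R, forall x, 0 <= x -> 0 < x /\ good p w x}.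
    apply: (ae_imp2 gae (@ae_neq0 R)) => x h xn x0.
    have xp : 0 < x by rewrite lt_neqAle x0 andbT eq_sym; apply/eqP.
    by split=> //; exact: h.
  exists Z; split; first by exists Z; split.
  move=> x x0 nZ t t0.
  have [xp gx] : 0 < x /\ good p w x by apply: contrapT => n; apply: nZ; apply: sZ => /= /(_ x0).
  split; first exact: (good_finite mp mw w0 wneg DI xp gx t0).
  exact: (good_mild mp mw w0 wneg DI xp gx t0).
- apply: (fm_C_L1 mp mw w0 wneg HB DI) => t t0.
  have [K _ hK] := wdens_rinv sol rb F_leb t0.
  by exists K; apply: hK; rewrite t0 lexx.
- have i1 : (@lebesgue_measure R).-integrable (@nonneg R) (fun x => (f x 0 * Num.sqrt x)%:E).
    apply/integrableP; split.
      apply: measurable_funTS; apply/measurable_EFinP; apply: measurable_funM => //.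
      exact: (mfm1 mp mw w0).
    have -> : (\int[@lebesgue_measure R]_(x in @nonneg R) `|(f x 0 * Num.sqrt x)%:E|)%E = (massF F)%:E.
      rewrite -(mass 0 (lexx 0)); apply: eq_integral => x _.
      by rewrite gee0_abs// lee_fin mulr_ge0 ?sqrtr_ge0// fm_ge0.
    exact: ltry.
  (* Both functions represent [F 0] on every measurable subset of the half-line, hence agree almost
     everywhere; the factor [sqrt x] is then cancelled off 0. *)
  have ae1 : ae_eq (@lebesgue_measure R) (@nonneg R) (fun x => (f x 0 * Num.sqrt x)%:E) (fun x => (f0 x * Num.sqrt x)%:E).
    apply: (integral_ae_eq mnn i1 mf0s) => E sE mE.
    have eE : E `&` @nonneg R = E by exact: setIidl.
    by have := rep 0 (lexx 0) E mE; rewrite F0E// eE.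
  apply: (ae_imp2 ae1 (@ae_neq0 R)) => x h xn x0.
  have [e] := h x0.
  have xp : Num.sqrt x != 0.
    by rewrite gt_eqF// sqrtr_gt0 lt_neqAle x0 andbT eq_sym; apply/eqP.
  exact: (mulIf xp e).
- move=> t t0; split; first by rewrite (mass t t0) (mass 0 (lexx 0)).
  rewrite (ener t t0) (ener 0 (lexx 0)).
  by have [_ [/(_ t t0)[_ ->] _]] := sol.
Qed.
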